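(* Let $m\in\mathbb{R}$, $\mu\in\mathbb{R}$, and consider the Dirac operator with Lorentz-scalar potential $$H:=-i\alpha\cdot\nabla+m\beta+\frac{\mu}{|x|}\beta$$ in $L^2(\mathbb{R}^3)^4$, with minimal and maximal realizations $H_{min}$ and $H_{max}$ defined in the context. Then $H_{min}$ is essentially self-adjoint on $C_c^\infty(\mathbb{R}^3\setminus\{0\})^4$ (that is, the restriction of $H_{min}$ to this subspace is essentially self-adjoint), and $$\mathcal{D}(\overline{H_{min}})=\mathcal{D}(H_{max})=H^1(\mathbb{R}^3)^4.$$
   Context: The $4\times4$ matrices are $\beta=\begin{pmatrix}\mathbb{I}_2&0\\0&-\mathbb{I}_2\end{pmatrix}$ and $\alpha=(\alpha_1,\alpha_2,\alpha_3)$, $\alpha_j=\begin{pmatrix}0&\sigma_j\\\sigma_j&0\end{pmatrix}$, where $\sigma_1=\begin{pmatrix}0&1\\1&0\end{pmatrix}$, $\sigma_2=\begin{pmatrix}0&-i\\i&0\end{pmatrix}$, $\sigma_3=\begin{pmatrix}1&0\\0&-1\end{pmatrix}$ are the Pauli matrices and $\mathbb{I}_2$ is the $2\times2$ identity. $H_{min}$ is the operator with domain $\mathcal{D}(H_{min})=C_c^\infty(\mathbb{R}^3)^4$ and $H_{min}\psi=H\psi$. $H_{max}$ has domain $\mathcal{D}(H_{max})=\{\psi\in L^2(\mathbb{R}^3)^4: H\psi\in L^2(\mathbb{R}^3)^4\}$ and $H_{max}\psi=H\psi$, where $H\psi\in L^2$ is read in the distributional sense: the form $\varphi\in C_c^\infty(\mathbb{R}^3)^4\mapsto\int_{\mathbb{R}^3}\psi\cdot\overline{H\varphi}\,dx$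 extends boundedly to $L^2(\mathbb{R}^3)^4$, and $H_{max}\psi$ is the element of $L^2(\mathbb{R}^3)^4$ representing it. A bar denotes operator closure and $H^1$ is the usual Sobolev space. *)

(* Defs.v *)
From HB Require Import structures.
From mathcomp Require Import all_boot all_order all_algebra.
From mathcomp Require Import complex.
From mathcomp Require Import all_classical all_reals all_analysis.

Set Implicit Arguments.
Unset Strict Implicit.
Unset Printing Implicit Defensive.

Import Order.TTheory GRing.Theory Num.Theory.
Import numFieldNormedType.Exports.

Local Open Scope classical_set_scope.
Local Open Scope ring_scope.
Local Open Scope complex_scope.

(* [measurableTypeR R] is R with its Borel sigma-algebra; the product carries
   the product sigma-algebra and the product topology. The library norm of
   [R3 R] is the sup norm, whence [euclid] below. *)
Definition R3 (R : realType) :=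
  (measurableTypeR R * measurableTypeR R * measurableTypeR R)%type.

Definition leb3 (R : realType) : {measure set (R3 R) -> \bar R} :=
  ((@lebesgue_measure R \x @lebesgue_measure R) \x @lebesgue_measure R)%E.

Definition euclid (R : realType) (x : R3 R) : R :=
  Num.sqrt (x.1.1 ^+ 2 + x.1.2 ^+ 2 + x.2 ^+ 2).

Definition spinor (R : realType) := R3 R -> 'cV[R[i]]_4.

Definition component (R : realType) (psi : spinor R) (k : 'I_4) : R3 R -> R[i] :=
  fun x => psi x k 0.

(** ** Smooth functions *)

Definition basis_vec (R : realType) (j : 'I_3) : R3 R :=
  (((j == 0 :> nat)%:R, (j == 1 :> nat)%:R), (j == 2 :> nat)%:R).

Fixpoint class_C (R : realType) (n : nat) (f : R3 R -> R) : Prop :=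
  continuous f /\
  match n with
  | 0 => True
  | n'.+1 => forall j : 'I_3,
      (forall x, derivable f x (basis_vec R j)) /\
      class_C n' (fun x => 'D_(basis_vec R j) f x)
  end.

Definition smooth (R : realType) (f : R3 R -> R[i]) : Prop :=
  forall n, class_C n (fun x => complex.Re (f x)) /\
            class_C n (fun x => complex.Im (f x)).

Definition partial (R : realType) (j : 'I_3) (f : R3 R -> R[i])
    (x : R3 R) : R[i] :=
  'D_(basis_vec R j) (fun y => complex.Re (f y)) x +i*
  'D_(basis_vec R j) (fun y => complex.Im (f y)) x.

(* C_c^oo(U) for U open, its elements being extended by 0 outside U. *)
Definition test_fun (R : realType) (U : set (R3 R)) :
    set (R3 R -> R[i]) :=
  [set f | [/\ smooth f, compact (closure [set x | f x != 0])
             & closure [set x | f x != 0] `<=` U]].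

Definition test_spinor (R : realType) (U : set (R3 R)) : set (spinor R) :=
  [set phi | forall k, test_fun U (component phi k)].

(** ** The spaces L^2(R^3), L^2(R^3)^4 and H^1(R^3)^4 *)

(* An element of L^2 is represented by all the functions of its class: every
   set of functions below that stands for a set of elements of L^2 is
   closed under almost everywhere equality (of measurable functions). *)
Definition L2 (R : realType) : set (R3 R -> R[i]) :=
  [set f | (fun x => complex.Re (f x)) \in Lfun (leb3 R) 2%:E /\
           (fun x => complex.Im (f x)) \in Lfun (leb3 R) 2%:E].

Definition L2_spinor (R : realType) : set (spinor R) :=
  [set psi | forall k, L2 (component psi k)].

Definition cintegral (R : realType) (f : R3 R -> R[i]) : R[i] :=
  (\int[leb3 R]_x complex.Re (f x)) +i* (\int[leb3 R]_x complex.Im (f x)).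

(* Linear in the first argument, antilinear in the second. *)
Definition l2dot (R : realType) (psi phi : spinor R) : R[i] :=
  cintegral (fun x => \sum_(k < 4) psi x k 0 * (phi x k 0)^*).

Definition l2norm (R : realType) (psi : spinor R) : R :=
  Num.sqrt (complex.Re (l2dot psi psi)).

Definition sobolev_H1 (R : realType) : set (R3 R -> R[i]) :=
  [set f | L2 f /\ forall j, exists2 g, L2 g &
     forall phi, test_fun setT phi ->
       cintegral (fun x => f x * partial j phi x) =
       - cintegral (fun x => g x * phi x)].

Definition sobolev_H1_spinor (R : realType) : set (spinor R) :=
  [set psi | forall k, sobolev_H1 (component psi k)].

(** ** Unbounded operators in L^2(R^3)^4 *)

(* [op_val T psi] is the class of T psi, for psi in [op_dom T]; the value of
   [op_val T] outside [op_dom T] is irrelevant. *)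
Record unbounded_op (R : realType) := Operator {
  op_dom : set (spinor R) ;
  op_val : spinor R -> set (spinor R) }.

Definition op_graph (R : realType) (T : unbounded_op R) (psi eta : spinor R) :
    Prop :=
  op_dom T psi /\ op_val T psi eta.

Definition op_eq (R : realType) (S T : unbounded_op R) : Prop :=
  op_dom S = op_dom T /\
  forall psi, op_dom S psi -> op_val S psi = op_val T psi.

(* The operator with domain (the classes of the elements of) D acting as F. *)
Definition op_on (R : realType) (D : set (spinor R))
    (F : spinor R -> spinor R) : unbounded_op R :=
  Operator
    [set psi | L2_spinor psi /\ exists2 phi, D phi & psi = phi %[ae leb3 R]]
    (fun psi => [set eta | L2_spinor eta /\
       exists2 phi, D phi & psi = phi %[ae leb3 R] /\ eta = F phi %[ae leb3 R]]).

Definition op_restr (R : realType) (T : unbounded_op R) (D : set (spinor R)) :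
    unbounded_op R :=
  Operator
    [set psi | op_dom T psi /\ exists2 phi, D phi & psi = phi %[ae leb3 R]]
    (op_val T).

(* The operator whose graph is the closure of the graph of T in
   L^2(R^3)^4 x L^2(R^3)^4. *)
Definition closed_graph (R : realType) (T : unbounded_op R)
    (psi eta : spinor R) : Prop :=
  [/\ L2_spinor psi, L2_spinor eta &
    forall e : R, 0 < e -> exists p q, [/\ op_graph T p q,
      l2norm (fun x => psi x - p x) < e & l2norm (fun x => eta x - q x) < e]].

Definition op_closure (R : realType) (T : unbounded_op R) : unbounded_op R :=
  Operator [set psi | exists eta, closed_graph T psi eta] (closed_graph T).

Definition op_adjoint (R : realType) (T : unbounded_op R) : unbounded_op R :=
  let val psi := [set eta | L2_spinor eta /\
    forall p q, op_graph T p q -> l2dot q psi = l2dot p eta] in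
  Operator [set psi | L2_spinor psi /\ exists eta, val psi eta] val.

Definition densely_defined (R : realType) (T : unbounded_op R) : Prop :=
  forall f, L2_spinor f -> forall e : R, 0 < e ->
    exists2 p, op_dom T p & l2norm (fun x => f x - p x) < e.

Definition op_symmetric (R : realType) (T : unbounded_op R) : Prop :=
  densely_defined T /\
  forall p q, op_graph T p q -> op_graph (op_adjoint T) p q.

Definition self_adjoint (R : realType) (T : unbounded_op R) : Prop :=
  densely_defined T /\ op_eq T (op_adjoint T).

Definition essentially_self_adjoint (R : realType) (T : unbounded_op R) : Prop :=
  op_symmetric T /\ self_adjoint (op_closure T).

(** ** The Dirac operator *)

Definition mx2 (C : nmodType) (a b c d : C) : 'M[C]_2 :=
  \matrix_(i < 2, j < 2) nth 0 (nth [::] [:: [:: a; b]; [:: c; d]] i) j.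

Definition pauli (R : realType) (j : 'I_3) : 'M[R[i]]_2 :=
  nth 0 [:: mx2 0 1 1 0; mx2 0 (- 'i) 'i 0; mx2 1 0 0 (- 1)] j.

Definition dirac_alpha (R : realType) (j : 'I_3) : 'M[R[i]]_4 :=
  @block_mx _ 2 2 2 2 0 (pauli R j) (pauli R j) 0.

Definition dirac_beta (R : realType) : 'M[R[i]]_4 :=
  @block_mx _ 2 2 2 2 1%:M 0 0 (- 1%:M).

(* H phi for a smooth phi. At the origin the potential is 0, as 0^-1 = 0;
   this affects a null set only. *)
Definition dirac_op (R : realType) (m mu : R) (phi : spinor R) : spinor R :=
  fun x => - 'i *: (\sum_(j < 3) dirac_alpha R j *m (\col_k partial j (component phi k) x))
           + m%:C *: (dirac_beta R *m phi x)
           + (mu / euclid x)%:C *: (dirac_beta R *m phi x).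

Definition Hmin (R : realType) (m mu : R) : unbounded_op R :=
  op_on (test_spinor setT) (dirac_op m mu).

(* Boundedness and antilinearity make F constant on classes. *)
Definition bounded_antilinear (R : realType) (F : spinor R -> R[i]) : Prop :=
  (forall (a b : R[i]) (f g : spinor R), L2_spinor f -> L2_spinor g ->
     F (fun x => a *: f x + b *: g x) = a^* * F f + b^* * F g) /\
  exists C : R, forall f, L2_spinor f -> `|F f| <= (C * l2norm f)%:C.

Definition Hmax (R : realType) (m mu : R) : unbounded_op R :=
  Operator
    [set psi | L2_spinor psi /\ exists2 F, bounded_antilinear F &
       forall phi, test_spinor setT phi -> F phi = l2dot psi (dirac_op m mu phi)]
    (fun psi => [set eta | L2_spinor eta /\
       forall phi, test_spinor setT phi ->
         l2dot psi (dirac_op m mu phi) = l2dot eta phi]).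

(* Main.v *)
Require Import Defs.
From HB Require Import structures.
From mathcomp Require Import all_boot all_order all_algebra.
From mathcomp Require Import complex.
From mathcomp Require Import all_classical all_reals all_analysis.
From mathcomp Require Import measurable_realfun ring lra.

Set Implicit Arguments.
Unset Strict Implicit.
Unset Printing Implicit Defensive.

Import Order.TTheory GRing.Theory Num.Theory.
Import numFieldNormedType.Exports.

Local Open Scope classical_set_scope.
Local Open Scope ring_scope.

(** Write D_mu for the massless operator -i alpha.grad + (mu/|x|) beta; the
    mass term is bounded and is added at the end.  Everything rests on one
    Hardy inequality,
      int |u|^2 / |x|^2 <= 2176 int |D_mu u|^2,
    which holds for every mu and, what is decisive, for every weak solution
    u in L^2 of D_mu u = v in L^2 on the punctured space (hardy_weak).

    Why it holds.  Let E = x.grad, let N = 1 + S be the spin-orbit operator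
    and let Phi consist of the upper half of u and of the lower half turned
    by sigma.x/|x|.  In polar form
      |x|^2 |D_mu u|^2 = |(E + 1) Phi - Lambda Phi|^2,
    where Lambda is symmetric, commutes with E, and
    Lambda^2 = N^2 + mu^2 >= N^2.  With respect to dx/|x|^2 the operator
    E + 1/2 is skew, so the right-hand side dominates
    |(Lambda - 1/2) Phi|^2, and it suffices that N^2 - 1/4 has a positive
    lower bound.  The reason for this is the half-integer spin: a spinor
    changes sign under a full turn, so the generators of its rotations have
    no small eigenvalues (rot_ineq), and N^2 - 1/4 is the sum of their
    squares.  All these identities are used in integrated form, as
    statements that certain weighted expressions have zero integral.

    Why it reaches weak solutions.  It is not known beforehand that u/|x| is
    square integrable, so 1/|x|^2 is replaced by (kappa + s)^-M with
    s = |x|^(2/M).  This weight is bounded, its product with |x|^2 is at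
    most 1, and for a large exponent M it varies so slowly that the error it
    causes is absorbed by the spectral gap (core_ineq).  For fixed kappa
    the weighted inequality passes from smooth functions to weak solutions
    by cutting off near 0 and infinity and mollifying; Fatou's lemma then
    lets kappa tend to 0.

    What follows from it.  Since u/|x| is in L^2, the commutator of D_mu with
    the cut-off functions tends to 0 in L^2, so every weak solution is a limit in
    graph norm of smooth functions supported away from 0 (weak_closure).
    Hence the weak graph is the closure of the operator on these functions;
    it is also its adjoint, which gives essential self-adjointness
    (H0_ess_selfadjoint), and it is the graph closure of H_min.  The maximal
    domain consists of weak solutions by the Riesz representation theorem
    (Hmax_weak_graph).  Finally
    |grad u|^2 and |D_0 u|^2 have the same integral for smooth u, so the
    Hardy inequality bounds the gradient of weak solutions (weak_H1), and
    conversely the Hardy inequality with mu = 0 makes u/|x| square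
    integrable for u in H^1 (sobolev_weak_graph).

    Spinors are handled as families of eight real functions, the real and
    imaginary parts of the four components, on which -i alpha_j acts by a
    signed permutation. *)

(** * Lebesgue measure, integrals and square-integrable functions on R^3 *)

Lemma product_sigma_finite d1 d2 (T1 : measurableType d1) (T2 : measurableType d2)
    (R : realType) (m1 : {sigma_finite_measure set T1 -> \bar R})
    (m2 : {sigma_finite_measure set T2 -> \bar R}) : sigma_finite setT (m1 \x m2)%E.
Proof.
have /sigma_finiteP[F [TF ndF Foo]] := sigma_finiteT m1.
have /sigma_finiteP[G [TG ndG Goo]] := sigma_finiteT m2.
exists (fun n => F n `*` G n).
  rewrite -setXTT TF TG predeqE => -[x y]; split.
    move=> [/= [n _ Fnx] [k _ Gky]]; exists (maxn n k) => //; split.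
    - by move: x Fnx; exact/subsetPset/ndF/leq_maxl.
    - by move: y Gky; exact/subsetPset/ndG/leq_maxr.
  by move=> [n _ []/= ? ?]; split; exists n.
move=> k; have [? ?] := Foo k; have [? ?] := Goo k.
split; first exact: measurableX.
by rewrite product_measure1E// lte_mul_pinfty// ge0_fin_numE.
Qed.

(** The two inner factors of leb3, named so that the sigma-finiteness of their
    product can be registered; likewise leb3s below. *)
Definition leb2 (R : realType) : set (measurableTypeR R * measurableTypeR R)%type -> \bar R :=
  (@lebesgue_measure R \x @lebesgue_measure R)%E.
HB.instance Definition _ (R : realType) :=
  Measure.copy (@leb2 R) (@lebesgue_measure R \x @lebesgue_measure R)%E.
HB.instance Definition _ (R : realType) := Measure_isSigmaFinite.Build _ _ _ (@leb2 R)
  (product_sigma_finite (@lebesgue_measure R) (@lebesgue_measure R)).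

Definition leb3s (R : realType) : set (R3 R) -> \bar R :=
  (@leb2 R \x @lebesgue_measure R)%E.
HB.instance Definition _ (R : realType) :=
  Measure.copy (@leb3s R) (@leb2 R \x @lebesgue_measure R)%E.
HB.instance Definition _ (R : realType) := Measure_isSigmaFinite.Build _ _ _ (@leb3s R)
  (product_sigma_finite (@leb2 R) (@lebesgue_measure R)).

HB.lock Definition int3 (R : realType) (f : R3 R -> R) : R := \int[leb3 R]_x f x.

Section measure_R3.
Context {R : realType}.
Local Notation T := (R3 R).
Local Notation mu := (leb3 R).
Local Notation leb := (@lebesgue_measure R).

Lemma tonelli3 (F : T -> \bar R) : measurable_fun setT F ->
  (forall x, 0 <= F x)%E ->
  (\int[mu]_x F x = \int[leb]_x \int[leb]_y \int[leb]_z F ((x, y), z))%E.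
Proof.
move=> mF F0.
have mG : measurable_fun setT (fubini_F leb F) := measurable_fun_fubini_tonelli_F F mF F0.
have G0 : forall p, (0 <= fubini_F leb F p)%E by move=> p; apply: integral_ge0.
transitivity (\int[@leb2 R]_p fubini_F leb F p)%E.
  exact: (fubini_tonelli1 (m1 := @leb2 R) (m2 := leb) F mF F0).
exact: (fubini_tonelli1 (m1 := leb) (m2 := leb) (fubini_F leb F) mG G0).
Qed.

(** leb3 itself is sigma-finite, so Tonelli applies to two points of R^3. *)
Lemma tonelli33 (F : T * T -> \bar R) : measurable_fun setT F ->
  (forall x, 0 <= F x)%E ->
  (\int[mu]_x \int[mu]_y F (x, y) = \int[mu]_y \int[mu]_x F (x, y))%E.
Proof.
move=> mF F0.
exact: (fubini_tonelli (m1 := @leb3s R) (m2 := @leb3s R) F mF F0).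
Qed.

(** An open set is a countable union of boxes with rational corners. *)
Lemma open_measurable3 (U : set T) : open U -> measurable U.
Proof.
move=> oU.
pose box (q : (rat * rat) * (rat * rat) * (rat * rat)) : set T :=
  [set x : T | [/\ ratr q.1.1.1 < x.1.1 < ratr q.1.1.2, ratr q.1.2.1 < x.1.2 < ratr q.1.2.2
   & ratr q.2.1 < x.2 < ratr q.2.2]].
have mbox q : measurable (box q).
  have -> : box q = (`]ratr q.1.1.1, ratr q.1.1.2[ `*` `]ratr q.1.2.1, ratr q.1.2.2[)
       `*` `]ratr q.2.1, ratr q.2.2[.
    rewrite /box; apply/seteqP; split => x /=; rewrite !in_itv/=; first by move=> [-> -> ->].
    by move=> [[-> ->] ->].
  by apply: measurableX => //; apply: measurableX.
have -> : U = \bigcup_q (box q `&` [set x | box q `<=` U]).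
  apply/seteqP; split => x; last by move=> [q _ [bq qU]]; apply: qU.
  move=> Ux; have /nbhs_ballP[e /= e0 eU] : nbhs x U by exact: open_nbhs_nbhs.
  have rat_lt (a : R) : exists p : rat * rat, [/\ ratr p.1 < a < ratr p.2, a - e < ratr p.1 & ratr p.2 < a + e].
    have := @rat_in_itvoo R (a - e) a; rewrite gtrBl => /(_ e0) [p]; rewrite in_itv/= => /andP[p1 p2].
    have := @rat_in_itvoo R a (a + e); rewrite ltrDl => /(_ e0) [q]; rewrite in_itv/= => /andP[q1 q2].
    by exists (p, q); rewrite /= p1 p2 q1 q2.
  have [p1 [h1 h1a h1b]] := rat_lt x.1.1.
  have [p2 [h2 h2a h2b]] := rat_lt x.1.2.
  have [p3 [h3 h3a h3b]] := rat_lt x.2.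
  exists (p1, p2, p3) => //=.
  have hb (a b : R) (p : rat * rat) : a - e < ratr p.1 -> ratr p.2 < a + e ->
      ratr p.1 < b < ratr p.2 -> ball a e b.
    by move=> ? ? /andP[? ?]; rewrite /ball/= ltr_distlC; apply/andP; split; lra.
  split => //; move=> y [/= y1 y2 y3]; apply: eU; split => /=; last exact: hb y3.
  by split => /=; [exact: hb y1|exact: hb y2].
apply: countable_bigcupT_measurable => // q.
have [qU|qU] := pselect (box q `<=` U).
  by rewrite (_ : _ `&` _ = box q)//; apply/seteqP; split => // x [].
by rewrite (_ : _ `&` _ = set0)//; apply/seteqP; split => // x [].
Qed.

Lemma continuous_measurable3 (f : T -> R) : continuous f -> measurable_fun setT f.
Proof.
move=> cf; apply: (measurability _ (RGenOInfty.measurableE R)) => //.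
move=> _ [_ [a ->] <-]; rewrite setTI.
by apply: open_measurable3; apply: open_comp.
Qed.

Lemma leb_translate (c : R) (F : R -> \bar R) : measurable_fun setT F ->
  (forall x, 0 <= F x)%E -> (\int[leb]_x F (x + c)%R = \int[leb]_x F x)%E.
Proof.
move=> mF F0.
pose tr : R -> measurableTypeR R := fun x => x + c.
have mc : measurable_fun setT tr by exact: measurable_funD.
transitivity (\int[pushforward leb tr]_x F x)%E.
  by rewrite ge0_integral_pushforward//=; rewrite ?preimage_setT.
apply: eq_measure_integral => //= A mA _.
apply/esym/lebesgue_measure_unique => //= _ [[a b]] _ <-.
rewrite /pushforward.
have -> : tr @^-1` `]a, b] = `]a - c, b - c]%classic.
  apply/seteqP; rewrite /tr; split => x /=; rewrite !in_itv/= => /andP[? ?]; apply/andP; split; lra.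
rewrite !lebesgue_measure_itv/= !lte_fin ltrD2r.
by case: ifPn => // ab; rewrite !EFinN -!EFinD; congr EFin; lra.
Qed.

(** Invariance of the integrals of all nonnegative functions; it passes to
    integrable functions through their positive and negative parts. *)
Definition preserving (phi : T -> T) := measurable_fun setT phi /\
  forall F : T -> \bar R, measurable_fun setT F -> (forall x, 0 <= F x)%E ->
    (\int[mu]_x F (phi x) = \int[mu]_x F x)%E.

Lemma preserving_comp phi psi : preserving phi -> preserving psi -> preserving (phi \o psi).
Proof.
move=> [mphi hphi] [mpsi hpsi]; split; first exact: measurableT_comp.
move=> F mF F0; rewrite -(hphi _ mF F0) -(hpsi (F \o phi))//.
  exact: measurableT_comp.
by move=> x /=.
Qed.

Lemma measurable_R3 (a b c : T -> R) : measurable_fun setT a -> measurable_fun setT b ->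
  measurable_fun setT c -> measurable_fun setT (fun x => ((a x, b x), c x) : T).
Proof.
by move=> ma mb mc; apply: measurable_fun_pair => //; apply: measurable_fun_pair.
Qed.

Lemma measurable_x1 : measurable_fun setT (fun x : T => x.1.1 : R).
Proof. exact: (measurableT_comp measurable_fst measurable_fst). Qed.

Lemma measurable_x2 : measurable_fun setT (fun x : T => x.1.2 : R).
Proof. exact: (measurableT_comp measurable_snd measurable_fst). Qed.

Lemma measurable_x3 : measurable_fun setT (fun x : T => x.2 : R).
Proof. exact: measurable_snd. Qed.

Lemma preserving_swap12 : preserving (fun x => ((x.1.2, x.1.1), x.2)).
Proof.
have m : measurable_fun setT (fun x : T => ((x.1.2, x.1.1), x.2) : T).
  exact: (measurable_R3 measurable_x2 measurable_x1 measurable_x3).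
split => // F mF F0.
rewrite (tonelli3 (measurableT_comp mF m))//; last by move=> x /=.
rewrite (tonelli3 mF F0).
have mG : measurable_fun setT (fubini_F leb F) := measurable_fun_fubini_tonelli_F F mF F0.
have G0 : forall p, (0 <= fubini_F leb F p)%E by move=> p; apply: integral_ge0.
exact/esym/(fubini_tonelli (m1 := leb) (m2 := leb) (fubini_F leb F) mG G0).
Qed.

Lemma preserving_swap23 : preserving (fun x => ((x.1.1, x.2), x.1.2)).
Proof.
have m : measurable_fun setT (fun x : T => ((x.1.1, x.2), x.1.2) : T).
  exact: (measurable_R3 measurable_x1 measurable_x3 measurable_x2).
split => // F mF F0.
rewrite (tonelli3 (measurableT_comp mF m))//; last by move=> x /=.
rewrite (tonelli3 mF F0).
apply: eq_integral => x _.
pose G (p : measurableTypeR R * measurableTypeR R) := F ((x, p.1), p.2).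
have mG : measurable_fun setT G.
  apply: (measurableT_comp mF).
  apply: measurable_fun_pair => //; apply: measurable_fun_pair => //.
have G0 : forall p, (0 <= G p)%E by move=> p; apply: F0.
exact/esym/(fubini_tonelli (m1 := leb) (m2 := leb) G mG G0).
Qed.

(** A shear: the last coordinate is translated by a function of the other two.
    Shears generate translations and rotations, so both follow from Fubini's
    theorem and the translation invariance of Lebesgue measure on the line. *)
Lemma preserving_shift3 (a : R -> R -> R) :
  measurable_fun setT (fun x : T => a x.1.1 x.1.2) ->
  preserving (fun x => ((x.1.1, x.1.2), x.2 + a x.1.1 x.1.2)).
Proof.
move=> ma.
have m : measurable_fun setT (fun x : T => ((x.1.1, x.1.2), x.2 + a x.1.1 x.1.2) : T).
  apply: (measurable_R3 measurable_x1 measurable_x2).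
  exact: measurable_funD measurable_x3 ma.
split => // F mF F0.
rewrite (tonelli3 (measurableT_comp mF m))//; last by move=> x /=.
rewrite (tonelli3 mF F0).
apply: eq_integral => x _; apply: eq_integral => y _ /=.
apply: (@leb_translate (a x y) (fun z => F ((x, y), z))) => //.
apply: (measurableT_comp mF).
by apply: measurable_fun_pair.
Qed.

Lemma preserving_shift2 (a : R -> R -> R) :
  measurable_fun setT (fun x : T => a x.1.1 x.2) ->
  preserving (fun x => ((x.1.1, x.1.2 + a x.1.1 x.2), x.2)).
Proof.
move=> ma; have := preserving_comp (preserving_comp preserving_swap23 (@preserving_shift3 a _)) preserving_swap23.
apply; exact: (measurableT_comp ma preserving_swap23.1).
Qed.

Lemma preserving_shift1 (a : R -> R -> R) :
  measurable_fun setT (fun x : T => a x.1.2 x.2) ->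
  preserving (fun x => ((x.1.1 + a x.1.2 x.2, x.1.2), x.2)).
Proof.
move=> ma; have := preserving_comp (preserving_comp preserving_swap12 (@preserving_shift2 a _)) preserving_swap12.
apply; exact: (measurableT_comp ma preserving_swap12.1).
Qed.

Lemma preserving_translate (v : T) : preserving (fun x => x + v).
Proof.
have h1 := @preserving_shift1 (fun _ _ => v.1.1) (measurable_cst _).
have h2 := @preserving_shift2 (fun _ _ => v.1.2) (measurable_cst _).
have h3 := @preserving_shift3 (fun _ _ => v.2) (measurable_cst _).
have := preserving_comp (preserving_comp h1 h2) h3.
by congr preserving; apply/funext => -[[x y] z]; case: v {h1 h2 h3} => -[].
Qed.

Implicit Types (f g h : T -> R) (k C : R).

Definition itg (f : T -> R) := mu.-integrable setT (EFin \o f).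

Lemma itg_meas f : itg f -> measurable_fun setT f.
Proof. by move=> /measurable_int/measurable_EFinP. Qed.

Lemma itg_le f g : measurable_fun setT f -> itg g -> (forall x, `|f x| <= g x) -> itg f.
Proof.
move=> mf ig fg; apply: (le_integrable _ _ _ ig) => //.
  exact/measurable_EFinP.
by move=> x _ /=; rewrite lee_fin (le_trans (fg x))// ler_norm.
Qed.

Lemma itgD f g : itg f -> itg g -> itg (fun x => f x + g x).
Proof. by move=> h1 h2; exact: (integrableD measurableT h1 h2). Qed.

Lemma itgZ k f : itg f -> itg (fun x => k * f x).
Proof. by move=> h; exact: (integrableZl measurableT k h). Qed.

Lemma itgN f : itg f -> itg (fun x => - f x).
Proof. by move=> h; under eq_fun do rewrite -mulN1r; exact: itgZ. Qed.

Lemma itgB f g : itg f -> itg g -> itg (fun x => f x - g x).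
Proof. by move=> h1 h2; apply: itgD => //; apply: itgN. Qed.

Lemma itg0 : itg (fun _ => 0).
Proof. exact: integrable0. Qed.

Lemma itg_sum n (F : nat -> T -> R) : (forall i, (i < n)%N -> itg (F i)) ->
  itg (fun x => \sum_(i < n) F i x).
Proof.
elim: n => [|n ih] h.
  by under eq_fun do rewrite big_ord0; exact: itg0.
under eq_fun do rewrite big_ord_recr/=.
by apply: itgD; [apply: ih => i lt; apply: h; exact: ltnW|exact: h].
Qed.

Lemma itg_abs f : itg f -> itg (fun x => `|f x|).
Proof. exact: integrable_norm. Qed.

Lemma int3D f g : itg f -> itg g -> int3 (fun x => f x + g x) = int3 f + int3 g.
Proof. by move=> h1 h2; rewrite int3.unlock; exact: RintegralD. Qed.

Lemma int3Z k f : itg f -> int3 (fun x => k * f x) = k * int3 f.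
Proof. by move=> h; rewrite int3.unlock; exact: RintegralZl. Qed.

Lemma int3N f : itg f -> int3 (fun x => - f x) = - int3 f.
Proof.
by move=> h; rewrite -mulN1r -int3Z//; congr int3; apply/funext => x; rewrite mulN1r.
Qed.

Lemma int3B f g : itg f -> itg g -> int3 (fun x => f x - g x) = int3 f - int3 g.
Proof. by move=> h1 h2; rewrite int3.unlock; exact: RintegralB. Qed.

Lemma int30 : int3 (fun _ : T => 0) = 0.
Proof. by rewrite int3.unlock /Rintegral integral0. Qed.

Lemma int3_sum n (F : nat -> T -> R) : (forall i, (i < n)%N -> itg (F i)) ->
  int3 (fun x => \sum_(i < n) F i x) = \sum_(i < n) int3 (F i).
Proof.
elim: n => [|n ih] h.
  by rewrite big_ord0; under eq_fun do rewrite big_ord0; exact: int30.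
rewrite big_ord_recr/= -ih; last by move=> i lt; apply: h; exact: ltnW.
rewrite -int3D; [|apply: itg_sum => i lt; apply: h; exact: ltnW|exact: h].
by under eq_fun do rewrite big_ord_recr/=.
Qed.

Lemma int3_ge0 f : (forall x, 0 <= f x) -> 0 <= int3 f.
Proof. by move=> h; rewrite int3.unlock; apply: Rintegral_ge0. Qed.

Lemma ler_int3 f g : itg f -> itg g -> (forall x, f x <= g x) -> int3 f <= int3 g.
Proof. by move=> h1 h2 h; rewrite int3.unlock; apply: le_Rintegral. Qed.

Lemma ler_norm_int3 f : itg f -> `|int3 f| <= int3 (fun x => `|f x|).
Proof. by move=> h; rewrite int3.unlock; apply: le_normr_Rintegral. Qed.

Lemma itg_bdM f h C : itg f -> measurable_fun setT h -> (forall x, `|h x| <= C) ->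
  itg (fun x => h x * f x).
Proof.
move=> hf mh hC; apply: (itg_le _ (itgZ C (itg_abs hf))).
  by apply: measurable_funM => //; exact: itg_meas.
by move=> x; rewrite normrM ler_wpM2r.
Qed.

Lemma preserving_itg phi f : preserving phi -> itg f -> itg (fun x => f (phi x)).
Proof.
move=> [mphi hphi] /integrableP[mf fi]; apply/integrableP; split.
  exact: (measurableT_comp mf).
rewrite (hphi (fun x => `|(f x)%:E|%E))//.
exact: measurableT_comp.
Qed.

Lemma preserving_int3 phi f : preserving phi -> itg f -> int3 (fun x => f (phi x)) = int3 f.
Proof.
move=> [mphi hphi] /integrableP[mf _].
rewrite int3.unlock /Rintegral; congr fine; rewrite integralE [RHS]integralE.
have mE : measurable_fun setT (EFin \o f) by [].
have hp := hphi _ (measurable_funepos mE) (funepos_ge0 (EFin \o f)).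
have hn := hphi _ (measurable_funeneg mE) (funeneg_ge0 (EFin \o f)).
have ep : ((fun x => (f (phi x))%:E)^\+ = (EFin \o f)^\+ \o phi)%E by exact: (funepos_comp (EFin \o f) phi).
have en : ((fun x => (f (phi x))%:E)^\- = (EFin \o f)^\- \o phi)%E by exact: (funeneg_comp (EFin \o f) phi).
congr (_ - _)%E; [rewrite ep; exact: hp|rewrite en; exact: hn].
Qed.

Lemma dct3 (F : nat -> T -> R) f g : (forall n, measurable_fun setT (F n)) ->
  (forall x, F ^~ x @ \oo --> f x) -> itg g -> (forall n x, `|F n x| <= g x) ->
  itg f /\ (fun n => int3 (F n)) @ \oo --> int3 f.
Proof.
move=> mF Ff ig Fg.
have mf : measurable_fun setT f.
  by apply: (measurable_fun_cvg mF) => x _; exact: Ff.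
have [|||||h1 _ h2] := @dominated_convergence _ _ _ mu setT measurableT
   (fun n => EFin \o F n) (EFin \o f) (EFin \o g).
- by move=> n; exact/measurable_EFinP.
- exact/measurable_EFinP.
- by apply: aeW => x _; apply: cvg_EFin; [exact: nearW|exact: Ff].
- exact: ig.
- by apply: aeW => x n _; rewrite lee_fin.
split; first exact: h1.
rewrite int3.unlock; apply: fine_cvg; rewrite fineK//; exact: integrable_fin_num.
Qed.

Definition L2r (f : T -> R) : Prop := f \in Lfun mu 2%:E.

Lemma L2rP f : L2r f <-> measurable_fun setT f /\ itg (fun x => f x ^+ 2).
Proof.
split => [h|[mf]].
  split; last exact: Lfun2_integrable_sqr h.
  by move: h; rewrite /L2r inE => /andP[/[!inE]].
move=> /integrableP[mf2 hf]; rewrite /L2r inE; apply/andP; split; rewrite inE/=//.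
rewrite /finite_norm unlock; apply: poweR_lty.
apply: le_lt_trans hf; rewrite le_eqVlt; apply/orP; left; apply/eqP.
apply: eq_integral => x _ /=.
by rewrite powR_mulrn// normrX.
Qed.

Lemma L2r_meas f : L2r f -> measurable_fun setT f.
Proof. by move=> /L2rP[]. Qed.

Lemma L2r_sq f : L2r f -> itg (fun x => f x ^+ 2).
Proof. by move=> /L2rP[]. Qed.

Lemma L2r_mul f g : L2r f -> L2r g -> itg (fun x => f x * g x).
Proof.
move=> /L2rP[mf f2] /L2rP[mg g2]; apply: (itg_le _ (itgD f2 g2)).
  exact: measurable_funM.
move=> x; rewrite ler_norml.
by have := sqr_ge0 (f x + g x); have := sqr_ge0 (f x - g x); have := sqr_ge0 (f x); have := sqr_ge0 (g x); nra.
Qed.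

Lemma L2r_le f g : measurable_fun setT f -> L2r g -> (forall x, `|f x| <= `|g x|) -> L2r f.
Proof.
move=> mf /L2rP[mg g2] fg; apply/L2rP; split => //.
apply: (itg_le _ g2); first exact: measurable_funX.
by move=> x; rewrite -[leRHS]ger0_norm ?sqr_ge0// !normrX lerXn2r// nnegrE.
Qed.

Lemma L2r0 : L2r (fun _ => 0).
Proof.
apply/L2rP; split => //.
by under eq_fun do rewrite expr0n/=; exact: itg0.
Qed.

Lemma L2rZ k f : L2r f -> L2r (fun x => k * f x).
Proof.
move=> /L2rP[mf f2]; apply/L2rP; split; first exact: measurable_funM.
by under eq_fun do rewrite exprMn; exact: itgZ.
Qed.

Lemma L2rD f g : L2r f -> L2r g -> L2r (fun x => f x + g x).
Proof.
move=> hf hg; have [mf f2] := (L2rP f).1 hf; have [mg g2] := (L2rP g).1 hg.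
apply/L2rP; split; first exact: measurable_funD.
under eq_fun do rewrite sqrrD.
by apply: itgD => //; apply: itgD => //; under eq_fun do rewrite -mulr_natl; apply/itgZ/L2r_mul.
Qed.

Lemma L2rN f : L2r f -> L2r (fun x => - f x).
Proof. by move=> h; under eq_fun do rewrite -mulN1r; exact: L2rZ. Qed.

Lemma L2rB f g : L2r f -> L2r g -> L2r (fun x => f x - g x).
Proof. by move=> hf hg; apply: L2rD => //; exact: L2rN. Qed.

Lemma L2r_bdM f h C : L2r f -> measurable_fun setT h -> (forall x, `|h x| <= C) ->
  L2r (fun x => h x * f x).
Proof.
move=> hf mh hC; have mf := L2r_meas hf.
apply: (@L2r_le _ (fun x => C * f x)); [exact: measurable_funM|exact: L2rZ|].
by move=> x; rewrite !normrM ler_wpM2r// (le_trans (hC x))// ler_norm.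
Qed.

(** The square of the L^2 norm. *)
Definition nsq (f : T -> R) := int3 (fun x => f x ^+ 2).

Lemma nsq_ge0 f : 0 <= nsq f.
Proof. by apply: int3_ge0 => x; exact: sqr_ge0. Qed.

Lemma nsqZ k f : L2r f -> nsq (fun x => k * f x) = k ^+ 2 * nsq f.
Proof.
by move=> /L2r_sq h; rewrite /nsq -int3Z//; congr int3; apply/funext => x; rewrite exprMn.
Qed.

Lemma nsqD_le f g : L2r f -> L2r g -> nsq (fun x => f x + g x) <= 2 * nsq f + 2 * nsq g.
Proof.
move=> hf hg; have f2 := L2r_sq hf; have g2 := L2r_sq hg.
rewrite /nsq -!int3Z// -int3D; [|exact: itgZ..].
apply: ler_int3; [exact: (L2r_sq (L2rD hf hg))|by apply: itgD; exact: itgZ|].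
by move=> x; have := sqr_ge0 (f x - g x); nra.
Qed.

Lemma nsqB_le f g : L2r f -> L2r g -> nsq (fun x => f x - g x) <= 2 * nsq f + 2 * nsq g.
Proof.
move=> hf hg; have := nsqD_le hf (L2rN hg); rewrite {3}/nsq.
by under [X in _ <= _ + 2 * int3 X -> _]eq_fun do rewrite sqrrN.
Qed.

(** The quadratic polynomial nsq (s f + g) of s is nonnegative. *)
Lemma cauchy_schwarz3 f g : L2r f -> L2r g ->
  (int3 (fun x => f x * g x)) ^+ 2 <= nsq f * nsq g.
Proof.
move=> hf hg; have f2 := L2r_sq hf; have g2 := L2r_sq hg; have fg := L2r_mul hf hg.
have key s : 0 <= nsq f - 2 * s * int3 (fun x => f x * g x) + s ^+ 2 * nsq g.
  rewrite /nsq -!int3Z// -int3B//; last exact: itgZ.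
  rewrite -int3D; [|by apply: itgB => //; exact: itgZ|exact: itgZ].
  by apply: int3_ge0 => x; have := sqr_ge0 (f x - s * g x); nra.
set B := int3 _ in key *; have := nsq_ge0 g; rewrite le_eqVlt => /predU1P[g0|g0].
  rewrite -g0 mulr0; have [->|B0] := eqVneq B 0; first by rewrite expr0n.
  have := key ((nsq f + 1) / (2 * B)); rewrite -g0 mulr0 addr0.
  have -> : 2 * ((nsq f + 1) / (2 * B)) * B = nsq f + 1 by field.
  lra.
have := key (B / nsq g).
have -> : nsq f - 2 * (B / nsq g) * B + (B / nsq g) ^+ 2 * nsq g = (nsq f * nsq g - B ^+ 2) / nsq g.
  by field; exact: lt0r_neq0.
by rewrite pmulr_lge0 ?invr_gt0// subr_ge0.
Qed.

Lemma dctL2 (F : nat -> T -> R) f g : (forall n, L2r (F n)) -> L2r f ->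
  (forall x, F ^~ x @ \oo --> f x) -> L2r g -> (forall n x, `|F n x - f x| <= `|g x|) ->
  (fun n => nsq (fun x => F n x - f x)) @ \oo --> 0.
Proof.
move=> hF hf Ff hg Fg.
have [||||_] := @dct3 (fun n x => (F n x - f x) ^+ 2) (fun _ => 0) (fun x => g x ^+ 2).
- by move=> n; apply: measurable_funX; apply: measurable_funB; exact: L2r_meas.
- move=> x; have h : (fun n => F n x - f x) @ \oo --> 0.
    by rewrite -(subrr (f x)); apply: cvgB => //; exact: cvg_cst.
  by under eq_fun do rewrite expr2; rewrite -(mulr0 0); exact: cvgM.
- exact: L2r_sq.
- by move=> n x; rewrite -[leRHS]ger0_norm ?sqr_ge0// !normrX lerXn2r// nnegrE.
by rewrite int30.
Qed.

End measure_R3.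

(** * Smooth functions and test functions *)

HB.lock Definition pd (R : realType) (j : 'I_3) (f : R3 R -> R) : R3 R -> R :=
  fun x => 'D_(basis_vec R j) f x.

HB.lock Definition coord3 (R : realType) (j : 'I_3) (x : R3 R) : R :=
  nth 0 [:: x.1.1; x.1.2; x.2] j.

HB.lock Definition rsq (R : realType) (x : R3 R) : R :=
  x.1.1 ^+ 2 + x.1.2 ^+ 2 + x.2 ^+ 2.

Section calculus.
Context {R : realType}.
Local Notation T := (R3 R).
Implicit Types (f g : T -> R) (x y z w v : T) (C e d : R).

Lemma pdE j f x : pd j f x = 'D_(basis_vec R j) f x.
Proof. by rewrite pd.unlock. Qed.

Definition pderivable f := forall j x, derivable f x (basis_vec R j).

Lemma pdD j f g : pderivable f -> pderivable g ->
  pd j (fun x => f x + g x) = (fun x => pd j f x + pd j g x).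
Proof. by move=> hf hg; apply/funext => x; rewrite !pdE; exact: deriveD. Qed.

Lemma pderivableD f g : pderivable f -> pderivable g -> pderivable (fun x => f x + g x).
Proof. by move=> hf hg j x; exact: derivableD. Qed.

Lemma pdM j f g : pderivable f -> pderivable g ->
  pd j (fun x => f x * g x) = (fun x => f x * pd j g x + pd j f x * g x).
Proof.
move=> hf hg; apply/funext => x; transitivity (f x *: pd j g x + g x *: pd j f x).
  by rewrite !pdE; exact: deriveM.
by congr (_ + _); exact: mulrC.
Qed.

Lemma pderivableM f g : pderivable f -> pderivable g -> pderivable (fun x => f x * g x).
Proof. by move=> hf hg j x; exact: derivableM. Qed.

Lemma pd_cst j (c : R) : pd j (fun _ => c) = fun _ => 0.
Proof. by apply/funext => x; rewrite pdE; exact: derive_cst. Qed.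

Lemma pderivable_cst (c : R) : pderivable (fun _ => c).
Proof. by move=> j x; exact: derivable_cst. Qed.

Lemma class_C0 n f : class_C n f -> continuous f.
Proof. by case: n => [|n] []. Qed.

Lemma class_CS n f : class_C n.+1 f <-> [/\ continuous f, pderivable f & forall j, class_C n (pd j f)].
Proof.
rewrite pd.unlock; split => [[cf h]|[cf df h]]; first by split => // [j x|j]; [exact: (h j).1|exact: (h j).2].
by split.
Qed.

Lemma class_C_pred n f : class_C n.+1 f -> class_C n f.
Proof.
elim: n f => [|n ih] f; first by move=> [].
by move=> /class_CS[cf df h]; apply/class_CS; split => // j; exact: ih.
Qed.

Lemma class_C_cst n (c : R) : class_C n (fun _ => c).
Proof.
elim: n c => [|n ih] c; first by split => // x; exact: cvg_cst.
apply/class_CS; split; [by move=> x; exact: cvg_cst|exact: pderivable_cst|].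
by move=> j; rewrite pd_cst.
Qed.

Lemma class_CD n f g : class_C n f -> class_C n g -> class_C n (fun x => f x + g x).
Proof.
elim: n f g => [|n ih] f g.
  by move=> [cf _] [cg _]; split => // x; apply: cvgD; [exact: cf|exact: cg].
move=> /class_CS[cf df hf] /class_CS[cg dg hg]; apply/class_CS; split.
- by move=> x; apply: cvgD; [exact: cf|exact: cg].
- exact: pderivableD.
- by move=> j; rewrite pdD//; exact: ih.
Qed.

Lemma class_CM n f g : class_C n f -> class_C n g -> class_C n (fun x => f x * g x).
Proof.
elim: n f g => [|n ih] f g.
  by move=> [cf _] [cg _]; split => // x; apply: cvgM; [exact: cf|exact: cg].
move=> hf0 hg0; have hf1 := class_C_pred hf0; have hg1 := class_C_pred hg0.
move: hf0 hg0 => /class_CS[cf df hf] /class_CS[cg dg hg]; apply/class_CS; split.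
- by move=> x; apply: cvgM; [exact: cf|exact: cg].
- exact: pderivableM.
- by move=> j; rewrite pdM//; apply: class_CD; exact: ih.
Qed.

Definition rsmooth f := forall n, class_C n f.

Lemma rsmooth_cst (c : R) : rsmooth (fun _ => c).
Proof. by move=> n; exact: class_C_cst. Qed.

Lemma rsmoothD f g : rsmooth f -> rsmooth g -> rsmooth (fun x => f x + g x).
Proof. by move=> hf hg n; exact: class_CD. Qed.

Lemma rsmoothM f g : rsmooth f -> rsmooth g -> rsmooth (fun x => f x * g x).
Proof. by move=> hf hg n; exact: class_CM. Qed.

Lemma rsmooth_cont f : rsmooth f -> continuous f.
Proof. by move=> /(_ 0%N)/class_C0. Qed.

Lemma rsmooth_pderivable f : rsmooth f -> pderivable f.
Proof. by move=> /(_ 1%N)/class_CS[]. Qed.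

Lemma rsmooth_pd j f : rsmooth f -> rsmooth (pd j f).
Proof. by move=> h n; have /class_CS[_ _] := h n.+1. Qed.

Lemma rsmoothZ (c : R) f : rsmooth f -> rsmooth (fun x => c * f x).
Proof. by move=> h; apply: rsmoothM => //; exact: rsmooth_cst. Qed.

Lemma rsmoothN f : rsmooth f -> rsmooth (fun x => - f x).
Proof. by move=> h; under eq_fun do rewrite -mulN1r; exact: rsmoothZ. Qed.

Lemma coord3_cont j : continuous (@coord3 R j).
Proof.
rewrite coord3.unlock; case: j => -[|[|[|//]]] i x.
- exact: (@continuous_comp _ _ _ fst fst x cvg_fst cvg_fst).
- exact: (@continuous_comp _ _ _ fst snd x cvg_fst cvg_snd).
- exact: cvg_snd.
Qed.

Lemma coord3_lin j (t : R) (v x : T) : coord3 j (t *: v + x) = t * coord3 j v + coord3 j x.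
Proof. by rewrite coord3.unlock; case: j => -[|[|[|//]]]. Qed.

Lemma coord3_basis i j : coord3 i (basis_vec R j) = (i == j)%:R.
Proof. by rewrite coord3.unlock; case: i => -[|[|[|//]]] hi; case: j => -[|[|[|//]]] hj. Qed.

Lemma coord3_derive j v x : is_derive x v (coord3 j) (coord3 j v).
Proof.
have h : (fun h : R => h^-1 *: (coord3 j (h *: v + x) - coord3 j x)) @ 0^' --> coord3 j v.
  have e : {near 0^', (fun _ : R => coord3 j v) =1 (fun h : R => h^-1 *: (coord3 j (h *: v + x) - coord3 j x))}.
    near=> h; rewrite coord3_lin addrK /= [_ *: _]mulrA mulVf ?mul1r//.
    by near: h; exact: nbhs_dnbhs_neq.
  by apply: cvg_trans (near_eq_cvg e) _; exact: cvg_cst.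
split; last exact/cvg_lim.
by apply/cvg_ex; exists (coord3 j v).
Unshelve. all: by end_near. Qed.

Lemma coord3_rsmooth j : rsmooth (coord3 j).
Proof.
case=> [|n]; first by split => //; exact: coord3_cont.
apply/class_CS; split; first exact: coord3_cont.
  by move=> i x; have [] := coord3_derive j (basis_vec R i) x.
move=> i; rewrite (_ : pd i _ = fun _ => coord3 j (basis_vec R i)).
  exact: class_C_cst.
by apply/funext => x; rewrite pdE; have [_ ->] := coord3_derive j (basis_vec R i) x.
Qed.

Lemma line_derive f x v t : derivable f (t *: v + x) v ->
  is_derive t 1 (fun s : R => f (s *: v + x)) ('D_v f (t *: v + x)).
Proof.
have e : (fun h : R => h^-1 *: (((fun s : R => f (s *: v + x)) \o shift t) (h *: 1) - f (t *: v + x)))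
   = (fun h : R => h^-1 *: ((f \o shift (t *: v + x)) (h *: v) - f (t *: v + x))).
  by apply/funext => h /=; rewrite [h%:A]mulr1 scalerDl addrA.
move=> hf; split; first by rewrite /derivable e.
by rewrite /derive e.
Qed.

Lemma line_derive0 f x v d :
  is_derive (0 : R) 1 (fun s : R => f (s *: v + x)) d -> is_derive x v f d.
Proof.
have e : (fun h : R => h^-1 *: (((fun s : R => f (s *: v + x)) \o shift 0) (h *: 1) - f (0 *: v + x)))
   = (fun h : R => h^-1 *: ((f \o shift x) (h *: v) - f x)).
  by apply/funext => h /=; rewrite [h%:A]mulr1 addr0 scale0r add0r.
by move=> [h1 h2]; split; [move: h1; rewrite /derivable e|move: h2; rewrite /derive e].
Qed.

Lemma comp_derive (W : R -> R) (w : R) f x v :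
  is_derive (f x) 1 W w -> derivable f x v ->
  is_derive x v (fun y => W (f y)) (w * 'D_v f x).
Proof.
move=> hW hf; apply: line_derive0.
have x0 : 0 *: v + x = x by rewrite scale0r add0r.
have := @line_derive f x v 0; rewrite x0 => /(_ hf) h.
by apply: (@is_derive1_comp _ W (fun s : R => f (s *: v + x))); rewrite ?x0.
Qed.

Lemma line_cont (f : T -> R) (x v : T) : continuous f -> continuous (fun s : R => f (s *: v + x)).
Proof.
move=> cf t; apply: (@continuous_comp _ _ _ (fun s : R => s *: v + x) f).
  by apply: cvgD; [exact: cvgZr_tmp|exact: cvg_cst].
exact: cf.
Qed.

(** The mean value theorem along a segment, for a function known only to have
    a directional derivative. *)
Lemma line_MVT f x v (t : R) : continuous f -> (forall y, derivable f y v) ->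
  exists2 s, `|s| <= `|t| & f (t *: v + x) - f x = t * 'D_v f (s *: v + x).
Proof.
move=> cf df.
have hd (s : R) : is_derive s 1 (fun s : R => f (s *: v + x)) ('D_v f (s *: v + x)).
  by apply: line_derive.
have hc (a b : R) : {within `[a, b], continuous (fun s : R => f (s *: v + x))}.
  by apply: continuous_subspaceT; exact: line_cont.
have [t0|t0] := leP 0 t.
  have [c] := @MVT_segment R _ _ 0 t t0 (fun s _ => hd s) (hc 0 t).
  rewrite in_itv/= => /andP[c0 ct] e; exists c; first by rewrite !ger0_norm.
  by move: e; rewrite scale0r add0r subr0 mulrC.
have [c] := @MVT_segment R _ _ t 0 (ltW t0) (fun s _ => hd s) (hc t 0).
rewrite in_itv/= => /andP[ct c0] e; exists c.
  by rewrite !ler0_norm ?lerN2// ltW.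
move: e; rewrite scale0r add0r sub0r => e.
by rewrite -opprB e mulrN opprK mulrC.
Qed.

(** t^-k exp(-1/t) on the positive half-line, extended by 0. The family is
    stable under differentiation, which makes its members smooth; it is the
    source of all cut-off functions below. *)
Definition expinv (k : nat) (t : R) : R := if 0 < t then t^-1 ^+ k * expR (- t^-1) else 0.

Lemma expinv_ge0 k t : 0 <= expinv k t.
Proof.
rewrite /expinv; case: ifPn => // t0.
by rewrite mulr_ge0 ?expR_ge0// exprn_ge0// invr_ge0 ltW.
Qed.

Lemma expinv_bound k t : expinv k t <= k`!%:R.
Proof.
rewrite /expinv; case: ifPn => // t0; rewrite expRN ler_pdivrMr ?expR_gt0//.
have s0 : 0 <= t^-1 by rewrite invr_ge0 ltW.
case: k => [|k].
  by rewrite expr0 fact0 mul1r; have := expR_ge1Dx t^-1; lra.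
have := expR_ge1Dxn k s0.
have f0 : 0 < (k.+1)`!%:R :> R by rewrite ltr0n fact_gt0.
move=> h; rewrite mulrC -ler_pdivrMr//; lra.
Qed.

(** From exp(1/t) >= t^-(k+n) / (k+n)!: vanishing to every order at 0. *)
Lemma expinv_decr k n t : expinv k t <= (k + n)`!%:R * `|t| ^+ n.
Proof.
have [t0|t0] := ltP 0 t; last first.
  by rewrite /expinv ltNge t0/=; apply: mulr_ge0 => //; exact: exprn_ge0.
have := expinv_bound (k + n) t; rewrite /expinv t0 exprD => h.
rewrite gtr0_norm// -ler_pdivrMr ?exprn_gt0// (le_trans _ h)//.
by rewrite -exprVn mulrAC.
Qed.

(** At 0 both sides vanish, because expinv k vanishes there to second order. *)
Lemma is_derive_expinv k (t : R) : is_derive t 1 (expinv k) (expinv k.+2 t - k%:R * expinv k.+1 t).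
Proof.
have [t0|t0|<-] := ltgtP 0 t; last first.
- have -> : expinv k.+2 0 - k%:R * expinv k.+1 0 = 0 by rewrite /expinv ltxx mulr0 subr0.
  have h : (fun h : R => h^-1 *: ((expinv k \o shift 0) (h *: 1) - expinv k 0)) @ 0^' --> 0.
    have e0 : expinv k 0 = 0 by rewrite /expinv ltxx.
    under eq_fun do rewrite /= [_%:A]mulr1 addr0 e0 subr0.
    apply: norm_cvg0.
    apply: (@squeeze_cvgr _ _ _ _ (fun _ => 0) (fun h : R => (k + 2)`!%:R * `|h|)).
    + near=> h; rewrite normr_ge0/= [_ *: _]mulrC normrM normfV.
      have h0 : 0 < `|h| by rewrite normr_gt0; near: h; exact: nbhs_dnbhs_neq.
      rewrite ler_pdivrMr// -mulrA -expr2 ger0_norm ?expinv_ge0//.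
      exact: expinv_decr.
    + exact: cvg_cst.
    + rewrite -[X in _ --> X](mulr0 (k + 2)`!%:R); apply: cvgM; first exact: cvg_cst.
      have hn : (fun x : R => `|x|) @ (0 : R)^' --> `|0 : R|.
        by apply: cvg_within_filter; exact: (@norm_continuous _ R 0).
      by rewrite normr0 in hn.
  by split; [apply/cvg_ex; exists 0|exact/cvg_lim].
- have -> : expinv k.+2 t - k%:R * expinv k.+1 t = 0 by rewrite /expinv ltNge (ltW t0)/= mulr0 subr0.
  apply: (near_eq_is_derive _ (@is_derive_cst _ R R (0 : R) t (1 : R))).
  near=> s; rewrite /expinv ltNge; have -> // : s <= 0.
  by apply: ltW; near: s; exact: lt_nbhsl.
- have tn0 : t != 0 by rewrite gt_eqF.
  apply: (@near_eq_is_derive _ _ _ (fun s : R => s^-1 ^+ k * expR (- s^-1))).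
    near=> s; rewrite /expinv; have -> // : 0 < s.
    by near: s; exact: lt_nbhsr.
  have hV : is_derive t 1 (fun s : R => s^-1) (- t ^- 2).
    have := @is_deriveV R id t 1 1 tn0 (is_derive_id _ _).
    by rewrite /= [_%:A]mulr1.
  pose F (u : R) : R := u ^+ k * expR (- u).
  have hE (u : R) : is_derive u 1 (fun u : R => expR (- u)) (- expR (- u)).
    have := @is_derive1_comp _ expR -%R u _ _ (is_derive_expR _) (is_deriveNid u 1).
    by rewrite mulrN1.
  have hX (u : R) : is_derive u 1 (fun u : R => u ^+ k) (k%:R * u ^+ k.-1).
    split; first exact: exprn_derivable.
    by rewrite exp_derive /GRing.scale/= mulr1.
  have hF (u : R) : is_derive u 1 F (u ^+ k *: - expR (- u) + expR (- u) *: (k%:R * u ^+ k.-1)).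
    exact: (is_deriveM (hX u) (hE u)).
  have := @is_derive1_comp _ F (fun s : R => s^-1) t _ _ (hF _) hV.
  congr is_derive; rewrite /expinv t0 -exprVn.
  case: k {F hF hX} => [|k]; rewrite /GRing.scale/= ?exprS ?expr0; ring.
Unshelve. all: by end_near. Qed.

Lemma expinv_cont k : continuous (expinv k).
Proof.
by move=> t; have [h _] := is_derive_expinv k t; apply/differentiable_continuous/derivable1_diffP.
Qed.

Lemma pd_expinv k f j : pderivable f ->
  pd j (fun x => expinv k (f x)) = (fun x => (expinv k.+2 (f x) - k%:R * expinv k.+1 (f x)) * pd j f x).
Proof.
move=> hf; apply/funext => x; rewrite pdE.
by rewrite pdE; have [_ ->] := comp_derive (is_derive_expinv k (f x)) (hf j x).
Qed.

Lemma pderivable_expinv k f : pderivable f -> pderivable (fun x => expinv k (f x)).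
Proof. by move=> hf j x; have [] := comp_derive (is_derive_expinv k (f x)) (hf j x). Qed.

Lemma rsmooth_expinv k f : rsmooth f -> rsmooth (fun x => expinv k (f x)).
Proof.
move=> hf n; elim: n k => [|n ih] k.
  by split => // x; apply: (@continuous_comp _ _ _ f); [exact: rsmooth_cont|exact: expinv_cont].
apply/class_CS; split.
- by move=> x; apply: (@continuous_comp _ _ _ f); [exact: rsmooth_cont|exact: expinv_cont].
- exact/pderivable_expinv/rsmooth_pderivable.
- move=> j; rewrite pd_expinv; last exact: rsmooth_pderivable.
  apply: class_CM; last by have := rsmooth_pd j hf; apply.
  apply: class_CD => //; under eq_fun do rewrite -mulNr.
  by apply: class_CM => //; exact: class_C_cst.
Qed.

Lemma cont_coord3 f x e : continuous f -> 0 < e -> exists2 d, 0 < d &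
  forall y, (forall j, `|coord3 j y - coord3 j x| < d) -> `|f y - f x| < e.
Proof.
move=> cf e0; have /cvgrPdist_lt/(_ e e0)/nbhs_ballP[d /= d0 hd] := cf x.
exists d => // y hy; rewrite distrC; apply: hd.
have h1 := hy ord0; have h2 := hy (lift ord0 ord0); have h3 := hy ord_max.
rewrite coord3.unlock/= in h1 h2 h3.
by split => /=; [split => /=|]; rewrite /ball/= distrC.
Qed.

Lemma translate_derive f (w x v : T) d :
  is_derive (x + w) v f d -> is_derive x v (fun y => f (y + w)) d.
Proof.
have e : (fun h : R => h^-1 *: (((fun y => f (y + w)) \o shift x) (h *: v) - f (x + w)))
   = (fun h : R => h^-1 *: ((f \o shift (x + w)) (h *: v) - f (x + w))).
  by apply/funext => h /=; rewrite addrA.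
by move=> [h1 h2]; split; [move: h1; rewrite /derivable -e|move: h2; rewrite /derive -e].
Qed.

Lemma coord3D j (x y : T) : coord3 j (x + y) = coord3 j x + coord3 j y.
Proof. by rewrite coord3.unlock; case: j => -[|[|[|//]]]. Qed.

Lemma coord3Z j (t : R) (x : T) : coord3 j (t *: x) = t * coord3 j x.
Proof. by rewrite coord3.unlock; case: j => -[|[|[|//]]]. Qed.

(** Two applications of the mean value theorem, first in direction i and then
    in direction j. *)
Lemma second_difference f i j x (h : R) : rsmooth f ->
  exists y, (forall l, `|coord3 l y - coord3 l x| <= `|h| + `|h|) /\
    f (h *: basis_vec R i + (x + h *: basis_vec R j)) - f (h *: basis_vec R i + x)
     - (f (x + h *: basis_vec R j) - f x) = h * (h * pd j (pd i f) y).
Proof.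
move=> sf; set ei := basis_vec R i; set ej := basis_vec R j.
pose g y := f (y + h *: ej) - f y.
have hg y : is_derive y ei g (pd i f (y + h *: ej) - pd i f y).
  rewrite !pdE.
  apply: is_deriveB; last by apply: derivableP; exact: rsmooth_pderivable.
  by apply: translate_derive; apply: derivableP; exact: rsmooth_pderivable.
have cg : continuous g.
  move=> y; apply: cvgB; last exact: rsmooth_cont.
  apply: (@continuous_comp _ _ _ (fun y : T => y + h *: ej) f); last exact: rsmooth_cont.
  by apply: cvgD; [exact: cvg_id|exact: cvg_cst].
have [s sh e1] := @line_MVT g x ei h cg (fun y => @ex_derive _ _ _ _ _ _ _ (hg y)).
have [s' sh' e2] := @line_MVT (pd i f) (s *: ei + x) ej h
   (rsmooth_cont (rsmooth_pd i sf)) (@rsmooth_pderivable _ (rsmooth_pd i sf) j).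
exists (s' *: ej + (s *: ei + x)); split.
  move=> l; rewrite !coord3D !coord3Z !coord3_basis addrA addrK.
  rewrite (le_trans (ler_normD _ _))// lerD// normrM.
    by case: (l == j); rewrite ?normr1 ?mulr1// normr0 mulr0.
  by case: (l == i); rewrite ?normr1 ?mulr1// normr0 mulr0.
rewrite addrA -/(g _) -/(g x) e1; congr (_ * _).
by have [_ ->] := hg (s *: ei + x); rewrite [_ + h *: ej]addrC e2 pdE.
Qed.

Lemma dist_half_le (e p q r r' : R) :
  r' = r -> `|r - p| < e / 2 -> `|r' - q| < e / 2 -> `|p - q| <= e.
Proof.
move=> ->; rewrite !ltr_norml => /andP[? ?] /andP[? ?].
by rewrite ler_norml; apply/andP; split; lra.
Qed.

(** The second difference is symmetric in the two directions; divide it by h^2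
    and let h tend to 0. *)
Lemma clairaut f i j : rsmooth f -> pd i (pd j f) = pd j (pd i f).
Proof.
move=> sf; apply/funext => x; apply/eqP; rewrite -subr_eq0 -normr_le0.
apply/ler_addgt0Pl => e e0; rewrite addr0.
have e20 : 0 < e / 2 by rewrite divr_gt0.
have cA := rsmooth_cont (rsmooth_pd i (rsmooth_pd j sf)).
have cB := rsmooth_cont (rsmooth_pd j (rsmooth_pd i sf)).
have [d d0 hd] := cont_coord3 x cA e20.
have [d' d'0 hd'] := cont_coord3 x cB e20.
pose h := Num.min d d' / 3.
have h0 : 0 < h by rewrite divr_gt0// lt_min d0 d'0.
have hhd : `|h| + `|h| < d /\ `|h| + `|h| < d'.
  have : Num.min d d' <= d by rewrite ge_min lexx.
  have : Num.min d d' <= d' by rewrite ge_min lexx orbT.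
  by rewrite gtr0_norm// /h => ? ?; have := h0; rewrite /h => ?; split; lra.
have [y [hy ey]] := @second_difference f i j x h sf.
have [z [hz ez]] := @second_difference f j i x h sf.
have eq : pd j (pd i f) y = pd i (pd j f) z.
  have hn0 : h != 0 by rewrite gt_eqF.
  have E : h * (h * pd j (pd i f) y) = h * (h * pd i (pd j f) z).
    apply: etrans (esym ey) (etrans _ ez).
    set A := h *: basis_vec R i; set B := h *: basis_vec R j.
    have -> : A + (x + B) = B + (x + A) by rewrite addrC addrAC addrC.
    rewrite (addrC x B) (addrC x A); ring.
  exact: (mulfI hn0 (mulfI hn0 E)).
have h1 : `|pd i (pd j f) z - pd i (pd j f) x| < e / 2.
  by apply: hd => l; exact: le_lt_trans (hz l) hhd.1.
have h2 : `|pd j (pd i f) y - pd j (pd i f) x| < e / 2.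
  by apply: hd' => l; exact: le_lt_trans (hy l) hhd.2.
exact: dist_half_le eq h1 h2.
Qed.

Lemma lipschitz3 f C : rsmooth f -> (forall j x, `|pd j f x| <= C) ->
  forall x w, `|f (w + x) - f x| <= C * (`|w.1.1| + `|w.1.2| + `|w.2|).
Proof.
move=> sf hC x w.
have step (y : T) j (t : R) : `|f (t *: basis_vec R j + y) - f y| <= C * `|t|.
  have [s _ ->] := @line_MVT f y (basis_vec R j) t (rsmooth_cont sf) (@rsmooth_pderivable _ sf j).
  by rewrite normrM mulrC; apply: ler_wpM2r => //; rewrite -pdE; exact: hC.
pose e1 := basis_vec R ord0; pose e2 := basis_vec R (lift ord0 ord0); pose e3 := basis_vec R ord_max.
have -> : w + x = w.1.1 *: e1 + (w.1.2 *: e2 + (w.2 *: e3 + x)).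
  have ext (p q : T) : (forall j, coord3 j p = coord3 j q) -> p = q.
    move=> h; move: (h ord0) (h (lift ord0 ord0)) (h ord_max); rewrite coord3.unlock/=.
    by case: p {h} => -[? ?] ?; case: q => -[? ?] ? /= -> -> ->.
  apply: ext => j; rewrite !coord3D !coord3Z !coord3_basis.
  by case: j => -[|[|[|//]]] ?; rewrite coord3.unlock/=; ring.
have h1 := step (w.1.2 *: e2 + (w.2 *: e3 + x)) ord0 w.1.1.
have h2 := step (w.2 *: e3 + x) (lift ord0 ord0) w.1.2.
have h3 := step x ord_max w.2.
move: h1 h2 h3; rewrite -/e1 -/e2 -/e3 !ler_norml.
by move=> /andP[? ?] /andP[? ?] /andP[? ?]; apply/andP; split; lra.
Qed.

Lemma rsqE x : rsq x = coord3 ord0 x ^+ 2 + coord3 (lift ord0 ord0) x ^+ 2 + coord3 ord_max x ^+ 2.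
Proof. by rewrite rsq.unlock coord3.unlock. Qed.

Lemma rsq_ge0 x : 0 <= rsq x.
Proof. by rewrite rsq.unlock !addr_ge0// sqr_ge0. Qed.

Lemma rsq_eq0 x : (rsq x == 0) = (x == 0).
Proof.
rewrite rsq.unlock !paddr_eq0 ?addr_ge0 ?sqr_ge0// !sqrf_eq0.
by case: x => -[a b] c.
Qed.

Lemma rsmooth_rsq : rsmooth (@rsq R).
Proof.
have h j : rsmooth (fun x => coord3 j x ^+ 2).
  by under eq_fun do rewrite expr2; apply: rsmoothM; exact: coord3_rsmooth.
have -> : @rsq R = fun x => coord3 ord0 x ^+ 2 + coord3 (lift ord0 ord0) x ^+ 2 + coord3 ord_max x ^+ 2.
  by apply/funext => x; rewrite rsqE.
exact: (rsmoothD (rsmoothD (h ord0) (h (lift ord0 ord0))) (h ord_max)).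
Qed.

Lemma pd_coord3 i j : pd i (@coord3 R j) = fun _ => (j == i)%:R.
Proof.
apply/funext => x; rewrite pdE; have [_ ->] := coord3_derive j (basis_vec R i) x.
by rewrite coord3_basis.
Qed.

Lemma pd_rsq j : pd j (@rsq R) = fun x => 2 * coord3 j x.
Proof.
have hp i := rsmooth_pderivable (coord3_rsmooth i).
have hM i : pderivable (fun x => coord3 i x * coord3 i x) by exact: pderivableM.
have -> : @rsq R = fun x => coord3 ord0 x * coord3 ord0 x + coord3 (lift ord0 ord0) x * coord3 (lift ord0 ord0) x
    + coord3 ord_max x * coord3 ord_max x.
  by apply/funext => x; rewrite rsqE !expr2.
rewrite pdD//; last exact: pderivableD.
rewrite pdD// !pdM// !pd_coord3; apply/funext => x.
by case: j => -[|[|[|//]]] ?; rewrite coord3.unlock /=; ring.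
Qed.

Definition csupp f := exists M, forall x, f x != 0 -> rsq x <= M.
(** The support keeps a positive distance from the origin. *)
Definition supp0 f := exists2 e, 0 < e & forall x, f x != 0 -> e <= rsq x.
Definition test f := rsmooth f /\ csupp f.
(** The test functions on the punctured space. *)
Definition test0 f := test f /\ supp0 f.

Lemma pd_open0 f j (U : set T) : open U -> (forall x, U x -> f x = 0) ->
  forall x, U x -> pd j f x = 0.
Proof.
move=> oU fU x Ux; rewrite pdE.
rewrite (@near_eq_derive _ _ _ f (fun _ => 0)) ?derive_cst//.
by apply: filterS fU _; exact: open_nbhs_nbhs.
Qed.

Lemma open_rsq_gt M : open [set x : T | M < rsq x].
Proof.
apply: (@open_comp _ _ (@rsq R) [set t | M < t]); last exact: open_gt.
by move=> x _; exact: rsmooth_cont rsmooth_rsq _.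
Qed.

Lemma open_rsq_lt M : open [set x : T | rsq x < M].
Proof.
apply: (@open_comp _ _ (@rsq R) [set t | t < M]); last exact: open_lt.
by move=> x _; exact: rsmooth_cont rsmooth_rsq _.
Qed.

Lemma supp_out f M x : (forall x, f x != 0 -> rsq x <= M) -> M < rsq x -> f x = 0.
Proof. by move=> h xM; apply/eqP/negPn/negP => /h; rewrite leNgt xM. Qed.

Lemma supp_in f e x : (forall x, f x != 0 -> e <= rsq x) -> rsq x < e -> f x = 0.
Proof. by move=> h xM; apply/eqP/negPn/negP => /h; rewrite leNgt xM. Qed.

Lemma csupp_pd f j : csupp f -> csupp (pd j f).
Proof.
move=> [M h]; exists M => x; apply: contraNT; rewrite -ltNge => xM; apply/eqP.
by apply: (pd_open0 j (@open_rsq_gt M)) xM => y; exact: supp_out.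
Qed.

Lemma supp0_pd f j : supp0 f -> supp0 (pd j f).
Proof.
move=> [e e0 h]; exists e => // x; apply: contraNT; rewrite -ltNge => xM; apply/eqP.
by apply: (pd_open0 j (@open_rsq_lt e)) xM => y; exact: supp_in.
Qed.

Lemma csuppD f g : csupp f -> csupp g -> csupp (fun x => f x + g x).
Proof.
move=> [M h] [N k]; exists (Num.max M N) => x.
have [->|/h fM _] := eqVneq (f x) 0; last by rewrite le_max fM.
by rewrite add0r => /k gN; rewrite le_max gN orbT.
Qed.

Lemma supp0D f g : supp0 f -> supp0 g -> supp0 (fun x => f x + g x).
Proof.
move=> [M M0 h] [N N0 k]; exists (Num.min M N); first by rewrite lt_min M0.
move=> x; have [->|/h fM _] := eqVneq (f x) 0; last by rewrite ge_min fM.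
by rewrite add0r => /k gN; rewrite ge_min gN orbT.
Qed.

Lemma csuppM f g : csupp f -> csupp (fun x => g x * f x).
Proof. by move=> [M h]; exists M => x; rewrite mulf_eq0 negb_or => /andP[_ /h]. Qed.

Lemma supp0M f g : supp0 f -> supp0 (fun x => g x * f x).
Proof. by move=> [M M0 h]; exists M => // x; rewrite mulf_eq0 negb_or => /andP[_ /h]. Qed.

Lemma test_pd f j : test f -> test (pd j f).
Proof. by move=> [sf cf]; split; [exact: rsmooth_pd|exact: csupp_pd]. Qed.

Lemma test0_pd f j : test0 f -> test0 (pd j f).
Proof. by move=> [tf cf]; split; [exact: test_pd|exact: supp0_pd]. Qed.

Lemma testD f g : test f -> test g -> test (fun x => f x + g x).
Proof. by move=> [sf cf] [sg cg]; split; [exact: rsmoothD|exact: csuppD]. Qed.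

Lemma test0D f g : test0 f -> test0 g -> test0 (fun x => f x + g x).
Proof. by move=> [sf cf] [sg cg]; split; [exact: testD|exact: supp0D]. Qed.

Lemma testM f g : test f -> rsmooth g -> test (fun x => g x * f x).
Proof. by move=> [sf cf] sg; split; [exact: rsmoothM|exact: csuppM]. Qed.

Lemma test0M f g : test0 f -> rsmooth g -> test0 (fun x => g x * f x).
Proof. by move=> [sf cf] sg; split; [exact: testM|exact: supp0M]. Qed.

Lemma testZ c f : test f -> test (fun x => c * f x).
Proof. by move=> h; apply: testM => //; exact: rsmooth_cst. Qed.

Lemma test0Z c f : test0 f -> test0 (fun x => c * f x).
Proof. by move=> h; apply: test0M => //; exact: rsmooth_cst. Qed.

Lemma csupp0 : csupp (fun _ => 0).
Proof. by exists 0 => x; rewrite eqxx. Qed.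

Lemma test_0 : test (fun _ => 0).
Proof. by split; [exact: rsmooth_cst|exact: csupp0]. Qed.

Lemma test0_0 : test0 (fun _ => 0).
Proof. by split; [exact: test_0|exists 1 => // x; rewrite eqxx]. Qed.

Lemma compact_cube (M : R) : compact (((`[- M, M] `*` `[- M, M]) `*` `[- M, M]) : set T).
Proof. by apply: compact_setX; [apply: compact_setX|]; exact: segment_compact. Qed.

Definition cube (M : R) : set T := ((`[- M, M] `*` `[- M, M]) `*` `[- M, M]).

Lemma cubeP M x : cube M x <-> forall j, `|coord3 j x| <= M.
Proof.
rewrite /cube /= !in_itv/=; split.
  move=> [[h1 h2] h3]; case => -[|[|[|//]]] ?; by rewrite coord3.unlock/= ler_norml.
rewrite coord3.unlock => h; rewrite -!ler_norml; split; [split; [exact: (h ord0)|exact: (h (lift ord0 ord0))]|exact: (h ord_max)].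
Qed.

Lemma rsq_cube M x : 0 <= M -> rsq x <= M -> cube (M + 1) x.
Proof.
move=> M0 xM; apply/cubeP => j.
have h : coord3 j x ^+ 2 <= (M + 1) ^+ 2.
  apply: (@le_trans _ _ (rsq x)); last by nra.
  rewrite rsqE; have h1 := sqr_ge0 (coord3 ord0 x); have h2 := sqr_ge0 (coord3 (lift ord0 ord0) x).
  have h3 := sqr_ge0 (coord3 ord_max x).
  by case: j => -[|[|[|//]]] ?; rewrite coord3.unlock/= in h1 h2 h3 *; lra.
by rewrite -ler_sqr ?nnegrE//; [rewrite -normrX ger0_norm ?sqr_ge0|lra].
Qed.

Lemma csupp_cube f : csupp f -> exists M, forall x, f x != 0 -> cube M x.
Proof.
move=> [M h]; exists (`|M| + 1) => x /h xM; apply: rsq_cube => //.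
exact: le_trans xM (ler_norm _).
Qed.

Lemma csupp_bounded f : continuous f -> csupp f -> exists C, forall x, `|f x| <= C.
Proof.
move=> cf /csupp_cube[M h].
have [c0|/set0P[y cy]] := eqVneq (cube M) set0.
  exists 0 => x; have [->|/h] := eqVneq (f x) 0; first by rewrite normr0.
  by rewrite c0.
have [c cc hc] := @compact_EVT_max T R (fun x => `|f x|) (cube M) (ex_intro _ y cy)
  (@compact_cube M) (continuous_subspaceT (fun x => cvg_norm (cf x))).
exists `|f c| => x; have [->|/h xM] := eqVneq (f x) 0; first by rewrite normr0.
by apply: hc; rewrite inE.
Qed.

Lemma measurable_cube M : measurable (cube M).
Proof. by apply: measurableX => //; apply: measurableX. Qed.

Lemma leb3_cube_lty M : (leb3 R (cube M) < +oo)%E.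
Proof.
pose J : set R := `[- M, M]%classic.
have m1 : measurable J by exact: measurable_itv.
have h1 : (@lebesgue_measure R J < +oo)%E.
  by rewrite lebesgue_measure_itv; case: ifPn => // _; rewrite ltry.
have m2 := measurableX m1 m1.
have e2 := product_measure1E (@lebesgue_measure R) (@lebesgue_measure R) m1 m1.
have e3 := product_measure1E (@leb2 R) (@lebesgue_measure R) m2 m1.
have -> : leb3 R (cube M) = (@leb2 R (J `*` J) * @lebesgue_measure R J)%E := e3.
have -> : @leb2 R (J `*` J) = (@lebesgue_measure R J * @lebesgue_measure R J)%E := e2.
have h2 : @lebesgue_measure R J \is a fin_num by rewrite ge0_fin_numE.
by rewrite -ge0_fin_numE ?mule_ge0// !fin_numM.
Qed.

Lemma itg_cube M : itg (\1_(cube M)).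
Proof.
apply/integrableP; split.
  by apply/measurable_EFinP; exact: measurable_indic (measurable_cube M).
under eq_integral do rewrite /= ger0_norm//.
rewrite integral_indic//; last exact: measurable_cube.
by rewrite setIT; exact: leb3_cube_lty.
Qed.

Lemma itg_csupp f : continuous f -> csupp f -> itg f.
Proof.
move=> cf hf; have [C hC] := csupp_bounded cf hf.
have [M hM] := csupp_cube hf.
apply: (itg_le _ (itgZ C (itg_cube M))); first exact: continuous_measurable3.
move=> x; have [->|/hM xM] := eqVneq (f x) 0.
  by rewrite normr0 mulr_ge0// (le_trans _ (hC x)).
by rewrite indicE mem_set// mulr1.
Qed.

Lemma itg_test f : test f -> itg f.
Proof. by move=> [sf cf]; apply: itg_csupp => //; exact: rsmooth_cont. Qed.

Lemma L2r_csupp f : continuous f -> csupp f -> L2r f.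
Proof.
move=> cf hf; apply/L2rP; split; first exact: continuous_measurable3.
apply: itg_csupp; first by move=> x; under eq_fun do rewrite expr2; apply: cvgM; exact: cf.
by under eq_fun do rewrite expr2; exact: csuppM.
Qed.

Lemma L2r_test f : test f -> L2r f.
Proof. by move=> [sf cf]; apply: L2r_csupp => //; exact: rsmooth_cont. Qed.

(** The gradient of a test function is bounded. *)
Lemma test_lipschitz f : test f -> exists2 C, 0 <= C &
  forall x w, `|f (w + x) - f x| <= C * (`|w.1.1| + `|w.1.2| + `|w.2|).
Proof.
move=> tf.
have h j : exists C, forall x, `|pd j f x| <= C.
  by have [s c] := test_pd j tf; apply: csupp_bounded => //; exact: rsmooth_cont.
have [C0 h0] := h ord0; have [C1 h1] := h (lift ord0 ord0); have [C2 h2] := h ord_max.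
have h0' := le_trans (normr_ge0 _) (h0 0); have h1' := le_trans (normr_ge0 _) (h1 0).
have h2' := le_trans (normr_ge0 _) (h2 0).
exists (C0 + C1 + C2); first by rewrite !addr_ge0.
apply: lipschitz3; first by case: tf.
case => -[|[|[|//]]] i x.
- rewrite (_ : Ordinal i = ord0); last exact: val_inj.
  by rewrite (le_trans (h0 x))// -addrA lerDl addr_ge0.
- rewrite (_ : Ordinal i = lift ord0 ord0); last exact: val_inj.
  by rewrite (le_trans (h1 x))// addrAC lerDr addr_ge0.
- rewrite (_ : Ordinal i = ord_max); last exact: val_inj.
  by rewrite (le_trans (h2 x))// lerDr addr_ge0.
Qed.

End calculus.

(** * Weighted expressions with zero integral *)

Section nullforms.
Context {R : realType}.
Local Notation T := (R3 R).
Implicit Types (f g h om eo : T -> R) (x y z w v : T) (C e d : R).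

Lemma basis_norm (j : 'I_3) (s : R) :
  `|(s *: basis_vec R j : T).1.1| + `|(s *: basis_vec R j : T).1.2| + `|(s *: basis_vec R j : T).2| = `|s|.
Proof.
by case: j => -[|[|[|//]]] ?; rewrite /basis_vec/= /GRing.scale/= mulr1 !mulr0 normr0 ?addr0 ?add0r.
Qed.

Lemma cubeW (M N : R) x : M <= N -> cube M x -> cube N x.
Proof. by move=> MN /cubeP h; apply/cubeP => j; exact: le_trans (h j) MN. Qed.

(** Used to conclude that a derivative of an integral vanishes: it is bounded
    by K t for all small t. *)
Lemma le_all_small (a K : R) : 0 <= a -> 0 <= K -> (forall t, 0 < t <= 1 -> a <= K * t) -> a = 0.
Proof.
rewrite le_eqVlt => /predU1P[//|a0] K0 h; exfalso.
have aK : 0 < a + K by lra.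
have /h : 0 < a / (a + K) <= 1.
  by rewrite divr_gt0//= ler_pdivrMr// mul1r lerDl.
rewrite mulrA ler_pdivlMr//; nra.
Qed.

Lemma cube_translate (M t : R) j x : `|t| <= 1 -> cube M (x + t *: basis_vec R j) -> cube (M + 1) x.
Proof.
move=> t1 /cubeP h; apply/cubeP => i; have := h i; rewrite coord3D coord3Z coord3_basis => hi.
have e : `|t * (i == j)%:R| <= 1 by case: (i == j); rewrite ?mulr1// mulr0 normr0.
rewrite -[coord3 i x](addrK (t * (i == j)%:R)) (le_trans (ler_normB _ _))//.
by rewrite lerD.
Qed.

(** Translation invariance: the integral of f (x + t e_j) - f x is 0 for every
    t, and by the Lipschitz bound on the gradient this difference is t times
    the derivative up to an error of order t^2. *)
Lemma int3_pd f j : test f -> int3 (pd j f) = 0.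
Proof.
move=> tf; have tp := test_pd j tf.
have [C C0 hC] := test_lipschitz tp.
have [M1 hM1] := csupp_cube tf.2; have [M2 hM2] := csupp_cube tp.2.
pose M := Num.max M1 M2.
have hf x : f x != 0 -> cube M x by move=> /hM1; apply: cubeW; rewrite le_max lexx.
have hp x : pd j f x != 0 -> cube M x by move=> /hM2; apply: cubeW; rewrite le_max lexx orbT.
have MM : M <= M + 1 by rewrite lerDl.
pose V := int3 (\1_(cube (M + 1)) : T -> R).
have V0 : 0 <= V by apply: int3_ge0 => x; rewrite indicE.
have sf := tf.1.
apply/eqP; rewrite -normr_eq0; apply/eqP.
apply: (@le_all_small _ (C * V)); [by []|exact: mulr_ge0|].
move=> t /andP[t0 t1].
pose ft x := f (x + t *: basis_vec R j).
have ift : itg ft by exact: preserving_itg (preserving_translate _) (itg_test tf).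
have eft : int3 ft = int3 f by exact: preserving_int3 (preserving_translate _) (itg_test tf).
have i1 : itg (fun x => ft x - f x - t * pd j f x).
  by apply: itgB; [apply: itgB => //; exact: itg_test|apply: itgZ; exact: itg_test].
have e0 : t * int3 (pd j f) = - int3 (fun x => ft x - f x - t * pd j f x).
  rewrite int3B; [|apply: itgB => //; exact: itg_test|apply: itgZ; exact: itg_test].
  rewrite int3B//; last exact: itg_test.
  by rewrite int3Z; [rewrite eft; ring|exact: itg_test].
have bd x : `|ft x - f x - t * pd j f x| <= (C * t ^+ 2) * \1_(cube (M + 1)) x.
  have [xM|xM] := pselect (cube (M + 1) x); last first.
    have fx : f x = 0 by apply/eqP/negPn/negP => /hf h; apply: xM; exact: cubeW h.
    have px : pd j f x = 0 by apply/eqP/negPn/negP => /hp h; apply: xM; exact: cubeW h.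
    have ftx : ft x = 0.
      apply/eqP/negPn/negP => /hf h; apply: xM; apply: cube_translate h.
      by rewrite gtr0_norm.
    rewrite ftx fx px subrr mulr0 subr0 normr0 mulr_ge0// mulr_ge0// sqr_ge0//.
  rewrite indicE mem_set// mulr1 /ft [x + _]addrC.
  have [s st ->] := @line_MVT _ f x (basis_vec R j) t (rsmooth_cont sf) (@rsmooth_pderivable _ _ sf j).
  rewrite -pdE -mulrBr normrM gtr0_norm// expr2 mulrCA ler_pM2l//.
  apply: le_trans (hC _ _) _; rewrite ler_wpM2l// basis_norm (le_trans st)//.
  by rewrite gtr0_norm.
have : t * `|int3 (pd j f)| <= C * V * t ^+ 2.
  rewrite -{1}(gtr0_norm t0) -normrM e0 normrN.
  apply: le_trans (ler_norm_int3 i1) _.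
  rewrite mulrAC /V -int3Z; last exact: itg_cube.
  by apply: ler_int3; [exact: itg_abs|apply: itgZ; exact: itg_cube|].
by rewrite expr2 mulrA [t * _]mulrC ler_pM2r.
Qed.

(** Zero integral, together with integrability: the integrated identities of
    the proof are linear combinations of null functions. *)
Definition null f := itg f /\ int3 f = 0.

Lemma nullD f g : null f -> null g -> null (fun x => f x + g x).
Proof. by move=> [i1 e1] [i2 e2]; split; [exact: itgD|rewrite int3D// e1 e2 addr0]. Qed.

Lemma nullZ C f : null f -> null (fun x => C * f x).
Proof. by move=> [i1 e1]; split; [exact: itgZ|rewrite int3Z// e1 mulr0]. Qed.

Lemma null_pd f j : test f -> null (pd j f).
Proof. by move=> tf; split; [exact: itg_test (test_pd j tf)|exact: int3_pd]. Qed.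

Lemma nullB f g : null f -> null g -> null (fun x => f x - g x).
Proof.
move=> hf hg; have := nullD hf (nullZ (-1) hg).
by under eq_fun do rewrite mulN1r.
Qed.

Lemma null_eq f g : (forall x, f x = g x) -> null g -> null f.
Proof. by move=> /funext ->. Qed.

Lemma null_int3 f g : itg g -> null (fun x => f x - g x) -> int3 f = int3 g.
Proof.
move=> ig [i e]; have -> : f = fun x => (f x - g x) + g x by apply/funext => x; rewrite subrK.
by rewrite int3D// e add0r.
Qed.

Definition o0 : 'I_3 := ord0.
Definition o1 : 'I_3 := lift ord0 ord0.
Definition o2 : 'I_3 := ord_max.

(** The Euler field x . grad, that is, r d/dr. *)
Definition euler f x := coord3 o0 x * pd o0 f x + coord3 o1 x * pd o1 f x + coord3 o2 x * pd o2 f x.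
(** The generator of rotations in the (a, b)-plane. *)
Definition rot (a b : 'I_3) f x := coord3 a x * pd b f x - coord3 b x * pd a f x.

Lemma test0_rot a b f : test0 f -> test0 (rot a b f).
Proof.
move=> tf; rewrite /rot; under eq_fun do rewrite -mulNr.
apply: test0D; apply: test0M; rewrite ?[rsmooth _]/(rsmooth _); try exact: test0_pd.
- exact: coord3_rsmooth.
- exact: rsmoothN (coord3_rsmooth _).
Qed.

Lemma test0_euler f : test0 f -> test0 (euler f).
Proof.
move=> tf; apply: test0D; [apply: test0D|]; apply: test0M; try exact: test0_pd; exact: coord3_rsmooth.
Qed.

Lemma test0_pder f : test0 f -> pderivable f.
Proof. by move=> [[s _] _]; exact: rsmooth_pderivable. Qed.

Lemma eulerM f g : pderivable f -> pderivable g ->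
  forall x, euler (fun x => f x * g x) x = f x * euler g x + euler f x * g x.
Proof. by move=> hf hg x; rewrite /euler !pdM//; ring. Qed.

Lemma rotM a b f g : pderivable f -> pderivable g ->
  forall x, rot a b (fun x => f x * g x) x = f x * rot a b g x + rot a b f x * g x.
Proof. by move=> hf hg x; rewrite /rot !pdM//; ring. Qed.

Lemma rsq0 : rsq (0 : T) = 0.
Proof. by rewrite rsq.unlock !expr0n !addr0. Qed.

Lemma pd_xcM a j (k : T -> R) x : pderivable k ->
  pd j (fun x => coord3 a x * k x) x = coord3 a x * pd j k x + (a == j)%:R * k x.
Proof.
by move=> hk; rewrite (pdM _ (rsmooth_pderivable (coord3_rsmooth a)) hk) pd_coord3.
Qed.

(** Multiplication by om preserves the test functions on the punctured space,
    and om has gradient (eo / |x|^2) x there, as a radial function with Euler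
    derivative eo has. The definition speaks of products only, so om may be
    singular at the origin. *)
Definition radial (om eo : T -> R) := forall h, test0 h -> test0 (fun x => om x * h x) /\
  forall j x, pd j (fun x => om x * h x) x = om x * pd j h x + (eo x * coord3 j x / rsq x) * h x.

Lemma radialD om eo om' eo' : radial om eo -> radial om' eo' ->
  radial (fun x => om x + om' x) (fun x => eo x + eo' x).
Proof.
move=> r1 r2 h th; have [t1 p1] := r1 _ th; have [t2 p2] := r2 _ th; split.
  by under eq_fun do rewrite mulrDl; exact: test0D.
move=> j x; under eq_fun do rewrite mulrDl.
by rewrite pdD ?p1 ?p2; [ring|exact: test0_pder..].
Qed.

Lemma radialZ C om eo : radial om eo -> radial (fun x => C * om x) (fun x => C * eo x).
Proof.
move=> r1 h th; have [t1 p1] := r1 _ th; split.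
  by under eq_fun do rewrite -mulrA; exact: test0Z.
move=> j x; under eq_fun do rewrite -mulrA.
by rewrite pdM ?pd_cst ?p1; [ring|exact: pderivable_cst|exact: test0_pder].
Qed.

Lemma radial_eq om eo om' eo' : radial om eo -> (forall x, x != 0 -> om' x = om x) ->
  (forall x, x != 0 -> eo' x = eo x) -> radial om' eo'.
Proof.
move=> r e1 e2 h th.
have h0 : h 0 = 0 by case: th => _ [d d0 hd]; apply: supp_in hd _; rewrite rsq0.
have E : (fun x => om' x * h x) = (fun x => om x * h x).
  by apply/funext => x; have [->|x0] := eqVneq x 0; [rewrite h0 !mulr0|rewrite e1].
have [t1 p1] := r _ th; rewrite E; split => // j x; rewrite p1.
by have [->|x0] := eqVneq x 0; [rewrite h0 (_ : pd j h 0 = 0) ?mulr0//; case: (test0_pd j th) => _ [d d0 hd]; apply: supp_in hd _; rewrite rsq0|rewrite e1// e2].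
Qed.

(** A rotation field has zero divergence and annihilates radial functions. *)
Lemma null_rot om eo a b h : radial om eo -> a != b -> test0 h ->
  null (fun x => om x * rot a b h x).
Proof.
move=> r ab th; have [tw pw] := r _ th.
have := nullB (null_pd b (testM tw.1 (coord3_rsmooth a))) (null_pd a (testM tw.1 (coord3_rsmooth b))).
apply: null_eq => x.
have dw := test0_pder tw.
rewrite /rot (pd_xcM a b x dw) (pd_xcM b a x dw) !pw (negbTE ab) eq_sym (negbTE ab).
by rewrite !mul0r !addr0; ring.
Qed.

(** The integrand is the divergence of om h x. *)
Lemma null_euler om eo h : radial om eo -> test0 h ->
  null (fun x => om x * euler h x + (3 * om x + eo x) * h x).
Proof.
move=> r th; have [tw pw] := r _ th.
have := nullD (nullD (null_pd o0 (testM tw.1 (coord3_rsmooth o0))) (null_pd o1 (testM tw.1 (coord3_rsmooth o1))))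
  (null_pd o2 (testM tw.1 (coord3_rsmooth o2))).
apply: null_eq => x.
have dw := test0_pder tw.
rewrite /euler (pd_xcM o0 o0 x dw) (pd_xcM o1 o1 x dw) (pd_xcM o2 o2 x dw) !pw !eqxx.
have [x0|x0] := eqVneq (rsq x) 0.
  have hx : h x = 0 by case: th => _ [d d0 hd]; apply: supp_in hd _; rewrite x0.
  by rewrite hx; ring.
have e : coord3 o0 x ^+ 2 + coord3 o1 x ^+ 2 + coord3 o2 x ^+ 2 = rsq x by rewrite rsqE.
have t1 : true%:R = 1 :> R by [].
move: x0; rewrite !t1 -e => x0; field; exact: x0.
Qed.

Lemma mul_supp0_cont om h : (forall x, x != 0 -> {for x, continuous om}) ->
  continuous h -> supp0 h -> continuous (fun x => om x * h x).
Proof.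
move=> co ch [d d0 hd] x; have [->|x0] := eqVneq x 0; last first.
  by apply: cvgM; [exact: co|exact: ch].
have e : {near (0 : T), (fun _ => 0) =1 (fun x => om x * h x)}.
  have : nbhs (0 : T) [set x : T | rsq x < d].
    by apply: open_nbhs_nbhs; split; [exact: open_rsq_lt|rewrite /= rsq0].
  by apply: filterS => y yd; rewrite (supp_in hd yd) mulr0.
have e0 : om 0 * h 0 = 0 by rewrite (supp_in hd) ?mulr0// rsq0.
by rewrite /continuous_at e0; apply: cvg_trans (near_eq_cvg e) _; exact: cvg_cst.
Qed.

Lemma mul_supp0_derive om om' h j : (forall x, x != 0 -> is_derive x (basis_vec R j) om (om' x)) ->
  pderivable h -> supp0 h ->
  forall x, is_derive x (basis_vec R j) (fun x => om x * h x) (om x * pd j h x + om' x * h x).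
Proof.
move=> dom dh sh x; have [d d0 hd] := sh; have [d' d'0 hd'] := supp0_pd j sh.
have [->|x0] := eqVneq x 0; last first.
  have h1 := dom _ x0; have h2 := derivableP (dh j x).
  have := is_deriveM h1 h2; rewrite -pdE /GRing.scale/= => h3.
  by apply: is_derive_eq h3 _; rewrite [h x * _]mulrC.
rewrite (supp_in hd') ?rsq0// (supp_in hd) ?rsq0// !mulr0 addr0.
apply: (near_eq_is_derive _ (@is_derive_cst _ T R (0 : R) 0 (basis_vec R j))).
have : nbhs (0 : T) [set x : T | rsq x < d].
  by apply: open_nbhs_nbhs; split; [exact: open_rsq_lt|rewrite /= rsq0].
by apply: filterS => y yd; rewrite (supp_in hd yd) mulr0.
Qed.

Lemma is_derive_exp_lin (p v : R) : is_derive v 1 (fun v : R => expR (p * v)) (p * expR (p * v)).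
Proof.
have h : is_derive v 1 (fun v : R => p * v) p.
  have := @is_deriveZ _ _ _ (fun v : R => v) p v 1 1 (is_derive_id _ _).
  by rewrite /GRing.scale/= mulr1.
by have := is_derive1_comp (is_derive_expR (p * v)) h; rewrite mulrC.
Qed.

Lemma is_derive_pow (n : nat) (u : R) : is_derive u 1 (fun u : R => u ^+ n) (n%:R * u ^+ n.-1).
Proof.
split; first exact: exprn_derivable.
by rewrite exp_derive /GRing.scale/= mulr1.
Qed.

Section family.
Variables (k q : R).
Hypothesis k0 : 0 < k.

(** The function t^p / (kappa + t^q)^n in the logarithmic variable v = ln t;
    it is written with k for kappa. *)
Definition lfam (p : R) (n : nat) (v : R) : R := expR (p * v) * ((k + expR (q * v))^-1) ^+ n.

Lemma lfam_den (v : R) : 0 < k + expR (q * v).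
Proof. by rewrite addr_gt0// expR_gt0. Qed.

Lemma is_derive_lfam p n (v : R) : is_derive v 1 (lfam p n)
  (p * lfam p n v - n%:R * q * (lfam p n v - k * lfam p n.+1 v)).
Proof.
pose B (v : R) := (k + expR (q * v))^-1.
have dn : k + expR (q * v) != 0 by rewrite gt_eqF// lfam_den.
have hB : is_derive v 1 B (- (k + expR (q * v)) ^- 2 * (q * expR (q * v))).
  have h : is_derive v 1 (fun v : R => k + expR (q * v)) (0 + q * expR (q * v)).
    by apply: is_deriveD; exact: is_derive_exp_lin.
  by have := @is_deriveV R (fun v : R => k + expR (q * v)) v _ 1 dn h; rewrite add0r.
have hBn := is_derive1_comp (is_derive_pow n (B v)) hB.
have hM := is_deriveM (is_derive_exp_lin p v) hBn.
apply: (@is_derive_eq _ _ _ (lfam p n) _ _ _ _ hM); rewrite /GRing.scale/= /lfam -/(B v).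
have e : expR (q * v) = (B v)^-1 - k by rewrite /B invrK addrC addKr.
have Bn : B v != 0 by rewrite /B invr_neq0.
have -> : (k + expR (q * v)) ^- 2 = B v ^+ 2 by rewrite /B exprVn.
rewrite {}e; move: (B v) Bn => b bn; clear hM hBn hB.
case: n => [|n] /=; first by rewrite expr0; ring.
by rewrite !exprS; field.
Qed.

(** All radial weights of the proof are of this form, with t = |x|^2. The
    family is closed under differentiation, up to the factors coord3 j /
    |x|^2, and under division by |x|^2. *)
Definition fam (p : R) (n : nat) (x : T) : R := lfam p n (ln (rsq x)).

(** The Euler derivative of fam p n. *)
Definition efam p n x := 2 * (p * fam p n x - n%:R * q * (fam p n x - k * fam p n.+1 x)).

Lemma rsq_gt0 x : x != 0 -> 0 < rsq x.
Proof. by move=> x0; rewrite lt_neqAle rsq_ge0 eq_sym rsq_eq0 x0. Qed.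

Lemma is_derive_fam p n j x : x != 0 ->
  is_derive x (basis_vec R j) (fam p n) (efam p n x * coord3 j x / rsq x).
Proof.
move=> x0; have t0 := rsq_gt0 x0.
have h := comp_derive (is_derive1_comp (is_derive_lfam p n (ln (rsq x))) (is_derive1_ln t0))
   (@rsmooth_pderivable _ _ (@rsmooth_rsq R) j x).
apply: is_derive_eq h _; rewrite -pdE pd_rsq /efam /fam; field.
by rewrite gt_eqF.
Qed.

Lemma fam_cont p n x : x != 0 -> {for x, continuous (fam p n)}.
Proof.
move=> x0; have t0 := rsq_gt0 x0.
apply: (@continuous_comp _ _ _ (@rsq R) (fun t : R => lfam p n (ln t))).
  exact: rsmooth_cont (@rsmooth_rsq R) x.
apply/differentiable_continuous/derivable1_diffP.
by have [] := is_derive1_comp (is_derive_lfam p n (ln (rsq x))) (is_derive1_ln t0).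
Qed.

Lemma fam_inv p n x : x != 0 -> fam p n x / rsq x = fam (p - 1) n x.
Proof.
move=> x0; have t0 := rsq_gt0 x0.
rewrite /fam /lfam mulrBl expRD mul1r expRN lnK ?posrE//; ring.
Qed.

(** By induction on m, since derivatives of fam are again combinations of
    members of the family times coordinates. *)
Lemma class_C_fam m p n h : test0 h -> class_C m (fun x => fam p n x * h x).
Proof.
elim: m p n h => [|m ih] p n h th; have [[sh ch] s0] := th.
  split => //; apply: mul_supp0_cont => //; [exact: fam_cont|exact: rsmooth_cont].
have D j := mul_supp0_derive (fun x => @is_derive_fam p n j x) (rsmooth_pderivable sh) s0.
apply/class_CS; split.
- apply: mul_supp0_cont => //; [exact: fam_cont|exact: rsmooth_cont].
- by move=> j x; have [] := D j x.
move=> j; pose c1 := 2 * (p - n%:R * q); pose c2 := 2 * (n%:R * q * k).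
have -> : pd j (fun x => fam p n x * h x) = fun x => fam p n x * pd j h x +
   (fam (p - 1) n x * (c1 * (coord3 j x * h x)) + fam (p - 1) n.+1 x * (c2 * (coord3 j x * h x))).
  apply/funext => x; rewrite pdE; have [_ ->] := D j x; congr (_ + _).
  have [->|x0] := eqVneq x 0.
    by have [d d0 hd] := s0; rewrite (supp_in hd) ?rsq0// !mulr0 addr0.
  rewrite -!fam_inv// /efam /c1 /c2; ring.
have tx : test0 (fun x => coord3 j x * h x) by apply: test0M => //; exact: coord3_rsmooth.
by apply: class_CD; [|apply: class_CD]; apply: ih; [exact: test0_pd|exact: test0Z..].
Qed.

Lemma radial_fam p n : radial (fam p n) (efam p n).
Proof.
move=> h th; have [[sh ch] s0] := th; split.
  split; last exact: supp0M.
  by split; [move=> m; exact: class_C_fam|exact: csuppM].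
move=> j x; rewrite pdE.
by have [_ ->] := mul_supp0_derive (fun x => @is_derive_fam p n j x) (rsmooth_pderivable sh) s0 x.
Qed.

End family.

End nullforms.

(** * An angular inequality for half-integer spin *)

Section rotation.
Context {R : realType}.
Local Notation T := (R3 R).
Implicit Types (f g h : T -> R) (x y z w v : T) (C e d : R).

(** For c = cos t and s = sin t, the rotation about the third axis. *)
Definition rotate3 (c s : R) (x : T) : T := ((c * x.1.1 - s * x.1.2, s * x.1.1 + c * x.1.2), x.2).

(** A rotation other than the half-turn is a product of three shears, with
    parameters -tan (t/2), sin t, -tan (t/2); the half-turn is the square of a
    quarter-turn. *)
Lemma preserving_rotate3 c s : c ^+ 2 + s ^+ 2 = 1 -> preserving (rotate3 c s).
Proof.
have main (a b : R) : a ^+ 2 + b ^+ 2 = 1 -> a != -1 -> preserving (rotate3 a b).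
  move=> e a1; have a10 : 1 + a != 0 by rewrite addrC addr_eq0.
  pose t := b / (1 + a).
  have m1 : measurable_fun setT (fun x : T => - t * x.1.2).
    by apply: measurable_funM => //; exact: measurable_x2.
  have m2 : measurable_fun setT (fun x : T => b * x.1.1).
    by apply: measurable_funM => //; exact: measurable_x1.
  have h1 := @preserving_shift1 _ (fun y _ : R => - t * y) m1.
  have h2 := @preserving_shift2 _ (fun y _ : R => b * y) m2.
  have := preserving_comp (preserving_comp h1 h2) h1.
  have et : t * b = 1 - a.
    rewrite /t mulrAC -expr2; have -> : b ^+ 2 = (1 - a) * (1 + a) by rewrite -[b ^+ 2](addKr (a ^+ 2)) e; ring.
    by rewrite mulfK.
  have et2 : t * (1 + a) = b by rewrite /t divfK.
  congr preserving; apply/funext => -[[x y] z]; rewrite /rotate3 /=.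
  have e2 : y + b * (x + - t * y) = b * x + a * y.
    by rewrite (_ : a = 1 - t * b); [ring|rewrite et; ring].
  rewrite e2; congr (_, _, _).
  transitivity ((1 - t * b) * x - (t * (1 + a)) * y); first by ring.
  by rewrite et et2; ring.
move=> e; have [c1|c1] := eqVneq c (-1); last exact: main.
have s0 : s = 0.
  by apply/eqP; rewrite -sqrf_eq0; apply/eqP; move: e; rewrite c1 sqrrN expr1n => e; rewrite -[LHS](addKr 1) e addNr.
have h : preserving (rotate3 0 1).
  by apply: main; [rewrite expr0n expr1n add0r|rewrite eq_sym oppr_eq0 oner_eq0].
have := preserving_comp h h; congr preserving; apply/funext => -[[x y] z].
by rewrite /rotate3 /= c1 s0; congr (_, _, _); ring.
Qed.

Lemma rsq_rotate3 c s x : c ^+ 2 + s ^+ 2 = 1 -> rsq (rotate3 c s x) = rsq x.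
Proof.
move=> e; rewrite rsq.unlock /rotate3/=.
have -> : (c * x.1.1 - s * x.1.2) ^+ 2 + (s * x.1.1 + c * x.1.2) ^+ 2 + x.2 ^+ 2 =
  (c ^+ 2 + s ^+ 2) * (x.1.1 ^+ 2 + x.1.2 ^+ 2) + x.2 ^+ 2 by ring.
by rewrite e mul1r.
Qed.

(** The l^1 norm; unlike the Euclidean norm it is convenient in first-order
    estimates. *)
Definition norm1 w : R := `|w.1.1| + `|w.1.2| + `|w.2|.

Lemma norm1D w v : norm1 (w + v) <= norm1 w + norm1 v.
Proof.
rewrite /norm1/=; have h1 := ler_normD w.1.1 v.1.1; have h2 := ler_normD w.1.2 v.1.2.
by have h3 := ler_normD w.2 v.2; rewrite (le_trans (lerD (lerD h1 h2) h3))//; lra.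
Qed.

Lemma coord3_ext x y : (forall j, coord3 j x = coord3 j y) -> x = y.
Proof.
rewrite coord3.unlock => h; move: (h ord0) (h (lift ord0 ord0)) (h ord_max) => /=.
by case: x {h} => -[? ?] ?; case: y => -[? ?] ? /= -> -> ->.
Qed.

Lemma basis_decomp w : w = w.1.1 *: basis_vec R o0 + (w.1.2 *: basis_vec R o1 + w.2 *: basis_vec R o2).
Proof.
apply: coord3_ext => j; rewrite !coord3D !coord3Z !coord3_basis.
by case: j => -[|[|[|//]]] ?; rewrite coord3.unlock/=; ring.
Qed.

(** First-order Taylor expansion with quadratic remainder, uniformly in the
    base point, by moving along one coordinate axis at a time. *)
Lemma taylor3 f : test f -> exists2 C, 0 <= C & forall y w,
  `|f (w + y) - f y - (w.1.1 * pd o0 f y + w.1.2 * pd o1 f y + w.2 * pd o2 f y)|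
    <= C * norm1 w ^+ 2.
Proof.
move=> tf.
have [C0 C00 h0] := test_lipschitz (test_pd o0 tf).
have [C1 C10 h1] := test_lipschitz (test_pd o1 tf).
have [C2 C20 h2] := test_lipschitz (test_pd o2 tf).
exists (C0 + C1 + C2); first by rewrite !addr_ge0.
move=> y w.
have a1 := normr_ge0 w.1.1; have a2 := normr_ge0 w.1.2; have a3 := normr_ge0 w.2.
have step (j : 'I_3) C (t : R) u : 0 <= C -> (forall x w, `|pd j f (w + x) - pd j f x| <= C * norm1 w) ->
   `|t| + norm1 u <= norm1 w ->
   `|f (t *: basis_vec R j + (u + y)) - f (u + y) - t * pd j f y| <= C * norm1 w ^+ 2.
  move=> Cp hC tW.
  have [s st ->] := @line_MVT _ f (u + y) (basis_vec R j) t (rsmooth_cont tf.1) (@rsmooth_pderivable _ _ tf.1 j).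
  rewrite -pdE -mulrBr normrM addrA expr2 mulrCA.
  have u0 : 0 <= norm1 u by rewrite /norm1 !addr_ge0.
  apply: ler_pM => //; first by apply: le_trans tW; rewrite lerDl.
  apply: le_trans (hC _ _) _; rewrite ler_wpM2l//.
  by rewrite (le_trans (norm1D _ _))// {1}/norm1 basis_norm (le_trans _ tW)// lerD2r.
pose u3 := w.2 *: basis_vec R o2; pose u2 := w.1.2 *: basis_vec R o1 + u3.
have n0 : norm1 0 = 0 by rewrite /norm1 !normr0 !addr0.
have n3 : norm1 u3 = `|w.2| by exact: basis_norm.
have n2 : norm1 u2 <= `|w.1.2| + `|w.2| by rewrite (le_trans (norm1D _ _))// n3 /norm1 basis_norm.
have s3 := step o2 C2 w.2 0 C20 h2; rewrite n0 addr0 add0r in s3.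
have s2 := step o1 C1 w.1.2 u3 C10 h1.
have s1 := step o0 C0 w.1.1 u2 C00 h0.
have {}s3 := s3 _; have {}s3 : `|f (w.2 *: basis_vec R o2 + y) - f y - w.2 * pd o2 f y| <= C2 * norm1 w ^+ 2.
  by apply: s3; rewrite /norm1 lerDr addr_ge0.
have {}s2 : `|f (w.1.2 *: basis_vec R o1 + (u3 + y)) - f (u3 + y) - w.1.2 * pd o1 f y| <= C1 * norm1 w ^+ 2.
  by apply: s2; rewrite n3 /norm1 -addrA lerDr.
have {}s1 : `|f (w.1.1 *: basis_vec R o0 + (u2 + y)) - f (u2 + y) - w.1.1 * pd o0 f y| <= C0 * norm1 w ^+ 2.
  by apply: s1; rewrite {2}/norm1 -addrA lerD2l.
have e1 : w.1.1 *: basis_vec R o0 + (u2 + y) = w + y by rewrite [in RHS](basis_decomp w) /u2 /u3 !addrA.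
have e2 : w.1.2 *: basis_vec R o1 + (u3 + y) = u2 + y by rewrite /u2 addrA.
rewrite e1 in s1; rewrite e2 in s2.
move: s1 s2 s3; rewrite -/u3.
move: (f (w + y)) (f (u2 + y)) (f (u3 + y)) (f y) (pd o0 f y) (pd o1 f y) (pd o2 f y) => F1 F2 F3 F4 D1 D2 D3.
move: (w.1.1) (w.1.2) (w.2) (norm1 w ^+ 2) => c1 c2 c3 W2.
move=> s1 s2 s3.
have -> : F1 - F4 - (c1 * D1 + c2 * D2 + c3 * D3) = (F1 - F2 - c1 * D1) + (F2 - F3 - c2 * D2) + (F3 - F4 - c3 * D3) by ring.
by rewrite !mulrDl (le_trans (ler_normD _ _))// lerD// (le_trans (ler_normD _ _))// lerD.
Qed.

(** A quadratic increment forces a zero derivative. Subtracting the linear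
    part first reduces the computation of derivatives to such estimates. *)
Lemma is_derive_quad (phi : R -> R) (t D : R) :
  (\forall s \near (0 : R), `|phi (s + t) - phi t| <= D * s ^+ 2) -> is_derive t 1 phi 0.
Proof.
move=> hD.
have h : (fun h : R => h^-1 *: ((phi \o shift t) (h *: 1) - phi t)) @ 0^' --> 0.
  apply: norm_cvg0.
  apply: (@squeeze_cvgr _ _ _ _ (fun _ => 0) (fun h : R => D * `|h|)).
  + near=> s; rewrite normr_ge0/= [s%:A]mulr1 [_ *: _]mulrC normrM normfV.
    have s0 : 0 < `|s| by rewrite normr_gt0; near: s; exact: nbhs_dnbhs_neq.
    rewrite ler_pdivrMr// -mulrA -expr2 real_normK ?num_real//.
    by near: s; apply: cvg_within; exact: hD.
  + exact: cvg_cst.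
  + rewrite -[X in _ --> X](mulr0 D); apply: cvgM; first exact: cvg_cst.
    have hn : (fun x : R => `|x|) @ (0 : R)^' --> `|0 : R|.
      by apply: cvg_within_filter; exact: (@norm_continuous _ R 0).
    by rewrite normr0 in hn.
by split; [apply/cvg_ex; exists 0|exact/cvg_lim].
Unshelve. all: by end_near. Qed.

Lemma derive_near_lip (c : R -> R) (t d : R) : is_derive t 1 c d ->
  \forall s \near (0 : R), `|c (s + t) - c t| <= (`|d| + 1) * `|s|.
Proof.
move=> [dc ec].
have h : (fun h : R => h^-1 *: ((c \o shift t) (h *: 1) - c t)) @ 0^' --> d by rewrite -ec.
have h1 : \forall s \near 0^', `|d - s^-1 *: ((c \o shift t) (s *: 1) - c t)| < 1.
  by move/cvgrPdist_lt : h; apply.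
have {}h1 : \forall s \near (0 : R), s != 0 -> `|d - s^-1 *: ((c \o shift t) (s *: 1) - c t)| < 1 := h1.
near=> s; have [->|s0] := eqVneq s 0; first by rewrite add0r subrr normr0 mulr0.
have : `|d - s^-1 *: ((c \o shift t) (s *: 1) - c t)| < 1.
  by move: (s0); near: s; exact: h1.
rewrite /= [s%:A]mulr1 [_ *: _]mulrC => h2.
have sp : 0 < `|s| by rewrite normr_gt0.
rewrite -ler_pdivrMr// -normfV -normrM.
rewrite -[X in `|X|](subKr d) (le_trans (ler_normB _ _))// lerD2l.
exact: ltW.
Unshelve. all: by end_near. Qed.

(** The chain rule along a curve, from the Taylor expansion. *)
Lemma chain_curve f (c1 c2 c3 : R -> R) (t d1 d2 d3 : R) : test f ->
  is_derive t 1 c1 d1 -> is_derive t 1 c2 d2 -> is_derive t 1 c3 d3 ->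
  is_derive t 1 (fun s => f ((c1 s, c2 s), c3 s))
    (d1 * pd o0 f ((c1 t, c2 t), c3 t) + d2 * pd o1 f ((c1 t, c2 t), c3 t) + d3 * pd o2 f ((c1 t, c2 t), c3 t)).
Proof.
move=> tf h1 h2 h3; have [C C0 hC] := taylor3 tf.
set y : T := ((c1 t, c2 t), c3 t).
pose L (s : R) := c1 s * pd o0 f y + c2 s * pd o1 f y + c3 s * pd o2 f y.
have hZ (c : R -> R) (d p : R) : is_derive t 1 c d -> is_derive t 1 (fun s => c s * p) (d * p).
  move=> hc; have := is_deriveM hc (@is_derive_cst _ R R p t 1).
  by rewrite /GRing.scale/= mulr0 add0r [p * d]mulrC.
have hL : is_derive t 1 L (d1 * pd o0 f y + d2 * pd o1 f y + d3 * pd o2 f y).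
  exact: (is_deriveD (is_deriveD (hZ _ _ (pd o0 f y) h1) (hZ _ _ (pd o1 f y) h2)) (hZ _ _ (pd o2 f y) h3)).
pose phi (s : R) := f ((c1 s, c2 s), c3 s) - L s.
pose K := (`|d1| + 1) + (`|d2| + 1) + (`|d3| + 1).
have hphi : is_derive t 1 phi 0.
  apply: (@is_derive_quad _ _ (C * K ^+ 2)).
  near=> s.
  have l1 : `|c1 (s + t) - c1 t| <= (`|d1| + 1) * `|s| by near: s; exact: derive_near_lip h1.
  have l2 : `|c2 (s + t) - c2 t| <= (`|d2| + 1) * `|s| by near: s; exact: derive_near_lip h2.
  have l3 : `|c3 (s + t) - c3 t| <= (`|d3| + 1) * `|s| by near: s; exact: derive_near_lip h3.
  pose w : T := ((c1 (s + t) - c1 t, c2 (s + t) - c2 t), c3 (s + t) - c3 t).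
  have ew : ((c1 (s + t), c2 (s + t)), c3 (s + t)) = w + y.
    by apply: coord3_ext => j; rewrite coord3D coord3.unlock; case: j => -[|[|[|//]]] ? /=; rewrite subrK.
  have nw : norm1 w <= K * `|s| by rewrite /norm1 /w /= /K !mulrDl in l1 l2 l3 *; lra.
  have nw0 : 0 <= norm1 w by rewrite /norm1 !addr_ge0.
  have -> : phi (s + t) - phi t = f (w + y) - f y - (w.1.1 * pd o0 f y + w.1.2 * pd o1 f y + w.2 * pd o2 f y).
    by rewrite /phi ew /L /w /= -/y; ring.
  apply: le_trans (hC _ _) _; rewrite -mulrA ler_wpM2l//.
  rewrite -(real_normK (num_real s)) -exprMn lerXn2r// nnegrE.
  exact: le_trans nw.
have := is_deriveD hphi hL; rewrite add0r.
by congr is_derive; apply/funext => s; rewrite /phi /= subrK.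
Unshelve. all: by end_near. Qed.

Lemma is_derive_ext (f1 f2 : R -> R) (t d1 d2 : R) : is_derive t 1 f1 d1 ->
  (forall s, f2 s = f1 s) -> d1 = d2 -> is_derive t 1 f2 d2.
Proof. by move=> h /funext -> <-. Qed.

Lemma rot_curve f x (t : R) : test f ->
  is_derive t 1 (fun s => f (rotate3 (cos s) (sin s) x)) (rot o0 o1 f (rotate3 (cos t) (sin t) x)).
Proof.
move=> tf.
have hc (a b : R) : is_derive t 1 (fun s : R => cos s * a - sin s * b) (- sin t * a - cos t * b).
  have h1 := is_deriveM (is_derive_cos t) (@is_derive_cst _ R R a t 1).
  have h2 := is_deriveM (is_derive_sin t) (@is_derive_cst _ R R b t 1).
  have := is_deriveB h1 h2; rewrite /GRing.scale/= !mulr0 !add0r.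
  by rewrite [a * _]mulrC [b * _]mulrC.
have hs (a b : R) : is_derive t 1 (fun s : R => sin s * a + cos s * b) (cos t * a - sin t * b).
  have h1 := is_deriveM (is_derive_sin t) (@is_derive_cst _ R R a t 1).
  have h2 := is_deriveM (is_derive_cos t) (@is_derive_cst _ R R b t 1).
  have := is_deriveD h1 h2; rewrite /GRing.scale/= !mulr0 !add0r.
  by rewrite [a * _]mulrC [b * _]mulrC mulNr.
have H := chain_curve tf (hc x.1.1 x.1.2) (hs x.1.1 x.1.2) (@is_derive_cst _ R R x.2 t 1).
apply: (is_derive_ext H) => //; rewrite mul0r addr0 /rot /rotate3 coord3.unlock /=; ring.
Qed.

Lemma rotate3_cos_sin (t : R) : cos t ^+ 2 + sin t ^+ 2 = 1.
Proof. by rewrite cos2Dsin2. Qed.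

Section inequality.
Variables (om eo : T -> R).
Hypothesis rom : radial om eo.
Hypothesis om0 : forall x, 0 <= om x.
Hypothesis om_rot : forall c s x, c ^+ 2 + s ^+ 2 = 1 -> om (rotate3 c s x) = om x.

Lemma itg_om h : test0 h -> itg (fun x => om x * h x).
Proof. by move=> th; apply: itg_test; exact: (rom th).1.1. Qed.

Lemma pi_lt4 : (pi : R) < 4.
Proof. by have := @pihalf_lt2 R; rewrite ltr_pdivrMr//; lra. Qed.

(** Rotate by t and compensate in the spin space by t/2: with G t = cos (t/2)
    p + sin (t/2) q evaluated at the rotated point, the spinor returns with
    the opposite sign, G (2 pi) = - G 0. The derivative of G consists of the
    two expressions on the right. Hence F t = int om p (G t) runs from int om
    p^2 to its opposite while t runs through [0, 2 pi], and the mean value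
    theorem bounds int om p^2 by pi times a value of -F'. *)
Lemma rot_ineq1 p q : test0 p -> test0 q ->
  int3 (fun x => om x * p x ^+ 2) <=
  16 * int3 (fun x => om x * ((rot o0 o1 p x + q x / 2) ^+ 2 + (rot o0 o1 q x - p x / 2) ^+ 2)).
Proof.
have fin (d a b : R) : d <= 8^-1 * a + 2 * b -> a <= 4 * d -> a <= 16 * b by lra.
move=> tp tq.
pose A x := rot o0 o1 p x + q x / 2; pose B x := rot o0 o1 q x - p x / 2.
have tA : test0 A.
  apply: test0D; first exact: test0_rot.
  by under eq_fun do rewrite mulrC; exact: test0Z.
have tB : test0 B.
  apply: test0D; first exact: test0_rot.
  by under eq_fun do rewrite mulrC -mulNr; exact: test0Z.
have sA := tA.1.1; have sB := tB.1.1.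
have tA2 : test0 (fun x => A x ^+ 2 + B x ^+ 2).
  by apply: test0D; under eq_fun do rewrite expr2; exact: test0M.
have tp2 : test0 (fun x => p x ^+ 2).
  by under eq_fun do rewrite expr2; apply: test0M => //; exact: tp.1.1.
pose G (t : R) x := cos (t / 2) * p (rotate3 (cos t) (sin t) x) + sin (t / 2) * q (rotate3 (cos t) (sin t) x).
pose dG (t : R) x := cos (t / 2) * A (rotate3 (cos t) (sin t) x) + sin (t / 2) * B (rotate3 (cos t) (sin t) x).
have hG (t : R) x : is_derive t 1 (G ^~ x) (dG t x).
  have hh : is_derive t 1 (fun s : R => s / 2) (2^-1).
    have := is_deriveM (@is_derive_id _ R t 1) (@is_derive_cst _ R R (2^-1 : R) t 1).
    by rewrite /GRing.scale/= mulr0 add0r mulr1.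
  have hc := @is_derive1_comp R cos (fun s : R => s / 2) t _ _ (is_derive_cos (t / 2)) hh.
  have hs := @is_derive1_comp R sin (fun s : R => s / 2) t _ _ (is_derive_sin (t / 2)) hh.
  have H := is_deriveD (is_deriveM hc (rot_curve x t tp.1)) (is_deriveM hs (rot_curve x t tq.1)).
  apply: (is_derive_ext H) => //; rewrite /dG /A /B /GRing.scale/=; ring.
pose F (t : R) := int3 (fun x => om x * p x * G t x).
have tG (t : R) : itg (fun x => om x * p x * G t x).
  have mr : measurable_fun setT (rotate3 (cos t) (sin t)) := (preserving_rotate3 (rotate3_cos_sin t)).1.
  have mp : measurable_fun setT (fun x => p (rotate3 (cos t) (sin t) x)).
    exact: (measurableT_comp (continuous_measurable3 (rsmooth_cont tp.1.1)) mr).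
  have mq : measurable_fun setT (fun x => q (rotate3 (cos t) (sin t) x)).
    exact: (measurableT_comp (continuous_measurable3 (rsmooth_cont tq.1.1)) mr).
  have [Kp hKp] := csupp_bounded (rsmooth_cont tp.1.1) tp.1.2.
  have [Kq hKq] := csupp_bounded (rsmooth_cont tq.1.1) tq.1.2.
  under eq_fun do rewrite mulrC.
  apply: (@itg_bdM _ _ (G t) (Kp + Kq)); first exact: itg_om.
    by apply: measurable_funD; apply: measurable_funM.
  move=> x; rewrite (le_trans (ler_normD _ _))// lerD// normrM.
    by rewrite -[leRHS]mul1r ler_pM// cos_max.
  by rewrite -[leRHS]mul1r ler_pM// sin_max.
have [CA hCA] := csupp_bounded (rsmooth_cont tA.1.1) tA.1.2.
have [CB hCB] := csupp_bounded (rsmooth_cont tB.1.1) tB.1.2.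
have hdG (t : R) x : `|dG t x| <= CA + CB.
  rewrite (le_trans (ler_normD _ _))// lerD// normrM.
    by rewrite -[leRHS]mul1r ler_pM// cos_max.
  by rewrite -[leRHS]mul1r ler_pM// sin_max.
have hF (t : R) : is_derive t 1 F (int3 (fun x => om x * p x * dG t x)).
  have I : t \in (`]t - 1, t + 1[)%R by rewrite in_itv/= ltrBlDr !ltrDl ltr01.
  have hd (s : R) x : is_derive s 1 (fun s : R => om x * p x * G s x) (om x * p x * dG s x).
    have := is_deriveM (@is_derive_cst _ R R (om x * p x) s 1) (hG s x).
    by rewrite /GRing.scale/= mulr0 addr0.
  have D1 s x : partial1of2 (fun (s : R) x => om x * p x * G s x) s x = om x * p x * dG s x.
    by rewrite partial1of2E; have [_] := hd s x.
  have C0 : 0 <= CA + CB by exact: le_trans (normr_ge0 _) (hdG t 0).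
  have G0 x : 0 <= (CA + CB) * `|om x * p x| by rewrite mulr_ge0.
  have iG : itg (fun x => (CA + CB) * `|om x * p x|) by apply/itgZ/itg_abs/itg_om.
  have Gub (s : R) x : `|partial1of2 (fun (s : R) x => om x * p x * G s x) s x| <= (CA + CB) * `|om x * p x|.
    by rewrite D1 normrM mulrC ler_wpM2r.
  have H := @cvg_differentiation_under_integral R _ _ (leb3 R) (fun s x => om x * p x * G s x)
    setT measurableT t (t - 1) (t + 1) I (fun s _ => tG s)
    (fun s x _ _ => @ex_derive _ _ _ _ _ _ _ (hd s x)) _ G0 iG (fun s x _ _ => Gub s x).
  have {}H : (fun h : R => h^-1 *: ((F \o shift t) (h *: 1) - F t)) @ 0^' --> int3 (fun x => om x * p x * dG t x).
    rewrite /F int3.unlock /=; under eq_fun do rewrite [_%:A]mulr1.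
    rewrite (_ : (fun x => om x * p x * dG t x) =
      (fun x => partial1of2 (fun (s : R) x => om x * p x * G s x) t x)); first exact: H.
    by apply/funext => x; rewrite D1.
  by split; [apply/cvg_ex; eexists; exact: H|exact/cvg_lim].
have F0 : F 0 = int3 (fun x => om x * p x ^+ 2).
  rewrite /F; congr int3; apply/funext => x.
  rewrite /G mul0r cos0 sin0 mul0r addr0 mul1r -mulrA expr2; congr (_ * (_ * p _)).
  by case: x => -[a b] c; rewrite /rotate3/=; congr (_, _, _); ring.
have F2 : F (pi *+ 2) = - F 0.
  rewrite -[RHS]mulN1r F0 -int3Z; last exact: itg_om.
  rewrite /F; congr int3; apply/funext => x.
  have e : pi *+ 2 / 2 = pi :> R by rewrite -[pi *+ 2]mulr_natr mulfK// pnatr_eq0.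
  rewrite /G e cospi sinpi cos2pi sin2pi mul0r addr0.
  have -> : rotate3 1 0 x = x by case: x => -[a b] c; rewrite /rotate3/=; congr (_, _, _); ring.
  by ring.
(* The sign change over a full turn: F (2 pi) - F 0 = - 2 int om p^2. *)
have [c _ hc] := @MVT_segment R F _ 0 (pi *+ 2) (mulrn_wge0 2 (@pi_ge0 R)) (fun s _ => hF s)
   (continuous_subspaceT (fun s => differentiable_continuous ((derivable1_diffP _ _).1 (@ex_derive _ _ _ _ _ _ _ (hF s))))).
set X := int3 (fun x => om x * p x ^+ 2).
set Y := int3 (fun x => om x * (A x ^+ 2 + B x ^+ 2)).
have X0 : 0 <= X by apply: int3_ge0 => x; rewrite mulr_ge0// sqr_ge0.
set D := int3 (fun x => om x * p x * dG c x) in hc.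
have hr := preserving_rotate3 (rotate3_cos_sin c).
have iY : itg (fun x => om x * (A x ^+ 2 + B x ^+ 2)) by exact: itg_om.
have iX : itg (fun x => om x * p x ^+ 2) by exact: itg_om.
have iD : itg (fun x => om x * p x * dG c x).
  under eq_fun do rewrite mulrC.
  apply: (@itg_bdM _ _ (dG c) (CA + CB)); [exact: itg_om| |exact: hdG].
  have mr := hr.1.
  by apply: measurable_funD; apply: measurable_funM => //;
    apply: (measurableT_comp (continuous_measurable3 (rsmooth_cont _)) mr).
have hD : - D <= 8^-1 * X + 2 * Y.
  rewrite /X /Y -(preserving_int3 hr iY) -!int3Z//; last exact: preserving_itg hr iY.
  rewrite -int3D; [|exact: itgZ|exact: itgZ (preserving_itg hr iY)].
  rewrite -int3N//; apply: ler_int3.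
  - exact: itgN.
  - by apply: itgD; [exact: itgZ|exact: itgZ (preserving_itg hr iY)].
  move=> x /=; rewrite om_rot ?rotate3_cos_sin// /dG.
  have cs := rotate3_cos_sin (c / 2); have o := om0 x.
  move: (cos (c / 2)) (sin (c / 2)) (A _) (B _) (om x) (p x) cs o => C S a b O P cs o.
  (* As pi < 4, the first term contributes at most half of int om p^2 in the
     end. *)
  have h1 : 0 <= 8^-1 * P ^+ 2 + 2 * (a ^+ 2 + b ^+ 2) + P * (C * a + S * b).
    have -> : 8^-1 * P ^+ 2 + 2 * (a ^+ 2 + b ^+ 2) + P * (C * a + S * b) =
      8^-1 * (P + 4 * (C * a + S * b)) ^+ 2 + 2 * ((C ^+ 2 + S ^+ 2) * (a ^+ 2 + b ^+ 2) - (C * a + S * b) ^+ 2)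
      + 2 * (1 - (C ^+ 2 + S ^+ 2)) * (a ^+ 2 + b ^+ 2) by field.
    rewrite cs subrr mulr0 mul0r addr0 addr_ge0//; first by rewrite mulr_ge0// sqr_ge0.
    rewrite mulr_ge0// -{1}cs.
    have -> : (C ^+ 2 + S ^+ 2) * (a ^+ 2 + b ^+ 2) - (C * a + S * b) ^+ 2 = (C * b - S * a) ^+ 2 by ring.
    exact: sqr_ge0.
  rewrite -subr_ge0 (_ : _ - _ = O * (8^-1 * P ^+ 2 + 2 * (a ^+ 2 + b ^+ 2) + P * (C * a + S * b))).
    exact: mulr_ge0.
  ring.
have hp := @pi_gt0 R; have hp4 := pi_lt4.
rewrite F2 subr0 F0 -/X in hc.
have e : X = pi * - D by move: hc; rewrite -mulr_natr => hc; lra.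
have Dge0 : 0 <= - D by rewrite -(pmulr_rge0 _ hp) -e.
have h4 : X <= 4 * - D by rewrite e ler_wpM2r// ltW.
exact: fin hD h4.
Qed.

(** The inequality rot_ineq1 for p and for q: the pair (q, -p) satisfies the
    same relations as (p, q). *)
Lemma rot_ineq p q : test0 p -> test0 q ->
  int3 (fun x => om x * (p x ^+ 2 + q x ^+ 2)) <=
  32 * int3 (fun x => om x * ((rot o0 o1 p x + q x / 2) ^+ 2 + (rot o0 o1 q x - p x / 2) ^+ 2)).
Proof.
move=> tp tq; have h1 := rot_ineq1 tp tq; have h2 := rot_ineq1 tq (test0Z (-1) tp).
have sq h : test0 h -> itg (fun x => om x * h x ^+ 2).
  move=> th; apply: itg_om; under eq_fun do rewrite expr2.
  by apply: test0M => //; exact: th.1.1.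
have -> : (fun x => om x * (p x ^+ 2 + q x ^+ 2)) = fun x => om x * p x ^+ 2 + om x * q x ^+ 2.
  by apply/funext => x; rewrite mulrDr.
rewrite int3D; [|exact: sq..].
have e2 : (fun x => om x * ((rot o0 o1 q x + (-1 * p x) / 2) ^+ 2 + (rot o0 o1 (fun x => -1 * p x) x - q x / 2) ^+ 2)) =
   (fun x => om x * ((rot o0 o1 p x + q x / 2) ^+ 2 + (rot o0 o1 q x - p x / 2) ^+ 2)).
  apply/funext => x; congr (_ * _).
  have rN : rot o0 o1 (fun x => -1 * p x) x = - rot o0 o1 p x.
    rewrite /rot !(@pdM _ _ (fun=> -1) p (@pderivable_cst R (-1)) (test0_pder tp)) !pd_cst; ring.
  rewrite rN; ring.
rewrite e2 in h2.
apply: le_trans (lerD h1 h2) _; set Z := int3 _; clear; lra.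
Qed.

End inequality.
End rotation.

(** * The weighted Hardy inequality for test functions *)

Section core.
Context {R : realType}.
Local Notation T := (R3 R).
Implicit Types (f g h : T -> R) (x y z w v : T) (C e d : R).

Lemma ord3P (P : 'I_3 -> Prop) : P o0 -> P o1 -> P o2 -> forall j, P j.
Proof.
move=> h0 h1 h2 [[|[|[|//]]] i].
- by rewrite (_ : Ordinal i = o0) //; exact/val_inj.
- by rewrite (_ : Ordinal i = o1) //; exact/val_inj.
- by rewrite (_ : Ordinal i = o2) //; exact/val_inj.
Qed.

Lemma o01 : (o0 == o1) = false. Proof. by []. Qed.
Lemma o02 : (o0 == o2) = false. Proof. by []. Qed.
Lemma o12 : (o1 == o2) = false. Proof. by []. Qed.
Lemma o10 : (o1 == o0) = false. Proof. by []. Qed.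
Lemma o20 : (o2 == o0) = false. Proof. by []. Qed.
Lemma o21 : (o2 == o1) = false. Proof. by []. Qed.
Definition ordE := (o01, o02, o12, o10, o20, o21, @eqxx).

Lemma pd_rot j a b f x : rsmooth f -> pd j (rot a b f) x =
  coord3 a x * pd j (pd b f) x + (a == j)%:R * pd b f x
  - (coord3 b x * pd j (pd a f) x + (b == j)%:R * pd a f x).
Proof.
move=> sf.
have hp i := @rsmooth_pderivable _ _ (@rsmooth_pd _ i _ sf).
have hx i := rsmooth_pderivable (@coord3_rsmooth R i).
rewrite -!pd_xcM//.
have e : rot a b f = fun x => coord3 a x * pd b f x + (-1) * (coord3 b x * pd a f x).
  by apply/funext => y; rewrite /rot mulN1r.
rewrite e pdD; [|exact: pderivableM|apply: pderivableM; [exact: pderivable_cst|exact: pderivableM]].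
congr (_ + _); rewrite (@pdM _ _ (fun=> -1)); [|exact: pderivable_cst|exact: pderivableM].
by rewrite pd_cst mul0r addr0 mulN1r.
Qed.

Lemma pd_euler j f x : rsmooth f -> pd j (euler f) x =
  (coord3 o0 x * pd j (pd o0 f) x + (o0 == j)%:R * pd o0 f x) +
  (coord3 o1 x * pd j (pd o1 f) x + (o1 == j)%:R * pd o1 f x) +
  (coord3 o2 x * pd j (pd o2 f) x + (o2 == j)%:R * pd o2 f x).
Proof.
move=> sf.
have hp i := @rsmooth_pderivable _ _ (@rsmooth_pd _ i _ sf).
have hx i := rsmooth_pderivable (@coord3_rsmooth R i).
have hM i : pderivable (fun x => coord3 i x * pd i f x) by exact: pderivableM.
rewrite -!pd_xcM// /euler pdD ?pdD//; exact: pderivableD.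
Qed.

Lemma euler_rot a b f x : rsmooth f -> euler (rot a b f) x = rot a b (euler f) x.
Proof.
move=> sf; rewrite {1}/euler {4}/rot !pd_rot// !pd_euler//.
by move: a b; apply: ord3P; apply: ord3P; rewrite ?(clairaut o1 o0 sf) ?(clairaut o2 o0 sf) ?(clairaut o2 o1 sf) ?ordE /= ?mulr1n ?mulr0n; ring.
Qed.

Lemma rot_comm12 f x : rsmooth f ->
  rot o1 o2 (rot o2 o0 f) x - rot o2 o0 (rot o1 o2 f) x = - rot o0 o1 f x.
Proof.
move=> sf; rewrite {1}/rot {3}/rot !pd_rot// ?ordE /= ?mulr1n ?mulr0n.
by rewrite ?(clairaut o1 o0 sf) ?(clairaut o2 o0 sf) ?(clairaut o2 o1 sf) /rot; ring.
Qed.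
Lemma rot_comm23 f x : rsmooth f ->
  rot o2 o0 (rot o0 o1 f) x - rot o0 o1 (rot o2 o0 f) x = - rot o1 o2 f x.
Proof.
move=> sf; rewrite {1}/rot {3}/rot !pd_rot// ?ordE /= ?mulr1n ?mulr0n.
by rewrite ?(clairaut o1 o0 sf) ?(clairaut o2 o0 sf) ?(clairaut o2 o1 sf) /rot; ring.
Qed.
Lemma rot_comm31 f x : rsmooth f ->
  rot o0 o1 (rot o1 o2 f) x - rot o1 o2 (rot o0 o1 f) x = - rot o2 o0 f x.
Proof.
move=> sf; rewrite {1}/rot {3}/rot !pd_rot// ?ordE /= ?mulr1n ?mulr0n.
by rewrite ?(clairaut o1 o0 sf) ?(clairaut o2 o0 sf) ?(clairaut o2 o1 sf) /rot; ring.
Qed.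

Lemma test0_mul f g : test0 f -> test0 g -> test0 (fun x => f x * g x).
Proof. by move=> tf tg; apply: test0M => //; exact: tf.1.1. Qed.

(** The constants: the rotation inequality gains 1/17 * 1/32, and N^2 >= 1/4
    gains 1/68, against the losses 1/64 of square_lower and 1/2176 from the
    variation of the weight. *)
Lemma core_arith (a1 a2 a3 a4 : R) : a1 <= 32 * a3 -> a2 <= 32 * a4 ->
  1 / 2176 * (a1 + a2) <= 1 / 17 * (a3 + a4) + (1 / 68 - 1 / 64 - 1 / 2176) * (a1 + a2).
Proof. lra. Qed.

Section pieces.
Variables (w b eb : T -> R).
Hypothesis rw : radial w (fun x => (2 * b x - 1) * w x).
Hypothesis rwb : radial (fun x => w x * b x) (fun x => (2 * b x - 1) * (w x * b x) + w x * eb x).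

(** E + 1 + b is skew with respect to w dx when the Euler derivative of w is
    (2 b - 1) w; for w = 1/|x|^2 this means b = -1/2. *)
Definition dilation f x := euler f x + (1 + b x) * f x.

(** Skewness of dilation. *)
Lemma null_sym p q : test0 p -> test0 q ->
  null (fun x => w x * (dilation p x * q x + dilation q x * p x)).
Proof.
move=> tp tq; have := null_euler rw (test0_mul tp tq); apply: null_eq => x.
rewrite (eulerM (test0_pder tp) (test0_pder tq)) /dilation; ring.
Qed.

(** Skewness of the dilation, tested with p and b p; here eb is the Euler
    derivative of b. *)
Lemma null_dilation p : test0 p ->
  null (fun x => w x * (2 * b x * (dilation p x * p x) + eb x * p x ^+ 2)).
Proof.
move=> tp; have := null_euler rwb (test0_mul tp tp); apply: null_eq => x.
rewrite (eulerM (test0_pder tp) (test0_pder tp)) /dilation; ring.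
Qed.

(** Rotations commute with dilations and are skew, while a dilation is skew
    too; hence their product is symmetric and its antisymmetrization
    integrates to 0. *)
Lemma null_twist i j p q : i != j -> test0 p -> test0 q ->
  null (fun x => w x * (dilation p x * rot i j q x - dilation q x * rot i j p x)).
Proof.
move=> ij tp tq; have trq := test0_rot i j tq; have teq := test0_euler tq.
have h1 := null_euler rw (test0_mul tp trq).
have h2 := null_rot rw ij (test0_mul tp teq).
have h3 := null_rot (radialD rw rwb) ij (test0_mul tp tq).
have := nullB (nullB h1 h2) h3; apply: null_eq => x.
rewrite (eulerM (test0_pder tp) (test0_pder trq)) (rotM i j (test0_pder tp) (test0_pder teq)).
rewrite (rotM i j (test0_pder tp) (test0_pder tq)) (euler_rot i j x tq.1.1) /dilation; ring.
Qed.

(** Integrating by parts twice turns the antisymmetrized product of two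
    rotations into their commutator, which is the third rotation. *)
Lemma null_comm (i j k l m n : 'I_3) p q : i != j -> k != l -> m != n ->
  (forall f x, rsmooth f -> rot i j (rot k l f) x - rot k l (rot i j f) x = - rot m n f x) ->
  test0 p -> test0 q ->
  null (fun x => w x * (rot i j p x * rot k l q x - rot k l p x * rot i j q x
    - (p x * rot m n q x - q x * rot m n p x) / 2)).
Proof.
move=> ij kl mn hc tp tq.
have t1 := test0_rot i j tq; have t2 := test0_rot k l tq.
have h1 := null_rot rw ij (test0_mul tp t2).
have h2 := null_rot rw kl (test0_mul tp t1).
have h3 := null_rot rw mn (test0_mul tp tq).
have := nullD (nullB h1 h2) (nullZ (2^-1) h3); apply: null_eq => x.
rewrite (rotM i j (test0_pder tp) (test0_pder t2)) (rotM k l (test0_pder tp) (test0_pder t1)).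
rewrite (rotM m n (test0_pder tp) (test0_pder tq)).
have -> : rot i j (rot k l q) x = rot k l (rot i j q) x - rot m n q x.
  by rewrite -hc ?subrKC//; exact: tq.1.1.
by field.
Qed.

Definition R1 := rot (R := R) o1 o2.
Definition R2 := rot (R := R) o2 o0.
Definition R3r := rot (R := R) o0 o1.

(** The angular part sum_i e_i R_i, where e_i = -i sigma_i acts on the real
    coordinates (Re f1, Im f1, Re f2, Im f2) of a two-spinor as a quaternion
    unit. *)
Definition ang_mom (p : nat -> T -> R) (k : nat) x : R := match k with
  | 0 => R1 (p 3) x - R2 (p 2) x + R3r (p 1) x
  | 1 => - R1 (p 2) x - R2 (p 3) x - R3r (p 0) x
  | 2 => R1 (p 1) x + R2 (p 0) x - R3r (p 3) x
  | _ => - R1 (p 0) x + R2 (p 1) x + R3r (p 2) x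
  end.

(** The spin-orbit operator N = 1 + S. *)
Definition spin_orbit (p : nat -> T -> R) k x : R := p k x + ang_mom p k x.

(** The square |R_3 f - e_3 f / 2|^2, arranged as the two pairs to which the
    rotation inequality applies. *)
Definition rotsq (p : nat -> T -> R) x : R := (R3r (p 1) x + p 0 x / 2) ^+ 2 + (R3r (p 0) x - p 1 x / 2) ^+ 2
  + ((R3r (p 2) x + p 3 x / 2) ^+ 2 + (R3r (p 3) x - p 2 x / 2) ^+ 2).

(** The squares |R_1 f - e_1 f / 2|^2 + |R_2 f - e_2 f / 2|^2. *)
Definition rotsq12 (p : nat -> T -> R) x : R :=
  (R1 (p 0) x - p 3 x / 2) ^+ 2 + (R1 (p 1) x + p 2 x / 2) ^+ 2 +
  (R1 (p 2) x - p 1 x / 2) ^+ 2 + (R1 (p 3) x + p 0 x / 2) ^+ 2 +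
  ((R2 (p 0) x + p 2 x / 2) ^+ 2 + (R2 (p 1) x + p 3 x / 2) ^+ 2 +
  (R2 (p 2) x - p 0 x / 2) ^+ 2 + (R2 (p 3) x - p 1 x / 2) ^+ 2).

(** In integrated form, N^2 = 1/4 + sum_i |R_i - e_i / 2|^2. The operators R_i
    - e_i / 2 generate the rotations of spinors. *)
Lemma null_spin_orbit_sq (p : nat -> T -> R) : (forall k, test0 (p k)) ->
  null (fun x => w x * (\sum_(k < 4) (spin_orbit p k x ^+ 2 - p k x ^+ 2 / 4) - (rotsq p x + rotsq12 p x))).
Proof.
move=> tp.
have C12 k l := @null_comm o1 o2 o2 o0 o0 o1 (p k) (p l) isT isT isT rot_comm12 (tp k) (tp l).
have C23 k l := @null_comm o2 o0 o0 o1 o1 o2 (p k) (p l) isT isT isT rot_comm23 (tp k) (tp l).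
have C31 k l := @null_comm o0 o1 o1 o2 o2 o0 (p k) (p l) isT isT isT rot_comm31 (tp k) (tp l).
have := nullZ 2 (nullD (nullB (C12 2 3) (C12 0 1)) (nullD (nullB (C23 1 2) (C23 0 3)) (nullD (C31 0 2) (C31 1 3)))).
apply: null_eq => x; rewrite !big_ord_recr big_ord0 /= /spin_orbit /ang_mom /rotsq /rotsq12 /R1 /R2 /R3r.
move: (rot o0 o1 (p 0) x) (rot o0 o1 (p 1) x) (rot o0 o1 (p 2) x) (rot o0 o1 (p 3) x).
move: (rot o1 o2 (p 0) x) (rot o1 o2 (p 1) x) (rot o1 o2 (p 2) x) (rot o1 o2 (p 3) x).
move: (rot o2 o0 (p 0) x) (rot o2 o0 (p 1) x) (rot o2 o0 (p 2) x) (rot o2 o0 (p 3) x).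
move: (p 0 x) (p 1 x) (p 2 x) (p 3 x) (w x) => ? ? ? ? ? ? ? ? ? ? ? ? ? ? ? ? ?.
by field.
Qed.

(** N is symmetric and commutes with the skew operator dilation, so their
    product is skew. *)
Lemma null_dilation_spin_orbit (p : nat -> T -> R) : (forall k, test0 (p k)) ->
  null (fun x => w x * \sum_(k < 4) (dilation (p k) x * spin_orbit p k x)).
Proof.
move=> tp.
have T1 k l := @null_twist o1 o2 (p k) (p l) isT (tp k) (tp l).
have T2 k l := @null_twist o2 o0 (p k) (p l) isT (tp k) (tp l).
have T3 k l := @null_twist o0 o1 (p k) (p l) isT (tp k) (tp l).
have S0 k := null_sym (tp k) (tp k).
have := nullD (nullZ (2^-1) (nullD (nullD (S0 0) (S0 1)) (nullD (S0 2) (S0 3))))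
  (nullD (nullB (T1 0 3) (T1 1 2)) (nullB (nullB (T3 0 1) (T3 2 3)) (nullD (T2 0 2) (T2 1 3)))).
apply: null_eq => x; rewrite !big_ord_recr big_ord0 /= /spin_orbit /ang_mom /R1 /R2 /R3r.
move: (rot o0 o1 (p 0) x) (rot o0 o1 (p 1) x) (rot o0 o1 (p 2) x) (rot o0 o1 (p 3) x).
move: (rot o1 o2 (p 0) x) (rot o1 o2 (p 1) x) (rot o1 o2 (p 2) x) (rot o1 o2 (p 3) x).
move: (rot o2 o0 (p 0) x) (rot o2 o0 (p 1) x) (rot o2 o0 (p 2) x) (rot o2 o0 (p 3) x).
move: (dilation (p 0) x) (dilation (p 1) x) (dilation (p 2) x) (dilation (p 3) x).
move: (p 0 x) (p 1 x) (p 2 x) (p 3 x) (w x) => ? ? ? ? ? ? ? ? ? ? ? ? ? ? ? ? ? ? ? ? ?.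
by field.
Qed.

(** Symmetry of N. *)
Lemma null_spin_orbit_sym (p q : nat -> T -> R) : (forall k, test0 (p k)) -> (forall k, test0 (q k)) ->
  null (fun x => w x * \sum_(k < 4) (spin_orbit q k x * p k x - spin_orbit p k x * q k x)).
Proof.
move=> tp tq.
have T1 k l := @null_rot _ _ _ o1 o2 _ rw isT (test0_mul (tp k) (tq l)).
have T2 k l := @null_rot _ _ _ o2 o0 _ rw isT (test0_mul (tp k) (tq l)).
have T3 k l := @null_rot _ _ _ o0 o1 _ rw isT (test0_mul (tp k) (tq l)).
have := nullD (nullD (nullB (T1 0 3) (T1 1 2)) (nullB (T1 2 1) (T1 3 0)))
  (nullD (nullB (nullD (T2 2 0) (T2 3 1)) (nullD (T2 0 2) (T2 1 3)))
         (nullD (nullB (T3 0 1) (T3 1 0)) (nullB (T3 3 2) (T3 2 3)))).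
apply: null_eq => x; rewrite !big_ord_recr big_ord0 /= /spin_orbit /ang_mom /R1 /R2 /R3r.
have e i j k l : rot i j (fun x => p k x * q l x) x = p k x * rot i j (q l) x + rot i j (p k) x * q l x.
  exact: rotM (test0_pder (tp k)) (test0_pder (tq l)) x.
rewrite !e.
move: (rot o0 o1 (p 0) x) (rot o0 o1 (p 1) x) (rot o0 o1 (p 2) x) (rot o0 o1 (p 3) x).
move: (rot o1 o2 (p 0) x) (rot o1 o2 (p 1) x) (rot o1 o2 (p 2) x) (rot o1 o2 (p 3) x).
move: (rot o2 o0 (p 0) x) (rot o2 o0 (p 1) x) (rot o2 o0 (p 2) x) (rot o2 o0 (p 3) x).
move: (rot o0 o1 (q 0) x) (rot o0 o1 (q 1) x) (rot o0 o1 (q 2) x) (rot o0 o1 (q 3) x).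
move: (rot o1 o2 (q 0) x) (rot o1 o2 (q 1) x) (rot o1 o2 (q 2) x) (rot o1 o2 (q 3) x).
move: (rot o2 o0 (q 0) x) (rot o2 o0 (q 1) x) (rot o2 o0 (q 2) x) (rot o2 o0 (q 3) x).
move: (q 0 x) (q 1 x) (q 2 x) (q 3 x).
move: (p 0 x) (p 1 x) (p 2 x) (p 3 x) (w x).
move=> ? ? ? ? ? ? ? ? ? ? ? ? ? ? ? ? ? ? ? ? ? ? ? ? ? ? ? ? ? ? ? ? ?.
by ring.
Qed.

(** The square on the right is |dilation - (Lambda + b)|^2. Drop the square of
    the dilation, and split |(Lambda + b) Phi|^2 with the parameter 16/17: at
    least (1 - 16/17) |Lambda Phi|^2 - (17/16 - 1) b^2 |Phi|^2. All terms
    containing the derivatives Ep and Eq integrate to 0 against the weight. *)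
Lemma square_lower (p q n n' m b0 e0 : R) :
  b0 ^+ 2 <= 1/4 ->
  forall (Ep Eq : R),
  -2 * ((Ep + (1 + b0) * p) * n) + 2 * ((Eq + (1 + b0) * q) * n')
  + 2 * m * ((Ep + (1 + b0) * p) * q + (Eq + (1 + b0) * q) * p)
  - (2 * b0 * ((Ep + (1 + b0) * p) * p) + e0 * p ^+ 2) - (2 * b0 * ((Eq + (1 + b0) * q) * q) + e0 * q ^+ 2)
  + e0 * (p ^+ 2 + q ^+ 2) + 1/17 * (n ^+ 2 + n' ^+ 2 + 2 * m * (n' * p - n * q)) - 1/64 * (p ^+ 2 + q ^+ 2)
  <= (Ep + p - (n - m * q)) ^+ 2 + (Eq + q + (n' + m * p)) ^+ 2.
Proof.
move=> hb Ep Eq; rewrite -subr_ge0.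
have -> : (Ep + p - (n - m * q)) ^+ 2 + (Eq + q + (n' + m * p)) ^+ 2 - (
  -2 * ((Ep + (1 + b0) * p) * n) + 2 * ((Eq + (1 + b0) * q) * n')
  + 2 * m * ((Ep + (1 + b0) * p) * q + (Eq + (1 + b0) * q) * p)
  - (2 * b0 * ((Ep + (1 + b0) * p) * p) + e0 * p ^+ 2) - (2 * b0 * ((Eq + (1 + b0) * q) * q) + e0 * q ^+ 2)
  + e0 * (p ^+ 2 + q ^+ 2) + 1/17 * (n ^+ 2 + n' ^+ 2 + 2 * m * (n' * p - n * q)) - 1/64 * (p ^+ 2 + q ^+ 2)) =
  (Ep + (1 + b0) * p) ^+ 2 + (Eq + (1 + b0) * q) ^+ 2
  + 1/17 * m ^+ 2 * (p ^+ 2 + q ^+ 2)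
  + 17/16 * ((16/17 * (n - m * q) + b0 * p) ^+ 2 + (16/17 * (n' + m * p) - b0 * q) ^+ 2)
  + 1/16 * (1/4 - b0 ^+ 2) * (p ^+ 2 + q ^+ 2) by field.
have h0 : 0 <= p ^+ 2 + q ^+ 2 by rewrite addr_ge0 ?sqr_ge0.
have h1 : 0 <= 1/4 - b0 ^+ 2 by rewrite subr_ge0.
have h2 : 0 <= 1/17 * m ^+ 2 * (p ^+ 2 + q ^+ 2) by rewrite mulr_ge0// mulr_ge0 ?sqr_ge0.
have h3 : 0 <= 1/16 * (1/4 - b0 ^+ 2) * (p ^+ 2 + q ^+ 2) by rewrite mulr_ge0// mulr_ge0.
have h4 (u v : R) : 0 <= u ^+ 2 + v ^+ 2 by rewrite addr_ge0 ?sqr_ge0.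
by rewrite !addr_ge0 ?sqr_ge0// mulr_ge0.
Qed.

Hypothesis w_ge0 : forall x, 0 <= w x.
Hypothesis w_rot : forall c s x, c ^+ 2 + s ^+ 2 = 1 -> w (rotate3 c s x) = w x.
Hypothesis b_le : forall x, b x ^+ 2 <= 1/4.
Hypothesis eb_ge : forall x, - (1/2176) <= eb x.

Lemma itg_w h : test0 h -> itg (fun x => w x * h x).
Proof. by move=> th; apply: itg_test; exact: (rw th).1.1. Qed.

Lemma test0_sum n (F : nat -> T -> R) : (forall k, test0 (F k)) -> test0 (fun x => \sum_(k < n) F k x).
Proof.
move=> tF; elim: n => [|n ih].
  by under eq_fun do rewrite big_ord0; exact: test0_0.
by under eq_fun do rewrite big_ord_recr /=; exact: test0D.
Qed.

Lemma test0_sq f : test0 f -> test0 (fun x => f x ^+ 2).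
Proof. by move=> tf; under eq_fun do rewrite expr2; exact: test0_mul. Qed.

Lemma test0_half f g s : test0 f -> test0 g -> test0 (fun x => f x + s * (g x / 2)).
Proof.
move=> tf tg; apply: test0D => //; apply: test0Z.
by under eq_fun do rewrite mulrC; exact: test0Z.
Qed.

Lemma test0_rotsq p : (forall k, test0 (p k)) -> test0 (rotsq p).
Proof.
move=> tp; have tR k := test0_rot o0 o1 (tp k).
have P k l : test0 (fun x => (R3r (p k) x + p l x / 2) ^+ 2).
  by apply: test0_sq; have := test0_half 1 (tR k) (tp l); under eq_fun do rewrite mul1r.
have Q k l : test0 (fun x => (R3r (p k) x - p l x / 2) ^+ 2).
  by apply: test0_sq; have := test0_half (-1) (tR k) (tp l); under eq_fun do rewrite mulN1r.
by apply: test0D; apply: test0D.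
Qed.

Lemma rotsq_ineq (p : nat -> T -> R) : (forall k, test0 (p k)) ->
  int3 (fun x => w x * \sum_(k < 4) p k x ^+ 2) <= 32 * int3 (fun x => w x * rotsq p x).
Proof.
move=> tp.
have P k l : test0 (fun x => p k x ^+ 2 + p l x ^+ 2).
  by apply: test0D; exact: test0_sq.
have tR k := test0_rot o0 o1 (tp k).
have Q k l : test0 (fun x => (R3r (p k) x + p l x / 2) ^+ 2 + (R3r (p l) x - p k x / 2) ^+ 2).
  apply: test0D; apply: test0_sq.
    by have := test0_half 1 (tR k) (tp l); under eq_fun do rewrite mul1r.
  by have := test0_half (-1) (tR l) (tp k); under eq_fun do rewrite mulN1r.
have -> : (fun x => w x * \sum_(k < 4) p k x ^+ 2) =
    fun x => w x * (p 1 x ^+ 2 + p 0 x ^+ 2) + w x * (p 2 x ^+ 2 + p 3 x ^+ 2).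
  by apply/funext => x; rewrite !big_ord_recr big_ord0 /=; ring.
have -> : (fun x => w x * rotsq p x) = fun x => w x * ((R3r (p 1) x + p 0 x / 2) ^+ 2 + (R3r (p 0) x - p 1 x / 2) ^+ 2)
   + w x * ((R3r (p 2) x + p 3 x / 2) ^+ 2 + (R3r (p 3) x - p 2 x / 2) ^+ 2).
  by apply/funext => x; rewrite /rotsq mulrDr.
rewrite !int3D; [|exact: itg_w..]; rewrite mulrDr lerD//.
  exact: (rot_ineq rw w_ge0 w_rot (tp 1) (tp 0)).
exact: (rot_ineq rw w_ge0 w_rot (tp 2) (tp 3)).
Qed.

Lemma rotsq12_ge0 p x : 0 <= rotsq12 p x.
Proof. by rewrite !addr_ge0// sqr_ge0. Qed.

(** Integrate square_lower, where n stands for N p and n' for N q, against w.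
    The null terms are collected in Z; what remains positive is N^2 - 1/4,
    estimated by the rotation inequality about the third axis, and the squares
    belonging to the other two axes are dropped. *)
Lemma core_abstract (m : R) (p q : nat -> T -> R) : (forall k, test0 (p k)) -> (forall k, test0 (q k)) ->
  1/2176 * int3 (fun x => w x * \sum_(k < 4) (p k x ^+ 2 + q k x ^+ 2)) <=
  int3 (fun x => w x * \sum_(k < 4) ((euler (p k) x + p k x - (spin_orbit p k x - m * q k x)) ^+ 2
    + (euler (q k) x + q k x + (spin_orbit q k x + m * p k x)) ^+ 2)).
Proof.
move=> tp tq.
pose Z x := -2 * (w x * \sum_(k < 4) (dilation (p k) x * spin_orbit p k x)) +
   2 * (w x * \sum_(k < 4) (dilation (q k) x * spin_orbit q k x)) +
   \sum_(k < 4) (2 * m * (w x * (dilation (p k) x * q k x + dilation (q k) x * p k x))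
    - w x * (2 * b x * (dilation (p k) x * p k x) + eb x * p k x ^+ 2)
    - w x * (2 * b x * (dilation (q k) x * q k x) + eb x * q k x ^+ 2)) +
   1/17 * (w x * (\sum_(k < 4) (spin_orbit p k x ^+ 2 - p k x ^+ 2 / 4) - (rotsq p x + rotsq12 p x)) +
    w x * (\sum_(k < 4) (spin_orbit q k x ^+ 2 - q k x ^+ 2 / 4) - (rotsq q x + rotsq12 q x)) +
    2 * m * (w x * \sum_(k < 4) (spin_orbit q k x * p k x - spin_orbit p k x * q k x))).
have nZ : null Z.
  have S k := nullB (nullB (nullZ (2 * m) (null_sym (tp k) (tq k))) (null_dilation (tp k))) (null_dilation (tq k)).
  have S4 := nullD (nullD (S 0) (S 1)) (nullD (S 2) (S 3)).
  have := nullD (nullD (nullD (nullZ (-2) (null_dilation_spin_orbit tp)) (nullZ 2 (null_dilation_spin_orbit tq))) S4)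
    (nullZ (1/17) (nullD (nullD (null_spin_orbit_sq tp) (null_spin_orbit_sq tq)) (nullZ (2 * m) (null_spin_orbit_sym tp tq)))).
  apply: null_eq => x; rewrite /Z; congr (_ + _ + _).
  by rewrite !big_ord_recr big_ord0 /= add0r !addrA.
set F := fun x => w x * \sum_(k < 4) (_ + _).
set G := fun x => w x * \sum_(k < 4) (_ + _).
have tF : test0 (fun x => \sum_(k < 4) (p k x ^+ 2 + q k x ^+ 2)).
  by apply: (@test0_sum 4 (fun k x => p k x ^+ 2 + q k x ^+ 2)) => k; apply: test0D; exact: test0_sq.
have iF : itg F by exact: itg_w.
have tN (f : T -> R) : test0 f -> test0 (fun x => - f x).
  by move=> tf; have := test0Z (-1) tf; under eq_fun do rewrite mulN1r.
have tang (f : nat -> T -> R) k : (forall k, test0 (f k)) -> test0 (spin_orbit f k).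
  move=> tf; have r0 l := test0_rot o0 o1 (tf l); have r1 l := test0_rot o1 o2 (tf l).
  have r2 l := test0_rot o2 o0 (tf l); apply: test0D => //.
  by case: k => [|[|[|k]]] /=; repeat first [apply: r0|apply: r1|apply: r2|apply: test0D|apply: tN].
have iG : itg G.
  apply: itg_w; apply: (@test0_sum 4 (fun k x => (euler (p k) x + p k x - (spin_orbit p k x - m * q k x)) ^+ 2
    + (euler (q k) x + q k x + (spin_orbit q k x + m * p k x)) ^+ 2)) => k.
  have te1 := test0_euler (tp k); have te2 := test0_euler (tq k).
  apply: test0D; apply: test0_sq; apply: test0D; first exact: test0D.
  - by apply/tN/test0D; [exact: tang|exact/tN/test0Z].
  - exact: test0D.
  - by apply: test0D; [exact: tang|exact: test0Z].
pose Qp x := w x * \sum_(k < 4) p k x ^+ 2; pose Qq x := w x * \sum_(k < 4) q k x ^+ 2.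
have iQ (f : nat -> T -> R) : (forall k, test0 (f k)) -> itg (fun x => w x * \sum_(k < 4) f k x ^+ 2).
  by move=> tf; apply: itg_w; apply: (@test0_sum 4 (fun k x => f k x ^+ 2)) => k; exact: test0_sq.
have iS (f : nat -> T -> R) : (forall k, test0 (f k)) -> itg (fun x => w x * rotsq f x).
  by move=> tf; apply: itg_w; exact: test0_rotsq.
have FE : int3 F = int3 Qp + int3 Qq.
  rewrite -int3D; [|exact: iQ..]; congr int3; apply/funext => x.
  by rewrite /F /Qp /Qq -mulrDr -big_split.
have rp := rotsq_ineq tp; have rq := rotsq_ineq tq.
have key x : Z x + 1/17 * (w x * rotsq p x + w x * rotsq q x) + (1/68 - 1/64 - 1/2176) * (Qp x + Qq x) <= G x.
  have g1 := rotsq12_ge0 p x; have g2 := rotsq12_ge0 q x; have w0 := w_ge0 x; have e0 := eb_ge x.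
  have A0 : 0 <= 1/17 :> R by rewrite divr_ge0.
  have A1 : 0 <= rotsq12 p x + rotsq12 q x := addr_ge0 g1 g2.
  have A2 : 0 <= eb x + 1/2176 by rewrite -lerBlDr sub0r.
  have A3 : 0 <= \sum_(k < 4) (p k x ^+ 2 + q k x ^+ 2).
    by apply: sumr_ge0 => k _; rewrite addr_ge0 ?sqr_ge0.
  rewrite /Z /G /Qp /Qq.
  pose LB k : R := -2 * (dilation (p k) x * spin_orbit p k x) + 2 * (dilation (q k) x * spin_orbit q k x)
  + 2 * m * (dilation (p k) x * q k x + dilation (q k) x * p k x)
  - (2 * b x * (dilation (p k) x * p k x) + eb x * p k x ^+ 2) - (2 * b x * (dilation (q k) x * q k x) + eb x * q k x ^+ 2)
  + eb x * (p k x ^+ 2 + q k x ^+ 2) + 1/17 * (spin_orbit p k x ^+ 2 + spin_orbit q k x ^+ 2 + 2 * m * (spin_orbit q k x * p k x - spin_orbit p k x * q k x))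
  - 1/64 * (p k x ^+ 2 + q k x ^+ 2).
  have hLB : w x * \sum_(k < 4) LB k <= w x * \sum_(k < 4) ((euler (p k) x + p k x - (spin_orbit p k x - m * q k x)) ^+ 2
    + (euler (q k) x + q k x + (spin_orbit q k x + m * p k x)) ^+ 2).
    apply: ler_wpM2l => //; apply: ler_sum => k _; exact: square_lower.
  apply: le_trans hLB.
  rewrite -subr_ge0.
  suff -> : w x * \sum_(k < 4) LB k - (Z x + 1/17 * (w x * rotsq p x + w x * rotsq q x) + (1/68 - 1/64 - 1/2176) * (Qp x + Qq x))
     = w x * (1/17 * (rotsq12 p x + rotsq12 q x)) + w x * ((eb x + 1/2176) * \sum_(k < 4) (p k x ^+ 2 + q k x ^+ 2)).
    exact: (addr_ge0 (mulr_ge0 w0 (mulr_ge0 A0 A1)) (mulr_ge0 w0 (mulr_ge0 A2 A3))).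
  rewrite /Z /Qp /Qq /LB; move: (rotsq12 p x) (rotsq12 q x) (rotsq p x) (rotsq q x) => s1 s2 s3 s4.
  clear -p q.
  rewrite !big_ord_recr !big_ord0 /=.
  move: (spin_orbit p 0 x) (spin_orbit p 1 x) (spin_orbit p 2 x) (spin_orbit p 3 x) (spin_orbit q 0 x) (spin_orbit q 1 x) (spin_orbit q 2 x) (spin_orbit q 3 x).
  move: (dilation (p 0) x) (dilation (p 1) x) (dilation (p 2) x) (dilation (p 3) x) (dilation (q 0) x) (dilation (q 1) x) (dilation (q 2) x) (dilation (q 3) x).
  move: (p 0 x) (p 1 x) (p 2 x) (p 3 x) (q 0 x) (q 1 x) (q 2 x) (q 3 x) (w x) (b x) (eb x).
  move=> ? ? ? ? ? ? ? ? ? ? ? ? ? ? ? ? ? ? ? ? ? ? ? ? ? ? ?.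
  by field.
have iL : itg (fun x => Z x + 1/17 * (w x * rotsq p x + w x * rotsq q x) + (1/68 - 1/64 - 1/2176) * (Qp x + Qq x)).
  by apply: itgD; [apply: itgD; [exact: nZ.1|apply: itgZ; apply: itgD; exact: iS]|apply: itgZ; apply: itgD; exact: iQ].
have h := ler_int3 iL iG key.
have i1 : itg (fun x => w x * rotsq p x + w x * rotsq q x) by apply: itgD; exact: iS.
have i2 : itg (fun x => Qp x + Qq x) by apply: itgD; exact: iQ.
rewrite int3D in h; [|by apply: itgD; [exact: nZ.1|exact: itgZ]|exact: itgZ].
rewrite int3D in h; [|exact: nZ.1|exact: itgZ].
rewrite nZ.2 add0r !int3Z// !int3D in h; try exact: iS; try exact: iQ.
rewrite FE; apply: le_trans h.
move: rp rq; rewrite -/(Qp) -/(Qq).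
move: (int3 Qp) (int3 Qq) (int3 (fun x => w x * rotsq p x)) (int3 (fun x => w x * rotsq q x)) => a1 a2 a3 a4.
exact: core_arith.
Qed.

End pieces.

(** The operator -i alpha_j acts on the eight real coordinates as a signed
    permutation: row k has the single entry dsign j k, in column didx j k. As
    the default value is 0, the rows k >= 8 vanish. *)
Definition dsign (j : 'I_3) (k : nat) : R :=
  nth 0 (nth [::] [:: [:: 1; -1; 1; -1; 1; -1; 1; -1]; [:: -1; -1; 1; 1; -1; -1; 1; 1];
    [:: 1; -1; -1; 1; 1; -1; -1; 1]] j) k.
(** The same permutation on the four real coordinates of a two-spinor. *)
Definition didx4 (j : 'I_3) (k : nat) : nat :=
  nth 0%N (nth [::] [:: [:: 3; 2; 1; 0]; [:: 2; 3; 0; 1]; [:: 1; 0; 3; 2]]%N j) k.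
Definition didx (j : 'I_3) (k : nat) : nat :=
  nth 0%N (nth [::] [:: [:: 7; 6; 5; 4; 3; 2; 1; 0]; [:: 6; 7; 4; 5; 2; 3; 0; 1]; [:: 5; 4; 7; 6; 1; 0; 3; 2]]%N j) k.
Definition beta_sign (a : nat) : R := if (a < 4)%N then 1 else -1.

Definition sum3 (F : 'I_3 -> R) : R := F o0 + F o1 + F o2.

(** The operator -i alpha . grad. *)
Definition free_dirac (u : nat -> T -> R) (a : nat) x : R := sum3 (fun j => dsign j a * pd j (u (didx j a)) x).

(** The Coulomb potential 1/|x|, with value 0 at the origin. *)
Definition inv_norm x : R := (Num.sqrt (rsq x))^-1.

Lemma inv_norm_fam x : x != 0 -> inv_norm x = fam 1 0 (- (1/2)) 0 x.
Proof.
move=> x0; have t0 := rsq_gt0 x0.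
rewrite /inv_norm /fam /lfam expr0 mulr1 mulNr expRN; congr (_^-1).
have e : expR (1/2 * ln (rsq x)) ^+ 2 = rsq x.
  by rewrite expr2 -expRD -mulrDl -[X in _ = X]lnK//; congr expR; field.
by rewrite -[in LHS]e sqrtr_sqr ger0_norm// expR_ge0.
Qed.

Lemma radial_inv_norm : radial inv_norm (fun x => - inv_norm x).
Proof.
apply: (radial_eq (radial_fam 0 ltr01 (- (1/2)) 0)); first exact: inv_norm_fam.
by move=> x x0; rewrite /efam -inv_norm_fam// mul0r mul0r subr0; field.
Qed.

(** Multiplication by -i sigma . x. *)
Definition posmul (g : nat -> T -> R) k x : R := sum3 (fun j => dsign j k * (coord3 j x * g (didx4 j k) x)).

Lemma test0_sum3 (F : 'I_3 -> T -> R) : (forall j, test0 (F j)) -> test0 (fun x => sum3 (F ^~ x)).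
Proof. by move=> tF; apply: test0D => //; exact: test0D. Qed.

Lemma pd_sum3 i (F : 'I_3 -> T -> R) : (forall j, pderivable (F j)) ->
  forall x, pd i (fun x => sum3 (F ^~ x)) x = sum3 (fun j => pd i (F j) x).
Proof. by move=> dF x; rewrite /sum3 pdD ?pdD//; exact: pderivableD. Qed.

Lemma test0_posmul (g : nat -> T -> R) k : (forall k, test0 (g k)) -> test0 (posmul g k).
Proof.
move=> tg; apply: (@test0_sum3 (fun j x => dsign j k * (coord3 j x * g (didx4 j k) x))) => j.
by apply: test0Z; apply: test0M => //; exact: coord3_rsmooth.
Qed.

Lemma pd_Z i (C : R) f x : pderivable f -> pd i (fun x => C * f x) x = C * pd i f x.
Proof.
move=> df; have h : pderivable (fun _ : T => C) by exact: pderivable_cst.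
by rewrite (pdM i h df) pd_cst mul0r addr0.
Qed.

Lemma pd_posmul i (g : nat -> T -> R) k x : (forall k, test0 (g k)) ->
  pd i (posmul g k) x = sum3 (fun j => dsign j k * (coord3 j x * pd i (g (didx4 j k)) x + (j == i)%:R * g (didx4 j k) x)).
Proof.
move=> tg; have dg l := test0_pder (tg l).
have dM j : pderivable (fun x => coord3 j x * g (didx4 j k) x).
  by apply: pderivableM => //; exact: rsmooth_pderivable (coord3_rsmooth j).
rewrite /posmul (@pd_sum3 i (fun j x => dsign j k * (coord3 j x * g (didx4 j k) x))); last first.
  by move=> j; apply: pderivableM => //; exact: pderivable_cst.
by congr (_ + _ + _); rewrite pd_Z// pd_xcM.
Qed.

(** The Weyl operator -i sigma . grad on two-spinors. *)
Definition dir4 (v : nat -> T -> R) k x : R := sum3 (fun j => dsign j k * pd j (v (didx4 j k)) x).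

(** The polar decomposition with the two factors in the other order: it
    expresses the Weyl operator of g through polar derivatives of -i sigma . x
    g. *)
Lemma posmul_dir4 (g : nat -> T -> R) k x : (forall k, test0 (g k)) -> (k < 4)%N ->
  posmul g k x + euler (posmul g k) x + ang_mom (posmul g) k x = rsq x * dir4 g k x.
Proof.
move=> tg k4.
have -> : euler (posmul g k) x = sum3 (fun i => coord3 i x * sum3 (fun j => dsign j k * (coord3 j x * pd i (g (didx4 j k)) x + (j == i)%:R * g (didx4 j k) x))).
  by rewrite /euler !pd_posmul.
have er a b l : rot a b (posmul g l) x =
  coord3 a x * sum3 (fun j => dsign j l * (coord3 j x * pd b (g (didx4 j l)) x + (j == b)%:R * g (didx4 j l) x))
  - coord3 b x * sum3 (fun j => dsign j l * (coord3 j x * pd a (g (didx4 j l)) x + (j == a)%:R * g (didx4 j l) x)).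
  by rewrite /rot !pd_posmul.
rewrite rsqE -/o0 -/o1 -/o2.
case: k k4 => [|[|[|[|//]]]] _; rewrite /ang_mom /R1 /R2 /R3r !er /dir4 /posmul /sum3 ?ordE /dsign /didx4 /= ?mulr1n ?mulr0n;
  move: (pd o0 (g 0) x) (pd o0 (g 1) x) (pd o0 (g 2) x) (pd o0 (g 3) x)
    (pd o1 (g 0) x) (pd o1 (g 1) x) (pd o1 (g 2) x) (pd o1 (g 3) x)
    (pd o2 (g 0) x) (pd o2 (g 1) x) (pd o2 (g 2) x) (pd o2 (g 3) x);
  move: (g 0 x) (g 1 x) (g 2 x) (g 3 x) (coord3 o0 x) (coord3 o1 x) (coord3 o2 x); intros; ring.
Qed.

(** Polar form of the Weyl operator: (-i sigma . x)(-i sigma . grad) = - E +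
    S, a consequence of sigma_i sigma_j = delta_ij + i eps_ijk sigma_k. *)
Lemma dir4_polar (f : nat -> T -> R) k x : (k < 4)%N ->
  euler (f k) x - ang_mom f k x = - sum3 (fun j => dsign j k * (coord3 j x * dir4 f (didx4 j k) x)).
Proof.
case: k => [|[|[|[|//]]]] _; rewrite /ang_mom /R1 /R2 /R3r /rot /euler /dir4 /sum3 /dsign /didx4 /=;
  move: (pd o0 (f 0) x) (pd o0 (f 1) x) (pd o0 (f 2) x) (pd o0 (f 3) x)
    (pd o1 (f 0) x) (pd o1 (f 1) x) (pd o1 (f 2) x) (pd o1 (f 3) x)
    (pd o2 (f 0) x) (pd o2 (f 1) x) (pd o2 (f 2) x) (pd o2 (f 3) x);
  move: (coord3 o0 x) (coord3 o1 x) (coord3 o2 x); intros; ring.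
Qed.

(** (sigma . x)^2 = |x|^2. *)
Lemma posmul_isometry (v : nat -> R) x :
  \sum_(k < 4) (sum3 (fun j => dsign j k * (coord3 j x * v (didx4 j k)))) ^+ 2 = rsq x * \sum_(k < 4) v k ^+ 2.
Proof.
rewrite rsqE -/o0 -/o1 -/o2 /sum3 /dsign /didx4 !big_ord_recr !big_ord0 /=.
move: (v 0) (v 1) (v 2) (v 3) (coord3 o0 x) (coord3 o1 x) (coord3 o2 x); intros; ring.
Qed.

Lemma inv_norm_sq x : x != 0 -> inv_norm x ^+ 2 * rsq x = 1.
Proof.
by move=> x0; rewrite /inv_norm exprVn sqr_sqrtr ?rsq_ge0// mulVf// gt_eqF// rsq_gt0.
Qed.

Lemma radial_euler om eo h x : radial om eo -> test0 h -> x != 0 ->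
  euler (fun x => om x * h x) x = om x * euler h x + eo x * h x.
Proof.
move=> r th x0; rewrite /euler !(r _ th).2.
have t0 : rsq x != 0 by rewrite gt_eqF// rsq_gt0.
transitivity (om x * (coord3 o0 x * pd o0 h x + coord3 o1 x * pd o1 h x + coord3 o2 x * pd o2 h x) +
  eo x / rsq x * (coord3 o0 x ^+ 2 + coord3 o1 x ^+ 2 + coord3 o2 x ^+ 2) * h x); first by ring.
by rewrite -[_ + _ + coord3 o2 x ^+ 2]rsqE divfK.
Qed.

Lemma radial_rot om eo a b h x : radial om eo -> test0 h ->
  rot a b (fun x => om x * h x) x = om x * rot a b h x.
Proof. by move=> r th; rewrite /rot !(r _ th).2; ring. Qed.

(** The operator -i alpha . grad + (m/|x|) beta. *)
Definition massless_dirac (m : R) (u : nat -> T -> R) a x : R := free_dirac u a x + beta_sign a * (m * inv_norm x) * u a x.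

(** Polar coordinates turn core_abstract into an inequality for the Dirac
    operator; the lower half is first turned by -i sigma . x / |x|, which does
    not change its length. *)
Lemma core_dirac (w b eb : T -> R) (m : R) (u : nat -> T -> R) :
  radial w (fun x => (2 * b x - 1) * w x) ->
  radial (fun x => w x * b x) (fun x => (2 * b x - 1) * (w x * b x) + w x * eb x) ->
  (forall x, 0 <= w x) ->
  (forall c s x, c ^+ 2 + s ^+ 2 = 1 -> w (rotate3 c s x) = w x) ->
  (forall x, b x ^+ 2 <= 1/4) -> (forall x, - (1/2176) <= eb x) ->
  (forall k, test0 (u k)) ->
  1/2176 * int3 (fun x => w x * \sum_(a < 8) u a x ^+ 2) <=
  int3 (fun x => w x * (rsq x * \sum_(a < 8) massless_dirac m u a x ^+ 2)).
Proof.
move=> rw rwb w0 wr b4 e0 tu.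
pose g k := u (4 + k)%N; have tg k : test0 (g k) by exact: tu.
pose q k := fun x => inv_norm x * posmul g k x.
have tY k := test0_posmul k tg.
have tq k : test0 (q k) by exact: (radial_inv_norm (tY k)).1.
have h := core_abstract rw rwb w0 wr b4 e0 m tu tq.
have u0 (f : T -> R) : test0 f -> f 0 = 0.
  by move=> [_ [d d0 hd]]; apply: supp_in hd _; rewrite rsq0.
suff E x : \sum_(k < 4) ((euler (u k) x + u k x - (spin_orbit u k x - m * q k x)) ^+ 2
    + (euler (q k) x + q k x + (spin_orbit q k x + m * u k x)) ^+ 2) = rsq x * \sum_(a < 8) massless_dirac m u a x ^+ 2.
  have e1 : (fun x => w x * \sum_(a < 8) u a x ^+ 2) = (fun x => w x * \sum_(k < 4) (u k x ^+ 2 + q k x ^+ 2)).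
    apply/funext => x; congr (_ * _); rewrite big_split /=.
    have -> : \sum_(k < 4) q k x ^+ 2 = \sum_(k < 4) g k x ^+ 2.
      have [->|x0] := eqVneq x 0.
        by apply: eq_bigr => k _; rewrite (u0 _ (tq k)) (u0 _ (tg k)).
      rewrite /q; under eq_bigr do rewrite exprMn.
      rewrite -mulr_sumr (posmul_isometry (g ^~ x)) mulrA inv_norm_sq// mul1r//.
    by rewrite !big_ord_recr !big_ord0 /= /g /=; ring.
  by rewrite e1; apply: le_trans h _; rewrite le_eqVlt; apply/orP; left; apply/eqP; congr int3; apply/funext => x; rewrite E.
have tE f : test0 f -> euler f 0 = 0 by move=> tf; apply: u0; exact: test0_euler.
have tR a b' f : test0 f -> rot a b' f 0 = 0 by move=> tf; apply: u0; exact: test0_rot.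
have [->|x0] := eqVneq x 0.
  rewrite rsq0 mul0r big1// => k _.
  rewrite (tE _ (tu k)) (tE _ (tq k)) (u0 _ (tu k)) (u0 _ (tq k)) /spin_orbit (u0 _ (tu k)) (u0 _ (tq k)).
  have ta (f : nat -> T -> R) l : (forall k, test0 (f k)) -> ang_mom f l 0 = 0.
    by move=> tf; case: l => [|[|[|l]]] /=; rewrite /R1 /R2 /R3r !tR// ?oppr0 ?addr0 ?subr0.
  by rewrite !ta// !(mulr0, addr0, subr0, oppr0) expr0n/= addr0.
rewrite big_split /=.
have eD : \sum_(a < 8) massless_dirac m u a x ^+ 2 =
  \sum_(k < 4) (dir4 g k x + m * inv_norm x * u k x) ^+ 2 + \sum_(k < 4) (dir4 u k x - m * inv_norm x * g k x) ^+ 2.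
  rewrite !big_ord_recr !big_ord0 /= /massless_dirac /free_dirac /dir4 /beta_sign /g /sum3 /dsign /didx /didx4 /=; ring.
rewrite eD mulrDr addrC; congr (_ + _).
  have -> : \sum_(k < 4) (euler (q k) x + q k x + (spin_orbit q k x + m * u k x)) ^+ 2
     = \sum_(k < 4) (inv_norm x * rsq x * (dir4 g k x + m * inv_norm x * u k x)) ^+ 2.
    apply: eq_bigr => k _; congr (_ ^+ 2).
    rewrite /spin_orbit (radial_euler radial_inv_norm (tY k) x0).
    have -> : ang_mom q k x = inv_norm x * ang_mom (posmul g) k x.
      by case: k => -[|[|[|k]]] ? /=; rewrite /R1 /R2 /R3r !(radial_rot _ _ _ radial_inv_norm)//; ring.
    have h1 := posmul_dir4 x tg (ltn_ord k); have h2 := inv_norm_sq x0.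
    have -> : inv_norm x * rsq x * (dir4 g k x + m * inv_norm x * u k x) = inv_norm x * (rsq x * dir4 g k x) + (inv_norm x ^+ 2 * rsq x) * (m * u k x) by ring.
    by rewrite h2 -h1 /q; ring.
  under eq_bigr do rewrite exprMn.
  by rewrite -mulr_sumr; congr (_ * _); rewrite exprMn expr2 [rsq x ^+ 2]expr2 -expr2 mulrA inv_norm_sq// mul1r.
rewrite -(posmul_isometry (fun k => dir4 u k x - m * inv_norm x * g k x)); apply: eq_bigr => k _; rewrite -sqrrN; congr (_ ^+ 2).
have h1 := dir4_polar u x (ltn_ord k).
have -> : - (euler (u k) x + u k x - (spin_orbit u k x - m * q k x)) = - (euler (u k) x - ang_mom u k x) - m * q k x.
  by rewrite /spin_orbit; ring.
by rewrite h1 /q /posmul /sum3; ring.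
Qed.

Section weights.
Variables (kap : R) (N : nat).
Hypotheses (kap0 : 0 < kap) (N_big : (1088 <= N)%N).
Let q : R := N%:R^-1.
(** The weight (kappa + s)^-N with s = |x|^(2/N), which increases to 1/|x|^2
    as kappa decreases to 0. *)
Definition weight x : R := fam kap q 0 N x.
Let B x : R := (kap + expR (q * ln (rsq x)))^-1.
Let b x : R := kap * B x - 1/2.
Let eb x : R := - 2 * q * (kap * B x) * (1 - kap * B x).

Let Nq : N%:R * q = 1.
Proof. by rewrite /q mulfV// pnatr_eq0 -lt0n (leq_trans _ N_big). Qed.

Let famS n x : fam kap q 0 n.+1 x = fam kap q 0 n x * B x.
Proof. by rewrite /fam /lfam exprSr mulrA. Qed.

Let B_gt0 x : 0 < B x.
Proof. by rewrite invr_gt0 addr_gt0// expR_gt0. Qed.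

Let kB x : 0 <= kap * B x <= 1.
Proof.
have h : 0 < kap + expR (q * ln (rsq x)) by rewrite addr_gt0// expR_gt0.
apply/andP; split; first by apply: mulr_ge0; exact: ltW.
by rewrite /B ler_pdivrMr// mul1r lerDl expR_ge0.
Qed.

Lemma weight_ge0 x : 0 <= weight x.
Proof. by rewrite /weight /fam /lfam mulr_ge0 ?expR_ge0// exprn_ge0// ltW// B_gt0. Qed.

(** With a = kappa / (kappa + s) one has b = a - 1/2, so b^2 <= 1/4, and the
    Euler derivative of b is -(2/N) a (1 - a) >= -1/(2N). This is where N >=
    1088 enters. *)
Lemma core_ineq (m : R) (u : nat -> T -> R) : (forall k, test0 (u k)) ->
  1/2176 * int3 (fun x => weight x * \sum_(a < 8) u a x ^+ 2) <=
  int3 (fun x => weight x * (rsq x * \sum_(a < 8) massless_dirac m u a x ^+ 2)).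
Proof.
apply: (@core_dirac weight b eb).
- apply: (radial_eq (radial_fam q kap0 0 N)) => // x _.
  by rewrite /efam mul0r sub0r famS Nq -/(weight x) /b; field.
- have r1 := radialZ kap (radial_fam q kap0 0 N.+1).
  have r2 := radialZ (- (1/2)) (radial_fam q kap0 0 N).
  apply: (radial_eq (radialD r1 r2)) => x _; rewrite /efam !famS -/(weight x) /b; first by field.
  have -> : N.+1%:R * q = 1 + q by rewrite -natr1 mulrDl Nq mul1r.
  by rewrite Nq /eb; field.
- exact: weight_ge0.
- by move=> c s x h; rewrite /weight /fam rsq_rotate3.
- move=> x; have /andP[h1 h2] := kB x; rewrite /b -subr_ge0.
  have -> : 1/4 - (kap * B x - 1/2) ^+ 2 = (kap * B x) * (1 - kap * B x) by field.
  by rewrite mulr_ge0// subr_ge0.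
move=> x; have /andP[h1 h2] := kB x; rewrite /eb.
have hq : 0 <= q <= 1/1088.
  rewrite invr_ge0 ler0n /= mul1r lef_pV2 ?posrE ?ltr0n ?(leq_trans _ N_big)//.
  by rewrite ler_nat.
have h3 : kap * B x * (1 - kap * B x) <= 1/4.
  rewrite -subr_ge0; have -> : 1/4 - (kap * B x) * (1 - kap * B x) = (kap * B x - 1/2) ^+ 2 by field.
  exact: sqr_ge0.
have h4 : 0 <= kap * B x * (1 - kap * B x) by rewrite mulr_ge0// subr_ge0.
case/andP: hq => q1 q2.
have h5 := ler_pM q1 h4 q2 h3.
rewrite -2!mulrA mulNr lerN2 (le_trans (ler_wpM2l _ h5))//; lra.
Qed.

End weights.
End core.

(** * Completeness of L^2 and the Riesz representation *)

Section L2theory.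
Context {R : realType}.
Local Notation T := (R3 R).
Local Notation mu := (leb3 R).
Implicit Types (f g h : T -> R) (x y z w v : T) (C e d : R).

Lemma itgE f : itg f -> (\int[mu]_x (f x)%:E = (int3 f)%:E)%E.
Proof. by move=> h; rewrite int3.unlock /Rintegral fineK//; exact: integrable_fin_num h. Qed.

Lemma ge0_itg f (C : R) : measurable_fun setT f -> (forall x, 0 <= f x) ->
  (\int[mu]_x (f x)%:E <= C%:E)%E -> itg f /\ int3 f <= C.
Proof.
move=> mf f0 h; have i : itg f.
  apply/integrableP; split; first exact/measurable_EFinP.
  under eq_integral do rewrite gee0_abs ?lee_fin//.
  by rewrite (le_lt_trans h)// ltry.
by split => //; rewrite -lee_fin -itgE.
Qed.

Lemma fatou3 (F : nat -> T -> R) f (C : R) : (forall n, itg (F n)) -> (forall n x, 0 <= F n x) ->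
  (forall x, F ^~ x @ \oo --> f x) -> (forall n, int3 (F n) <= C) -> itg f /\ int3 f <= C.
Proof.
move=> iF F0 Ff FC.
have mF n := itg_meas (iF n).
have mf : measurable_fun setT f by apply: (measurable_fun_cvg mF) => x _; exact: Ff.
have f0 x : 0 <= f x.
  rewrite -(cvg_lim (@Rhausdorff R) (Ff x)); apply: limr_ge.
    by apply/cvg_ex; exists (f x); exact: Ff.
  by apply: nearW => n; exact: F0.
apply: ge0_itg => //.
have mEF n : measurable_fun setT (EFin \o F n) by exact/measurable_EFinP.
have EF0 n x : setT x -> (0 <= (EFin \o F n) x)%E by move=> _; rewrite lee_fin.
have := @fatou _ _ _ mu setT measurableT (fun n => EFin \o F n) mEF EF0.
have -> : (fun x => limn_einf ((fun n => EFin \o F n) ^~ x)) = (fun x => (f x)%:E).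
  apply/funext => x; apply: (@cvg_limn_einf_sup _ _ _ _).1.
  by apply: cvg_EFin; [exact: nearW|exact: Ff].
move=> h; apply: le_trans h _; rewrite limn_einf_lim; apply: lime_le; first exact: is_cvg_einfs.
apply: nearW => n; apply: le_trans (_ : (int3 (F n))%:E <= _)%E; last by rewrite lee_fin.
by rewrite -itgE//; apply: ereal_inf_lbound; exists n => /=.
Qed.

Lemma int3_ae f g : measurable_fun setT f -> measurable_fun setT g ->
  {ae mu, forall x, f x = g x} -> int3 f = int3 g.
Proof.
move=> mf mg h; rewrite int3.unlock /Rintegral; congr fine.
apply: ae_eq_integral => //; [exact/measurable_EFinP..|].
by apply: filterS h => x -> _.
Qed.

Lemma ae_indicator (G : set T) : measurable G -> {ae mu, forall x, G x} ->
  {ae mu, forall x, \1_G x = 1 :> R}.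
Proof. by move=> mG; apply: filterS => x Gx; rewrite indicE mem_set. Qed.

Lemma geometric2 n : \sum_(k < n) (2^-1 : R) ^+ k <= 2.
Proof.
suff -> : \sum_(k < n) (2^-1 : R) ^+ k = 2 - 2 * (2^-1) ^+ n by rewrite gerBl mulr_ge0// exprn_ge0.
elim: n => [|n ih]; first by rewrite big_ord0 expr0 mulr1 subrr.
by rewrite big_ord_recr /= ih exprS; field.
Qed.

(** The series sum_n 2^n |F (n+1) - F n|^2 has finite integral, so it is
    finite almost everywhere, and there the increments are summable by the
    inequality of the means. *)
Lemma L2r_fast (F : nat -> T -> R) : (forall n, L2r (F n)) ->
  (forall n, nsq (fun x => F n.+1 x - F n x) <= (4^-1) ^+ n) ->
  exists G : set T, [/\ measurable G, {ae mu, forall x, G x} &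
    forall x, G x -> cvgn (F ^~ x)].
Proof.
move=> lF hF.
pose d n x := F n.+1 x - F n x.
have ld n : L2r (d n) by apply: L2rB.
pose t n x : \bar R := (2 ^+ n * d n x ^+ 2)%:E.
have t0 n x : (0 <= t n x)%E by rewrite lee_fin mulr_ge0 ?sqr_ge0// exprn_ge0.
have it n : itg (fun x => 2 ^+ n * d n x ^+ 2) by apply: itgZ; exact: L2r_sq.
have mt n : measurable_fun setT (t n) by apply/measurable_EFinP; exact: itg_meas (it n).
pose H x := (\sum_(0 <= k <oo) t k x)%E.
have mH : measurable_fun setT H by apply: ge0_emeasurable_sum.
have H0 x : (0 <= H x)%E by apply: nneseries_ge0.
have iH : mu.-integrable setT H.
  apply/integrableP; split => //.
  under eq_integral do rewrite gee0_abs//.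
  rewrite integral_nneseries//.
  apply: (@le_lt_trans _ _ (2 : R)%:E); last exact: ltry.
  apply: lime_le; first by apply: is_cvg_nneseries => n _ _; exact: integral_ge0.
  apply: nearW => n; rewrite big_mkord.
  have -> : (\sum_(i < n) \int[mu]_x t i x = (\sum_(i < n) int3 (fun x => 2 ^+ i * d i x ^+ 2))%:E)%E.
    by rewrite -sumEFin; apply: eq_bigr => i _; rewrite /t itgE.
  rewrite lee_fin; apply: le_trans (geometric2 n); apply: ler_sum => i _.
  rewrite int3Z; last exact: L2r_sq.
  have := hF i; rewrite -/(nsq (d i)) -[nsq _]/(nsq (d i)) => h.
  apply: le_trans (ler_wpM2l _ h) _; first exact: exprn_ge0.
  by rewrite -exprMn; have -> : 2 * 4^-1 = 2^-1 :> R by field.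
(* The exceptional set is where the dominating series diverges. *)
exists (~` (H @^-1` [set +oo%E])); split.
- by apply: measurableC; rewrite -[X in measurable X]setTI; apply: mH => //; exact: emeasurable_set1.
- by have := integrable_ae measurableT iH; apply: filterS => x h /= e; move: (h I); rewrite e.
move=> x Gx.
have Hfin : H x \is a fin_num by rewrite ge0_fin_numE// ltey; apply/eqP.
have part n : \sum_(k < n) (2 ^+ k * d k x ^+ 2) <= fine (H x).
  rewrite -lee_fin fineK// -sumEFin.
  have := @nneseries_lim_ge R (fun k => t k x) xpredT 0 n (fun k _ _ => t0 k x); rewrite big_mkord => h; exact: h.
have cd : cvgn (series (d ^~ x)).
  apply: normed_cvg; apply: nondecreasing_is_cvgn.
    by apply: nondecreasing_series => j _ _; exact: normr_ge0.
  exists (1 + fine (H x) / 2) => _ [n _ <-].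
  suff h : \sum_(k < n) `|d k x| <= 1 + fine (H x) / 2.
    by apply: le_trans h; rewrite -(big_mkord xpredT (fun k => `|d k x|)).
  apply: (@le_trans _ _ (\sum_(k < n) (2^-1 * (2^-1) ^+ k + 2^-1 * (2 ^+ k * d k x ^+ 2)))).
    apply: ler_sum => k _.
    have p0 : 0 < 2 ^+ k :> R by exact: exprn_gt0.
    rewrite -(ler_pM2l p0) exprVn mulrDr mulrCA mulfV ?gt_eqF// -subr_ge0.
    have -> : 2^-1 * 1 + 2 ^+ k * (2^-1 * (2 ^+ k * d k x ^+ 2)) - 2 ^+ k * `|d k x| =
       2^-1 * (1 - 2 ^+ k * `|d k x|) ^+ 2.
      by rewrite -[d k x ^+ 2]real_normK ?num_real//; field.
    by rewrite mulr_ge0 ?sqr_ge0.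
  rewrite big_split/= -!mulr_sumr.
  have := geometric2 n; have := part n.
  move: (\sum_(k < n) _) (\sum_(i < n) _) => a b; lra.
have -> : F ^~ x = (fun n => F 0 x + series (d ^~ x) n).
  by apply/funext => n; rewrite seriesEnat /= telescope_sumr// subrKC.
by apply: is_cvgD => //; exact: is_cvg_cst.
Qed.

(** Fatou's lemma applied to a fast subsequence. *)
Lemma L2r_complete (F : nat -> T -> R) : (forall n, L2r (F n)) ->
  (forall e, 0 < e -> exists N, forall n m, (N <= n)%N -> (N <= m)%N -> nsq (fun x => F n x - F m x) <= e) ->
  exists2 f, L2r f & forall e, 0 < e -> exists N, forall n, (N <= n)%N -> nsq (fun x => F n x - f x) <= e.
Proof.
move=> lF cF.
have e0 k : 0 < (4^-1 : R) ^+ k by rewrite exprn_gt0.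
have /choice[N hN] k := cF _ (e0 k).
pose phi k := (\sum_(i < k.+1) (N i).+1)%N.
have phiN k : (N k <= phi k)%N by rewrite /phi big_ord_recr /= (leq_trans (leqnSn _))// leq_addl.
have phiS k : (phi k <= phi k.+1)%N by rewrite {2}/phi big_ord_recr /= leq_addr.
have phi_ge k : (k <= phi k)%N.
  elim: k => // k ih; rewrite /phi big_ord_recr /= -/(phi k) addnS ltnS.
  exact: leq_trans ih (leq_addr _ _).
have [|G [mG aG cG]] := @L2r_fast (fun k => F (phi k)) (fun k => lF _).
  by move=> k; apply: hN => //; exact: leq_trans (phiS k).
have m1 : measurable_fun setT (\1_G : T -> R) by exact: measurable_indic.
pose f x := lim ((fun k => \1_G x * F (phi k) x) @ \oo).
have cf x : (fun k => \1_G x * F (phi k) x) @ \oo --> f x.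
  suff : cvgn (fun k => \1_G x * F (phi k) x) by [].
  have [Gx|Gx] := pselect (G x).
    by apply: is_cvgM; [exact: is_cvg_cst|exact: cG].
  by rewrite indicE memNset//; under eq_fun do rewrite mul0r; exact: is_cvg_cst.
have lGn n : L2r (fun x => \1_G x * F n x).
  by apply: (@L2r_bdM _ _ _ 1) => // x; rewrite indicE; case: (_ \in _); rewrite ?normr1// normr0.
have lG k : L2r (fun x => \1_G x * F (phi k) x) by exact: lGn.
have main n K (C : R) : (forall k, (K <= k)%N -> nsq (fun x => F n x - F (phi k) x) <= C) ->
    L2r f /\ nsq (fun x => F n x - f x) <= C.
  move=> hC.
  have [||||h1 h2] := @fatou3 (fun k x => (\1_G x * F n x - \1_G x * F (phi (k + K)%N) x) ^+ 2)
     (fun x => (\1_G x * F n x - f x) ^+ 2) C.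
  - by move=> k; apply: L2r_sq; apply: L2rB => //; exact: lGn.
  - by move=> k x; exact: sqr_ge0.
  - move=> x; under eq_fun do rewrite expr2; rewrite expr2.
    have cK : (fun k => \1_G x * F (phi (k + K)%N) x) @ \oo --> f x.
      by have := cf x; rewrite -(cvg_shiftn K).
    by apply: cvgM; apply: cvgB => //; exact: cvg_cst.
  - move=> k; apply: le_trans (hC (k + K)%N (leq_addl _ _)); rewrite le_eqVlt; apply/orP; left; apply/eqP; apply: int3_ae.
    + by apply/measurable_funX/measurable_funB; exact: L2r_meas.
    + by apply/measurable_funX/measurable_funB; exact: L2r_meas.
    + by have := ae_indicator mG aG; apply: filterS => x ->; rewrite !mul1r.
  have mf : measurable_fun setT f.
    by apply: (measurable_fun_cvg (fun k => L2r_meas (lG k))) => x _; exact: cf.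
  have lf : L2r f.
    have l1 : L2r (fun x => \1_G x * F n x - f x).
      by apply/L2rP; split => //; apply: measurable_funB => //; exact: L2r_meas.
    have := L2rB (lGn n) l1; congr L2r; apply/funext => x; rewrite opprB addrC subrK//.
  split=> //; apply: le_trans h2; rewrite le_eqVlt; apply/orP; left; apply/eqP; apply: int3_ae.
  + by apply/measurable_funX/measurable_funB => //; exact: L2r_meas.
  + by apply/measurable_funX/measurable_funB => //; exact: L2r_meas.
  + by have := ae_indicator mG aG; apply: filterS => x ->; rewrite !mul1r.
have main2 e : 0 < e -> exists N, forall n, (N <= n)%N -> L2r f /\ nsq (fun x => F n x - f x) <= e.
  move=> ep; have [N1 h1] := cF _ ep; exists N1 => n n1; apply: (main n N1) => k kN.
  by apply: h1 => //; exact: leq_trans (phi_ge _).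
exists f; first by have [N1 h1] := main2 _ ltr01; have [] := h1 _ (leqnn _).
by move=> e ep; have [N1 h1] := main2 _ ep; exists N1 => n /h1[].
Qed.

Lemma riesz_arith (e a b c d k p q i : R) : p <= e / 4 -> q <= e / 4 ->
  a - 2 * c <= i + p -> b - 2 * d <= i + q ->
  i <= 2^-1 ^+ 2 * a + 2^-1 ^+ 2 * b + 2 / 2 / 2 * k - 2 * (2^-1 * c + 2^-1 * d) ->
  a + b - 2 * k <= e.
Proof. lra. Qed.

Lemma riesz_arith2 (A B Q n d e : R) : 0 < Q -> 0 <= n <= Q -> B ^+ 2 <= e * Q ->
  d <= e -> - d <= (- (A / Q)) ^+ 2 * n + 2 * (- (A / Q)) * (A + B) -> A ^+ 2 <= 6 * Q * e.
Proof.
move=> Q0 /andP[n0 nQ] hB hd h.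
have : Q * - d <= A ^+ 2 / Q * n - 2 * A * (A + B).
  have -> : A ^+ 2 / Q * n - 2 * A * (A + B) = Q * ((- (A / Q)) ^+ 2 * n + 2 * (- (A / Q)) * (A + B)).
    by field; rewrite gt_eqF.
  by rewrite ler_wpM2l// ltW.
have : A ^+ 2 / Q * n <= A ^+ 2.
  by rewrite -mulrA ler_piMr ?sqr_ge0// mulrC ler_pdivrMr// mul1r.
have : Q * d <= Q * e by rewrite ler_wpM2l// ltW.
have := sqr_ge0 (A + 2 * B); move: hB.
rewrite (_ : (A + 2 * B) ^+ 2 = A ^+ 2 + 4 * (A * B) + 4 * B ^+ 2); last by ring.
rewrite (_ : 2 * A * (A + B) = 2 * A ^+ 2 + 2 * (A * B)); last by ring.
rewrite [Q * - d]mulrN -[6 * Q * e]mulrA [e * Q]mulrC; move: (A ^+ 2) (A * B) (B ^+ 2) (Q * e) (Q * d) (A ^+ 2 / Q * n) => *; lra.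
Qed.

Lemma riesz_arith3 (i a b c p q s d : R) :
  i <= 1 ^+ 2 * a + s ^+ 2 * b + 2 * 1 * s * c - 2 * (1 * p + s * q) -> a - 2 * p < i + d ->
  - d <= s ^+ 2 * b + 2 * s * (c - q).
Proof.
move=> h1 h2; rewrite -subr_ge0.
have -> : s ^+ 2 * b + 2 * s * (c - q) - - d = (1 ^+ 2 * a + s ^+ 2 * b + 2 * 1 * s * c - 2 * (1 * p + s * q) - i)
   + (i + d - (a - 2 * p)) by ring.
by apply: addr_ge0; rewrite subr_ge0// ltW.
Qed.

(** The representative minimizes nsq f - 2 l f. A minimizing sequence is a
    Cauchy sequence by the parallelogram identity, and the first-order
    condition at its limit is the claim. *)
Lemma L2r_riesz (l : (T -> R) -> R) C : 0 < C ->
  (forall (a b : R) f g, L2r f -> L2r g -> l (fun x => a * f x + b * g x) = a * l f + b * l g) ->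
  (forall f, L2r f -> l f ^+ 2 <= C * nsq f) ->
  exists2 v, L2r v & forall f, L2r f -> l f = int3 (fun x => v x * f x).
Proof.
move=> C0 lin bd.
pose J f := nsq f - 2 * l f.
have J_ge f : L2r f -> - C <= J f.
  move=> lf; rewrite /J -subr_ge0 -(pmulr_rge0 _ C0).
  have -> : C * (nsq f - 2 * l f - - C) = (C * nsq f - l f ^+ 2) + (l f - C) ^+ 2 by ring.
  by rewrite addr_ge0 ?sqr_ge0// subr_ge0 bd.
pose S := [set J f | f in [set f | L2r f]].
have S0 : S !=set0 by exists (J (fun=> 0)); exists (fun=> 0) => //; exact: L2r0.
have lbS : has_inf S by split => //; exists (- C) => _ [f lf <-]; exact: J_ge.
pose i0 := inf S.
have JI f : L2r f -> i0 <= J f by move=> lf; apply: (ge_inf lbS.2); exists f.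
have near (n : nat) : exists f, L2r f /\ J f < i0 + n.+1%:R^-1.
  have n0 : 0 < (n.+1%:R^-1 : R) by rewrite invr_gt0.
  by have [_ [f lf <-] h] := inf_adherent n0 lbS; exists f.
have /choice[F hF] := near.
have lF n := (hF n).1.
have int_comb (a b : R) f g h : L2r f -> L2r g -> L2r h ->
   int3 (fun x => (a * f x + b * g x) * h x) = a * int3 (fun x => f x * h x) + b * int3 (fun x => g x * h x).
  move=> lf lg lh; have i1 := L2r_mul lf lh; have i2 := L2r_mul lg lh.
  by rewrite -!int3Z// -int3D; [congr int3; apply/funext => x; ring|exact: itgZ..].
have int_symm f g : int3 (fun x => f x * g x) = int3 (fun x => g x * f x).
  by congr int3; apply/funext => x; rewrite mulrC.
have nsqE f : nsq f = int3 (fun x => f x * f x) by congr int3; apply/funext => x; rewrite expr2.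
have lcomb (a b : R) f g : L2r f -> L2r g -> L2r (fun x => a * f x + b * g x).
  by move=> lf lg; apply: L2rD; exact: L2rZ.
have Jcomb (a b : R) f g : L2r f -> L2r g -> J (fun x => a * f x + b * g x) =
    a ^+ 2 * nsq f + b ^+ 2 * nsq g + 2 * a * b * int3 (fun x => f x * g x) - 2 * (a * l f + b * l g).
  move=> lf lg; rewrite /J lin// nsqE int_comb//; last exact: lcomb.
  rewrite [int3 (fun x => f x * (_ + _))]int_symm [int3 (fun x => g x * (_ + _))]int_symm !int_comb//.
  by rewrite (int_symm g f) !nsqE; ring.
have diff f g : L2r f -> L2r g -> nsq (fun x => f x - g x) = nsq f + nsq g - 2 * int3 (fun x => f x * g x).
  move=> lf lg; have -> : (fun x => f x - g x) = (fun x => 1 * f x + (-1) * g x).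
    by apply/funext => x; ring.
  rewrite nsqE int_comb//; last exact: lcomb.
  rewrite [int3 (fun x => f x * (_ + _))]int_symm [int3 (fun x => g x * (_ + _))]int_symm !int_comb//.
  by rewrite (int_symm g f) !nsqE; ring.
have inv_small e : 0 < e -> exists N, forall n, (N <= n)%N -> (n.+1%:R^-1 : R) <= e.
  move=> e0; exists (Num.truncn e^-1) => n hn; rewrite invf_ple ?posrE//.
  apply: le_trans (ltW (truncnS_gt _)) _; by rewrite ler_nat ltnS.
have cF e : 0 < e -> exists N, forall n m, (N <= n)%N -> (N <= m)%N -> nsq (fun x => F n x - F m x) <= e.
  move=> e0; have [N hN] := inv_small (e / 4) (divr_gt0 e0 (ltr0Sn _ _)).
  exists N => n m /hN hn /hN hm.
  have h1 := ltW (hF n).2; have h2 := ltW (hF m).2.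
  have h3 := JI _ (lcomb 2^-1 2^-1 _ _ (lF n) (lF m)).
  rewrite Jcomb// in h3; rewrite /J in h1 h2; rewrite diff//.
  exact: riesz_arith hn hm h1 h2 h3.
have [v lv cv] := L2r_complete lF cF.
exists v => // f lf.
set V := int3 (fun x => v x * f x); pose A := V - l f; pose Q := nsq f + 1.
have Q0 : 0 < Q by rewrite /Q ltr_wpDl// nsq_ge0.
have key e : 0 < e -> A ^+ 2 <= 6 * Q * e.
  move=> e0; have [N1 h1] := inv_small _ e0; have [N2 h2] := cv _ e0.
  pose n := maxn N1 N2; have hn := h1 n (leq_maxl _ _); have hv := h2 n (leq_maxr _ _).
  (* The step s minimizes the quadratic up to the normalization Q > nsq f. *)
  pose s := - (A / Q).
  have h3 := JI _ (lcomb 1 s _ _ (lF n) lf); rewrite Jcomb// in h3.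
  have h4 := (hF n).2; rewrite /J in h4.
  pose B := int3 (fun x => F n x * f x) - V.
  have hB : B ^+ 2 <= e * Q.
    have -> : B = int3 (fun x => (F n x - v x) * f x).
      rewrite /B /V -int3B; [|exact: L2r_mul..].
      by congr int3; apply/funext => x; ring.
    apply: le_trans (cauchy_schwarz3 (L2rB (lF n) lv) lf) _.
    by apply: ler_pM => //; [exact: nsq_ge0|exact: nsq_ge0|rewrite /Q lerDl].
  apply: (@riesz_arith2 A B Q (nsq f) n.+1%:R^-1 e) => //.
    by rewrite nsq_ge0 /Q lerDl ler01.
  have -> : A + B = int3 (fun x => F n x * f x) - l f by rewrite /A /B; ring.
  exact: riesz_arith3 h3 h4.
suff A0 : A = 0 by apply/esym/eqP; rewrite -subr_eq0 -/A A0.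
apply/eqP; rewrite -sqrf_eq0; apply/eqP/le_anti; rewrite sqr_ge0 andbT.
apply/ler_addgt0Pl => e e0; rewrite addr0.
have Q6 : 0 < 6 * Q by rewrite mulr_gt0.
by apply: le_trans (key _ (divr_gt0 e0 Q6)) _; rewrite mulrC divfK// gt_eqF.
Qed.

End L2theory.

(** * Cut-off functions and density of test functions *)

(** The scale 1/(n+1)^2, the square of the radius of the n-th cut-off and of
    the n-th mollifier. *)
Definition tau (R : realType) (n : nat) : R := (n.+1%:R^-1) ^+ 2.
Arguments tau {R}.

(** A smooth cut-off supported in tau n <= |x|^2 <= 1 / tau n; the factor e
    normalizes its limit to 1. *)
HB.lock Definition chi (R : realType) (n : nat) (x : R3 R) : R :=
  expR 1 * (expinv 0 ((tau n)^-1 * rsq x + (-1)) * expinv 0 (1 + (- tau n) * rsq x)).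
Arguments chi {R}.

Section cutoff.
Context {R : realType}.
Local Notation T := (R3 R).
Local Notation mu := (leb3 R).
Implicit Types (f g h : T -> R) (x y z w v : T) (C e d : R).

Lemma tau_gt0 n : 0 < tau n :> R.
Proof. by rewrite exprn_gt0// invr_gt0. Qed.

Lemma cvg_ext (u v : nat -> R) (l : R) : (forall n, u n = v n) -> u @ \oo --> l -> v @ \oo --> l.
Proof. by move=> /funext ->. Qed.

Lemma cvgM_seq (u v : nat -> R) (a b : R) : u @ \oo --> a -> v @ \oo --> b ->
  (fun n => u n * v n) @ \oo --> a * b.
Proof. by move=> hu hv; exact: cvgM. Qed.

Lemma cvgZ_seq (c : R) (u : nat -> R) (a : R) : u @ \oo --> a -> (fun n => c * u n) @ \oo --> c * a.
Proof. by move=> hu; apply: cvgM_seq => //; exact: cvg_cst. Qed.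

Lemma tau_cvg : @tau R @ \oo --> (0 : R).
Proof.
have h := @cvg_harmonic R; have := cvgM_seq h h; rewrite mulr0.
by apply: cvg_ext => n; rewrite /tau expr2.
Qed.

Lemma expinv_posE k (s : R) : 0 < s -> expinv k s = s^-1 ^+ k * expR (- s^-1).
Proof. by rewrite /expinv => ->. Qed.

Lemma expinv_neg k (s : R) : s <= 0 -> expinv k s = 0.
Proof. by rewrite /expinv ltNge => ->. Qed.

Lemma rsmooth_affine_rsq (a b : R) : rsmooth (fun x : T => a * rsq x + b).
Proof. by apply: rsmoothD; [apply: rsmoothZ; exact: rsmooth_rsq|exact: rsmooth_cst]. Qed.

Lemma test0_chi n : test0 (@chi R n).
Proof.
have t0 := tau_gt0 n.
have s1 : rsmooth (fun x : T => (tau n)^-1 * rsq x + (-1)) by exact: rsmooth_affine_rsq.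
have s2 : rsmooth (fun x : T => 1 + (- tau n) * rsq x).
  by under eq_fun do rewrite addrC; exact: rsmooth_affine_rsq.
rewrite chi.unlock; split; [split|].
- by apply: rsmoothZ; apply: rsmoothM; exact: rsmooth_expinv.
- exists (tau n)^-1 => x; apply: contraNT; rewrite -ltNge => h.
  rewrite (@expinv_neg 0 (1 + _)) ?mulr0//.
  by rewrite mulNr subr_le0 -ler_pdivrMl// mulr1 ltW.
- exists (tau n) => // x; apply: contraNT; rewrite -ltNge => h.
  rewrite (@expinv_neg 0 (_ + -1)) ?mul0r ?mulr0//.
  by rewrite subr_le0 ler_pdivrMl// mulr1 ltW.
Qed.

Lemma chi_bound n x : 0 <= chi n x <= expR 1.
Proof.
rewrite chi.unlock; apply/andP; split.
  by rewrite !mulr_ge0 ?expinv_ge0// expR_ge0.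
rewrite ler_piMr ?expR_ge0// mulr_ile1 ?expinv_ge0//; exact: expinv_bound.
Qed.

(** The Euler derivative of chi n, as a function of t = |x|^2. *)
Definition chi_slope (n : nat) (t : R) : R :=
  2 * expR 1 * ((tau n)^-1 * t * expinv 2 ((tau n)^-1 * t - 1) * expinv 0 (1 - tau n * t)
   - tau n * t * expinv 2 (1 - tau n * t) * expinv 0 ((tau n)^-1 * t - 1)).

Lemma pd_chi n j x : x != 0 -> pd j (chi n) x = chi_slope n (rsq x) * (coord3 j x / rsq x).
Proof.
move=> x0; have t0 := tau_gt0 n.
have s1 : pderivable (fun x : T => (tau n)^-1 * rsq x + (-1)).
  exact: rsmooth_pderivable (rsmooth_affine_rsq _ _).
have s2 : pderivable (fun x : T => 1 + (- tau n) * rsq x).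
  by under eq_fun do rewrite addrC; exact: rsmooth_pderivable (rsmooth_affine_rsq _ _).
have pr := rsmooth_pderivable (@rsmooth_rsq R).
have pc (c : R) : pderivable (fun _ : T => c) by exact: pderivable_cst.
have pz (a : R) : pderivable (fun x : T => a * rsq x).
  exact: pderivableM (pc a) pr.
have pa (a : R) : pd j (fun x : T => a * rsq x) = fun x => a * (2 * coord3 j x).
  by apply/funext => y; rewrite pd_Z// pd_rsq.
rewrite chi.unlock pd_Z; last by apply: pderivableM; exact: pderivable_expinv.
rewrite pdM; [|exact: pderivable_expinv..]; rewrite !pd_expinv//.
rewrite (pdD j (pz _) (pc _)) (pdD j (pc _) (pz _)) !pa !pd_cst /chi_slope !mul0r !subr0 add0r addr0 !mulNr.
have r0 : rsq x != 0 by rewrite gt_eqF// rsq_gt0.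
by field; rewrite r0 gt_eqF.
Qed.

(** Each summand is a product of the form s^-2 exp (-1/s) (1 + s), or the same
    with 1 - s, hence bounded: near 0 the cut-off depends on t / tau n only,
    and near infinity on tau n t only. *)
Lemma chi_slope_bound n (t : R) : 0 <= t -> `|chi_slope n t| <= 10 * expR 1.
Proof.
move=> t0; have n0 := tau_gt0 n.
have h1 : 0 <= (tau n)^-1 * t * expinv 2 ((tau n)^-1 * t - 1) <= 3.
  rewrite mulr_ge0 ?expinv_ge0 ?mulr_ge0 ?invr_ge0 ?(ltW n0)//=.
  set s := _ - 1; have -> : (tau n)^-1 * t = s + 1 by rewrite subrK.
  have [s0|s0] := leP s 0; first by rewrite expinv_neg// mulr0.
  have -> : (s + 1) * expinv 2 s = expinv 1 s + expinv 2 s by rewrite !expinv_posE//; field; rewrite gt_eqF.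
  by have := expinv_bound 1 s; have := expinv_bound 2 s; rewrite (_ : 2`!%:R = 2 :> R)// (_ : 1`!%:R = 1 :> R)//; lra.
have h2 : 0 <= tau n * t * expinv 2 (1 - tau n * t) <= 2.
  rewrite mulr_ge0 ?expinv_ge0 ?mulr_ge0 ?(ltW n0)//=.
  have [s0|s0] := leP (1 - tau n * t) 0; first by rewrite expinv_neg// mulr0.
  rewrite -[leRHS]mul1r ler_pM ?expinv_ge0 ?mulr_ge0 ?(ltW n0)//; first by rewrite -subr_ge0 ltW.
  exact: expinv_bound.
have h3 (s : R) : 0 <= expinv 0 s <= 1 by rewrite expinv_ge0; exact: expinv_bound.
rewrite /chi_slope; have /andP[a1 a2] := h3 (1 - tau n * t); have /andP[b1 b2] := h3 ((tau n)^-1 * t - 1).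
case/andP: h1 => c1 c2; case/andP: h2 => d1 d2.
have e0 := @expR_ge0 R 1.
rewrite normrM ger0_norm ?mulr_ge0// (_ : 10 * expR 1 = 2 * expR 1 * 5); last by ring.
rewrite ler_wpM2l ?mulr_ge0// (le_trans (ler_normB _ _))//.
have h4 := ler_pM c1 a1 c2 a2; have h5 := ler_pM d1 b1 d2 b2.
rewrite (ger0_norm (mulr_ge0 c1 a1)) (ger0_norm (mulr_ge0 d1 b1)).
by rewrite (le_trans (lerD h4 h5))//; lra.
Qed.

Lemma coord3_div j x : x != 0 -> `|coord3 j x / rsq x| <= inv_norm x.
Proof.
move=> x0; have t0 := rsq_gt0 x0.
have e : rsq x = Num.sqrt (rsq x) ^+ 2 by rewrite sqr_sqrtr// ltW.
rewrite normrM normfV (gtr0_norm t0) ler_pdivrMr// /inv_norm {2}e expr2 mulKf; last by rewrite gt_eqF// sqrtr_gt0.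
rewrite -sqrtr_sqr ler_wsqrtr// rsqE.
have h0 := sqr_ge0 (coord3 o0 x); have h1 := sqr_ge0 (coord3 o1 x); have h2 := sqr_ge0 (coord3 o2 x).
by move: j; apply: ord3P; rewrite -/o0 -/o1 -/o2; clear -h0 h1 h2; lra.
Qed.

Lemma inv_norm_ge0 x : 0 <= inv_norm x. Proof. by rewrite invr_ge0 sqrtr_ge0. Qed.

(** Uniform in n: the commutator of a first-order operator with the cut-off is
    controlled by u/|x|. *)
Lemma pd_chi_bound n j x : `|pd j (chi n) x| <= 10 * expR 1 * inv_norm x.
Proof.
have [->|x0] := eqVneq x 0.
  have [_ [d d0 hd]] := test0_pd j (test0_chi n).
  by rewrite (supp_in hd) ?rsq0// normr0 mulr_ge0 ?inv_norm_ge0// mulr_ge0 ?expR_ge0.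
rewrite pd_chi// normrM; apply: ler_pM => //; last exact: coord3_div.
by apply: chi_slope_bound; exact: rsq_ge0.
Qed.

Section limits.
Variable t : R.
Hypothesis t0 : 0 < t.

Let a n : R := tau n / (t - tau n).
Let b n : R := (1 - tau n * t)^-1.

Let cvg_a : a @ \oo --> (0 : R).
Proof.
rewrite (_ : 0 = 0 / (t - 0)); last by rewrite mul0r.
apply: cvgM; first exact: tau_cvg.
apply: cvgV; first by rewrite subr0 gt_eqF.
by apply: cvgB; [exact: cvg_cst|exact: tau_cvg].
Qed.

Let cvg_b : b @ \oo --> (1 : R).
Proof.
have h : (fun n => 1 - tau n * t) @ \oo --> (1 - 0 * t : R).
  by apply: cvgB; [exact: cvg_cst|apply: cvgM; [exact: tau_cvg|exact: cvg_cst]].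
rewrite -[X in _ --> X]invr1; apply: cvgV => //.
by rewrite mul0r subr0 in h.
Qed.

Let cvg_ea : (fun n => expR (- a n)) @ \oo --> (1 : R).
Proof. by rewrite -[X in _ --> X]expR0 -oppr0; apply: continuous_cvg; [exact: continuous_expR|exact: cvgN]. Qed.

Let cvg_eb : (fun n => expR (- b n)) @ \oo --> (expR (-1) : R).
Proof. by apply: continuous_cvg; [exact: continuous_expR|exact: cvgN]. Qed.

Let eventually_small : \forall n \near \oo, tau n < t /\ tau n * t < 1.
Proof.
have h1 : \forall n \near \oo, tau n < t.
  have /cvgrPdist_lt/(_ t t0) := tau_cvg.
  by apply: filterS => n; rewrite sub0r normrN ger0_norm// ltW// tau_gt0.
have h2 : \forall n \near \oo, tau n < t^-1.
  have /cvgrPdist_lt/(_ t^-1) := tau_cvg; rewrite invr_gt0 => /(_ t0).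
  by apply: filterS => n; rewrite sub0r normrN ger0_norm// ltW// tau_gt0.
near=> n; split; first by near: n.
rewrite -ltr_pdivlMr// mul1r; by near: n.
Unshelve. all: by end_near. Qed.

Let eka k n : tau n < t -> expinv k ((tau n)^-1 * t - 1) = a n ^+ k * expR (- a n).
Proof.
move=> h; have n0 := tau_gt0 n.
have e : ((tau n)^-1 * t - 1)^-1 = a n.
  by rewrite /a; field; rewrite !gt_eqF//= subr_gt0.
by rewrite expinv_posE ?e// subr_gt0 ltr_pdivlMl// mulr1.
Qed.

Let ekb k n : tau n * t < 1 -> expinv k (1 - tau n * t) = b n ^+ k * expR (- b n).
Proof. by move=> h; rewrite expinv_posE// subr_gt0. Qed.

Lemma phi_cvg : (fun n => expR 1 * (expinv 0 ((tau n)^-1 * t - 1) * expinv 0 (1 - tau n * t))) @ \oo --> (1 : R).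
Proof.
have e : {near \oo, (fun n => expR 1 * (expR (- a n) * expR (- b n))) =1
   (fun n => expR 1 * (expinv 0 ((tau n)^-1 * t - 1) * expinv 0 (1 - tau n * t)))}.
  by apply: filterS eventually_small => n [h1 h2]; rewrite eka// ekb// !expr0 !mul1r.
apply: cvg_trans (near_eq_cvg e) _.
have e1 : expR 1 * (1 * expR (-1)) = 1 :> R by rewrite mul1r -expRD subrr expR0.
by have := @cvgZ_seq (expR 1) _ _ (cvgM_seq cvg_ea cvg_eb); rewrite e1.
Qed.

Lemma chi_slope_cvg : chi_slope ^~ t @ \oo --> (0 : R).
Proof.
have e : {near \oo, (fun n => 2 * expR 1 * ((a n + a n * a n) * expR (- a n) * expR (- b n)
    - tau n * t * (b n * b n * expR (- b n)) * expR (- a n))) =1 chi_slope ^~ t}.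
  apply: filterS eventually_small => n [h1 h2]; rewrite /chi_slope !eka// !ekb// !expr0 !mul1r.
  have -> : (tau n)^-1 * t * (a n ^+ 2 * expR (- a n)) = (a n + a n * a n) * expR (- a n); last by rewrite expr2.
  have n0 := tau_gt0 n; rewrite mulrA; congr (_ * _).
  by rewrite /a; field; rewrite !gt_eqF//= subr_gt0.
apply: cvg_trans (near_eq_cvg e) _.
rewrite (_ : 0 = 2 * expR 1 * ((0 + 0 * 0) * 1 * expR (-1) - 0 * t * (1 * 1 * expR (-1)) * 1) :> R); last by ring.
apply: cvgM; first exact: cvg_cst.
apply: cvgB; apply: cvgM => //; apply: cvgM => //.
- by apply: cvgD => //; exact: cvgM.
- by apply: cvgM; [exact: tau_cvg|exact: cvg_cst].
- by apply: cvgM => //; exact: cvgM.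
Qed.
End limits.

Lemma chi_cvg x : x != 0 -> chi ^~ x @ \oo --> (1 : R).
Proof.
move=> /rsq_gt0 t0; have := phi_cvg t0.
by apply: cvg_ext => n; rewrite chi.unlock mulNr.
Qed.

Lemma pd_chi_cvg j x : x != 0 -> (fun n => pd j (chi n) x) @ \oo --> (0 : R).
Proof.
move=> x0; have := @cvgZ_seq (coord3 j x / rsq x) _ _ (chi_slope_cvg (rsq_gt0 x0)); rewrite mulr0.
by apply: cvg_ext => n; rewrite pd_chi// mulrC.
Qed.

Lemma leb3_0 : mu [set 0 : T] = 0%E.
Proof.
have -> : [set 0 : T] = ([set 0] `*` [set 0]) `*` [set 0].
  apply/seteqP; split => [x /= -> //|[[x y] z] /= [[-> ->] ->] //].
have m1 : measurable ([set 0 : R]) by exact: measurable_set1.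
transitivity (((@lebesgue_measure R \x @lebesgue_measure R) ([set (0%R : R)] `*` [set (0%R : R)]) * @lebesgue_measure R [set (0%R : R)])%E).
  by apply: product_measure1E => //; exact: measurableX.
by rewrite [X in (_ * X)%E]lebesgue_measure_set1 mule0.
Qed.

Lemma ae_neq0 : {ae mu, forall x, x != 0}.
Proof.
exists [set 0 : T]; split; [|exact: leb3_0|].
  have m1 : measurable ([set 0 : R]) by exact: measurable_set1.
  have -> : [set 0 : T] = ([set 0] `*` [set 0]) `*` [set 0].
    by apply/seteqP; split => [x /= -> //|[[x y] z] /= [[-> ->] ->] //].
  by apply: measurableX => //; exact: measurableX.
by move=> x /= /negP; rewrite negbK => /eqP.
Qed.

(** Membership in the L^2 closure of the test functions on the punctured
    space. *)
Definition approx0 f := L2r f /\ forall e, 0 < e -> exists2 p, test0 p & nsq (fun x => f x - p x) <= e.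

Lemma approx0_test f : test0 f -> approx0 f.
Proof.
move=> tf; split; first exact: L2r_test tf.1.
move=> e e0; exists f => //; rewrite (_ : (fun x => _) = fun=> 0); last by apply/funext => x; rewrite subrr.
by rewrite /nsq (_ : (fun x => _) = fun=> 0) ?int30 ?ltW//; apply/funext => x; rewrite expr0n.
Qed.

Lemma approx0_lim f : L2r f -> (forall e, 0 < e -> exists2 g, approx0 g & nsq (fun x => f x - g x) <= e) -> approx0 f.
Proof.
move=> lf h; split => // e e0.
have e4 : 0 < e / 4 by rewrite divr_gt0.
have [g [lg cg] fg] := h _ e4; have [p tp gp] := cg _ e4; exists p => //.
have lp := L2r_test tp.1.
have := nsqD_le (L2rB lf lg) (L2rB lg lp).
rewrite (_ : (fun x => _) = (fun x => f x - p x)); last by apply/funext => x; ring.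
by move=> k; apply: le_trans k _; lra.
Qed.

Lemma approx0D f g : approx0 f -> approx0 g -> approx0 (fun x => f x + g x).
Proof.
move=> [lf cf] [lg cg]; split; first exact: L2rD.
move=> e e0; have e4 : 0 < e / 4 by rewrite divr_gt0.
have [p tp hp] := cf _ e4; have [q tq hq] := cg _ e4.
exists (fun x => p x + q x); first exact: test0D.
have := nsqD_le (L2rB lf (L2r_test tp.1)) (L2rB lg (L2r_test tq.1)).
rewrite (_ : (fun x => _) = (fun x => f x + g x - (p x + q x))); last by apply/funext => x; ring.
by move=> k; apply: le_trans k _; lra.
Qed.

Lemma approx0Z C f : approx0 f -> approx0 (fun x => C * f x).
Proof.
move=> [lf cf]; split; first exact: L2rZ.
move=> e e0; have c0 : 0 < C ^+ 2 + 1 by rewrite ltr_wpDl ?sqr_ge0.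
have [p tp hp] := cf _ (divr_gt0 e0 c0).
exists (fun x => C * p x); first exact: test0Z.
rewrite (_ : (fun x => _) = (fun x => C * (f x - p x))); last by apply/funext => x; ring.
rewrite nsqZ; last exact: L2rB lf (L2r_test tp.1).
apply: le_trans (ler_wpM2l (sqr_ge0 C) hp) _.
by rewrite mulrA ler_pdivrMr// mulrC ler_wpM2l ?(ltW e0)// lerDl.
Qed.

Lemma approx0_sum n (F : nat -> T -> R) : (forall i, (i < n)%N -> approx0 (F i)) -> approx0 (fun x => \sum_(i < n) F i x).
Proof.
elim: n => [|n ih] h.
  by under eq_fun do rewrite big_ord0; exact: approx0_test test0_0.
under eq_fun do rewrite big_ord_recr /=.
by apply: approx0D; [apply: ih => i ni; apply: h; exact: ltnW|exact: h].
Qed.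

Lemma approx0_dct (F : nat -> T -> R) f g : (forall n, approx0 (F n)) -> L2r f -> L2r g ->
  (forall x, F ^~ x @ \oo --> f x) -> (forall n x, `|F n x - f x| <= `|g x|) -> approx0 f.
Proof.
move=> cF lf lg Ff Fg; apply: approx0_lim => // e e0.
have h := dctL2 (fun n => (cF n).1) lf Ff lg Fg.
have /cvgrPdist_lt/(_ _ e0) h2 := h.
have [N _ hN] := h2; exists (F N) => //.
have := hN N (leqnn N); rewrite sub0r normrN ger0_norm ?nsq_ge0//.
rewrite (_ : nsq (fun x => F N x - f x) = nsq (fun x => f x - F N x)); first exact: ltW.
by congr int3; apply/funext => x; rewrite -sqrrN opprB.
Qed.

Lemma ind_bound (A : set T) x : `|\1_A x : R| <= 1.
Proof. by rewrite indicE; case: (_ \in _); rewrite ?normr1// normr0. Qed.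

Lemma L2r_ind (A : set T) f : measurable A -> L2r f -> L2r (fun x => \1_A x * f x).
Proof.
by move=> mA lf; apply: (@L2r_bdM _ _ _ 1) => // x; exact: ind_bound.
Qed.

Lemma measurable_coord3 j : measurable_fun setT (@coord3 R j).
Proof. exact: continuous_measurable3 (@coord3_cont R j). Qed.

Lemma measurable_ray j (a : R) : measurable [set x : T | a < coord3 j x].
Proof.
have -> : [set x : T | a < coord3 j x] = @coord3 R j @^-1` `]a, +oo[%classic.
  by apply/seteqP; split => x /=; rewrite in_itv/= andbT.
by rewrite -[X in measurable X]setTI; apply: measurable_coord3.
Qed.

(** A smooth approximation of the indicator function of a half-line. *)
Lemma ray_cvg (s : R) : (fun n => expinv 0 ((tau n)^-1 * s)) @ \oo --> (if 0 < s then 1 else 0 : R).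
Proof.
case: ifPn => s0; last first.
  rewrite (_ : (fun n => _) = fun=> 0); first exact: cvg_cst.
  by apply/funext => n; rewrite expinv_neg// pmulr_rle0 ?invr_gt0 ?tau_gt0// leNgt.
have h : (fun n => expR (- (tau n * s^-1))) @ \oo --> (expR (- (0 * s^-1)) : R).
  apply: continuous_cvg; first exact: continuous_expR.
  by apply: cvgN; apply: cvgM; [exact: tau_cvg|exact: cvg_cst].
rewrite mul0r oppr0 expR0 in h; apply: cvg_ext h => n.
by rewrite expinv_posE ?mulr_gt0 ?invr_gt0 ?tau_gt0// expr0 mul1r invfM invrK.
Qed.

(** Multiplication by indicator functions of half-spaces preserves the
    closure, because these are limits of smooth functions. *)
Lemma approx0_ray j (a : R) f : approx0 f -> approx0 (fun x => \1_[set x : T | a < coord3 j x] x * f x).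
Proof.
move=> [lf cf]; have mA := measurable_ray j a; set A := [set _ | _] in mA *.
apply: approx0_lim; first exact: L2r_ind.
move=> e e0; have [p tp fp] := cf _ e0; have lp := L2r_test tp.1.
exists (fun x => \1_A x * p x); last first.
  apply: le_trans fp; apply: ler_int3.
  - by apply: L2r_sq; apply: L2rB; exact: L2r_ind.
  - by apply: L2r_sq; exact: L2rB.
  move=> x; rewrite -mulrBr exprMn -[leRHS]mul1r ler_wpM2r ?sqr_ge0//.
have sx : rsmooth (fun x : T => coord3 j x - a) by apply: rsmoothD; [exact: coord3_rsmooth|exact: rsmooth_cst].
apply: (@approx0_dct (fun n x => expinv 0 ((tau n)^-1 * (coord3 j x - a)) * p x) _ (fun x => 2 * p x)).
- by move=> n; apply: approx0_test; apply: test0M => //; apply: rsmooth_expinv; exact: rsmoothZ.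
- exact: L2r_ind.
- exact: L2rZ.
- move=> x; apply: cvgM; last exact: cvg_cst.
  have := @ray_cvg (coord3 j x - a); rewrite subr_gt0 indicE.
  rewrite (_ : (x \in A) = (a < coord3 j x)); first by case: (a < coord3 j x).
  by apply/idP/idP => [/set_mem//|h]; apply: mem_set.
- move=> n x; rewrite -mulrBl !normrM ler_wpM2r// (le_trans (ler_normB _ _))//.
  rewrite (ger0_norm (expinv_ge0 _ _)) [leRHS]ger0_norm// (_ : 2 = 1 + 1 :> R)// lerD ?ind_bound//.
  exact: expinv_bound.
Qed.

(** The sets whose indicator functions are multipliers of the closure form a
    sigma-algebra. As it contains the half-spaces, it contains every
    measurable set. *)
Definition approx0_stable (A : set T) := measurable A /\ forall f, approx0 f -> approx0 (fun x => \1_A x * f x).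

Lemma approx0_stableI (A B : set T) : approx0_stable A -> approx0_stable B -> approx0_stable (A `&` B).
Proof.
move=> [mA hA] [mB hB]; split; first exact: measurableI.
by move=> f cf; under eq_fun do rewrite indicI /= -mulrA; exact/hA/hB.
Qed.

Lemma approx0_stableC (A : set T) : approx0_stable A -> approx0_stable (~` A).
Proof.
move=> [mA hA]; split; first exact: measurableC.
move=> f cf; rewrite (_ : (fun x => _) = (fun x => f x + (-1) * (\1_A x * f x))).
  by apply: approx0D => //; apply: approx0Z; exact: hA.
by apply/funext => x; rewrite !indicE in_setC; case: (x \in A) => /=; ring.
Qed.

Lemma approx0_stable0 : approx0_stable set0.
Proof.
split => // f cf; under eq_fun do rewrite indic0 mul0r.
exact: approx0_test test0_0.
Qed.

Lemma approx0_stable_bigcup (A : nat -> set T) : (forall n, approx0_stable (A n)) -> approx0_stable (\bigcup_n A n).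
Proof.
move=> hA; have mU : measurable (\bigcup_n A n) by apply: bigcupT_measurable => n; exact: (hA n).1.
split=> // f cf.
pose B (n : nat) : set T := [set x | exists2 i, (i < n)%N & A i x].
have inB n x : B n x <-> exists2 i, (i < n)%N & A i x by [].
have hB n : approx0_stable (B n).
  elim: n => [|n ih].
    rewrite (_ : B 0 = set0); first exact: approx0_stable0.
    by apply/seteqP; split => x // [].
  rewrite (_ : B n.+1 = ~` (~` B n `&` ~` A n)).
    by apply: approx0_stableC; apply: approx0_stableI; exact: approx0_stableC.
  rewrite setCI !setCK; apply/seteqP; split => x /=.
    move=> [i ni Ax]; have [e|ni'] := eqVneq i n; first by right; rewrite -e.
    by left; exists i => //; rewrite ltn_neqAle ni' -ltnS.
  by move=> [[i ni Ax]|Ax]; [exists i => //; exact: ltnW|exists n].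
apply: (@approx0_dct (fun n x => \1_(B n) x * f x) _ (fun x => 2 * f x)).
- by move=> n; exact: (hB n).2.
- by apply: L2r_ind => //; exact: cf.1.
- by apply: L2rZ; exact: cf.1.
- move=> x; apply: cvgM; last exact: cvg_cst.
  have [[i _ Ax]|nU] := pselect ((\bigcup_n A n) x).
    rewrite (_ : \1_(\bigcup_n A n) x = 1); last by rewrite indicE mem_set//; exists i.
    apply: cvg_near_cst; exists i.+1 => // n /= ni; rewrite indicE mem_set//.
    by apply/inB; exists i.
  rewrite (_ : \1_(\bigcup_n A n) x = 0); last by rewrite indicE memNset.
  apply: cvg_near_cst; apply: nearW => n; rewrite indicE memNset//.
  by move/inB => [i _ Ax]; apply: nU; exists i.
- move=> n x; rewrite -mulrBl !normrM ler_wpM2r// (le_trans (ler_normB _ _))//.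
  by rewrite [leRHS]ger0_norm// (_ : 2 = 1 + 1 :> R)// lerD ?ind_bound.
Qed.

Lemma approx0_stable_sigma : sigma_algebra setT approx0_stable.
Proof.
split; [exact: approx0_stable0| |exact: approx0_stable_bigcup].
by move=> A hA; rewrite setTD; exact: approx0_stableC.
Qed.

Lemma preimage_sigma (X : Type) (g : T -> X) : sigma_algebra setT [set E | approx0_stable (g @^-1` E)].
Proof.
split => /=.
- by rewrite preimage_set0; exact: approx0_stable0.
- by move=> A hA; rewrite setTD preimage_setC; exact: approx0_stableC.
- by move=> A hA; rewrite preimage_bigcup; exact: approx0_stable_bigcup.
Qed.

Lemma approx0_stable_coord3 j (E : set R) : measurable (E : set (measurableTypeR R)) -> approx0_stable (@coord3 R j @^-1` E).
Proof.
have -> : (measurable : set (set (measurableTypeR R))) = <<s @RGenOInfty.G R >>.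
  exact: RGenOInfty.measurableE.
apply: (smallest_sub (@preimage_sigma _ (@coord3 R j))) => _ [a ->] /=.
rewrite (_ : _ @^-1` _ = [set x : T | a < coord3 j x]).
  by split; [exact: measurable_ray|move=> f; exact: approx0_ray].
by apply/seteqP; split => x /=; rewrite in_itv/= andbT.
Qed.

(** The product sigma-algebra is generated by rectangles, one factor at a
    time. *)
Lemma approx0_stable_all (A : set T) : measurable A -> approx0_stable A.
Proof.
have h2 (E : set (measurableTypeR R * measurableTypeR R)) : measurable E -> approx0_stable ((fun x : T => x.1) @^-1` E).
  rewrite measurable_prod_measurableType; apply: (smallest_sub (@preimage_sigma _ (fun x : T => x.1))).
  move=> _ [A1 mA1 [A2 mA2 <-]] /=.
  rewrite (_ : _ @^-1` _ = @coord3 R o0 @^-1` A1 `&` @coord3 R o1 @^-1` A2).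
    by apply: approx0_stableI; exact: approx0_stable_coord3.
  by rewrite coord3.unlock; apply/seteqP; split => x /=.
rewrite measurable_prod_measurableType; apply: (smallest_sub approx0_stable_sigma).
move=> _ [A1 mA1 [A2 mA2 <-]] /=.
rewrite (_ : _ `*` _ = (fun x : T => x.1) @^-1` A1 `&` @coord3 R o2 @^-1` A2).
  by apply: approx0_stableI; [exact: h2|exact: approx0_stable_coord3].
by rewrite coord3.unlock; apply/seteqP; split => x /=.
Qed.

Lemma indicator_chi n (A : set T) : measurable A -> approx0 (fun x => \1_A x * chi n x).
Proof. by move=> /approx0_stable_all[_]; apply; exact/approx0_test/test0_chi. Qed.

Lemma chi_abs n x : `|chi n x| <= expR 1.
Proof. by have /andP[h1 h2] := chi_bound n x; rewrite ger0_norm. Qed.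

Lemma measurable_chi n : measurable_fun setT (@chi R n).
Proof. exact: continuous_measurable3 (rsmooth_cont (test0_chi n).1.1). Qed.

Import HBNNSimple.

Lemma approx0_simple n (g : {nnsfun T >-> R}) : approx0 (fun x => chi n x * g x).
Proof.
pose s : seq R := finmap.enum_fset (fset_set (range g)).
have gE x : g x = \sum_(i < size s) (s`_i * \1_(g @^-1` [set s`_i]) x) by exact: fimfunEord.
have -> : (fun x => chi n x * g x) =
    fun x => \sum_(i < size s) (s`_i * (\1_(g @^-1` [set s`_i]) x * chi n x)).
  by apply/funext => x; rewrite gE mulrC mulr_suml; apply: eq_bigr => i _; ring.
apply: (@approx0_sum _ (fun i x => s`_i * (\1_(g @^-1` [set s`_i]) x * chi n x))) => i _.
by apply: approx0Z; apply: indicator_chi; exact: measurable_funPTI.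
Qed.

(** Simple functions times a cut-off lie in the closure; let the simple
    functions increase to f, then let the cut-offs tend to 1 off the origin. *)
Lemma approx0_nonneg f : L2r f -> (forall x, 0 <= f x) -> approx0 f.
Proof.
move=> lf f0.
have mf : measurable_fun setT (EFin \o f) by apply/measurable_EFinP; exact: L2r_meas.
pose g := nnsfun_approx measurableT mf.
have gf x : (fun k => g k x) @ \oo --> f x.
  have := @cvg_nnsfun_approx _ _ _ _ measurableT _ mf (fun x _ => f0 x) x I.
  by move=> h; apply: (fine_cvg h).
have g_le k x : 0 <= g k x <= f x.
  rewrite fun_ge0/=.
  have nd : nondecreasing_seq (fun k => g k x).
    by move=> m n mn; have /lefP := nd_nnsfun_approx measurableT mf mn; apply.
  rewrite -(cvg_lim (@Rhausdorff R) (gf x)); apply: nondecreasing_cvgn_le => //.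
  by apply/cvg_ex; exists (f x).
have e0 : 0 <= expR 1 :> R by exact: expR_ge0.
have lchi n : L2r (fun x => chi n x * f x).
  by apply: (@L2r_bdM _ _ _ (expR 1)) => //; [exact: measurable_chi|exact: chi_abs].
have c1 n : approx0 (fun x => chi n x * f x).
  apply: (@approx0_dct (fun k x => chi n x * g k x) _ (fun x => expR 1 * f x)) => //.
  - by move=> k; exact: approx0_simple.
  - exact: L2rZ.
  - by move=> x; apply: cvgM; [exact: cvg_cst|exact: gf].
  - move=> k x; have /andP[h1 h2] := g_le k x.
    rewrite -mulrBr (normrM (chi n x)) (normrM (expR 1)); apply: ler_pM => //.
      exact: le_trans (chi_abs n x) (ler_norm _).
    by rewrite distrC (ger0_norm (f0 x)) ger0_norm ?subr_ge0// gerBl.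
have mA : measurable [set x : T | x != 0].
  rewrite (_ : [set x : T | x != 0] = ~` (([set (0 : R)%R] `*` [set (0 : R)%R]) `*` [set (0 : R)%R])).
    by apply: measurableC; apply: measurableX; [apply: measurableX|]; exact: measurable_set1.
  apply/seteqP; split => [[[x y] z] /= /eqP h [[/= x0 y0] z0]|[[x y] z] /= h]; first by apply: h; rewrite x0 y0 z0.
  by apply/eqP => -[x0 y0 z0]; apply: h; rewrite x0 y0 z0.
have c2 : approx0 (fun x => \1_[set x : T | x != 0] x * f x).
  apply: (@approx0_dct (fun n x => chi n x * f x) _ (fun x => (expR 1 + 1) * f x)) => //.
  - exact: L2r_ind.
  - exact: L2rZ.
  - move=> x; apply: cvgM; last exact: cvg_cst.
    have [->|x0] := eqVneq x 0.
      rewrite indicE memNset; last by rewrite /= eqxx.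
      have [_ [d d0 hd]] := test0_chi 0.
      apply: cvg_near_cst; apply: nearW => n; have [_ [d' d'0 hd']] := test0_chi n.
      by rewrite (supp_in hd') ?rsq0.
    by rewrite indicE mem_set//; exact: chi_cvg.
  - move=> n x; rewrite -mulrBl (normrM _ (f x)) (normrM _ (f x)) ler_wpM2r// (le_trans (ler_normB _ _))//.
    by rewrite [leRHS]ger0_norm ?addr_ge0// lerD ?ind_bound// chi_abs.
apply: approx0_lim => // e ep; exists (fun x => \1_[set x : T | x != 0] x * f x) => //.
rewrite /nsq (_ : int3 _ = int3 (fun=> 0)); first by rewrite int30 ltW.
apply: int3_ae => //; first by apply: measurable_funX; apply: L2r_meas; apply: L2rB => //; exact: c2.1.
apply: filterS ae_neq0 => x x0; rewrite indicE mem_set// mul1r subrr expr0n//.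
Qed.

Lemma L2r_dense f : L2r f -> approx0 f.
Proof.
move=> lf.
have mf := L2r_meas lf.
have l1 : L2r (fun x => Num.max (f x) 0).
  apply: (L2r_le _ lf); first by apply: measurable_maxr.
  by move=> x; case: (leP (f x) 0) => h; rewrite ?normr0.
have l2 : L2r (fun x => Num.max (- f x) 0).
  apply: (L2r_le _ lf); first by apply: measurable_maxr => //; exact: measurableT_comp.
  by move=> x; case: (leP (- f x) 0) => h; rewrite ?normr0// normrN.
have p1 : approx0 (fun x => Num.max (f x) 0) by apply: approx0_nonneg => // x; rewrite le_max lexx orbT.
have p2 : approx0 (fun x => Num.max (- f x) 0) by apply: approx0_nonneg => // x; rewrite le_max lexx orbT.
have := approx0D p1 (approx0Z (-1) p2); congr approx0; apply/funext => x.
by case: (leP (f x) 0) => h1; case: (leP (- f x) 0) => h2; lra.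
Qed.
End cutoff.

(** * Mollification *)

Section mollifier.
Context {R : realType}.
Local Notation T := (R3 R).
Local Notation mu := (leb3 R).
Implicit Types (f g h k : T -> R) (x y z w v : T) (C e d : R).

(** Convolution of f with the reflected kernel k; for the even kernels below
    it is the usual one. *)
Definition convol k f x : R := int3 (fun y => k (y - x) * f y).

Lemma rsqD_le x y : rsq (x + y) <= 2 * rsq x + 2 * rsq y.
Proof.
rewrite rsq.unlock /= -subr_ge0.
have -> : 2 * (x.1.1 ^+ 2 + x.1.2 ^+ 2 + x.2 ^+ 2) + 2 * (y.1.1 ^+ 2 + y.1.2 ^+ 2 + y.2 ^+ 2) -
  ((x.1.1 + y.1.1) ^+ 2 + (x.1.2 + y.1.2) ^+ 2 + (x.2 + y.2) ^+ 2) =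
  (x.1.1 - y.1.1) ^+ 2 + (x.1.2 - y.1.2) ^+ 2 + (x.2 - y.2) ^+ 2 by ring.
by rewrite !addr_ge0 ?sqr_ge0.
Qed.

Lemma norm1_ge0 w : 0 <= norm1 w.
Proof. by rewrite /norm1 !addr_ge0. Qed.

Lemma coord3_norm1 j w : `|coord3 j w| <= norm1 w.
Proof.
have h0 := normr_ge0 w.1.1; have h1 := normr_ge0 w.1.2; have h2 := normr_ge0 w.2.
by move: j; apply: ord3P; rewrite coord3.unlock /norm1 /=; lra.
Qed.

Lemma coord3_rsq j w : coord3 j w ^+ 2 <= rsq w.
Proof.
have h0 := sqr_ge0 (coord3 o0 w); have h1 := sqr_ge0 (coord3 o1 w); have h2 := sqr_ge0 (coord3 o2 w).
by rewrite rsqE -/o0 -/o1 -/o2; move: j; apply: ord3P; lra.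
Qed.

Lemma L2r_translate f v : L2r f -> L2r (fun y => f (y + v)).
Proof.
move=> lf; have hm := preserving_translate v; apply/L2rP; split.
  exact: (measurableT_comp (L2r_meas lf) hm.1).
exact: preserving_itg hm (L2r_sq lf).
Qed.

Lemma itg_convol k f x : L2r k -> L2r f -> itg (fun y => k (y - x) * f y).
Proof. by move=> lk lf; apply: L2r_mul => //; exact: L2r_translate. Qed.

Lemma L2r_cube M : L2r (\1_(cube M) : T -> R).
Proof.
apply/L2rP; split; first by apply: measurable_indic; exact: measurable_cube.
apply: (itg_le _ (itg_cube M)); first by apply: measurable_funX; apply: measurable_indic; exact: measurable_cube.
move=> x; rewrite indicE; case: (_ \in _); first by rewrite expr1n normr1.
by rewrite expr0n normr0.
Qed.

(** Bounds increments of convol k f by increments of k, with a bound that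
    stays integrable against f because the kernel has compact support. *)
Lemma convol_diff_bound f x M (K : T -> R) B : L2r f -> L2r K -> 0 <= B ->
  (forall z, `|K z| <= B * \1_(cube M) z) ->
  `|convol K f x| <= B * int3 (fun y => \1_(cube M) (y - x) * `|f y|).
Proof.
move=> lf lK B0 hK.
have lf' : L2r (fun y => `|f y|).
  apply: (L2r_le _ lf); last by move=> y; rewrite normr_id.
  by apply: measurableT_comp => //; exact: L2r_meas.
rewrite -int3Z; last exact: itg_convol (L2r_cube M) lf'.
apply: le_trans (ler_norm_int3 (itg_convol x lK lf)) _; apply: ler_int3.
- exact/itg_abs/itg_convol.
- exact/itgZ/itg_convol/lf'/L2r_cube.
by move=> y; rewrite normrM mulrA ler_wpM2r.
Qed.

Lemma convol_lin (a b : R) k1 k2 f x : L2r k1 -> L2r k2 -> L2r f ->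
  convol (fun z => a * k1 z + b * k2 z) f x = a * convol k1 f x + b * convol k2 f x.
Proof.
move=> l1 l2 lf; rewrite /convol -!int3Z ?itg_convol// -int3D; [|exact/itgZ/itg_convol..].
by congr int3; apply/funext => y; ring.
Qed.

Lemma convol_linr (a b : R) k f g x : L2r k -> L2r f -> L2r g ->
  convol k (fun z => a * f z + b * g z) x = a * convol k f x + b * convol k g x.
Proof.
move=> l1 l2 lf; rewrite /convol -!int3Z ?itg_convol// -int3D; [|exact/itgZ/itg_convol..].
by congr int3; apply/funext => y; ring.
Qed.

Lemma convol_translate k f x w : convol k f (x + w) = convol (fun z => k (z - w)) f x.
Proof. by congr int3; apply/funext => y; rewrite opprD addrA. Qed.

Lemma norm1N w : norm1 (- w) = norm1 w.
Proof. by rewrite /norm1 /= !normrN. Qed.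

Lemma cube_shift M z w : norm1 w <= 1 -> cube M (z - w) -> cube (M + 1) z.
Proof.
move=> hw /cubeP h; apply/cubeP => i.
rewrite -(subrK w z) coord3D (le_trans (ler_normD _ _))// lerD//.
exact: le_trans (coord3_norm1 _ _) hw.
Qed.

Lemma mul_ind (A : set T) z C B : (A z -> C <= B) -> (~ A z -> C = 0) -> C <= B * \1_A z.
Proof.
move=> h1 h2; rewrite indicE; have [Az|nAz] := pselect (A z).
  by rewrite mem_set// mulr1; exact: h1.
by rewrite memNset// mulr0 h2.
Qed.

Lemma convol_lipschitz k f x : test k -> L2r f ->
  exists2 D, 0 <= D & forall w, norm1 w <= 1 -> `|convol k f (x + w) - convol k f x| <= D * norm1 w.
Proof.
move=> tk lf; have lk := L2r_test tk.
have [C C0 hC] := test_lipschitz tk; have [M hM] := csupp_cube tk.2.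
have supp z : ~ cube M z -> k z = 0.
  by move=> nz; apply/eqP; apply: contra_notT nz; exact: hM.
set I := int3 (fun y => \1_(cube (M + 1)) (y - x) * `|f y|).
exists (C * I).
  by rewrite mulr_ge0// int3_ge0// => y; rewrite mulr_ge0// indicE.
move=> w hw; have lkw := L2r_translate (- w) lk.
have -> : convol k f (x + w) - convol k f x = convol (fun z => 1 * k (z - w) + (-1) * k z) f x.
  by rewrite convol_lin// convol_translate; ring.
rewrite mulrAC.
apply: convol_diff_bound => //; first by apply: L2rD; exact: L2rZ.
  by rewrite mulr_ge0// norm1_ge0.
move=> z; apply: mul_ind => [_|nz].
  have -> : 1 * k (z - w) + (-1) * k z = k (- w + z) - k z by rewrite [- w + z]addrC; ring.
  by apply: le_trans (hC _ _) _; rewrite -/(norm1 (- w)) norm1N.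
rewrite !supp; [by rewrite !mulr0 addr0 normr0| |].
  by apply: contra_not nz => /cubeW; apply; rewrite lerDl.
by apply: contra_not nz; exact: cube_shift.
Qed.

Lemma norm1_near x d : 0 < d -> \forall y \near x, norm1 (y - x) < d.
Proof.
move=> d0; have d3 : 0 < d / 3 by rewrite divr_gt0.
have h j : \forall y \near x, `|coord3 j y - coord3 j x| < d / 3.
  have /cvgrPdist_lt/(_ _ d3) := @coord3_cont R j x.
  by apply: filterS => y; rewrite distrC.
near=> y.
have h0 : `|coord3 o0 y - coord3 o0 x| < d / 3 by near: y; exact: h.
have h1 : `|coord3 o1 y - coord3 o1 x| < d / 3 by near: y; exact: h.
have h2 : `|coord3 o2 y - coord3 o2 x| < d / 3 by near: y; exact: h.
by rewrite /norm1; move: h0 h1 h2; rewrite coord3.unlock /=; lra.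
Unshelve. all: by end_near. Qed.

Lemma convol_cont k f : test k -> L2r f -> continuous (convol k f).
Proof.
move=> tk lf x; have [D Dge0 hD] := convol_lipschitz x tk lf.
apply/cvgrPdist_le => e e0; near=> y.
have h1 : norm1 (y - x) < 1 by near: y; exact: norm1_near.
have h2 : norm1 (y - x) < e / (D + 1) by near: y; apply: norm1_near; rewrite divr_gt0// ltr_wpDl.
rewrite distrC -{1}(subrKC x y); apply: le_trans (hD _ (ltW h1)) _.
apply: le_trans (_ : (D + 1) * norm1 (y - x) <= _); first by rewrite ler_wpM2r ?norm1_ge0// lerDl.
by rewrite mulrC -ler_pdivlMr ?ltW// ltr_wpDl.
Unshelve. all: by end_near. Qed.

Lemma norm1_basis (s : R) j : norm1 (s *: basis_vec R j : T) = `|s|.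
Proof. exact: basis_norm. Qed.

Lemma taylor_dir k : test k -> exists2 C, 0 <= C & forall j y (s : R),
  `|k (y - s *: basis_vec R j) - k y + s * pd j k y| <= C * s ^+ 2.
Proof.
move=> tk; have [C C0 hC] := taylor3 tk; exists C => // j y s.
have := hC y ((- s) *: basis_vec R j); rewrite norm1_basis normrN real_normK ?num_real//.
rewrite scaleNr [- (s *: _) + y]addrC.
have -> : (- (s *: basis_vec R j)).1.1 * pd o0 k y + (- (s *: basis_vec R j)).1.2 * pd o1 k y +
   (- (s *: basis_vec R j)).2 * pd o2 k y = - (s * pd j k y); last by rewrite opprK.
by move: j; apply: ord3P; rewrite /basis_vec /= /GRing.scale /= ?mulr1n ?mulr0n; ring.
Qed.

(** The difference quotient of the kernel approximates its derivative up to an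
    error of order s^2, uniformly, by the Taylor estimate. *)
Lemma convol_derive k f x j : test k -> L2r f ->
  is_derive x (basis_vec R j) (convol k f) (- convol (pd j k) f x).
Proof.
move=> tk lf; have lk := L2r_test tk.
have tpk := test_pd j tk; have lpk := L2r_test tpk.
have [C C0 hC] := taylor_dir tk.
have [M1 hM1] := csupp_cube tk.2; have [M2 hM2] := csupp_cube tpk.2.
pose M := Num.max M1 M2.
have supp1 z : ~ cube M z -> k z = 0.
  by move=> nz; apply/eqP; apply: contra_notT nz => /hM1/cubeW; apply; rewrite le_max lexx.
have supp2 z : ~ cube M z -> pd j k z = 0.
  by move=> nz; apply/eqP; apply: contra_notT nz => /hM2/cubeW; apply; rewrite le_max lexx orbT.
apply: line_derive0.
pose phi (s : R) := convol k f (s *: basis_vec R j + x) + s * convol (pd j k) f x.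
set I := int3 (fun y => \1_(cube (M + 1)) (y - x) * `|f y|).
have hphi : is_derive (0 : R) 1 phi 0.
  apply: (@is_derive_quad _ _ _ (C * I)).
  have : \forall s \near (0 : R), `|s| < 1.
    have /cvgrPdist_lt/(_ _ ltr01) := @cvg_id _ (nbhs (0 : R)).
    by apply: filterS => s; rewrite sub0r normrN.
  apply: filterS => s s1; rewrite /phi addr0 scale0r add0r mul0r addr0 mulrAC.
  set w := s *: basis_vec R j; have lkw := L2r_translate (- w) lk.
  have -> : convol k f (w + x) + s * convol (pd j k) f x - convol k f x =
     convol (fun z => 1 * (1 * k (z - w) + (-1) * k z) + s * pd j k z) f x.
    by rewrite !convol_lin//; [rewrite [w + x]addrC convol_translate; ring|apply: L2rD; exact: L2rZ].
  apply: convol_diff_bound => //.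
  - by apply: L2rD; apply: L2rZ => //; apply: L2rD; exact: L2rZ.
  - by rewrite mulr_ge0// sqr_ge0.
  move=> z; apply: mul_ind => [_|nz].
    have -> : 1 * (1 * k (z - w) + (-1) * k z) + s * pd j k z = k (z - w) - k z + s * pd j k z by ring.
    exact: hC.
  have nz2 : ~ cube M z by apply: contra_not nz => /cubeW; apply; rewrite lerDl.
  have k0 : k (z - w) = 0.
    by apply: supp1; apply: contra_not nz; apply: cube_shift; rewrite norm1_basis ltW.
  by rewrite (supp2 _ nz2) (supp1 _ nz2) k0 !(mulr0, addr0) normr0.
have hl : is_derive (0 : R) 1 (fun s : R => s * (- convol (pd j k) f x)) (- convol (pd j k) f x).
  have := is_deriveM (@is_derive_id _ R 0 1) (@is_derive_cst _ R R (- convol (pd j k) f x) (0 : R) 1).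
  by rewrite /GRing.scale/= mulr0 add0r mulr1.
have := is_deriveD hphi hl => H; apply: (is_derive_ext H) => [s|]; last by rewrite add0r.
transitivity (phi s + s * (- convol (pd j k) f x)); last by [].
by rewrite /phi; ring.
Qed.

Lemma pd_convol k f j : test k -> L2r f -> pd j (convol k f) = fun x => - convol (pd j k) f x.
Proof. by move=> tk lf; apply/funext => x; rewrite pdE; have [_ ->] := convol_derive x j tk lf. Qed.

Lemma rsmooth_convol k f : test k -> L2r f -> rsmooth (convol k f).
Proof.
move=> tk lf n; elim: n k tk => [|n ih] k tk; first by split => //; exact: convol_cont.
apply/class_CS; split; first exact: convol_cont.
  by move=> j x; have [] := convol_derive x j tk lf.
move=> j; rewrite pd_convol//.
have -> : (fun x => - convol (pd j k) f x) = (fun x => (-1) * convol (pd j k) f x).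
  by apply/funext => x; rewrite mulN1r.
by apply: class_CM; [exact: class_C_cst|apply: ih; exact: test_pd].
Qed.

(** A smooth bump supported in |z|^2 <= tau n. *)
Definition rho0 n z : R := expinv 0 (1 + (- (tau n)^-1) * rsq z).

Lemma rho0_ge0 n z : 0 <= rho0 n z. Proof. exact: expinv_ge0. Qed.

Lemma rho0_supp n z : rho0 n z != 0 -> rsq z <= tau n.
Proof.
have t0 := @tau_gt0 R n; apply: contraNT; rewrite -ltNge => h; rewrite /rho0 expinv_neg//.
by rewrite mulNr subr_le0 ler_pdivlMl// mulr1 ltW.
Qed.

Lemma test_rho0 n : test (rho0 n).
Proof.
split; last by exists (tau n); exact: rho0_supp.
apply: rsmooth_expinv; under eq_fun do rewrite addrC; exact: rsmooth_affine_rsq.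
Qed.

Lemma leb3_cube_gt0 (M : R) : 0 < M -> (0 < leb3 R (cube M))%E.
Proof.
move=> M0; pose J : set R := `[- M, M]%classic.
have m1 : measurable J by exact: measurable_itv.
have h1 : (0 < @lebesgue_measure R J)%E.
  by rewrite lebesgue_measure_itv /= lte_fin gtrN// -EFinD lte_fin opprK addr_gt0.
have m2 := measurableX m1 m1.
have e2 := product_measure1E (@lebesgue_measure R) (@lebesgue_measure R) m1 m1.
have e3 := product_measure1E (@leb2 R) (@lebesgue_measure R) m2 m1.
have -> : leb3 R (cube M) = (@leb2 R (J `*` J) * @lebesgue_measure R J)%E := e3.
have -> : @leb2 R (J `*` J) = (@lebesgue_measure R J * @lebesgue_measure R J)%E := e2.
by rewrite !mule_gt0.
Qed.

Lemma int3_cube_gt0 (M : R) : 0 < M -> 0 < int3 (\1_(cube M) : T -> R).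
Proof.
move=> M0; rewrite int3.unlock /Rintegral fine_gt0//.
rewrite integral_indic//; last exact: measurable_cube.
by rewrite setIT leb3_cube_gt0//= leb3_cube_lty.
Qed.

Definition rho_mass n : R := int3 (rho0 n).

(** The bump exceeds a positive constant on a small cube. *)
Lemma rho_mass_gt0 n : 0 < rho_mass n.
Proof.
have t0 := @tau_gt0 R n.
pose M : R := Num.sqrt (tau n / 6); have M0 : 0 < M by rewrite sqrtr_gt0 divr_gt0.
have a0 : 0 < expinv 0 (1/2 : R) by rewrite expinv_posE// expr0 mul1r expR_gt0.
have emono (s t : R) : 0 < s -> s <= t -> expinv 0 s <= expinv 0 t.
  move=> s0 st; have t1 := lt_le_trans s0 st.
  by rewrite !expinv_posE// !expr0 !mul1r ler_expR lerN2 lef_pV2.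
have key : int3 (fun x => expinv 0 (1/2) * \1_(cube M) x) <= rho_mass n.
  apply: ler_int3; [exact/itgZ/itg_cube|exact/itg_test/test_rho0|].
  move=> x; rewrite mulrC indicE; have [xc0|nx] := pselect (cube M x); last first.
    by rewrite memNset// mul0r; exact: rho0_ge0.
  have -> : (x \in cube M) = true by exact: mem_set.
  rewrite mulr1n (mul1r (expinv 0 _)); apply: emono; first by rewrite divr_gt0.
  have hs j : coord3 j x ^+ 2 <= tau n / 6.
    have h := (cubeP _ _).1 xc0 j.
    rewrite -real_normK ?num_real// -[leRHS]sqr_sqrtr ?divr_ge0 ?(ltW t0)//.
    by rewrite lerXn2r// nnegrE ltW.
  have : rsq x <= tau n / 2.
    by rewrite rsqE -/o0 -/o1 -/o2; have := hs o0; have := hs o1; have := hs o2; lra.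
  rewrite mulNr => h; rewrite lerBrDr -lerBrDl; apply: le_trans (_ : (tau n)^-1 * (tau n / 2) <= _).
    by rewrite ler_wpM2l// invr_ge0 ltW.
  by rewrite mulrA mulVf ?gt_eqF// mul1r; lra.
apply: lt_le_trans key; rewrite int3Z; last exact: itg_cube.
by rewrite mulr_gt0// int3_cube_gt0.
Qed.

Definition rho n z : R := (rho_mass n)^-1 * rho0 n z.

Lemma test_rho n : test (rho n).
Proof. exact/testZ/test_rho0. Qed.

Lemma rho_ge0 n z : 0 <= rho n z.
Proof. by rewrite mulr_ge0 ?rho0_ge0// invr_ge0 ltW// rho_mass_gt0. Qed.

Lemma int_rho n : int3 (rho n) = 1.
Proof. by rewrite int3Z ?mulVf ?gt_eqF ?rho_mass_gt0//; exact/itg_test/test_rho0. Qed.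

Lemma rho_even n x y : rho n (y - x) = rho n (x - y).
Proof.
by rewrite /rho /rho0; have -> : rsq (y - x) = rsq (x - y) by rewrite rsq.unlock /=; ring.
Qed.

Lemma rho_supp n z : rho n z != 0 -> rsq z <= tau n.
Proof.
move=> h; apply: rho0_supp; apply: contra_neq h => e.
by rewrite /rho e mulr0.
Qed.

Lemma int_rho_translate n x : itg (fun y => rho n (y - x)) /\ int3 (fun y => rho n (y - x)) = 1.
Proof.
have hm := preserving_translate (- x); have ir0 := itg_test (test_rho n).
by split; [exact: preserving_itg hm ir0|rewrite (preserving_int3 hm ir0) int_rho].
Qed.

Definition mollify n f := convol (rho n) f.

Lemma itg_rho_sq n f x : L2r f -> itg (fun y => rho n (y - x) * f y ^+ 2).
Proof.
move=> lf; have [C hC] := csupp_bounded (rsmooth_cont (test_rho n).1) (test_rho n).2.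
apply: (@itg_bdM _ _ _ C); [exact: L2r_sq| |by move=> y; exact: hC].
exact: itg_meas (int_rho_translate n x).1.
Qed.

(** The Cauchy-Schwarz inequality with respect to the probability density rho
    n. *)
Lemma mollify_jensen n f x : L2r f -> mollify n f x ^+ 2 <= int3 (fun y => rho n (y - x) * f y ^+ 2).
Proof.
move=> lf; have lr := L2r_test (test_rho n); have [ir0 er] := int_rho_translate n x.
have i1 := itg_rho_sq n x lf; have i2 := itg_convol x lr lf.
set s := mollify n f x.
have h0 : 0 <= int3 (fun y => rho n (y - x) * (f y - s) ^+ 2).
  by apply: int3_ge0 => y; rewrite mulr_ge0 ?rho_ge0// sqr_ge0.
have e : int3 (fun y => rho n (y - x) * (f y - s) ^+ 2) =
    int3 (fun y => rho n (y - x) * f y ^+ 2) - 2 * s * s + s ^+ 2.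
  have -> : (fun y => rho n (y - x) * (f y - s) ^+ 2) = (fun y =>
      rho n (y - x) * f y ^+ 2 + ((-2 * s) * (rho n (y - x) * f y) + s ^+ 2 * rho n (y - x))).
    by apply/funext => y; ring.
  rewrite int3D//; last by apply: itgD; exact: itgZ.
  rewrite int3D; [|exact: itgZ..]; rewrite (int3Z _ i2) (int3Z _ ir0) er -[int3 (fun y => rho n (y - x) * f y)]/s; ring.
rewrite e in h0.
have fin (A b : R) : 0 <= A - 2 * b * b + b ^+ 2 -> b ^+ 2 <= A.
  by move=> h; rewrite -subr_ge0; have -> : A - b ^+ 2 = A - 2 * b * b + b ^+ 2 by ring.
exact: fin h0.
Qed.

Lemma mollify_smooth n f : L2r f -> rsmooth (mollify n f).
Proof. by move=> lf; apply: rsmooth_convol => //; exact: test_rho. Qed.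

(** Jensen's inequality and Tonelli's theorem. *)
Lemma mollify_bound n f : L2r f -> L2r (mollify n f) /\ nsq (mollify n f) <= nsq f.
Proof.
move=> lf; have mm : measurable_fun setT (mollify n f).
  exact: continuous_measurable3 (rsmooth_cont (mollify_smooth n lf)).
suff [h1 h2] : itg (fun x => mollify n f x ^+ 2) /\ nsq (mollify n f) <= nsq f.
  by split => //; apply/L2rP.
apply: ge0_itg; first exact: measurable_funX.
  by move=> x; exact: sqr_ge0.
pose F (p : T * T) : \bar R := (rho n (p.2 - p.1) * f p.2 ^+ 2)%:E.
have mF : measurable_fun setT F.
  apply/measurable_EFinP; apply: measurable_funM; last first.
    apply: measurable_funX; apply: (measurableT_comp (L2r_meas lf)); exact: measurable_snd.
  have mr : measurable_fun setT (rho n).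
    exact: continuous_measurable3 (rsmooth_cont (test_rho n).1).
  have msub : measurable_fun setT (fun p : T * T => p.2 - p.1).
    have m1 := measurable_x1 (R := R); have m2 := measurable_x2 (R := R); have m3 := measurable_x3 (R := R).
    have s1 : measurable_fun setT (fun p : T * T => p.1) by exact: measurable_fst.
    have s2 : measurable_fun setT (fun p : T * T => p.2) by exact: measurable_snd.
    have h (c : T -> R) : measurable_fun setT c -> measurable_fun setT (fun p : T * T => c p.2 - c p.1).
      by move=> mc; apply: measurable_funB; [exact: (measurableT_comp mc s2)|exact: (measurableT_comp mc s1)].
    apply/measurable_fun_pairP; split; last exact: h m3.
    by apply/measurable_fun_pairP; split; [exact: h m1|exact: h m2].
  exact: (measurableT_comp mr msub).
have F0 p : (0 <= F p)%E by rewrite lee_fin mulr_ge0 ?rho_ge0// sqr_ge0.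
have T33 := tonelli33 mF F0.
have mFx : measurable_fun setT (fun x : T => \int[mu]_y F (x, y))%E.
  exact: (measurable_fun_fubini_tonelli_F (m2 := @leb3s R) F mF F0).
apply: (@le_trans _ _ (\int[mu]_x \int[mu]_y F (x, y))%E).
  apply: ge0_le_integral.
  - exact: measurableT.
  - by move=> x _; rewrite lee_fin sqr_ge0.
  - by apply/measurable_EFinP; exact: measurable_funX.
  - exact: mFx.
  - move=> x _; rewrite /F/= itgE; last exact: itg_rho_sq.
    by rewrite lee_fin mollify_jensen.
rewrite T33 (_ : (fun y => _) = (fun y => (f y ^+ 2)%:E)).
  by rewrite (itgE (L2r_sq lf)).
apply/funext => y; rewrite /F/=.
have [h1 h2] := int_rho_translate n y.
rewrite (_ : (fun x => _) = (fun x => (f y ^+ 2 * rho n (x - y))%:E)); last first.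
  by apply/funext => x; rewrite rho_even mulrC.
by have := itgE (itgZ (f y ^+ 2) h1); rewrite (int3Z _ h1) h2 mulr1.
Qed.

Lemma mollify_lin (a b : R) n f g x : L2r f -> L2r g ->
  mollify n (fun z => a * f z + b * g z) x = a * mollify n f x + b * mollify n g x.
Proof. by move=> lf lg; apply: convol_linr => //; exact: L2r_test (test_rho n). Qed.

Lemma sqrt_tau n : Num.sqrt (tau n) = n.+1%:R^-1 :> R.
Proof. by rewrite /tau sqrtr_sqr ger0_norm// invr_ge0. Qed.

Lemma rho_norm1 n z : rho n z != 0 -> norm1 z <= 3 * n.+1%:R^-1.
Proof.
move=> /rho_supp h.
have hc j : `|coord3 j z| <= n.+1%:R^-1.
  by rewrite -sqrt_tau -sqrtr_sqr ler_wsqrtr// (le_trans (coord3_rsq j z)).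
by rewrite /norm1; have := hc o0; have := hc o1; have := hc o2; rewrite coord3.unlock /=; move: (n.+1%:R^-1 : R); clear; intros; lra.
Qed.

(** A test function is Lipschitz and rho n lives within distance 3/(n+1), so
    the difference is at most a multiple of 1/(n+1) on a fixed cube. *)
Lemma mollify_test_cvg p : test p -> exists2 C, 0 <= C & forall n, nsq (fun x => mollify n p x - p x) <= C * tau n.
Proof.
move=> tp; have [C C0 hC] := test_lipschitz tp; have [M hM] := csupp_cube tp.2.
have lp := L2r_test tp.
have suppp z : ~ cube M z -> p z = 0.
  by move=> nz; apply/eqP; apply: contra_notT nz; exact: hM.
pose I := int3 (\1_(cube (M + 3)) : T -> R).
exists ((3 * C) ^+ 2 * I).
  by rewrite mulr_ge0 ?sqr_ge0// int3_ge0// => y; rewrite indicE.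
move=> n; have lr := L2r_test (test_rho n).
have key x : `|mollify n p x - p x| <= (3 * C * n.+1%:R^-1) * \1_(cube (M + 3)) x.
  have [ir0 er] := int_rho_translate n x; have i2 := itg_convol x lr lp.
  have -> : mollify n p x - p x = int3 (fun y => rho n (y - x) * (p y - p x)).
    rewrite /mollify /convol -[X in _ - X]mulr1 -er -(int3Z _ ir0) -int3B//; last exact: itgZ.
    by congr int3; apply/funext => y; ring.
  have i3 : itg (fun y => rho n (y - x) * (p y - p x)).
    have -> : (fun y => rho n (y - x) * (p y - p x)) = (fun y => rho n (y - x) * p y - p x * rho n (y - x)).
      by apply/funext => y; ring.
    by apply: itgB => //; exact: itgZ.
  set B := _ * _^-1; set i := \1_ _ x.
  have bnd y : `|rho n (y - x) * (p y - p x)| <= (B * i) * rho n (y - x).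
    have [e|ne] := eqVneq (rho n (y - x)) 0; first by rewrite e mul0r normr0 mulr0.
    rewrite normrM (ger0_norm (rho_ge0 _ _)) mulrC ler_wpM2r ?rho_ge0//.
    have hn := rho_norm1 ne; apply: mul_ind => [_|nx].
      have := hC x (y - x); rewrite subrK => h; apply: le_trans h _.
      rewrite -/(norm1 (y - x)) /B [3 * C]mulrC -mulrA; exact: ler_wpM2l.
    rewrite !suppp ?subrr ?normr0//.
      by apply: contra_not nx => /cubeW; apply; rewrite lerDl.
    apply: contra_not nx => /cubeP hy; apply/cubeP => j.
    have -> : coord3 j x = coord3 j y - coord3 j (y - x) by have := coord3D j (y - x) x; rewrite subrK => ->; ring.
    rewrite (le_trans (ler_normB _ _))// lerD// (le_trans (coord3_norm1 _ _))// (le_trans hn)//.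
    by rewrite ler_piMr// invf_le1// ler1n.
  apply: le_trans (ler_norm_int3 i3) _.
  have := ler_int3 (itg_abs i3) (itgZ (B * i) ir0) bnd.
  by rewrite (int3Z _ ir0) er mulr1.
have [lm _] := mollify_bound n lp.
have -> : (3 * C) ^+ 2 * I * tau n = int3 (fun x => ((3 * C * n.+1%:R^-1) ^+ 2) * \1_(cube (M + 3)) x).
  by rewrite (int3Z _ (itg_cube _)) /tau /I; ring.
apply: ler_int3; [exact/L2r_sq/L2rB|exact/itgZ/itg_cube|].
move=> x; rewrite -real_normK ?num_real//; have h := key x.
apply: le_trans (_ : ((3 * C * n.+1%:R^-1) * \1_(cube (M + 3)) x) ^+ 2 <= _).
  by rewrite lerXn2r// nnegrE// (le_trans _ h).
rewrite exprMn ler_wpM2l ?sqr_ge0// indicE; case: (_ \in _); first by rewrite expr1n.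
by rewrite expr0n.
Qed.

Lemma tau_small e : 0 < e -> exists N, forall n, (N <= n)%N -> tau n <= e.
Proof.
move=> e0; have /cvgrPdist_le/(_ _ e0)[N _ h] := @tau_cvg R; exists N => n /h.
by rewrite sub0r normrN ger0_norm// ltW// tau_gt0.
Qed.

(** Approximate f by a test function and use that mollification does not
    increase the norm. *)
Lemma mollify_cvg f : L2r f -> forall e, 0 < e -> exists N, forall n, (N <= n)%N ->
  nsq (fun x => mollify n f x - f x) <= e.
Proof.
move=> lf e e0; have e16 : 0 < e / 16 by rewrite divr_gt0.
have [_ /(_ _ e16)[p tp hp]] := L2r_dense lf; have lp := L2r_test tp.1.
have [C C0 hC] := mollify_test_cvg tp.1.
have C1 : 0 < C + 1 by rewrite ltr_wpDl.
have [N hN] := tau_small (divr_gt0 e16 C1).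
exists N => n /hN hn.
have lfp := L2rB lf lp.
have [l1 h1] := mollify_bound n lfp; have [l2 _] := mollify_bound n lp.
have hT : nsq (fun x => mollify n p x - p x) <= e / 16.
  apply: le_trans (hC n) _; apply: le_trans (ler_wpM2l C0 hn) _.
  by rewrite mulrA ler_pdivrMr// mulrC ler_wpM2l ?(ltW e16)// lerDl.
have l3 := L2rB l2 lp.
have s1 := nsqB_le l1 lfp; have s2 := nsqD_le (L2rB l1 lfp) l3.
have -> : (fun x => mollify n f x - f x) =
   (fun x => mollify n (fun y => f y - p y) x - (f x - p x) + (mollify n p x - p x)).
  apply/funext => x; have -> : (fun y => f y - p y) = (fun y => 1 * f y + (-1) * p y).
    by apply/funext => y; ring.
  by rewrite mollify_lin//; ring.
have fin (a b c d g h : R) : a <= 2 * b + 2 * c -> g <= 2 * a + 2 * d -> d <= h / 16 -> c <= h / 16 ->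
    b <= c -> 0 < h -> g <= h by lra.
exact: fin s1 s2 hT hp h1 e0.
Qed.

(** If f lives in c <= |x|^2 <= K then its mollifications, for small scales,
    live away from the origin and from infinity. *)
Lemma mollify_supp n f c K : L2r f -> (forall x, f x != 0 -> c <= rsq x <= K) -> tau n <= c / 8 ->
  (forall x, mollify n f x != 0 -> c / 4 <= rsq x <= 2 * K + c).
Proof.
move=> lf hf hn x; have t0 := @tau_gt0 R n; apply: contraNT => h; apply/eqP.
rewrite /mollify /convol (_ : (fun y => _) = fun=> 0) ?int30//; apply/funext => y.
have [->|ne] := eqVneq (rho n (y - x)) 0; first by rewrite mul0r.
have [->|fy] := eqVneq (f y) 0; first by rewrite mulr0.
exfalso; move/negP: h; apply.
have h1 := rho_supp ne; have /andP[h2 h3] := hf _ fy.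
have h4 := rsqD_le x (y - x); rewrite subrKC in h4.
have h5 := rsqD_le y (x - y); rewrite subrKC in h5.
have h6 : rsq (x - y) = rsq (y - x) by rewrite rsq.unlock /=; ring.
rewrite h6 in h5.
by apply/andP; split; move: h1 h2 h3 h4 h5 hn t0; clear; lra.
Qed.

End mollifier.

(** * The Hardy inequality for weak solutions *)

Section weak.
Context {R : realType}.
Local Notation T := (R3 R).
Local Notation leb := (leb3 R).
Implicit Types (f g h k : T -> R) (x y z w : T) (C e d : R) (u v U V : nat -> T -> R) (a : nat).
Variable mu : R.

(** The equation massless_dirac mu u = v, tested with the functions in P. The
    free operator is formally symmetric, so the derivatives fall on the test
    function with a minus sign. *)
Definition weak_on (P : (T -> R) -> Prop) u v := forall a h, P h ->
  int3 (fun x => v a x * h x) =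
  - sum3 (fun j => dsign j a * int3 (fun x => u (didx j a) x * pd j h x))
  + beta_sign a * mu * int3 (fun x => u a x * (inv_norm x * h x)).

(** Only the indices below 8 have a meaning for spinors; asking for square
    integrability of all members avoids side conditions. *)
Definition L2fam u := forall a, L2r (u a).

Lemma sum3D (F G : 'I_3 -> R) : sum3 F + sum3 G = sum3 (fun j => F j + G j).
Proof. by rewrite /sum3; ring. Qed.
Lemma sum3N (F : 'I_3 -> R) : - sum3 F = sum3 (fun j => - F j).
Proof. by rewrite /sum3; ring. Qed.
Lemma sum3_eq (F G : 'I_3 -> R) : (forall j, F j = G j) -> sum3 F = sum3 G.
Proof. by move=> h; rewrite /sum3 !h. Qed.
Lemma int3_sum3 (F : 'I_3 -> T -> R) : (forall j, itg (F j)) ->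
  itg (fun x => sum3 (F ^~ x)) /\ int3 (fun x => sum3 (F ^~ x)) = sum3 (fun j => int3 (F j)).
Proof.
move=> h; rewrite /sum3; split; first by apply: itgD => //; exact: itgD.
by rewrite int3D// ?int3D//; exact: itgD.
Qed.
Lemma L2r_sum3 (F : 'I_3 -> T -> R) : (forall j, L2r (F j)) -> L2r (fun x => sum3 (F ^~ x)).
Proof. by move=> h; apply: L2rD => //; exact: L2rD. Qed.

(** The image of c u under the operator: c v plus the commutator with the
    gradient of c. *)
Definition cut_v c u v a x : R :=
  c x * v a x + sum3 (fun j => dsign j a * (pd j c x * u (didx j a) x)).

Lemma test_bounded p : test p -> exists C, forall x, `|p x| <= C.
Proof. by move=> [sp cp]; apply: csupp_bounded => //; exact: rsmooth_cont. Qed.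

Lemma L2r_testM p f : test p -> L2r f -> L2r (fun x => p x * f x).
Proof.
move=> tp lf; have [C hC] := test_bounded tp.
by apply: (@L2r_bdM _ _ _ C) => //; exact: continuous_measurable3 (rsmooth_cont tp.1).
Qed.

Lemma L2fam_cut c u v : test c -> L2fam u -> L2fam v -> L2fam (cut_v c u v).
Proof.
move=> tc lu lv a; apply: L2rD; first exact: L2r_testM.
by apply: (@L2r_sum3 (fun j x => _)) => j; apply: L2rZ; apply: L2r_testM => //; exact: test_pd.
Qed.

(** Multiplication by a cut-off that vanishes near the origin allows test
    functions that do not. *)
Lemma weak_cut c u v : L2fam u -> L2fam v -> weak_on test0 u v -> test0 c ->
  weak_on test (fun a x => c x * u a x) (cut_v c u v).
Proof.
move=> lu lv huv tc a h th.
have tch : test0 (fun x => h x * c x) by apply: test0M => //; exact: th.1.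
have H := huv a _ tch.
have lh := L2r_test th; have lp j := L2r_test (test_pd j th).
have lc f : L2r f -> L2r (fun x => c x * f x) by exact: L2r_testM tc.1.
have lpc j f : L2r f -> L2r (fun x => pd j c x * f x) by apply: L2r_testM; exact: test_pd tc.1.
have pdch j : pd j (fun x => h x * c x) = fun x => h x * pd j c x + pd j h x * c x.
  by apply: pdM; [exact: rsmooth_pderivable th.1|exact: test0_pder].
have e1 j : int3 (fun x => u (didx j a) x * pd j (fun x => h x * c x) x) =
   int3 (fun x => (pd j c x * u (didx j a) x) * h x) + int3 (fun x => (c x * u (didx j a) x) * pd j h x).
  rewrite -int3D; [|exact: L2r_mul (lpc _ _ (lu _)) lh|exact: L2r_mul (lc _ (lu _)) (lp j)].
  by congr int3; apply/funext => x; rewrite pdch; ring.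
have e2 : int3 (fun x => u a x * (inv_norm x * (h x * c x))) = int3 (fun x => c x * u a x * (inv_norm x * h x)).
  by congr int3; apply/funext => x; ring.
have e3 : int3 (fun x => v a x * (h x * c x)) = int3 (fun x => c x * v a x * h x).
  by congr int3; apply/funext => x; ring.
rewrite e2 e3 in H.
have e4 : int3 (fun x => cut_v c u v a x * h x) = int3 (fun x => c x * v a x * h x) +
    sum3 (fun j => dsign j a * int3 (fun x => pd j c x * u (didx j a) x * h x)).
  have ij j : itg (fun x => dsign j a * (pd j c x * u (didx j a) x * h x)).
    by apply: itgZ; exact: L2r_mul (lpc _ _ (lu _)) lh.
  have [i1 e5] := int3_sum3 ij.
  have -> : sum3 (fun j => dsign j a * int3 (fun x => pd j c x * u (didx j a) x * h x)) =
      int3 (fun x => sum3 (fun j => dsign j a * (pd j c x * u (didx j a) x * h x))).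
    by rewrite e5; apply: sum3_eq => j; rewrite int3Z//; exact: L2r_mul (lpc _ _ (lu _)) lh.
  rewrite -int3D//; last exact: L2r_mul (lc _ (lv _)) lh.
  by congr int3; apply/funext => x; rewrite /cut_v /sum3; ring.
rewrite e4 H addrAC; congr (_ + _).
rewrite sum3N sum3D sum3N; apply: sum3_eq => j; rewrite e1; ring.
Qed.

Lemma translate_pd k x j : (forall y, derivable k y (basis_vec R j)) ->
  pd j (fun y => k (y - x)) = fun y => pd j k (y - x).
Proof.
move=> dk; apply/funext => y; rewrite !pdE.
have H := @translate_derive _ k (- x) y (basis_vec R j) _ (@derivableP _ _ _ k (y - x) _ (dk _)).
by have [_ ->] := H.
Qed.

Lemma rsmooth_translate k x : rsmooth k -> rsmooth (fun y => k (y - x)).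
Proof.
move=> sk n; elim: n k sk => [|n ih] k sk.
  split => // y; apply: (@continuous_comp _ _ _ (fun y : T => y - x) k).
    by apply: cvgB; [exact: cvg_id|exact: cvg_cst].
  exact: rsmooth_cont.
apply/class_CS; split.
- exact: (ih k sk).1 || exact: class_C0 (ih k sk).
- move=> j y.
  have dk := @rsmooth_pderivable _ _ sk j (y - x).
  by have [] := @translate_derive _ k (- x) y (basis_vec R j) _ (@derivableP _ _ _ k (y - x) _ dk).
- move=> j; rewrite translate_pd; last exact: rsmooth_pderivable.
  by apply: ih; exact: rsmooth_pd.
Qed.

Lemma test_translate k x : test k -> test (fun y => k (y - x)).
Proof.
move=> [sk [M hM]]; split; first exact: rsmooth_translate.
exists (2 * M + 2 * rsq x) => y /hM h.
have := rsqD_le (y - x) x; rewrite subrK => h2; apply: le_trans h2 _.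
by rewrite lerD2r ler_wpM2l.
Qed.

(** Mollification commutes with derivatives, because u may be tested with
    translates of the kernel. *)
Lemma free_dirac_convol k U V : test k -> L2fam U -> weak_on test U V ->
  forall a x, free_dirac (fun a => convol k (U a)) a x =
    convol k (V a) x - beta_sign a * mu * convol k (fun x => inv_norm x * U a x) x.
Proof.
move=> tr lU hUV a x.
have := hUV a _ (test_translate x tr); rewrite /free_dirac.
have -> : int3 (fun y => V a y * k (y - x)) = convol k (V a) x.
  by congr int3; apply/funext => y; rewrite mulrC.
have -> : int3 (fun y => U a y * (inv_norm y * k (y - x))) = convol k (fun x => inv_norm x * U a x) x.
  by congr int3; apply/funext => y; ring.
move=> ->; rewrite addrK sum3N; apply: sum3_eq => j.
rewrite pd_convol// /convol mulrN; congr (- (_ * _)); congr int3; apply/funext => y.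
rewrite translate_pd; first by rewrite mulrC.
exact: (@rsmooth_pderivable _ _ tr.1 j).
Qed.

Lemma common_bound (P : nat -> nat -> Prop) (m : nat) :
  (forall a, exists N, forall n, (N <= n)%N -> P a n) ->
  exists N, forall n a, (N <= n)%N -> (a < m)%N -> P a n.
Proof.
move=> h; elim: m => [|m [N ih]]; first by exists 0%N.
have [N' hN'] := h m; exists (maxn N N') => n a; rewrite geq_max => /andP[n1' n2'].
by rewrite ltnS leq_eqVlt => /predU1P[->|am]; [exact: hN'|exact: ih].
Qed.

Lemma inv_norm_le x c : 0 < c -> c <= rsq x -> inv_norm x ^+ 2 <= c^-1.
Proof.
move=> c0 h; have t0 := lt_le_trans c0 h.
by rewrite /inv_norm exprVn sqr_sqrtr ?(ltW t0)// lef_pV2.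
Qed.

Lemma measurable_inv_norm : measurable_fun setT (@inv_norm R).
Proof.
pose F n x : R := Num.sqrt (rsq x) / (rsq x + tau n).
have den n x : rsq x + tau n != 0 by rewrite gt_eqF// ltr_wpDl ?rsq_ge0// tau_gt0.
have cr := rsmooth_cont (@rsmooth_rsq R).
have cF n : continuous (F n).
  move=> x; apply: cvgM.
    by apply: (@continuous_comp _ _ _ (@rsq R) Num.sqrt); [exact: cr|exact: sqrt_continuous].
  apply: cvgV; first exact: den.
  by apply: cvgD; [exact: cr|exact: cvg_cst].
apply: (measurable_fun_cvg (fun n => continuous_measurable3 (cF n))) => x _.
have [e|r0] := eqVneq (rsq x) 0.
  rewrite /inv_norm e sqrtr0 invr0 (_ : (fun n => _) = fun=> 0); first exact: cvg_cst.
  by apply/funext => n; rewrite /F e sqrtr0 mul0r.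
have -> : inv_norm x = Num.sqrt (rsq x) * (rsq x + 0)^-1.
  have h : Num.sqrt (rsq x) != 0 by rewrite gt_eqF// sqrtr_gt0 lt_neqAle eq_sym r0 rsq_ge0.
  by rewrite addr0 /inv_norm -[X in _ * X^-1]sqr_sqrtr ?rsq_ge0//; field.
apply: cvgM; first exact: cvg_cst.
apply: cvgV; first by rewrite addr0.
by apply: cvgD; [exact: cvg_cst|exact: tau_cvg].
Qed.

Lemma inv_norm_bound x c : 0 < c -> c <= rsq x -> inv_norm x <= c^-1 + 1.
Proof.
move=> c0 h; have h1 := inv_norm_le c0 h; have h2 := sqr_ge0 (inv_norm x - 1).
have -> : inv_norm x = ((inv_norm x ^+ 2 + 1) - (inv_norm x - 1) ^+ 2) / 2 by field.
rewrite ler_pdivrMr//; have := invr_gt0 c; rewrite c0; move: h1 h2.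
by move: (inv_norm x ^+ 2) ((inv_norm x - 1) ^+ 2) (c^-1); clear; intros; lra.
Qed.

(** Away from the origin the potential is bounded. *)
Lemma L2r_inv_norm f c : 0 < c -> L2r f -> (forall x, f x != 0 -> c <= rsq x) ->
  L2r (fun x => inv_norm x * f x) /\ nsq (fun x => inv_norm x * f x) <= (c^-1 + 1) ^+ 2 * nsq f.
Proof.
move=> c0 lf hf.
have B0 : 0 <= c^-1 + 1 by rewrite addr_ge0// invr_ge0 ltW.
have key x : `|inv_norm x * f x| <= `|(c^-1 + 1) * f x|.
  have [->|fx] := eqVneq (f x) 0; first by rewrite !mulr0.
  rewrite !normrM ler_wpM2r// (ger0_norm B0) ger0_norm ?inv_norm_ge0//.
  by apply: inv_norm_bound => //; exact: hf.
have lg := L2rZ (c^-1 + 1) lf.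
have li : L2r (fun x => inv_norm x * f x).
  by apply: (L2r_le _ lg) => //; apply: measurable_funM; [exact: measurable_inv_norm|exact: L2r_meas].
split=> //; rewrite -nsqZ//; apply: ler_int3; [exact: L2r_sq|exact: L2r_sq|].
move=> x; rewrite -real_normK ?num_real// -[leRHS]real_normK ?num_real//.
by rewrite lerXn2r// nnegrE.
Qed.

(** Mollify. The free part commutes with mollification, and the potential is
    bounded on the support of U, which keeps a positive distance from the
    origin. *)
Lemma weak_approx U V c K : 0 < c -> L2fam U -> L2fam V ->
  (forall a x, U a x != 0 -> c <= rsq x <= K) -> weak_on test U V ->
  forall e, 0 < e -> exists phi : nat -> T -> R, [/\ forall a, test0 (phi a),
    forall a, (a < 8)%N -> nsq (fun x => phi a x - U a x) <= e &
    forall a, (a < 8)%N -> L2r (massless_dirac mu phi a) /\ nsq (fun x => massless_dirac mu phi a x - V a x) <= e].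
Proof.
move=> c0 lU lV sU hUV e e0.
have q4 : c / 4 <= c by lra.
have sU1 a x : U a x != 0 -> c <= rsq x by move=> /sU/andP[].
have lW a := (L2r_inv_norm c0 (lU a) (@sU1 a)).1.
have c4 : 0 < c / 4 by rewrite divr_gt0.
pose B := ((c / 4)^-1 + 1) ^+ 2.
have B0 : 0 <= B by exact: sqr_ge0.
pose d := e / (4 * (1 + 4 * mu ^+ 2 * (1 + B))).
have m0 : 0 <= mu ^+ 2 by exact: sqr_ge0.
have E0 : 0 <= 4 * mu ^+ 2 * (1 + B) by apply: mulr_ge0; [exact: mulr_ge0|exact: addr_ge0].
have D0' : 0 < 4 * (1 + 4 * mu ^+ 2 * (1 + B)) by rewrite mulr_gt0// ltr_wpDr.
have d0 : 0 < d by rewrite divr_gt0.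
pose P a n := [/\ nsq (fun x => mollify n (U a) x - U a x) <= d,
   nsq (fun x => mollify n (V a) x - V a x) <= d &
   nsq (fun x => mollify n (fun x => inv_norm x * U a x) x - inv_norm x * U a x) <= d].
have [N hN] : exists N, forall n a, (N <= n)%N -> (a < 8)%N -> P a n.
  apply: common_bound => a; have [N1 h1] := mollify_cvg (lU a) d0.
  have [N2 h2] := mollify_cvg (lV a) d0; have [N3 h3] := mollify_cvg (lW a) d0.
  exists (maxn N1 (maxn N2 N3)) => n; rewrite !geq_max => /and3P[n1' n2' n3'].
  by split; [exact: h1|exact: h2|exact: h3].
have [N' hN'] := @tau_small R (c / 8) (divr_gt0 c0 (ltr0Sn _ _)).
pose n := maxn N N'; have tn := hN' n (leq_maxr _ _).
have hP a : (a < 8)%N -> P a n by apply: hN; exact: leq_maxl.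
pose phi a := mollify n (U a).
have suppphi a x : phi a x != 0 -> c / 4 <= rsq x <= 2 * K + c.
  by apply: (mollify_supp (lU a) _ tn) => z; exact: sU.
have tphi a : test0 (phi a).
  split; [split; first exact: mollify_smooth|].
    by exists (2 * K + c) => x /suppphi/andP[].
  by exists (c / 4) => // x /suppphi/andP[].
have lphi a : L2r (phi a) := (mollify_bound n (lU a)).1.
have de : d <= e.
  rewrite /d ler_pdivrMr// ler_peMr ?ltW//.
  have := E0.
  by move: (4 * mu ^+ 2 * (1 + B)); clear; intros; lra.
exists phi; split => // a a8; have [h1 h2 h3] := hP a a8; first exact: le_trans de.
have lMW := (mollify_bound n (lW a)).1; have lMV := (mollify_bound n (lV a)).1.
have ldif := L2rB (lphi a) (lU a).
have supdif x : phi a x - U a x != 0 -> c / 4 <= rsq x.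
  have [e1|ne _] := eqVneq (phi a x) 0; last by have /andP[] := suppphi _ _ ne.
  rewrite e1 sub0r oppr_eq0 => /sU1 h; exact: le_trans h.
have [li hi] := L2r_inv_norm c4 ldif supdif.
have eD : massless_dirac mu phi a = fun x => mollify n (V a) x + beta_sign a * mu * (inv_norm x * (phi a x - U a x) -
    (mollify n (fun x => inv_norm x * U a x) x - inv_norm x * U a x)).
  apply/funext => x; rewrite /massless_dirac /phi (free_dirac_convol (test_rho n) lU hUV) -/(mollify _ _) -/(mollify _ _) /mollify; ring.
have l3 := L2rB lMW (lW a).
have ldd : L2r (fun x => inv_norm x * (phi a x - U a x) - (mollify n (fun x => inv_norm x * U a x) x - inv_norm x * U a x)).
  exact: L2rB.
split; first by rewrite eD; apply: L2rD => //; exact: L2rZ.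
have -> : (fun x => massless_dirac mu phi a x - V a x) = (fun x => (mollify n (V a) x - V a x) + beta_sign a * mu *
   (inv_norm x * (phi a x - U a x) - (mollify n (fun x => inv_norm x * U a x) x - inv_norm x * U a x))).
  by apply/funext => x; rewrite eD; ring.
apply: le_trans (nsqD_le (L2rB lMV (lV a)) (L2rZ _ ldd)) _.
have es : (beta_sign a * mu) ^+ 2 = mu ^+ 2.
  by rewrite exprMn /beta_sign; case: ifP => _; rewrite ?sqrrN expr1n mul1r.
rewrite nsqZ// es.
have h4 := nsqB_le li l3.
have h5 : nsq (fun x => inv_norm x * (phi a x - U a x)) <= B * d by apply: le_trans hi _; rewrite ler_wpM2l.
have h6 : mu ^+ 2 * nsq (fun x => inv_norm x * (phi a x - U a x) - (mollify n (fun x => inv_norm x * U a x) x - inv_norm x * U a x))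
   <= mu ^+ 2 * (2 * (B * d) + 2 * d).
  rewrite ler_wpM2l//; apply: le_trans h4 _; rewrite lerD// ler_wpM2l//.
apply: (@le_trans _ _ (2 * d + 2 * (mu ^+ 2 * (2 * (B * d) + 2 * d)))).
  by rewrite lerD// ler_wpM2l.
have -> : 2 * d + 2 * (mu ^+ 2 * (2 * (B * d) + 2 * d)) = (2 + 4 * mu ^+ 2 * (1 + B)) * d by ring.
rewrite /d mulrCA ler_piMr ?(ltW e0)// ler_pdivrMr// mul1r.
have := E0.
by move: (4 * mu ^+ 2 * (1 + B)); clear; intros; lra.
Qed.

Lemma cvg_sum_seq (m : nat) (F : nat -> nat -> R) (l : nat -> R) :
  (forall a, (a < m)%N -> F a @ \oo --> l a) ->
  (fun n => \sum_(a < m) F a n) @ \oo --> \sum_(a < m) l a.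
Proof.
elim: m => [|m ih] h.
  by rewrite big_ord0; under eq_fun do rewrite big_ord0; exact: cvg_cst.
rewrite big_ord_recr /=; under eq_fun do rewrite big_ord_recr /=.
by apply: cvgD; [apply: ih => a am; apply: h; exact: ltnW|exact: h].
Qed.

Lemma itg_weight g f B : measurable_fun setT g -> (forall x, 0 <= g x <= B) -> L2r f ->
  itg (fun x => g x * f x ^+ 2).
Proof.
move=> mg gB lf; apply: (@itg_bdM _ _ _ B) => //; first exact: L2r_sq.
by move=> x; have /andP[h1 h2] := gB x; rewrite ger0_norm.
Qed.

(** L^2 convergence gives convergence of integrals of squares against a
    bounded weight. *)
Lemma weighted_cvg g B (F : nat -> T -> R) f : measurable_fun setT g -> (forall x, 0 <= g x <= B) ->
  (forall n, L2r (F n)) -> L2r f -> (fun n => nsq (fun x => F n x - f x)) @ \oo --> (0 : R) ->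
  (fun n => int3 (fun x => g x * F n x ^+ 2)) @ \oo --> int3 (fun x => g x * f x ^+ 2).
Proof.
move=> mg gB lF lf hF.
have B0 : 0 <= B by have /andP[h1 h2] := gB 0; exact: le_trans h2.
have key n s : 0 < s -> `|int3 (fun x => g x * f x ^+ 2) - int3 (fun x => g x * F n x ^+ 2)| <=
    B * (s * nsq f + (1 + s^-1) * nsq (fun x => F n x - f x)).
  move=> s0; have i1 := itg_weight mg gB lf; have i2 := itg_weight mg gB (lF n).
  have l3 := L2rB (lF n) lf.
  rewrite -int3B// /nsq -!int3Z; [|exact: L2r_sq..].
  rewrite -int3D; [|exact/itgZ/L2r_sq..]; rewrite -int3Z; last by apply: itgD; exact/itgZ/L2r_sq.
  apply: le_trans (ler_norm_int3 (itgB i1 i2)) _; apply: ler_int3; first exact/itg_abs/itgB.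
    by apply: itgZ; apply: itgD; exact/itgZ/L2r_sq.
  move=> x; have /andP[g0 gle] := gB x; rewrite -mulrBr normrM (ger0_norm g0) ler_pM//.
  move: (F n x) (f x) => p r.
  have e : s * r ^+ 2 + (1 + s^-1) * (p - r) ^+ 2 = (s * r - (p - r)) ^+ 2 / s + 2 * r * (p - r) + (p - r) ^+ 2.
    by field; rewrite gt_eqF.
  have e' : s * r ^+ 2 + (1 + s^-1) * (p - r) ^+ 2 = (s * r + (p - r)) ^+ 2 / s - 2 * r * (p - r) + (p - r) ^+ 2.
    by field; rewrite gt_eqF.
  have q1 : 0 <= (s * r - (p - r)) ^+ 2 / s by rewrite mulr_ge0 ?sqr_ge0// invr_ge0 ltW.
  have q2 : 0 <= (s * r + (p - r)) ^+ 2 / s by rewrite mulr_ge0 ?sqr_ge0// invr_ge0 ltW.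
  have q3 := sqr_ge0 (p - r).
  have e3 : r ^+ 2 - p ^+ 2 = - (2 * r * (p - r)) - (p - r) ^+ 2 by ring.
  rewrite e3 ler_norml; apply/andP; split; [rewrite e|rewrite e'].
    by move: q1 q3; move: (_ / s) (2 * r * (p - r)) ((p - r) ^+ 2); clear; intros; lra.
  by move: q2 q3; move: (_ / s) (2 * r * (p - r)) ((p - r) ^+ 2); clear; intros; lra.
apply/cvgrPdist_le => e e0.
have den : 0 < 2 * (B + 1) * (nsq f + 1) by rewrite !mulr_gt0// ltr_wpDl// nsq_ge0.
pose s := e / (2 * (B + 1) * (nsq f + 1)); have s0 : 0 < s by rewrite divr_gt0.
have si : 0 < 1 + s^-1 by rewrite ltr_wpDr// invr_ge0 ltW.
have den2 : 0 < 2 * (B + 1) * (1 + s^-1) by rewrite !mulr_gt0// ltr_wpDl.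
have /cvgrPdist_lt/(_ _ (divr_gt0 e0 den2)) := hF.
apply: filterS => n; rewrite sub0r normrN ger0_norm ?nsq_ge0// => hn.
apply: le_trans (key n s s0) _.
have B1 : 0 <= B + 1 by rewrite addr_ge0.
apply: (@le_trans _ _ ((B + 1) * (s * (nsq f + 1) + (1 + s^-1) * (e / (2 * (B + 1) * (1 + s^-1)))))).
  have nf := nsq_ge0 f; have nd := nsq_ge0 (fun x => F n x - f x).
  apply: ler_pM => //; [|by rewrite lerDl|apply: lerD].
  - by rewrite addr_ge0// mulr_ge0// ltW.
  - by rewrite ler_wpM2l ?(ltW s0)// lerDl.
  - by rewrite ler_wpM2l ?(ltW si)// ltW.
have n1' : nsq f + 1 != 0 by rewrite gt_eqF// ltr_wpDl// nsq_ge0.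
have b1' : B + 1 != 0 by rewrite gt_eqF// ltr_wpDl.
have -> : (B + 1) * (s * (nsq f + 1) + (1 + s^-1) * (e / (2 * (B + 1) * (1 + s^-1)))) =
  (B + 1) * (nsq f + 1) * s + e / 2.
  move: (1 + s^-1) (gt_eqF si) => k /negbT hk; field; by rewrite b1' hk.
rewrite le_eqVlt; apply/orP; left; apply/eqP; rewrite /s; field.
by rewrite n1' b1'.
Qed.

Lemma measurable_neq0 : measurable [set x : T | x != 0].
Proof.
rewrite (_ : [set x : T | x != 0] = ~` [set 0]); last by apply/seteqP; split => x /= /eqP.
apply: measurableC.
rewrite (_ : [set 0] = (([set (0 : R)%R] `*` [set (0 : R)%R]) `*` [set (0 : R)%R])).
  by apply: measurableX; [apply: measurableX|]; exact: measurable_set1.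
by apply/seteqP; split => [x /= -> //|[[x y] z] /= [[-> ->] ->] //].
Qed.

Lemma dct3_ne0 (F : nat -> T -> R) f g : (forall n, measurable_fun setT (F n)) -> measurable_fun setT f ->
  (forall x, x != 0 -> F ^~ x @ \oo --> f x) -> itg g -> (forall n x, `|F n x| <= g x) ->
  (fun n => int3 (F n)) @ \oo --> int3 f.
Proof.
move=> mF mf Ff ig hF.
have mA := measurable_neq0.
pose i : T -> R := \1_[set x : T | x != 0].
have mi : measurable_fun setT i by exact: measurable_indic.
have ae h : measurable_fun setT h -> int3 h = int3 (fun x => i x * h x).
  move=> mh; apply: int3_ae => //; first exact: measurable_funM.
  by apply: filterS ae_neq0 => x x0; rewrite /i indicE mem_set// mul1r.
have -> : (fun n => int3 (F n)) = (fun n => int3 (fun x => i x * F n x)).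
  by apply/funext => n; exact: ae.
rewrite (ae f mf); apply: (dct3 _ _ ig _).2.
- by move=> n; exact: measurable_funM.
- move=> x; have [->|x0] := eqVneq x 0.
    rewrite /i indicE memNset /=; last by rewrite eqxx.
    by rewrite mul0r; under eq_fun do rewrite mul0r; exact: cvg_cst.
  by apply: cvgM; [exact: cvg_cst|exact: Ff].
- move=> n x; apply: le_trans (hF n x); rewrite normrM -[leRHS]mul1r ler_wpM2r//.
  exact: ind_bound.
Qed.

Lemma didx_lt8 (j : 'I_3) a : (didx j a < 8)%N.
Proof.
have [a8|a8] := ltnP a 8; last first.
  by rewrite /didx nth_default//; apply: leq_trans a8; move: j; apply: ord3P.
by move: j; do 8?[case: a a8 => [|a] a8 //]; apply: ord3P.
Qed.

Lemma dsign_sq (j : 'I_3) a : @dsign R j a ^+ 2 <= 1.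
Proof.
have [a8|a8] := ltnP a 8; last first.
  rewrite /dsign nth_default ?expr0n//; apply: leq_trans a8.
  by move: j; apply: ord3P.
by move: j; do 8?[case: a a8 => [|a] a8 //]; apply: ord3P; rewrite /dsign /= ?sqrrN ?expr1n.
Qed.

Section weighted.
Variables (kap : R) (N : nat).
Hypotheses (kap0 : 0 < kap) (N_big : (1088 <= N)%N).

Lemma weight_le x : weight kap N x <= kap^-1 ^+ N.
Proof.
rewrite /weight /fam /lfam mul0r expR0 mul1r lerXn2r ?nnegrE ?invr_ge0 ?addr_ge0 ?expR_ge0 ?(ltW kap0)//.
by rewrite lef_pV2 ?posrE ?addr_gt0 ?expR_gt0// lerDl expR_ge0.
Qed.

(** t^(1/N) <= kappa + t^(1/N). *)
Lemma weight_rsq x : 0 <= weight kap N x * rsq x <= 1.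
Proof.
rewrite mulr_ge0 ?rsq_ge0 ?weight_ge0//=.
have [->|x0] := eqVneq x 0; first by rewrite rsq0 mulr0.
have t0 := rsq_gt0 x0.
have N0 : N%:R != 0 :> R by rewrite pnatr_eq0 -lt0n (leq_trans _ N_big).
have -> : rsq x = expR (N%:R^-1 * ln (rsq x)) ^+ N.
  by rewrite -expRM_natl mulrA mulfV// mul1r lnK.
rewrite /weight /fam /lfam mul0r expR0 mul1r -exprMn exprn_ile1//.
  by rewrite mulr_ge0 ?expR_ge0// invr_ge0 addr_ge0 ?expR_ge0// ltW.
by rewrite mulrC ler_pdivrMr ?addr_gt0 ?expR_gt0// mul1r lerDr ltW.
Qed.

Lemma measurable_weight : measurable_fun setT (weight kap N : T -> R).
Proof.
rewrite /weight /fam /lfam.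
have m1 : measurable_fun setT (fun x : T => ln (rsq x) : R).
  by apply: measurableT_comp; [exact: measurable_ln|exact: continuous_measurable3 (rsmooth_cont (@rsmooth_rsq R))].
have c1 : continuous (fun v : R => lfam kap N%:R^-1 0 N v).
  move=> v; apply/differentiable_continuous/derivable1_diffP.
  exact: (@ex_derive _ _ _ _ _ _ _ (is_derive_lfam _ kap0 _ _ v)).
exact: (measurableT_comp (continuous_measurable_fun c1) m1).
Qed.

Lemma sum_int (g : T -> R) (n : nat) (F : nat -> T -> R) : (forall a, itg (fun x => g x * F a x ^+ 2)) ->
  int3 (fun x => g x * \sum_(a < n) F a x ^+ 2) = \sum_(a < n) int3 (fun x => g x * F a x ^+ 2).
Proof.
move=> h; rewrite -(@int3_sum _ n (fun a x => g x * F a x ^+ 2)) => [|i _]; last exact: h.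
by congr int3; apply/funext => x; rewrite mulr_sumr.
Qed.

(** The weight is bounded, and so is its product with |x|^2; hence both sides
    are continuous for the approximation by test functions. *)
Lemma core_weak U V c K : 0 < c -> L2fam U -> L2fam V ->
  (forall a x, U a x != 0 -> c <= rsq x <= K) -> weak_on test U V ->
  1/2176 * \sum_(a < 8) int3 (fun x => weight kap N x * U a x ^+ 2) <=
  \sum_(a < 8) int3 (fun x => weight kap N x * rsq x * V a x ^+ 2).
Proof.
move=> c0 lU lV sU hUV.
have wB x : 0 <= weight kap N x <= kap^-1 ^+ N by rewrite weight_ge0//= weight_le.
have mw := measurable_weight.
have mwr : measurable_fun setT (fun x => weight kap N x * rsq x).
  by apply: measurable_funM => //; exact: continuous_measurable3 (rsmooth_cont (@rsmooth_rsq R)).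
have /choice[phi hphi] := fun n => weak_approx c0 lU lV sU hUV (@tau_gt0 R n).
have tphi n a : test0 (phi n a) by have [h _ _] := hphi n.
have lphi n a : L2r (phi n a) := L2r_test (tphi n a).1.
pose psi n a := if (a < 8)%N then massless_dirac mu (phi n) a else fun=> 0.
have lpsi n a : L2r (psi n a).
  rewrite /psi; case: ifPn => a8; last exact: L2r0.
  by have [_ _ h] := hphi n; have [] := h a a8.
have squeeze (F : nat -> R) : (forall n, 0 <= F n <= tau n) -> F @ \oo --> (0 : R).
  move=> h; apply: (@squeeze_cvgr _ _ _ _ (fun=> 0) (@tau R)); [exact: nearW|exact: cvg_cst|exact: tau_cvg].
have h1 n : 1/2176 * \sum_(a < 8) int3 (fun x => weight kap N x * phi n a x ^+ 2) <=
     \sum_(a < 8) int3 (fun x => weight kap N x * rsq x * psi n a x ^+ 2).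
  have := core_ineq kap0 N_big mu (tphi n).
  rewrite sum_int; last by move=> a; exact: itg_weight mw wB (lphi n a).
  move=> h; apply: le_trans h _.
  rewrite -sum_int; last by move=> a; exact: itg_weight mwr weight_rsq (lpsi n a).
  rewrite le_eqVlt; apply/orP; left; apply/eqP; congr int3; apply/funext => x.
  rewrite mulrA; congr (_ * _); apply: eq_bigr => -[a a8] _ /=; by rewrite /psi a8.
have c1 : (fun n => 1/2176 * \sum_(a < 8) int3 (fun x => weight kap N x * phi n a x ^+ 2)) @ \oo -->
    1/2176 * \sum_(a < 8) int3 (fun x => weight kap N x * U a x ^+ 2).
  apply: cvgZ_seq; apply: (@cvg_sum_seq 8 (fun a n => int3 (fun x => weight kap N x * phi n a x ^+ 2)) (fun a => int3 (fun x => weight kap N x * U a x ^+ 2))) => a a8.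
  apply: (weighted_cvg mw wB) => //; apply: squeeze => n.
  by rewrite nsq_ge0; have [_ h _] := hphi n; exact: h.
have c2 : (fun n => \sum_(a < 8) int3 (fun x => weight kap N x * rsq x * psi n a x ^+ 2)) @ \oo -->
    \sum_(a < 8) int3 (fun x => weight kap N x * rsq x * V a x ^+ 2).
  apply: (@cvg_sum_seq 8 (fun a n => int3 (fun x => weight kap N x * rsq x * psi n a x ^+ 2)) (fun a => int3 (fun x => weight kap N x * rsq x * V a x ^+ 2))) => a a8.
  apply: (weighted_cvg mwr weight_rsq) => //; apply: squeeze => n.
  by rewrite nsq_ge0 /psi a8; have [_ _ h] := hphi n; have [] := h a a8.
exact: (ler_cvg_to c1 c2 (nearW _ h1)).
Qed.

Lemma inv_norm_rsq x : inv_norm x ^+ 2 * rsq x <= 1.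
Proof.
have [->|x0] := eqVneq x 0; first by rewrite rsq0 mulr0.
by rewrite inv_norm_sq.
Qed.

Lemma L2r_chi n f : L2r f -> L2r (fun x => chi n x * f x).
Proof. by apply: L2r_testM; exact: (test0_chi n).1. Qed.

(** The commutator term is dominated by u/|x|, uniformly in the cut-off. *)
Lemma cut_v_le n u v a x : cut_v (chi n) u v a x ^+ 2 <=
  4 * ((expR 1) ^+ 2 * v a x ^+ 2 + sum3 (fun j => (10 * expR 1) ^+ 2 * (inv_norm x ^+ 2 * u (didx j a) x ^+ 2))).
Proof.
have e1 : 0 <= expR 1 :> R by exact: expR_ge0.
have sqle (p q : R) : `|p| <= q -> p ^+ 2 <= q ^+ 2.
  by move=> h; rewrite -real_normK ?num_real// lerXn2r// nnegrE// (le_trans _ h).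
have hA : (chi n x * v a x) ^+ 2 <= (expR 1) ^+ 2 * v a x ^+ 2.
  by rewrite exprMn ler_wpM2r ?sqr_ge0// sqle// chi_abs.
have hB j : (dsign j a * (pd j (chi n) x * u (didx j a) x)) ^+ 2 <= (10 * expR 1) ^+ 2 * (inv_norm x ^+ 2 * u (didx j a) x ^+ 2).
  rewrite exprMn -[leRHS]mul1r ler_pM ?sqr_ge0 ?dsign_sq//.
  rewrite exprMn mulrA ler_wpM2r ?sqr_ge0// -exprMn sqle//; exact: pd_chi_bound.
rewrite /cut_v /sum3; move: hA (hB o0) (hB o1) (hB o2).
move: (chi n x * v a x) (dsign o0 a * _) (dsign o1 a * _) (dsign o2 a * _) (expR 1 ^+ 2 * _)
  ((10 * expR 1) ^+ 2 * (_ * u (didx o0 a) x ^+ 2)) ((10 * expR 1) ^+ 2 * (_ * u (didx o1 a) x ^+ 2)) ((10 * expR 1) ^+ 2 * (_ * u (didx o2 a) x ^+ 2)).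
move=> A B1 B2 B3 a' b1 b2 b3 h0 h1 h2 h3.
apply: (@le_trans _ _ (4 * (A ^+ 2 + (B1 ^+ 2 + B2 ^+ 2 + B3 ^+ 2)))); last by rewrite ler_wpM2l// !lerD.
rewrite -subr_ge0.
have -> : 4 * (A ^+ 2 + (B1 ^+ 2 + B2 ^+ 2 + B3 ^+ 2)) - (A + (B1 + B2 + B3)) ^+ 2 =
  (A - B1) ^+ 2 + (A - B2) ^+ 2 + (A - B3) ^+ 2 + (B1 - B2) ^+ 2 + (B1 - B3) ^+ 2 + (B2 - B3) ^+ 2 by ring.
by rewrite !addr_ge0 ?sqr_ge0.
Qed.

Lemma cut_v_cvg u v a x : x != 0 -> (fun n => cut_v (chi n) u v a x) @ \oo --> v a x.
Proof.
move=> x0; rewrite -[X in _ --> X](mul1r (v a x)) -[X in _ --> X]addr0.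
apply: cvgD; first by apply: cvgM; [exact: chi_cvg|exact: cvg_cst].
have h j : (fun n => dsign j a * (pd j (chi n) x * u (didx j a) x)) @ \oo --> dsign j a * (0 * u (didx j a) x).
  by apply: cvgZ_seq; apply: cvgM_seq; [exact: pd_chi_cvg|exact: cvg_cst].
rewrite (_ : 0 = sum3 (fun j => dsign j a * (0 * u (didx j a) x))); last by rewrite /sum3; ring.
by apply: cvgD => //; exact: cvgD.
Qed.

(** Apply core_weak to chi n u. In the limit the commutator disappears by
    dominated convergence: for fixed kappa the weight times |x|^2 times |u|^2
    / |x|^2 is integrable, because the weight is bounded. *)
Lemma weak_weighted u v : L2fam u -> L2fam v -> weak_on test0 u v ->
  1/2176 * \sum_(a < 8) int3 (fun x => weight kap N x * u a x ^+ 2) <= \sum_(a < 8) nsq (v a).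
Proof.
move=> lu lv huv.
have wB x : 0 <= weight kap N x <= kap^-1 ^+ N by rewrite weight_ge0//= weight_le.
have kB0 : 0 <= kap^-1 ^+ N by rewrite exprn_ge0// invr_ge0 ltW.
have mw := measurable_weight.
have mr : measurable_fun setT (@rsq R) := continuous_measurable3 (rsmooth_cont (@rsmooth_rsq R)).
have mwr : measurable_fun setT (fun x => weight kap N x * rsq x) by exact: measurable_funM.
have lcut n := L2fam_cut (test0_chi n).1 lu lv.
have h1 n : 1/2176 * \sum_(a < 8) int3 (fun x => weight kap N x * (chi n x * u a x) ^+ 2) <=
     \sum_(a < 8) int3 (fun x => weight kap N x * rsq x * cut_v (chi n) u v a x ^+ 2).
  have [[_ [K hK]] [c c0 hc]] := @test0_chi R n.
  apply: (@core_weak (fun a x => chi n x * u a x) _ c K c0) => //.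
  - by move=> a; exact: L2r_chi.
  - move=> a x ne; have cn0 : chi n x != 0 by apply: contra_neq ne => ->; rewrite mul0r.
    by rewrite hc// hK.
  - exact: weak_cut lu lv huv (@test0_chi R n).
have c1 : (fun n => 1/2176 * \sum_(a < 8) int3 (fun x => weight kap N x * (chi n x * u a x) ^+ 2)) @ \oo -->
    1/2176 * \sum_(a < 8) int3 (fun x => weight kap N x * u a x ^+ 2).
  apply: cvgZ_seq; apply: (@cvg_sum_seq 8 (fun a n => int3 (fun x => weight kap N x * (chi n x * u a x) ^+ 2)) (fun a => int3 (fun x => weight kap N x * u a x ^+ 2))) => a a8.
  apply: (@dct3_ne0 _ _ (fun x => kap^-1 ^+ N * (expR 1 ^+ 2 * u a x ^+ 2))).
  - by move=> n; apply: measurable_funM => //; apply: measurable_funX; exact: L2r_meas (L2r_chi n (lu a)).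
  - by apply: measurable_funM => //; apply: measurable_funX; exact: L2r_meas.
  - move=> x x0; apply: cvgZ_seq; rewrite [X in _ --> X]expr2.
    under eq_fun do rewrite expr2.
    have h : (fun n => chi n x * u a x) @ \oo --> u a x.
      by rewrite -[X in _ --> X]mul1r; apply: cvgM_seq; [exact: chi_cvg|exact: cvg_cst].
    exact: cvgM_seq.
  - by do 2!apply: itgZ; exact: L2r_sq.
  - move=> n x; have /andP[w0 w1] := wB x; rewrite (ger0_norm (mulr_ge0 w0 (sqr_ge0 _))).
    apply: ler_pM => //; first exact: sqr_ge0.
    rewrite exprMn ler_wpM2r ?sqr_ge0//; have /andP[g0 g1] := chi_bound n x.
    by rewrite lerXn2r// nnegrE// expR_ge0.
have c2 : (fun n => \sum_(a < 8) int3 (fun x => weight kap N x * rsq x * cut_v (chi n) u v a x ^+ 2)) @ \oo -->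
    \sum_(a < 8) int3 (fun x => weight kap N x * rsq x * v a x ^+ 2).
  apply: (@cvg_sum_seq 8 (fun a n => int3 (fun x => weight kap N x * rsq x * cut_v (chi n) u v a x ^+ 2)) (fun a => int3 (fun x => weight kap N x * rsq x * v a x ^+ 2))) => a a8.
  apply: (@dct3_ne0 _ _ (fun x => 4 * (expR 1 ^+ 2 * v a x ^+ 2 + sum3 (fun j => (10 * expR 1) ^+ 2 * (kap^-1 ^+ N * u (didx j a) x ^+ 2))))).
  - by move=> n; apply: measurable_funM => //; apply: measurable_funX; exact: L2r_meas (lcut n a).
  - by apply: measurable_funM => //; apply: measurable_funX; exact: L2r_meas.
  - move=> x x0; apply: cvgZ_seq; rewrite [X in _ --> X]expr2.
    under eq_fun do rewrite expr2.
    by apply: cvgM_seq; exact: cut_v_cvg.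
  - apply: itgZ; apply: itgD; first by apply: itgZ; exact: L2r_sq.
    apply: (int3_sum3 (F := fun j x => (10 * expR 1) ^+ 2 * (kap^-1 ^+ N * u (didx j a) x ^+ 2)) _).1 => j.
    by do 2!apply: itgZ; exact: L2r_sq.
  - move=> n x; have /andP[w0 w1] := wB x; have /andP[r0 r1] := weight_rsq x.
    rewrite ger0_norm ?(mulr_ge0 r0) ?sqr_ge0//.
    apply: le_trans (ler_wpM2l r0 (cut_v_le n u v a x)) _; rewrite mulrCA ler_wpM2l// mulrDr lerD//.
      by rewrite ler_piMl// mulr_ge0 ?sqr_ge0// exprn_ge0// expR_ge0.
    have key j : weight kap N x * rsq x * ((10 * expR 1) ^+ 2 * (inv_norm x ^+ 2 * u (didx j a) x ^+ 2)) <=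
        (10 * expR 1) ^+ 2 * (kap^-1 ^+ N * u (didx j a) x ^+ 2).
      rewrite mulrCA ler_wpM2l ?sqr_ge0// mulrA ler_wpM2r ?sqr_ge0//.
      rewrite -mulrA [rsq x * _]mulrC; apply: le_trans w1; rewrite ler_piMr//; exact: inv_norm_rsq.
    by rewrite /sum3 !mulrDr !lerD.
apply: le_trans (ler_cvg_to c1 c2 (nearW _ h1)) _.
apply: ler_sum => a _; apply: ler_int3; [exact: itg_weight mwr weight_rsq (lv a)|exact: L2r_sq|].
by move=> x; have /andP[r0 r1] := weight_rsq x; rewrite ler_piMl// sqr_ge0.
Qed.
End weighted.

(** The weight at kappa = tau n, a sequence that tends to 0. *)
Lemma weight_cvg N x : (1088 <= N)%N -> x != 0 ->
  (fun n => weight (tau n) N x) @ \oo --> (inv_norm x ^+ 2 : R).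
Proof.
move=> hN x0; have t0 := rsq_gt0 x0.
have N0 : N%:R != 0 :> R by rewrite pnatr_eq0 -lt0n (leq_trans _ hN).
set s := expR (N%:R^-1 * ln (rsq x)).
have s0 : 0 < s by exact: expR_gt0.
have es : s ^+ N = rsq x by rewrite /s -expRM_natl mulrA mulfV// mul1r lnK.
have -> : inv_norm x ^+ 2 = ((0 + s)^-1) ^+ N.
  by rewrite add0r exprVn es /inv_norm exprVn sqr_sqrtr// ltW.
have h : (fun n => (tau n + s)^-1) @ \oo --> (0 + s)^-1.
  apply: cvgV; first by rewrite add0r gt_eqF.
  by apply: cvgD; [exact: tau_cvg|exact: cvg_cst].
have h2 : (fun n => ((tau n + s)^-1) ^+ N) @ \oo --> ((0 + s)^-1) ^+ N.
  elim: (N) => [|m ih]; first by under eq_fun do rewrite expr0; rewrite expr0; exact: cvg_cst.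
  by rewrite [X in _ --> X]exprS; apply: cvg_ext (cvgM_seq h ih) => n; rewrite exprS.
by apply: cvg_ext h2 => n; rewrite /weight /fam /lfam mul0r expR0 mul1r.
Qed.

(** The Hardy inequality for weak solutions: let kappa tend to 0 in
    weak_weighted and use Fatou's lemma. Its first half, that u/|x| is square
    integrable, is a regularity statement. *)
Lemma hardy_weak u v : L2fam u -> L2fam v -> weak_on test0 u v ->
  (forall a, (a < 8)%N -> L2r (fun x => inv_norm x * u a x)) /\
  1/2176 * \sum_(a < 8) nsq (fun x => inv_norm x * u a x) <= \sum_(a < 8) nsq (v a).
Proof.
move=> lu lv huv; set S := \sum_(a < 8) nsq (v a).
pose N := 1088%N; have hN : (1088 <= N)%N by [].
have tp n := @tau_gt0 R n.
have mw n := measurable_weight N (tp n).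
have wB n x : 0 <= weight (tau n) N x <= (tau n)^-1 ^+ N by rewrite weight_ge0//= weight_le.
have iw n a : itg (fun x => weight (tau n) N x * u a x ^+ 2) by exact: itg_weight (mw n) (wB n) (lu a).
pose F n x := \1_[set x : T | x != 0] x * \sum_(a < 8) (weight (tau n) N x * u a x ^+ 2).
pose f x := \sum_(a < 8) (inv_norm x * u a x) ^+ 2.
have ir0 : inv_norm (0 : T) = 0 by rewrite /inv_norm rsq0 sqrtr0 invr0.
have isum n : itg (fun x => \sum_(a < 8) (weight (tau n) N x * u a x ^+ 2)).
  by apply: (@itg_sum _ 8 (fun a x => weight (tau n) N x * u a x ^+ 2)) => a _.
have [||||i1 h1] := @fatou3 R F f (2176 * S).
- move=> n; apply: (@itg_bdM _ _ _ 1) => //; last by move=> x; exact: ind_bound.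
  exact: measurable_indic measurable_neq0.
- move=> n x; rewrite mulr_ge0 ?indicE//; apply: sumr_ge0 => a _.
  by rewrite mulr_ge0 ?sqr_ge0//; have /andP[] := wB n x.
- move=> x; have [->|x0] := eqVneq x 0.
    rewrite (_ : f 0 = 0); last by rewrite /f big1// => a _; rewrite ir0 mul0r expr0n.
    rewrite (_ : (fun n => F n 0) = fun=> 0); first exact: cvg_cst.
    by apply/funext => n; rewrite /F indicE memNset ?mul0r//= eqxx.
  rewrite /F /f indicE mem_set//; under eq_fun do rewrite mul1r.
  apply: (@cvg_sum_seq 8 (fun a n => weight (tau n) N x * u a x ^+ 2) (fun a => (inv_norm x * u a x) ^+ 2)) => a a8.
  by rewrite exprMn; apply: cvgM_seq; [exact: weight_cvg|exact: cvg_cst].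
- move=> n; apply: (@le_trans _ _ (int3 (fun x => \sum_(a < 8) (weight (tau n) N x * u a x ^+ 2)))).
    apply: ler_int3 => //.
      apply: (@itg_bdM _ _ _ 1) => //; last by move=> x; exact: ind_bound.
      exact: measurable_indic measurable_neq0.
    move=> x; rewrite -[leRHS]mul1r ler_wpM2r//.
      by apply: sumr_ge0 => a _; rewrite mulr_ge0 ?sqr_ge0//; have /andP[] := wB n x.
  rewrite (@int3_sum _ 8 (fun a x => weight (tau n) N x * u a x ^+ 2))//.
  have := weak_weighted (tp n) hN lu lv huv; rewrite -/S.
  by move: (\sum_(a < 8) int3 _); clear; intros; lra.
have mir := measurable_inv_norm.
have lir a : (a < 8)%N -> L2r (fun x => inv_norm x * u a x).
  move=> a8; have mm : measurable_fun setT (fun x => inv_norm x * u a x).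
    by apply: measurable_funM => //; exact: L2r_meas.
  apply/L2rP; split => //; apply: (itg_le _ i1); first exact: measurable_funX.
  move=> x; rewrite ger0_norm ?sqr_ge0// /f (bigD1 (Ordinal a8))//= lerDl.
  by apply: sumr_ge0 => b _; exact: sqr_ge0.
split => //.
have e : int3 f = \sum_(a < 8) nsq (fun x => inv_norm x * u a x).
  rewrite /f; rewrite (@int3_sum _ 8 (fun a x => (inv_norm x * u a x) ^+ 2))// => a a8.
  exact: L2r_sq (lir a a8).
by rewrite -e; move: h1; move: (int3 f); clear; intros; lra.
Qed.

Lemma dctL2_ne0 (F : nat -> T -> R) f g : (forall n, L2r (F n)) -> L2r f ->
  (forall x, x != 0 -> F ^~ x @ \oo --> f x) -> itg g ->
  (forall n x, (F n x - f x) ^+ 2 <= g x) ->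
  (fun n => nsq (fun x => F n x - f x)) @ \oo --> (0 : R).
Proof.
move=> lF lf Ff ig hF; rewrite -(@int30 R).
apply: (@dct3_ne0 _ _ g) => //.
- by move=> n; apply: measurable_funX; apply: L2r_meas; exact: L2rB.
- move=> x x0; rewrite (_ : 0 = (f x - f x) * (f x - f x)); last by rewrite subrr mulr0.
  under eq_fun do rewrite expr2.
  by apply: cvgM_seq; apply: cvgB => //; [exact: Ff|exact: cvg_cst|exact: Ff|exact: cvg_cst].
- by move=> n x; rewrite ger0_norm ?sqr_ge0.
Qed.

(** Since u/|x| is in L^2, it dominates the commutators of the cut-offs, which
    therefore tend to 0 in L^2: chi n u approximates u in the graph norm, and
    weak_approx applies to chi n u. *)
Lemma weak_closure u v : L2fam u -> L2fam v -> weak_on test0 u v ->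
  forall e, 0 < e -> exists phi : nat -> T -> R, [/\ forall a, test0 (phi a),
    forall a, (a < 8)%N -> nsq (fun x => phi a x - u a x) <= e &
    forall a, (a < 8)%N -> L2r (massless_dirac mu phi a) /\ nsq (fun x => massless_dirac mu phi a x - v a x) <= e].
Proof.
move=> lu lv huv e e0; have [lir _] := hardy_weak lu lv huv.
have lcut n := L2fam_cut (test0_chi n).1 lu lv.
have E0 : 0 <= expR 1 :> R by exact: expR_ge0.
have sq2 (p q : R) : (p - q) ^+ 2 <= 2 * p ^+ 2 + 2 * q ^+ 2.
  rewrite -subr_ge0; have -> : 2 * p ^+ 2 + 2 * q ^+ 2 - (p - q) ^+ 2 = (p + q) ^+ 2 by ring.
  exact: sqr_ge0.
have ix8 := didx_lt8.
have c1 a : (fun n => nsq (fun x => chi n x * u a x - u a x)) @ \oo --> (0 : R).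
  apply: (@dctL2_ne0 _ _ (fun x => 2 * (expR 1 ^+ 2 * u a x ^+ 2) + 2 * u a x ^+ 2)) => //.
  - by move=> n; exact: L2r_chi.
  - by move=> x x0; rewrite -[X in _ --> X]mul1r; apply: cvgM_seq; [exact: chi_cvg|exact: cvg_cst].
  - by apply: itgD; apply: itgZ; [apply: itgZ|]; exact: L2r_sq.
  - move=> n x; apply: le_trans (sq2 _ _) _; rewrite lerD2r ler_wpM2l// exprMn ler_wpM2r ?sqr_ge0//.
    by have /andP[g0 g1] := chi_bound n x; rewrite lerXn2r.
have c2 a : (fun n => nsq (fun x => cut_v (chi n) u v a x - v a x)) @ \oo --> (0 : R).
  apply: (@dctL2_ne0 _ _ (fun x => 2 * (4 * (expR 1 ^+ 2 * v a x ^+ 2 +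
       sum3 (fun j => (10 * expR 1) ^+ 2 * (inv_norm x * u (didx j a) x) ^+ 2))) + 2 * v a x ^+ 2)) => //.
  - by move=> n; exact: lcut.
  - by move=> x x0; exact: cut_v_cvg.
  - apply: itgD; last by apply: itgZ; exact: L2r_sq.
    do 2!apply: itgZ; apply: itgD; first by apply: itgZ; exact: L2r_sq.
    apply: (int3_sum3 (F := fun j x => (10 * expR 1) ^+ 2 * (inv_norm x * u (didx j a) x) ^+ 2) _).1 => j.
    by apply: itgZ; apply: L2r_sq; exact: lir.
  - move=> n x; apply: le_trans (sq2 _ _) _; rewrite lerD2r ler_wpM2l//.
    apply: le_trans (cut_v_le n u v a x) _; rewrite le_eqVlt; apply/orP; left; apply/eqP.
    by rewrite /sum3 !exprMn.
have e4 : 0 < e / 4 by rewrite divr_gt0.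
have ev (F : nat -> R) : F @ \oo --> (0 : R) -> (forall n, 0 <= F n) -> exists N, forall n, (N <= n)%N -> F n <= e / 4.
  move=> /cvgrPdist_le/(_ _ e4)[N _ h] F0; exists N => n /h.
  by rewrite sub0r normrN ger0_norm.
have [N hN] := @common_bound (fun a n => nsq (fun x => chi n x * u a x - u a x) <= e / 4) 8
   (fun a => ev _ (c1 a) (fun n => nsq_ge0 _)).
have [N' hN'] := @common_bound (fun a n => nsq (fun x => cut_v (chi n) u v a x - v a x) <= e / 4) 8
   (fun a => ev _ (c2 a) (fun n => nsq_ge0 _)).
pose n := maxn N N'.
have [[_ [K hK]] [c c0 hc]] := @test0_chi R n.
have lU : L2fam (fun a x => chi n x * u a x) by move=> a; exact: L2r_chi.
have sU a x : chi n x * u a x != 0 -> c <= rsq x <= K.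
  move=> ne; have cn0 : chi n x != 0 by apply: contra_neq ne => ->; rewrite mul0r.
  by rewrite hc// hK.
have [phi [tphi h1 h2]] := weak_approx c0 lU (lcut n) sU (weak_cut lu lv huv (@test0_chi R n)) e4.
have fin (f g h : T -> R) : L2r f -> L2r g -> L2r h -> nsq (fun x => f x - g x) <= e / 4 ->
    nsq (fun x => g x - h x) <= e / 4 -> nsq (fun x => f x - h x) <= e.
  move=> lf lg lh k1 k2; have := nsqD_le (L2rB lf lg) (L2rB lg lh).
  rewrite (_ : (fun x => f x - g x + (g x - h x)) = (fun x => f x - h x)); last by apply/funext => x; ring.
  by move=> k; apply: le_trans k _; move: k1 k2; move: (nsq _) (nsq _); clear; intros; lra.
exists phi; split => // a a8.
  apply: (fin _ (fun x => chi n x * u a x)) => //; [exact: L2r_test (tphi a).1|exact: h1|].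
  by apply: hN => //; exact: leq_maxl.
have [l2 k2] := h2 a a8; split => //.
apply: (fin _ (cut_v (chi n) u v a)) => //; first exact: lcut.
by apply: hN' => //; exact: leq_maxr.
Qed.
End weak.

(** * Regularity of weak solutions *)

Section consequences.
Context {R : realType}.
Local Notation T := (R3 R).
Local Notation leb := (leb3 R).
Implicit Types (f g h k p q : T -> R) (x y z w : T) (C e d : R) (u v U V : nat -> T -> R) (a : nat).

Lemma ibp f h j : test f -> rsmooth h -> int3 (fun x => pd j f x * h x) = - int3 (fun x => f x * pd j h x).
Proof.
move=> tf sh; have tp := test_pd j tf.
have t1 : test (fun x => h x * f x) by exact: testM.
have := int3_pd j t1.
rewrite (pdM j (rsmooth_pderivable sh) (rsmooth_pderivable tf.1)).
rewrite int3D; [|exact/itg_test/testM|exact/itg_test/(testM tf (rsmooth_pd j sh))].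
have -> : (fun x => h x * pd j f x) = (fun x => pd j f x * h x) by apply/funext => x; rewrite mulrC.
have -> : (fun x => pd j h x * f x) = (fun x => f x * pd j h x) by apply/funext => x; rewrite mulrC.
by move/eqP; rewrite addr_eq0 => /eqP.
Qed.

Lemma L2r_inv_norm_test0 h : test0 h -> L2r (fun x => inv_norm x * h x).
Proof. by move=> th; apply: L2r_test; exact: (radial_inv_norm th).1.1. Qed.

(** Integration by parts. *)
Lemma weak_test (mu : R) u (P : (T -> R) -> Prop) : (forall a, test (u a)) ->
  (forall a, L2r (fun x => inv_norm x * u a x)) ->
  (P = test \/ P = test0) -> weak_on mu P u (massless_dirac mu u).
Proof.
move=> tu lw hh a h th.
have {}th : test h by case: hh th => -> // [].
have lh := L2r_test th.
have lu b := L2r_test (tu b); have lp j b := L2r_test (test_pd j (tu b)).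
have lph j := L2r_test (test_pd j th).
have -> : int3 (fun x => massless_dirac mu u a x * h x) =
   int3 (fun x => sum3 (fun j => dsign j a * (pd j (u (didx j a)) x * h x))) +
   beta_sign a * mu * int3 (fun x => u a x * (inv_norm x * h x)).
  have i1 : itg (fun x => u a x * (inv_norm x * h x)).
    by under eq_fun do rewrite mulrCA mulrA; exact: L2r_mul (lw a) lh.
  rewrite -int3Z// -int3D; [|exact: (int3_sum3 (fun j => itgZ (dsign j a) (L2r_mul (lp j (didx j a)) lh))).1|exact: itgZ].
  by congr int3; apply/funext => x; rewrite /massless_dirac /free_dirac /sum3; ring.
congr (_ + _).
rewrite (int3_sum3 (fun j => itgZ (dsign j a) (L2r_mul (lp j (didx j a)) lh))).2 sum3N; apply: sum3_eq => j.
rewrite int3Z; last exact: L2r_mul (lp _ _) lh.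
by rewrite ibp//; [ring|exact: th.1].
Qed.

Lemma test0_massless_dirac mu u a : (forall a, test0 (u a)) -> test0 (massless_dirac mu u a).
Proof.
move=> tu; apply: test0D.
  by apply: (@test0_sum3 _ (fun j x => dsign j a * pd j (u (didx j a)) x)) => j; apply: test0Z; exact: test0_pd.
have -> : (fun x => beta_sign a * (mu * inv_norm x) * u a x) = (fun x => (beta_sign a * mu) * (inv_norm x * u a x)).
  by apply/funext => x; ring.
by apply: test0Z; exact: (radial_inv_norm (tu a)).1.
Qed.

Lemma hardy_test0 mu u : (forall a, test0 (u a)) ->
  1/2176 * \sum_(a < 8) nsq (fun x => inv_norm x * u a x) <= \sum_(a < 8) nsq (massless_dirac mu u a).
Proof.
move=> tu; have w : weak_on mu test0 u (massless_dirac mu u).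
  by apply: weak_test; [move=> a; exact: (tu a).1|move=> a; exact: L2r_inv_norm_test0|right].
by have [_] := hardy_weak (fun a => L2r_test (tu a).1) (fun a => L2r_test (test0_massless_dirac mu a tu).1) w.
Qed.

(** d_i p d_j q - d_j p d_i q is a divergence, as mixed derivatives agree. *)
Lemma null_curl i j p q : test p -> test q ->
  null (fun x => pd i p x * pd j q x - pd j p x * pd i q x).
Proof.
move=> tp tq.
have dp := rsmooth_pderivable tp.1; have d1 := rsmooth_pderivable (rsmooth_pd i tq.1).
have d2 := rsmooth_pderivable (rsmooth_pd j tq.1).
have n1' := null_pd i (testM (test_pd j tq) tp.1).
have n2' := null_pd j (testM (test_pd i tq) tp.1).
have := nullB n1' n2'; apply: null_eq => x.
rewrite (pdM i dp d2) (pdM j dp d1) (clairaut i j tq.1); ring.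
Qed.

(** The squares of the gradient and of the free Dirac operator have the same
    integral, as the square of the latter is minus the Laplacian: the cross
    terms are sums of curls. *)
Lemma gradient_bound u a j : (forall a, test (u a)) -> (a < 8)%N ->
  nsq (pd j (u a)) <= \sum_(b < 8) nsq (free_dirac u b).
Proof.
move=> tu a8.
have lp i b := L2r_test (test_pd i (tu b)).
pose G x : R := \sum_(b < 8) sum3 (fun i => pd i (u b) x ^+ 2).
have iD b : L2r (free_dirac u b) by apply: (@L2r_sum3 R (fun j x => _)) => i; exact: L2rZ.
have N01 (k l : nat) := null_curl o0 o1 (tu k) (tu l).
have N12 (k l : nat) := null_curl o1 o2 (tu k) (tu l).
have N20 (k l : nat) := null_curl o2 o0 (tu k) (tu l).
have Z (k : nat) := nullD (nullB (N01 (k + 2)%N (k + 3)%N) (N01 (k + 0)%N (k + 1)%N))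
   (nullD (nullB (N12 (k + 1)%N (k + 2)%N) (N12 (k + 0)%N (k + 3)%N)) (nullD (N20 (k + 0)%N (k + 2)%N) (N20 (k + 1)%N (k + 3)%N))).
have nl : null (fun x => \sum_(b < 8) free_dirac u b x ^+ 2 - G x).
  have := nullZ 2 (nullD (Z 0) (Z 4)); apply: null_eq => x.
  rewrite /G !big_ord_recr !big_ord0 /free_dirac /sum3 /dsign /didx /=.
  rewrite !addn0 !add0n /=.
  move: (pd o0 (u 0) x) (pd o0 (u 1) x) (pd o0 (u 2) x) (pd o0 (u 3) x) (pd o0 (u 4) x) (pd o0 (u 5) x) (pd o0 (u 6) x) (pd o0 (u 7) x).
  move: (pd o1 (u 0) x) (pd o1 (u 1) x) (pd o1 (u 2) x) (pd o1 (u 3) x) (pd o1 (u 4) x) (pd o1 (u 5) x) (pd o1 (u 6) x) (pd o1 (u 7) x).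
  move: (pd o2 (u 0) x) (pd o2 (u 1) x) (pd o2 (u 2) x) (pd o2 (u 3) x) (pd o2 (u 4) x) (pd o2 (u 5) x) (pd o2 (u 6) x) (pd o2 (u 7) x).
  intros; ring.
have iG : itg G.
  apply: (@itg_sum _ 8 (fun b x => sum3 (fun i => pd i (u b) x ^+ 2))) => b _.
  by apply: (int3_sum3 (F := fun i x => pd i (u b) x ^+ 2) _).1 => i; exact: L2r_sq.
have e := null_int3 iG nl.
rewrite (@int3_sum _ 8 (fun b x => free_dirac u b x ^+ 2)) in e; last by move=> b _; exact: L2r_sq.
rewrite /nsq e; apply: ler_int3 => //; first exact: L2r_sq.
move=> x; rewrite /G (bigD1 (Ordinal a8))//=.
have h b : 0 <= sum3 (fun i => pd i (u b) x ^+ 2) by rewrite /sum3 !addr_ge0 ?sqr_ge0.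
apply: (@le_trans _ _ (sum3 (fun i => pd i (u a) x ^+ 2))); last by rewrite lerDl sumr_ge0.
have h0 := sqr_ge0 (pd o0 (u a) x); have h1 := sqr_ge0 (pd o1 (u a) x); have h2 := sqr_ge0 (pd o2 (u a) x).
by rewrite /sum3; clear -h0 h1 h2; move: j; apply: ord3P; lra.
Qed.

(** The constant obtained from gradient_bound and the Hardy constant 2176 by
    splitting off the potential. *)
Definition gradC (mu : R) : R := 2 + 2 * mu ^+ 2 * 2176.

Lemma hardy_arith (A B c : R) : 0 <= c -> 1/2176 * B <= A -> 2 * A + 2 * c * B <= (2 + 2 * c * 2176) * A.
Proof.
move=> c0 hB; have h1 : c * B <= c * (2176 * A) by rewrite ler_wpM2l//; lra.
have -> : (2 + 2 * c * 2176) * A = 2 * A + 2 * (c * (2176 * A)) by ring.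
by rewrite -mulrA lerD2l ler_wpM2l.
Qed.

Lemma gradC_ge0 mu : 0 <= gradC mu.
Proof. by rewrite /gradC; have := sqr_ge0 mu; lra. Qed.

Lemma gradient_massless_dirac mu u a j : (forall a, test0 (u a)) -> (a < 8)%N ->
  nsq (pd j (u a)) <= gradC mu * \sum_(b < 8) nsq (massless_dirac mu u b).
Proof.
move=> tu a8; apply: le_trans (gradient_bound j (fun a => (tu a).1) a8) _.
have h := hardy_test0 mu tu.
have lD b := L2r_test (test0_massless_dirac mu b tu).1; have lw b := L2r_inv_norm_test0 (tu b).
have key b : nsq (free_dirac u b) <= 2 * nsq (massless_dirac mu u b) + 2 * mu ^+ 2 * nsq (fun x => inv_norm x * u b x).
  have -> : free_dirac u b = (fun x => massless_dirac mu u b x - (beta_sign b * mu) * (inv_norm x * u b x)).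
    by apply/funext => x; rewrite /massless_dirac; ring.
  apply: le_trans (nsqB_le (lD b) (L2rZ _ (lw b))) _; rewrite nsqZ//.
  have -> : (beta_sign b * mu) ^+ 2 = mu ^+ 2.
    by rewrite exprMn /beta_sign; case: ifP => _; rewrite ?sqrrN expr1n mul1r.
  by rewrite mulrA.
apply: (@le_trans _ _ (\sum_(b < 8) (2 * nsq (massless_dirac mu u b) + 2 * mu ^+ 2 * nsq (fun x => inv_norm x * u b x)))).
  by apply: ler_sum => b _.
rewrite big_split /= -!mulr_sumr /gradC.
exact: hardy_arith (sqr_ge0 mu) h.
Qed.

Lemma pairing_cvg (F : nat -> T -> R) f h : (forall n, L2r (F n)) -> L2r f -> L2r h ->
  (forall n, nsq (fun x => F n x - f x) <= tau n) ->
  (fun n => int3 (fun x => F n x * h x)) @ \oo --> int3 (fun x => f x * h x).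
Proof.
move=> lF lf lh hF.
have key n : (int3 (fun x => f x * h x) - int3 (fun x => F n x * h x)) ^+ 2 <= tau n * nsq h.
  rewrite -int3B; [|exact: L2r_mul..].
  rewrite (_ : (fun x => _) = (fun x => (f x - F n x) * h x)); last by apply/funext => x; ring.
  apply: le_trans (cauchy_schwarz3 (L2rB lf (lF n)) lh) _; rewrite ler_wpM2r ?nsq_ge0//.
  apply: le_trans (hF n); rewrite le_eqVlt; apply/orP; left; apply/eqP; congr int3.
  by apply/funext => x; ring.
apply/cvgrPdist_le => e e0.
have e2 : 0 < e ^+ 2 / (nsq h + 1) by rewrite divr_gt0 ?exprn_gt0// ltr_wpDl// nsq_ge0.
have [N hN] := @tau_small R _ e2; exists N => // n /= /hN hn.
rewrite -(@ler_pXn2r _ 2)// ?nnegrE// ?(ltW e0)// real_normK ?num_real//.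
apply: le_trans (key n) _; apply: le_trans (_ : tau n * (nsq h + 1) <= _).
  by rewrite ler_wpM2l ?lerDl// ltW// tau_gt0.
by rewrite -ler_pdivlMr// ltr_wpDl// nsq_ge0.
Qed.

(** Membership of a square-integrable function in the real Sobolev space H^1. *)
Definition weakly_derivable f := forall j, exists2 g, L2r g & forall h, test h ->
  int3 (fun x => f x * pd j h x) = - int3 (fun x => g x * h x).

Lemma massless_diracB mu u v a x : (forall a, test0 (u a)) -> (forall a, test0 (v a)) ->
  massless_dirac mu (fun a x => u a x - v a x) a x = massless_dirac mu u a x - massless_dirac mu v a x.
Proof.
move=> tu tv; rewrite /massless_dirac /free_dirac.
have e j b : pd j (fun x => u b x - v b x) x = pd j (u b) x - pd j (v b) x.
  have -> : (fun x => u b x - v b x) = (fun x => u b x + (-1) * v b x).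
    by apply/funext => y; rewrite mulN1r.
  have dv := test0_pder (tv b).
  rewrite (pdD j (test0_pder (tu b)) (test0_pder (test0Z (-1) (tv b)))) pd_Z//; ring.
by rewrite /sum3 !e; ring.
Qed.

(** Weak partial derivatives combine to a weak image under the free operator. *)
Lemma weakly_derivable_weak u (g : nat -> 'I_3 -> T -> R) : (forall b j, L2r (g b j)) ->
  (forall b j h, test h -> int3 (fun x => u b x * pd j h x) = - int3 (fun x => g b j x * h x)) ->
  let v a x := sum3 (fun j => dsign j a * g (didx j a) j x) in
  L2fam v /\ forall a h, test h -> int3 (fun x => v a x * h x) =
    - sum3 (fun j => dsign j a * int3 (fun x => u (didx j a) x * pd j h x)).
Proof.
move=> lg hg v; have lv : L2fam v.
  by move=> a; apply: (@L2r_sum3 R (fun j x => dsign j a * g (didx j a) j x)) => j; exact: L2rZ.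
split => // a h th; have lh := L2r_test th.
have ij j : itg (fun x => dsign j a * (g (didx j a) j x * h x)) by apply: itgZ; exact: L2r_mul.
have -> : (fun x => v a x * h x) = (fun x => sum3 (fun j => dsign j a * (g (didx j a) j x * h x))).
  by apply/funext => x; rewrite /v /sum3; ring.
rewrite (int3_sum3 ij).2 sum3N; apply: sum3_eq => j.
by rewrite int3Z; [rewrite hg//; ring|exact: L2r_mul].
Qed.

(** A test function is a weak solution of the free equation, so the Hardy
    inequality with mu = 0 applies, also if the function does not vanish at
    the origin. *)
Lemma L2r_inv_norm_test h : test h -> L2r (fun x => inv_norm x * h x).
Proof.
move=> th.
pose u (b : nat) : T -> R := if b == 0 then h else fun=> 0.
have tu b : test (u b) by rewrite /u; case: ifP => // _; exact: test_0.
have lu b := L2r_test (tu b).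
have [lv hv] := weakly_derivable_weak (u := u) (g := fun b j => pd j (u b))
   (fun b j => L2r_test (test_pd j (tu b))) (fun b j k tk => esym (etrans (congr1 _ (ibp j (tu b) tk.1)) (opprK _))).
have w : weak_on 0 test0 u (fun a x => sum3 (fun j => dsign j a * pd j (u (didx j a)) x)).
  by move=> a k tk; rewrite mulr0 mul0r addr0; exact: hv tk.1.
by have [/(_ 0 isT)] := hardy_weak lu lv w.
Qed.

Lemma sum8_const (s t : R) : (2 * s + 2 * t) *+ 8 <= 16 * (s + t).
Proof. by rewrite -mulr_natr; lra. Qed.

Lemma sum16_le (s t e : R) : s <= e -> t <= e -> 16 * (s + t) <= 32 * e.
Proof. lra. Qed.

Section approx.
Variables (mu : R) (u v : nat -> T -> R).
Hypotheses (lu : L2fam u) (lv : L2fam v) (huv : weak_on mu test0 u v).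

Lemma weak_seq : exists phi : nat -> nat -> T -> R, [/\ forall n a, test0 (phi n a),
    forall n a, (a < 8)%N -> nsq (fun x => phi n a x - u a x) <= tau n &
    forall n a, (a < 8)%N -> nsq (fun x => massless_dirac mu (phi n) a x - v a x) <= tau n].
Proof.
have /choice[phi h] := fun n => weak_closure lu lv huv (@tau_gt0 R n).
exists phi; split => [n a|n a a8|n a a8]; have [h1 h2 h3] := h n => //; first exact: h2.
by have [] := h3 a a8.
Qed.

(** In the approximation by test functions the gradients form a Cauchy
    sequence by gradient_massless_dirac; its limit is the weak gradient. *)
Lemma weak_H1 a : (a < 8)%N -> weakly_derivable (u a).
Proof.
move=> a8 j; have [phi [tphi h1 h2]] := weak_seq.
have lphi n b := L2r_test (tphi n b).1.
have lD n b := L2r_test (test0_massless_dirac mu b (tphi n)).1.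
have lpd n := L2r_test (test_pd j (tphi n a).1).
have C0 := gradC_ge0 mu.
have tdif n m b : test0 (fun x => phi n b x - phi m b x).
  by have := test0D (tphi n b) (test0Z (-1) (tphi m b)); under eq_fun do rewrite mulN1r.
have key n m : nsq (fun x => pd j (phi n a) x - pd j (phi m a) x) <= gradC mu * (16 * (tau n + tau m)).
  have h := gradient_massless_dirac mu j (tdif n m) a8.
  have e : pd j (fun x => phi n a x - phi m a x) = (fun x => pd j (phi n a) x - pd j (phi m a) x).
    have -> : (fun x => phi n a x - phi m a x) = (fun x => phi n a x + (-1) * phi m a x).
      by apply/funext => y; rewrite mulN1r.
    apply/funext => x; have dv := test0_pder (tphi m a).
    by rewrite (pdD j (test0_pder (tphi n a)) (test0_pder (test0Z (-1) (tphi m a)))) pd_Z//; ring.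
  rewrite e in h; apply: le_trans h _; rewrite ler_wpM2l//.
  apply: (@le_trans _ _ (\sum_(b < 8) (2 * tau n + 2 * tau m))); last first.
    by rewrite sumr_const card_ord; exact: sum8_const.
  apply: ler_sum => -[b b8] _ /=.
  have -> : massless_dirac mu (fun b x => phi n b x - phi m b x) b = (fun x => (massless_dirac mu (phi n) b x - v b x) - (massless_dirac mu (phi m) b x - v b x)).
    by apply/funext => x; rewrite massless_diracB//; ring.
  apply: le_trans (nsqB_le (L2rB (lD n b) (lv b)) (L2rB (lD m b) (lv b))) _.
  by apply: lerD; rewrite ler_wpM2l// h2.
have [g lg cg] : exists2 g, L2r g & forall e, 0 < e -> exists N, forall n, (N <= n)%N ->
    nsq (fun x => pd j (phi n a) x - g x) <= e.
  apply: L2r_complete => // e e0.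
  have C1 : 0 < gradC mu * 32 + 1 by rewrite ltr_wpDl// mulr_ge0.
  have [N hN] := @tau_small R _ (divr_gt0 e0 C1); exists N => n m /hN hn /hN hm.
  apply: le_trans (key n m) _.
  apply: (@le_trans _ _ ((gradC mu * 32 + 1) * (e / (gradC mu * 32 + 1)))); last by rewrite mulrC divfK// gt_eqF.
  rewrite [leRHS](mulrDl (gradC mu * 32) 1) mul1r; apply: (@le_trans _ _ (gradC mu * 32 * (e / (gradC mu * 32 + 1)))).
    by rewrite -mulrA ler_wpM2l//; exact: sum16_le.
  by rewrite lerDl ltW// divr_gt0.
exists g => // h th; have lh := L2r_test th; have lph := L2r_test (test_pd j th).
have /choice[s hs] (k : nat) := cg _ (@tau_gt0 R k).
have c1 : (fun k : nat => int3 (fun x => pd j (phi (maxn k (s k)) a) x * h x)) @ \oo --> int3 (fun x => g x * h x).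
  by apply: pairing_cvg => // k; apply: hs; exact: leq_maxr.
have c2 : (fun k : nat => int3 (fun x => phi (maxn k (s k)) a x * pd j h x)) @ \oo --> int3 (fun x => u a x * pd j h x).
  apply: pairing_cvg => // k; apply: le_trans (h1 _ _ a8) _.
  rewrite /tau lerXn2r ?nnegrE ?invr_ge0// lef_pV2 ?posrE// ler_nat ltnS; exact: leq_maxl.
have c3 : (fun k : nat => int3 (fun x => phi (maxn k (s k)) a x * pd j h x)) @ \oo --> - int3 (fun x => g x * h x).
  have c3 := @cvgZ_seq R (-1) _ _ c1; rewrite mulN1r in c3; apply: cvg_ext c3 => k.
  by rewrite mulN1r ibp ?opprK//; [exact: (tphi _ _).1|exact: th.1].
exact: (cvg_unique _ c2 c3).
Qed.

(** The origin is not seen by the weak equation: pass to the limit in the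
    identity for the approximating functions, which may be tested with any
    smooth function. *)
Lemma weak_ext a h : (a < 8)%N -> test h ->
  int3 (fun x => v a x * h x) =
  - sum3 (fun j => dsign j a * int3 (fun x => u (didx j a) x * pd j h x))
  + beta_sign a * mu * int3 (fun x => u a x * (inv_norm x * h x)).
Proof.
move=> a8 th; have lh := L2r_test th.
have [phi [tphi h1 h2]] := weak_seq.
have lphi n b := L2r_test (tphi n b).1.
have lD n b := L2r_test (test0_massless_dirac mu b (tphi n)).1.
have lph j := L2r_test (test_pd j th).
have w n := @weak_test mu (phi n) test (fun b => (tphi n b).1) (fun b => L2r_inv_norm_test0 (tphi n b)) (or_introl erefl).
have c1 : (fun n => int3 (fun x => massless_dirac mu (phi n) a x * h x)) @ \oo --> int3 (fun x => v a x * h x).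
  by apply: pairing_cvg => // n; exact: h2.
have c2 b k : (b < 8)%N -> L2r k -> (fun n => int3 (fun x => phi n b x * k x)) @ \oo --> int3 (fun x => u b x * k x).
  by move=> b8 lk; apply: pairing_cvg => // n; exact: h1.
have c3 : (fun n => - sum3 (fun j => dsign j a * int3 (fun x => phi n (didx j a) x * pd j h x))
   + beta_sign a * mu * int3 (fun x => phi n a x * (inv_norm x * h x))) @ \oo -->
   - sum3 (fun j => dsign j a * int3 (fun x => u (didx j a) x * pd j h x))
   + beta_sign a * mu * int3 (fun x => u a x * (inv_norm x * h x)).
  apply: cvgD; last by apply: cvgZ_seq; apply: c2 => //; exact: L2r_inv_norm_test.
  by apply: cvgN; apply: cvgD; [apply: cvgD|]; apply: cvgZ_seq; apply: c2 => //; exact: didx_lt8.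
apply: (cvg_unique _ c1) => //.
by apply: cvg_ext c3 => n; rewrite -(w n a h th).
Qed.

End approx.
End consequences.

(** * The Dirac operator in real coordinates *)

Section complexlayer.
Local Open Scope complex_scope.
Context {R : realType}.
Local Notation T := (R3 R).
Local Notation leb := (leb3 R).
Implicit Types (f g h : T -> R) (x y : T) (u v : nat -> T -> R) (a : nat) (z w : R[i]) (p q psi phi eta : spinor R).
Local Notation Re := complex.Re.
Local Notation Im := complex.Im.

Lemma ReM z w : Re (z * w) = Re z * Re w - Im z * Im w. Proof. by case: z w => [? ?] []. Qed.
Lemma ImM z w : Im (z * w) = Re z * Im w + Im z * Re w. Proof. by case: z w => [? ?] []. Qed.
Lemma ReD z w : Re (z + w) = Re z + Re w. Proof. by case: z w => [? ?] []. Qed.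
Lemma ImD z w : Im (z + w) = Im z + Im w. Proof. by case: z w => [? ?] []. Qed.
Lemma ReN z : Re (- z) = - Re z. Proof. by case: z. Qed.
Lemma ImN z : Im (- z) = - Im z. Proof. by case: z. Qed.
Lemma ReJ z : Re (z^*) = Re z. Proof. by case: z. Qed.
Lemma ImJ z : Im (z^*) = - Im z. Proof. by case: z. Qed.
Definition ReImE := (ReM, ImM, ReD, ImD, ReN, ImN, ReJ, ImJ).
Lemma complex_eq z w : Re z = Re w -> Im z = Im w -> z = w.
Proof. by case: z w => [? ?] [? ?] /= -> ->. Qed.

(** Natural numbers as component indices let the eight real coordinates be
    addressed by arithmetic. *)
Definition i4 (k : nat) : 'I_4 := inord k.

Lemma sumI4 (V : zmodType) (F : 'I_4 -> V) : \sum_k F k = F (i4 0) + F (i4 1) + F (i4 2) + F (i4 3).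
Proof.
rewrite 4!big_ord_recr big_ord0 /= add0r; congr (F _ + F _ + F _ + F _); apply: val_inj;
  by rewrite /= inordK.
Qed.

Lemma sumI3 (V : zmodType) (F : 'I_3 -> V) : \sum_j F j = F o0 + F o1 + F o2.
Proof.
by rewrite 3!big_ord_recr big_ord0 /= add0r; congr (F _ + F _ + F _); exact: val_inj.
Qed.

Lemma i4_cases (P : 'I_4 -> Prop) : P (i4 0) -> P (i4 1) -> P (i4 2) -> P (i4 3) -> forall k, P k.
Proof.
move=> h0 h1 h2 h3 k; have e : k = i4 k by rewrite /i4 inord_val.
by rewrite e; case: k {e} => -[|[|[|[|//]]]].
Qed.

(** Multiplication by an off-diagonal block matrix, in terms of the four
    components. *)
Lemma block_up (A : 'M[R[i]]_2) (B : 'M[R[i]]_2) (w : 'cV[R[i]]_4) :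
  (forall i : 'I_2, (@block_mx _ 2 2 2 2 0 A B 0 *m w) (i4 i) 0 = \sum_(l < 2) A i l * w (i4 (2 + l)) 0) /\
  (forall i : 'I_2, (@block_mx _ 2 2 2 2 0 A B 0 *m w) (i4 (2 + i)) 0 = \sum_(l < 2) B i l * w (i4 l) 0).
Proof.
have eL (i : 'I_2) : i4 i = lshift 2 i.
  by apply: val_inj; rewrite /= inordK//; case: i => -[|[|]].
have eR (i : 'I_2) : i4 (2 + i) = rshift 2 i.
  by apply: val_inj; rewrite /= inordK//; case: i => -[|[|]].
split=> i; rewrite ?eL ?eR mxE big_split_ord /=.
  rewrite big1 ?add0r; last by move=> l _; rewrite block_mxEul mxE mul0r.
  by apply: eq_bigr => l _; rewrite block_mxEur eR.
rewrite [X in _ + X]big1 ?addr0; last by move=> l _; rewrite block_mxEdr mxE mul0r.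
by apply: eq_bigr => l _; rewrite block_mxEdl eL.
Qed.

Lemma beta_block (w : 'cV[R[i]]_4) :
  (forall i : 'I_2, (@block_mx _ 2 2 2 2 1%:M 0 0 (- 1%:M) *m w) (i4 i) 0 = w (i4 i) 0) /\
  (forall i : 'I_2, (@block_mx _ 2 2 2 2 1%:M 0 0 (- 1%:M) *m w) (i4 (2 + i)) 0 = - w (i4 (2 + i)) 0).
Proof.
have eL (i : 'I_2) : i4 i = lshift 2 i.
  by apply: val_inj; rewrite /= inordK//; case: i => -[|[|]].
have eR (i : 'I_2) : i4 (2 + i) = rshift 2 i.
  by apply: val_inj; rewrite /= inordK//; case: i => -[|[|]].
split=> i; rewrite ?eL ?eR mxE big_split_ord /=.
  rewrite [X in _ + X]big1 ?addr0; last by move=> l _; rewrite block_mxEur mxE mul0r.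
  rewrite (bigD1 i)//= block_mxEul mxE eqxx mul1r big1 ?addr0// => l li.
  by rewrite block_mxEul mxE eq_sym (negPf li) mul0r.
rewrite big1 ?add0r; last by move=> l _; rewrite block_mxEdl mxE mul0r.
rewrite (bigD1 i)//= block_mxEdr !mxE eqxx mulN1r big1 ?addr0// => l li.
by rewrite block_mxEdr !mxE eq_sym (negPf li) oppr0 mul0r.
Qed.

Lemma beta_row (w : 'cV[R[i]]_4) :
  (forall i : 'I_2, (dirac_beta R *m w) (i4 i) 0 = w (i4 i) 0) /\
  (forall i : 'I_2, (dirac_beta R *m w) (i4 (2 + i)) 0 = - w (i4 (2 + i)) 0).
Proof. exact: beta_block. Qed.

Definition b0 : 'I_2 := ord0.
Definition b1 : 'I_2 := ord_max.
Lemma sumI2 (V : zmodType) (F : 'I_2 -> V) : \sum_j F j = F b0 + F b1.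
Proof. by rewrite 2!big_ord_recr big_ord0 /= add0r; congr (F _ + F _); exact: val_inj. Qed.

Lemma mx2E (a b c d : R[i]) : [/\ mx2 a b c d b0 b0 = a, mx2 a b c d b0 b1 = b,
  mx2 a b c d b1 b0 = c & mx2 a b c d b1 b1 = d].
Proof. by split; rewrite mxE. Qed.

Lemma alpha_row (w : 'cV[R[i]]_4) :
 [/\ (dirac_alpha R o0 *m w) (i4 0) 0 = w (i4 3) 0, (dirac_alpha R o0 *m w) (i4 1) 0 = w (i4 2) 0,
     (dirac_alpha R o0 *m w) (i4 2) 0 = w (i4 1) 0 & (dirac_alpha R o0 *m w) (i4 3) 0 = w (i4 0) 0] /\
 [/\ (dirac_alpha R o1 *m w) (i4 0) 0 = - 'i * w (i4 3) 0, (dirac_alpha R o1 *m w) (i4 1) 0 = 'i * w (i4 2) 0,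
     (dirac_alpha R o1 *m w) (i4 2) 0 = - 'i * w (i4 1) 0 & (dirac_alpha R o1 *m w) (i4 3) 0 = 'i * w (i4 0) 0] /\
 [/\ (dirac_alpha R o2 *m w) (i4 0) 0 = w (i4 2) 0, (dirac_alpha R o2 *m w) (i4 1) 0 = - w (i4 3) 0,
     (dirac_alpha R o2 *m w) (i4 2) 0 = w (i4 0) 0 & (dirac_alpha R o2 *m w) (i4 3) 0 = - w (i4 1) 0].
Proof.
have E j := block_up (pauli R j) (pauli R j) w.
have [e00 e01 e10 e11] := mx2E 0 1 1 0.
have [f00 f01 f10 f11] := mx2E 0 (- 'i) 'i 0.
have [g00 g01 g10 g11] := mx2E 1 0 0 (-1).
split; [|split]; split.
- by rewrite [LHS]((E o0).1 b0) sumI2 /pauli /= e00 e01 mul0r add0r mul1r.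
- by rewrite [LHS]((E o0).1 b1) sumI2 /pauli /= e10 e11 mul0r addr0 mul1r.
- by rewrite [LHS]((E o0).2 b0) sumI2 /pauli /= e00 e01 mul0r add0r mul1r.
- by rewrite [LHS]((E o0).2 b1) sumI2 /pauli /= e10 e11 mul0r addr0 mul1r.
- by rewrite [LHS]((E o1).1 b0) sumI2 /pauli /= f00 f01 mul0r add0r.
- by rewrite [LHS]((E o1).1 b1) sumI2 /pauli /= f10 f11 mul0r addr0.
- by rewrite [LHS]((E o1).2 b0) sumI2 /pauli /= f00 f01 mul0r add0r.
- by rewrite [LHS]((E o1).2 b1) sumI2 /pauli /= f10 f11 mul0r addr0.
- by rewrite [LHS]((E o2).1 b0) sumI2 /pauli /= g00 g01 mul0r addr0 mul1r.
- by rewrite [LHS]((E o2).1 b1) sumI2 /pauli /= g10 g11 mul0r add0r mulN1r.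
- by rewrite [LHS]((E o2).2 b0) sumI2 /pauli /= g00 g01 mul0r addr0 mul1r.
- by rewrite [LHS]((E o2).2 b1) sumI2 /pauli /= g10 g11 mul0r add0r mulN1r.
Qed.

(** The real coordinates of a spinor: index 2 k carries the real part of
    component k, and 2 k + 1 its imaginary part. The value is 0 for the
    indices without meaning. *)
Definition re8 psi a x : R :=
  if (a < 8)%N then (if odd a then Im (psi x (i4 a./2) 0) else Re (psi x (i4 a./2) 0)) else 0.

Lemma euclid_inv_norm (mu : R) x : mu / euclid x = mu * inv_norm x.
Proof. by rewrite /euclid /inv_norm rsq.unlock. Qed.

Lemma partial_re8 psi j k x : (k < 4)%N ->
  partial j (component psi (i4 k)) x = pd j (re8 psi k.*2) x +i* pd j (re8 psi k.*2.+1) x.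
Proof.
by move=> k4; rewrite /partial !pdE; case: k k4 => [|[|[|[|//]]]].
Qed.

Lemma dirac_entry (A B C D E : 'cV[R[i]]_4) (c d : R[i]) k :
  (- 'i *: (A + B + C) + c *: D + d *: E) k 0 =
  - 'i * (A k 0 + B k 0 + C k 0) + c * D k 0 + d * E k 0.
Proof. by rewrite !mxE. Qed.

(** The complex definition of the Dirac operator agrees with the signed
    permutations dsign and didx. *)
Lemma re8_dirac m mu phi a x : (a < 8)%N ->
  re8 (dirac_op m mu phi) a x = free_dirac (re8 phi) a x + beta_sign a * (m + mu * inv_norm x) * re8 phi a x.
Proof.
pose W j : 'cV[R[i]]_4 := \col_l partial j (component phi l) x.
have comp k A B C D : (dirac_alpha R o0 *m W o0) k 0 = A -> (dirac_alpha R o1 *m W o1) k 0 = B ->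
   (dirac_alpha R o2 *m W o2) k 0 = C -> (dirac_beta R *m phi x) k 0 = D ->
   dirac_op m mu phi x k 0 = - 'i * (A + B + C) + m%:C * D + (mu * inv_norm x)%:C * D.
  by move=> <- <- <- <-; rewrite /dirac_op sumI3 dirac_entry euclid_inv_norm.
have [[a00 a01 a02 a03] _] := alpha_row (W o0).
have [_ [[a10 a11 a12 a13] _]] := alpha_row (W o1).
have [_ [_ [a20 a21 a22 a23]]] := alpha_row (W o2).
have [bu bl] := beta_row (phi x).
have M j k : (k < 4)%N -> W j (i4 k) 0 = pd j (re8 phi k.*2) x +i* pd j (re8 phi k.*2.+1) x.
  by move=> k4; rewrite mxE partial_re8.
have neg (y z : R[i]) : y = z -> - y = - z by move=> ->.
have imul (c y z : R[i]) : y = z -> c * y = c * z by move=> ->.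
have C0 := comp (i4 0) _ _ _ _ (etrans a00 (M _ 3 isT)) (etrans a10 (imul _ _ _ (M _ 3 isT))) (etrans a20 (M _ 2 isT)) (bu b0).
have C1 := comp (i4 1) _ _ _ _ (etrans a01 (M _ 2 isT)) (etrans a11 (imul _ _ _ (M _ 2 isT))) (etrans a21 (neg _ _ (M _ 3 isT))) (bu b1).
have C2 := comp (i4 2) _ _ _ _ (etrans a02 (M _ 1 isT)) (etrans a12 (imul _ _ _ (M _ 1 isT))) (etrans a22 (M _ 0 isT)) (bl b0).
have C3 := comp (i4 3) _ _ _ _ (etrans a03 (M _ 0 isT)) (etrans a13 (imul _ _ _ (M _ 0 isT))) (etrans a23 (neg _ _ (M _ 1 isT))) (bl b1).
clear comp a00 a01 a02 a03 a10 a11 a12 a13 a20 a21 a22 a23 bu bl M neg imul W.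
have E0 : [/\ re8 phi 0 x = Re (phi x (i4 0) 0), re8 phi 1 x = Im (phi x (i4 0) 0), 
  re8 phi 2 x = Re (phi x (i4 1) 0) & re8 phi 3 x = Im (phi x (i4 1) 0)] by [].
have E1 : [/\ re8 phi 4 x = Re (phi x (i4 2) 0), re8 phi 5 x = Im (phi x (i4 2) 0), 
  re8 phi 6 x = Re (phi x (i4 3) 0) & re8 phi 7 x = Im (phi x (i4 3) 0)] by [].
have L : forall b, (b < 8)%N -> re8 (dirac_op m mu phi) b x = 
   (if odd b then Im (dirac_op m mu phi x (i4 b./2) 0) else Re (dirac_op m mu phi x (i4 b./2) 0)).
  by move=> b b8; rewrite /re8 b8.
move=> a8; rewrite L//; move: (dirac_op m mu phi x) C0 C1 C2 C3 => G.
move: E0 E1; rewrite [b0 : nat]/= [b1 : nat]/= [addn 2 0]/= [addn 2 1]/= [double _]/= [double 1]/= [double 2]/= [double 3]/=.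
rewrite /free_dirac /sum3; move: (phi x) (re8 phi) => F r8.
move=> [e0 e1 e2 e3] [e4 e5 e6 e7] C0 C1 C2 C3; clear L.
move: a a8 => [|[|[|[|[|[|[|[|//]]]]]]]] _;
  rewrite /= ?C0 ?C1 ?C2 ?C3 ?(e0, e1, e2, e3, e4, e5, e6, e7) /dsign /didx /beta_sign /= !ReImE /=; ring.
Qed.

End complexlayer.

(** * Spinors as families of eight real functions *)

Section spinors.
Local Open Scope complex_scope.
Context {R : realType}.
Local Notation T := (R3 R).
Local Notation leb := (leb3 R).
Implicit Types (f g h : T -> R) (x y : T) (u v : nat -> T -> R) (a : nat) (z w : R[i]) (p q psi phi eta : spinor R).
Local Notation Re := complex.Re.
Local Notation Im := complex.Im.

(** The spinor with given real coordinates. *)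
Definition cx8 u : spinor R := fun x => \col_(k < 4) (u k.*2 x +i* u k.*2.+1 x).

Lemma re8_ge psi a : (8 <= a)%N -> re8 psi a = fun=> 0.
Proof. by move=> a8; apply/funext => x; rewrite /re8 ltnNge a8. Qed.

Lemma re8_cx8 u a : (a < 8)%N -> re8 (cx8 u) a = u a.
Proof.
move=> a8; apply/funext => x; rewrite /re8 a8 /cx8 !mxE /=.
have a4 : (a./2 < 4)%N by move: a a8 => [|[|[|[|[|[|[|[|//]]]]]]]].
have e : (i4 a./2 : nat) = a./2 by rewrite /= inordK.
rewrite e; case: ifP => oa; rewrite -[in RHS](odd_double_half a) oa ?add0n ?add1n//.
Qed.

(** Transfers a property of functions that holds for 0 between spinors and
    their coordinate families. *)
Lemma re8P psi (P : (T -> R) -> Prop) : P (fun=> 0) ->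
  (forall a, P (re8 psi a)) <-> (forall k, P (fun x => Re (component psi k x)) /\ P (fun x => Im (component psi k x))).
Proof.
move=> P0; split => h.
  apply: i4_cases; split; [exact: (h 0%N)|exact: (h 1%N)|exact: (h 2%N)|exact: (h 3%N)|exact: (h 4%N)
    |exact: (h 5%N)|exact: (h 6%N)|exact: (h 7%N)].
move=> a; have [a8|a8] := ltnP a 8; last by rewrite re8_ge.
have [h1 h2] := h (i4 a./2); rewrite /re8 a8; by case: (odd a).
Qed.

Lemma L2_spinorE psi : L2_spinor psi <-> L2fam (re8 psi).
Proof. by split; [move=> h; apply/(re8P psi (@L2r0 R))|move=> /(re8P psi (@L2r0 R))]. Qed.

Lemma smoothE (f : T -> R[i]) : smooth f <-> rsmooth (fun x => Re (f x)) /\ rsmooth (fun x => Im (f x)).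
Proof.
split=> [h|[h1 h2] n]; last by split.
by split=> n; have [] := h n.
Qed.

Lemma supp_ReIm (f : T -> R[i]) x : (f x != 0) = (Re (f x) != 0) || (Im (f x) != 0).
Proof. by case: (f x) => s t; rewrite eq_complex /= negb_and. Qed.

(** Continuous functions attain their bounds on the compact closure of the
    support; conversely a support contained in a cube has compact closure. *)
Lemma test_funE (f : T -> R[i]) : test_fun setT f <-> test (fun x => Re (f x)) /\ test (fun x => Im (f x)).
Proof.
split.
  move=> [/smoothE[s1 s2] cK _].
  have [M hM] : exists M, forall x, f x != 0 -> rsq x <= M.
    have [K0|/set0P K0] := eqVneq (closure [set x | f x != 0]) set0.
      exists 0 => x fx; have : closure [set x | f x != 0] x by exact: subset_closure.
      by rewrite K0.
    have [c cc hc] := @compact_EVT_max T R (@rsq R) _ K0 cK (continuous_subspaceT (rsmooth_cont (@rsmooth_rsq R))).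
    by exists (rsq c) => x fx; apply: hc; rewrite inE; exact: subset_closure.
  by split; split => //; exists M => x h; apply: hM; rewrite supp_ReIm h// orbT.
move=> [[s1 c1] [s2 c2]].
have sf : smooth f by apply/smoothE; split.
split => //.
have [M1 h1] := csupp_cube c1; have [M2 h2] := csupp_cube c2.
have cub (M : R) : closed (cube M) by apply: compact_closed; [exact: norm_hausdorff|exact: compact_cube].
apply: (@subclosed_compact _ _ (cube M1 `|` cube M2)); first exact: closed_closure.
  by apply: compactU; exact: compact_cube.
have cl : closed (cube M1 `|` cube M2) by exact: closedU.
rewrite [X in _ `<=` X](closure_id _).1//; apply: closureS => x /=.
by rewrite supp_ReIm => /orP[/h1|/h2]; [left|right].
Qed.

(** The minimum of |x|^2 over the closure of the support is positive, because
    the closure is compact and does not contain the origin. *)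
Lemma test_fun0E (f : T -> R[i]) : test_fun (~` [set (0 : T)]) f <-> test0 (fun x => Re (f x)) /\ test0 (fun x => Im (f x)).
Proof.
split.
  move=> tf; have [sf cK K0] := tf.
  have /test_funE[t1 t2] : test_fun setT f by split.
  have [e e0 he] : exists2 e, 0 < e & forall x, f x != 0 -> e <= rsq x.
    have [K1|/set0P K1] := eqVneq (closure [set x | f x != 0]) set0.
      exists 1 => // x fx; have : closure [set x | f x != 0] x by exact: subset_closure.
      by rewrite K1.
    have [c cc hc] := @compact_EVT_min T R (@rsq R) _ K1 cK (continuous_subspaceT (rsmooth_cont (@rsmooth_rsq R))).
    exists (rsq c); last by move=> x fx; apply: hc; rewrite inE; exact: subset_closure.
    rewrite lt_neqAle rsq_ge0 andbT eq_sym rsq_eq0; apply/eqP => c0.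
    by move: cc; rewrite inE => /K0 /=; rewrite c0.
  by split; split => //; exists e => // x h; apply: he; rewrite supp_ReIm h// orbT.
move=> [[t1 [e1 p1 h1]] [t2 [e2 p2 h2]]].
have [sf cK _] : test_fun setT f by exact/test_funE.
split => //.
have cF : closed [set x : T | Num.min e1 e2 <= rsq x].
  rewrite (_ : [set x : T | _] = ~` [set x : T | rsq x < Num.min e1 e2]).
    by apply: open_closedC; exact: open_rsq_lt.
  by apply/seteqP; split => x /=; rewrite leNgt => /negP.
apply: (@subset_trans _ [set x : T | Num.min e1 e2 <= rsq x]).
  rewrite [X in _ `<=` X](closure_id _).1//; apply: closureS => x /=.
  by rewrite supp_ReIm => /orP[/h1|/h2] h; rewrite ge_min h ?orbT.
move=> x /= h x0; move: h; rewrite x0 (_ : rsq 0 = 0); last by apply/eqP; rewrite rsq_eq0.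
by rewrite leNgt lt_min p1 p2.
Qed.

Lemma test_spinorE phi : test_spinor setT phi <-> forall a, test (re8 phi a).
Proof.
apply: (iff_trans _ (iff_sym (re8P phi (@test_0 R)))).
by split=> h k; [exact/test_funE|exact/test_funE].
Qed.

Lemma test_spinor0E phi : test_spinor (~` [set (0 : T)]) phi <-> forall a, test0 (re8 phi a).
Proof.
apply: (iff_trans _ (iff_sym (re8P phi (@test0_0 R)))).
by split=> h k; [exact/test_fun0E|exact/test_fun0E].
Qed.

(** The real part of the scalar product. *)
Definition pair p q : R := \sum_(a < 8) int3 (fun x => re8 p a x * re8 q a x).
Definition nsq8 p : R := \sum_(a < 8) nsq (re8 p a).
(** Multiplication by i. Together with pair it recovers the complex scalar
    product, so that the analysis can be done with real scalars. *)
Definition imul p : spinor R := fun x => 'i *: p x.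

Lemma pairC p q : pair p q = pair q p.
Proof. by apply: eq_bigr => a _; congr int3; apply/funext => x; rewrite mulrC. Qed.

Lemma nsq8E p : nsq8 p = pair p p.
Proof. by apply: eq_bigr => a _; congr int3; apply/funext => x; rewrite expr2. Qed.

Lemma re8B p q a x : re8 (fun x => p x - q x) a x = re8 p a x - re8 q a x.
Proof. by rewrite /re8; case: ifP => _; rewrite ?subr0// !mxE; case: ifP => _; rewrite !ReImE. Qed.

Lemma re8_imul p a x : (a < 4)%N -> re8 (imul p) a.*2 x = - re8 p a.*2.+1 x /\ re8 (imul p) a.*2.+1 x = re8 p a.*2 x.
Proof.
case: a => [|[|[|[|//]]]] _; rewrite /re8 /imul /= !mxE !ReImE /=; split; ring.
Qed.

Lemma sum8 (F : nat -> R) : \sum_(a < 8) F a = F 0 + F 1 + F 2 + F 3 + F 4 + F 5 + F 6 + F 7.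
Proof. by rewrite !big_ord_recr big_ord0 /= add0r. Qed.

Lemma L2_imul p : L2_spinor p -> L2_spinor (imul p).
Proof.
move=> /L2_spinorE lp; apply/L2_spinorE => a.
have [a8|a8] := ltnP a 8; last by rewrite re8_ge//; exact: L2r0.
have a4 : (a./2 < 4)%N by move: a a8 => [|[|[|[|[|[|[|[|//]]]]]]]].
have [e1 e2] : re8 (imul p) a./2.*2 = (fun x => - re8 p a./2.*2.+1 x) /\ re8 (imul p) a./2.*2.+1 = re8 p a./2.*2.
  by split; apply/funext => x; have [] := re8_imul p x a4.
rewrite -(odd_double_half a); case: (odd a); rewrite ?add0n ?add1n; rewrite ?e1 ?e2; [exact: lp|exact: L2rN].
Qed.

Lemma l2dotE p q : L2_spinor p -> L2_spinor q -> l2dot p q = pair p q +i* pair p (imul q).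
Proof.
move=> lp lq; have li := L2_imul lq.
move: lp lq li => /L2_spinorE lp /L2_spinorE lq /L2_spinorE li.
have E r : L2fam (re8 r) -> pair p r = \int[leb]_x (\sum_(a < 8) re8 p a x * re8 r a x).
  move=> lr; rewrite /pair -(@int3_sum R 8 (fun a x => re8 p a x * re8 r a x)); last by move=> a _; exact: L2r_mul.
  by rewrite int3.unlock.
rewrite /l2dot /cintegral !E//; congr (_ +i* _); congr (Rintegral _ _ _); apply/funext => x.
  by rewrite sumI4 !ReImE (sum8 (fun a => re8 p a x * re8 q a x)) /re8 /=; ring.
have [e0 e1] := re8_imul q x (isT : 0 < 4)%N.
have [e2 e3] := re8_imul q x (isT : 1 < 4)%N.
have [e4 e5] := re8_imul q x (isT : 2 < 4)%N.
have [e6 e7] := re8_imul q x (isT : 3 < 4)%N.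
rewrite sumI4 !ReImE (sum8 (fun a => re8 p a x * re8 (imul q) a x)).
by rewrite e0 e1 e2 e3 e4 e5 e6 e7 /re8 /=; ring.
Qed.

Lemma l2normE p : L2_spinor p -> l2norm p = Num.sqrt (nsq8 p).
Proof. by move=> lp; rewrite /l2norm l2dotE//= nsq8E. Qed.

End spinors.

(** * The weak graph of the Dirac operator *)

Section realization.
Local Open Scope complex_scope.
Context {R : realType}.
Local Notation T := (R3 R).
Local Notation leb := (leb3 R).
Implicit Types (f g h : T -> R) (x y : T) (u v : nat -> T -> R) (a : nat) (z w : R[i]) (p q psi phi eta chi : spinor R).
Local Notation Re := complex.Re.
Local Notation Im := complex.Im.
Variables (m mu : R).
Local Notation dirac := (dirac_op m mu).

Lemma half_lt4 a : (a < 8)%N -> (a./2 < 4)%N.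
Proof. by move: a => [|[|[|[|[|[|[|[|//]]]]]]]]. Qed.

Lemma imul_test phi : (forall a, test (re8 phi a)) -> forall a, test (re8 (imul phi) a).
Proof.
move=> lp a; have [a8|a8] := ltnP a 8; last by rewrite re8_ge//; exact: test_0.
have [e1 e2] : re8 (imul phi) a./2.*2 = (fun x => (-1) * re8 phi a./2.*2.+1 x) /\ re8 (imul phi) a./2.*2.+1 = re8 phi a./2.*2.
  by split; apply/funext => x; have [] := re8_imul phi x (half_lt4 a8) => // ->; rewrite mulN1r.
rewrite -(odd_double_half a); case: (odd a); rewrite ?add0n ?add1n; rewrite ?e1 ?e2; [exact: lp|exact: testZ].
Qed.

Lemma scale_out (A1 A2 A3 B : 'M[R[i]]_4) (w1 w2 w3 w : 'cV[R[i]]_4) (c d e k : R[i]) :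
  k *: (A1 *m (c *: w1) + A2 *m (c *: w2) + A3 *m (c *: w3)) + d *: (B *m (c *: w)) + e *: (B *m (c *: w)) =
  c *: (k *: (A1 *m w1 + A2 *m w2 + A3 *m w3) + d *: (B *m w) + e *: (B *m w)).
Proof. by rewrite -!scalemxAr !scalerDr !scalerA !(mulrC c). Qed.

Definition grad_col j phi x : 'cV[R[i]]_4 := \col_k partial j (component phi k) x.

Lemma diracE phi x : dirac phi x =
  - 'i *: (dirac_alpha R o0 *m grad_col o0 phi x + dirac_alpha R o1 *m grad_col o1 phi x + dirac_alpha R o2 *m grad_col o2 phi x)
  + m%:C *: (dirac_beta R *m phi x) + (mu / euclid x)%:C *: (dirac_beta R *m phi x).
Proof. by rewrite /dirac_op sumI3. Qed.

Lemma dirac_imul phi : (forall a, test (re8 phi a)) -> dirac (imul phi) = imul (dirac phi).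
Proof.
move=> tp; apply/funext => x.
have E j k : partial j (component (imul phi) k) x = 'i * partial j (component phi k) x.
  move: k; have H k (k4 : (k < 4)%N) : partial j (component (imul phi) (i4 k)) x = 'i * partial j (component phi (i4 k)) x.
    rewrite !partial_re8//.
    have [e1 e2] : re8 (imul phi) k.*2 = (fun x => (-1) * re8 phi k.*2.+1 x) /\ re8 (imul phi) k.*2.+1 = re8 phi k.*2.
      by split; apply/funext => y; have [] := re8_imul phi y k4 => // ->; rewrite mulN1r.
    rewrite e1 e2 pd_Z; last exact: (@rsmooth_pderivable _ _ (tp _).1).
    by apply: complex_eq; rewrite !ReImE /=; ring.
  by apply: i4_cases; exact: H.
have W j : grad_col j (imul phi) x = 'i *: grad_col j phi x by apply/matrixP => k l; rewrite !mxE E.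
rewrite {2}/imul !diracE (W o0) (W o1) (W o2).
exact: (scale_out _ _ _ _ _ _ _ (phi x)).
Qed.

Lemma L2_test phi : (forall a, test (re8 phi a)) -> L2_spinor phi.
Proof. by move=> tp; apply/L2_spinorE => a; exact: L2r_test. Qed.

Lemma L2_dirac phi : (forall a, test (re8 phi a)) -> L2_spinor (dirac phi).
Proof.
move=> tp; apply/L2_spinorE => a; have [a8|a8] := ltnP a 8; last by rewrite re8_ge//; exact: L2r0.
have -> : re8 (dirac phi) a = (fun x => free_dirac (re8 phi) a x + (beta_sign a * m * re8 phi a x + beta_sign a * mu * (inv_norm x * re8 phi a x))).
  by apply/funext => x; rewrite re8_dirac//; ring.
apply: L2rD; last by apply: L2rD; apply: L2rZ; [exact: L2r_test|exact: L2r_inv_norm_test].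
by apply: (@L2r_sum3 R (fun j x => dsign j a * pd j (re8 phi (didx j a)) x)) => j; apply: L2rZ; exact: L2r_test (test_pd j (tp _)).
Qed.

(** Formal symmetry of the free operator: its derivatives are skew, and so are
    the matrices with entries dsign. *)
Lemma adj_sum (I : 'I_3 -> nat -> nat -> R) : \sum_(b < 8) sum3 (fun j => dsign j b * I j b (didx j b)) =
  \sum_(a < 8) - sum3 (fun j => dsign j a * I j (didx j a) a).
Proof.
rewrite (sum8 (fun b => sum3 (fun j => dsign j b * I j b (didx j b)))) (sum8 (fun a => - sum3 (fun j => dsign j a * I j (didx j a) a))).
rewrite /sum3 /dsign /didx /=; ring.
Qed.

(** The a-th coordinate of the adjoint equation for psi, tested with h. *)
Definition weak_form psi a h : R :=
  - sum3 (fun j => dsign j a * int3 (fun x => re8 psi (didx j a) x * pd j h x))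
  + (beta_sign a * mu * int3 (fun x => re8 psi a x * (inv_norm x * h x)) + beta_sign a * m * int3 (fun x => re8 psi a x * h x)).

Lemma pair_dirac psi phi : L2_spinor psi -> (forall a, test (re8 phi a)) ->
  pair psi (dirac phi) = \sum_(a < 8) weak_form psi a (re8 phi a).
Proof.
move=> /L2_spinorE lp tp.
have lt a := L2r_test (tp a); have li a := L2r_inv_norm_test (tp a); have lpd j a := L2r_test (test_pd j (tp a)).
rewrite big_split /= -(adj_sum (fun j b c => int3 (fun x => re8 psi b x * pd j (re8 phi c) x))) -big_split.
apply: eq_bigr => -[a a8] _ /=.
have ij j : itg (fun x => dsign j a * (re8 psi a x * pd j (re8 phi (didx j a)) x)) by apply: itgZ; exact: L2r_mul.
have [i0 es] := int3_sum3 ij.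
have i1 := L2r_mul (lp a) (li a); have i2 := L2r_mul (lp a) (lt a).
have -> : (fun x => re8 psi a x * re8 (dirac phi) a x) = (fun x => sum3 (fun j => dsign j a * (re8 psi a x * pd j (re8 phi (didx j a)) x))
   + (beta_sign a * mu * (re8 psi a x * (inv_norm x * re8 phi a x)) + beta_sign a * m * (re8 psi a x * re8 phi a x))).
  by apply/funext => x; rewrite re8_dirac// /free_dirac /sum3; ring.
have i3 := itgZ (beta_sign a * mu) i1; have i4' := itgZ (beta_sign a * m) i2.
rewrite (int3D i0 (itgD i3 i4')) (int3D i3 i4') (int3Z (beta_sign a * mu) i1) (int3Z (beta_sign a * m) i2) es; congr (_ + _).
by apply: sum3_eq => j; rewrite int3Z//; exact: L2r_mul.
Qed.

(** The image of psi under the massless operator when eta is its image under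
    the operator with mass. *)
Definition massless_part psi eta a x : R := re8 eta a x - beta_sign a * m * re8 psi a x.
(** The pairs (psi, eta) with H psi = eta in the weak sense on the punctured
    space. It turns out to be the graph of the closure, of the adjoint and of
    the maximal operator at once. *)
Definition weak_graph psi eta := [/\ L2_spinor psi, L2_spinor eta & weak_on mu test0 (re8 psi) (massless_part psi eta)].

Lemma L2_massless_part psi eta : L2_spinor psi -> L2_spinor eta -> L2fam (massless_part psi eta).
Proof. by move=> /L2_spinorE lp /L2_spinorE le a; apply: L2rB => //; exact: L2rZ. Qed.

Lemma int3_massless_part psi eta a h : L2_spinor psi -> L2_spinor eta -> test h ->
  int3 (fun x => massless_part psi eta a x * h x) = int3 (fun x => re8 eta a x * h x) - beta_sign a * m * int3 (fun x => re8 psi a x * h x).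
Proof.
move=> /L2_spinorE lp /L2_spinorE le th; have lh := L2r_test th.
have i1 := L2r_mul (lp a) lh; have i2 := L2r_mul (le a) lh.
rewrite -(int3Z _ i1) -int3B//; last exact: itgZ.
by congr int3; apply/funext => x; rewrite /massless_part; ring.
Qed.

(** The weak equation may be tested with functions that do not vanish at the
    origin, by weak_ext. *)
Lemma weak_graph_pair psi eta phi : weak_graph psi eta -> (forall a, test (re8 phi a)) -> pair psi (dirac phi) = pair eta phi.
Proof.
move=> [lp le w] tp; rewrite pair_dirac//; apply: eq_bigr => -[a a8] _ /=.
have := weak_ext ((L2_spinorE _).1 lp) (L2_massless_part lp le) w a8 (tp a).
rewrite int3_massless_part// => /eqP; rewrite subr_eq => /eqP ->.
by rewrite /weak_form addrA.
Qed.

(** The family with h in place a and 0 elsewhere; such families separate the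
    coordinates of the weak equation. *)
Definition delta8 a h : nat -> T -> R := fun b => if b == a then h else fun=> 0.

Lemma re8_delta a h b : (a < 8)%N -> re8 (cx8 (delta8 a h)) b = delta8 a h b.
Proof.
move=> a8; have [b8|b8] := ltnP b 8; first by rewrite re8_cx8.
by rewrite re8_ge// /delta8; case: eqP b8 => // ->; rewrite leqNgt a8.
Qed.

Lemma sum_delta a (F : (T -> R) -> nat -> R) h : (a < 8)%N -> (forall b, F (fun=> 0) b = 0) ->
  \sum_(b < 8) F (delta8 a h b) b = F h a.
Proof.
move=> a8 F0; rewrite (bigD1 (Ordinal a8))//= {1}/delta8 eqxx big1 ?addr0// => b ba.
by rewrite /delta8 ifN ?F0//; apply: contra ba => /eqP e; apply/eqP; exact: val_inj.
Qed.

Lemma pair_delta psi a h : (a < 8)%N -> pair psi (cx8 (delta8 a h)) = int3 (fun x => re8 psi a x * h x).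
Proof.
move=> a8; rewrite /pair; under eq_bigr do rewrite re8_delta//.
rewrite (sum_delta (F := fun h b => int3 (fun x => re8 psi b x * h x)))// => b.
by under eq_fun do rewrite mulr0; exact: int30.
Qed.

Lemma weak_graph_intro psi eta : L2_spinor psi -> L2_spinor eta ->
  (forall a h, (a < 8)%N -> test0 h -> int3 (fun x => massless_part psi eta a x * h x) =
    - sum3 (fun j => dsign j a * int3 (fun x => re8 psi (didx j a) x * pd j h x))
    + beta_sign a * mu * int3 (fun x => re8 psi a x * (inv_norm x * h x))) -> weak_graph psi eta.
Proof.
move=> lp le H; split => // a h th.
have [a8|a8] := ltnP a 8; first exact: H.
have s0 j : dsign (R := R) j a = 0.
  by rewrite /dsign nth_default//; apply: leq_trans a8; move: j; apply: ord3P.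
rewrite /massless_part /sum3 !s0 (re8_ge psi a8) (re8_ge eta a8).
by under eq_fun do rewrite mulr0 subr0 mul0r; under [X in _ + _ * int3 X]eq_fun do rewrite mul0r; rewrite int30; ring.
Qed.

Lemma weak_graph_of_pair psi eta : L2_spinor psi -> L2_spinor eta ->
  (forall a h, (a < 8)%N -> test0 h -> pair psi (dirac (cx8 (delta8 a h))) = pair eta (cx8 (delta8 a h))) -> weak_graph psi eta.
Proof.
move=> lp le H; apply: weak_graph_intro => // a h a8 th.
have td b : test (re8 (cx8 (delta8 a h)) b).
  by rewrite re8_delta// /delta8; case: (b == a); [exact: th.1|exact: test_0].
have := H a h a8 th; rewrite pair_delta// pair_dirac//.
under eq_bigr do rewrite re8_delta//.
rewrite (sum_delta (F := fun h b => weak_form psi b h))//; last first.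
  move=> b; rewrite /weak_form /sum3 !pd_cst.
  have z1 f : int3 (fun x => f x * 0) = 0 by under eq_fun do rewrite mulr0; exact: int30.
  have z2 f g : int3 (fun x => f x * (g x * 0)) = 0 by under eq_fun do rewrite !mulr0; exact: int30.
  by rewrite !z1 !z2; ring.
rewrite int3_massless_part//; last exact: th.1.
by move=> <-; rewrite /weak_form; ring.
Qed.

End realization.

(** * Closures, adjoints and essential self-adjointness *)

Section selfadjoint.
Local Open Scope complex_scope.
Context {R : realType}.
Local Notation T := (R3 R).
Local Notation leb := (leb3 R).
Implicit Types (f g h : T -> R) (x y : T) (u v : nat -> T -> R) (a : nat) (z w : R[i]) (p q r psi phi eta chi om : spinor R).
Local Notation Re := complex.Re.
Local Notation Im := complex.Im.

Lemma re8_ae p q a : p = q %[ae leb] -> {ae leb, forall x, re8 p a x = re8 q a x}.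
Proof. by apply: filterS => x h; rewrite /re8 h. Qed.

Lemma pair_ae p q r : L2_spinor p -> L2_spinor q -> L2_spinor r -> p = q %[ae leb] -> pair p r = pair q r.
Proof.
move=> /L2_spinorE lp /L2_spinorE lq /L2_spinorE lr e; apply: eq_bigr => -[a a8] _ /=.
apply: int3_ae; [by apply: measurable_funM; exact: L2r_meas|by apply: measurable_funM; exact: L2r_meas|].
by have := re8_ae a e; apply: filterS => x ->.
Qed.

Lemma nsq8_ge0 p : 0 <= nsq8 p.
Proof. by apply: sumr_ge0 => a _; exact: nsq_ge0. Qed.

Lemma nsq_le8 p a : (a < 8)%N -> nsq (re8 p a) <= nsq8 p.
Proof. by move=> a8; rewrite /nsq8 (bigD1 (Ordinal a8))//= lerDl sumr_ge0// => b _; exact: nsq_ge0. Qed.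

Lemma l2norm_ge0 p : 0 <= l2norm p.
Proof. exact: sqrtr_ge0. Qed.

Lemma pair_le p q : L2_spinor p -> L2_spinor q -> `|pair p q| <= 8 * (l2norm p * l2norm q).
Proof.
move=> lp lq; rewrite !l2normE//; move: lp lq => /L2_spinorE lp /L2_spinorE lq.
apply: le_trans (ler_norm_sum _ _ _) _.
apply: (@le_trans _ _ (\sum_(a < 8) Num.sqrt (nsq8 p) * Num.sqrt (nsq8 q))).
  apply: ler_sum => -[a a8] _ /=; rewrite -sqrtrM ?nsq8_ge0// -sqrtr_sqr; apply: ler_wsqrtr.
  by apply: le_trans (cauchy_schwarz3 (lp a) (lq a)) _; apply: ler_pM; rewrite ?nsq_ge0// nsq_le8.
by rewrite sumr_const card_ord mulr_natl.
Qed.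

Lemma l2norm_lt p (d e : R) : L2_spinor p -> (forall a, (a < 8)%N -> nsq (re8 p a) <= d) ->
  8 * d < e ^+ 2 -> 0 < e -> l2norm p < e.
Proof.
move=> lp h d8 e0; rewrite l2normE// -[ltRHS]gtr0_norm// -sqrtr_sqr ltr_sqrt ?exprn_gt0//.
apply: le_lt_trans d8; apply: (@le_trans _ _ (\sum_(a < 8) d)).
  by apply: ler_sum => -[a a8] _; exact: h.
by rewrite sumr_const card_ord mulr_natl.
Qed.

Lemma re8BE p q a : re8 (fun x => p x - q x) a = fun x => re8 p a x - re8 q a x.
Proof. by apply/funext => x; exact: re8B. Qed.

Lemma L2B p q : L2_spinor p -> L2_spinor q -> L2_spinor (fun x => p x - q x).
Proof.
move=> /L2_spinorE lp /L2_spinorE lq; apply/L2_spinorE => a.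
by rewrite re8BE; exact: L2rB.
Qed.

Lemma pairB p q r : L2_spinor p -> L2_spinor q -> L2_spinor r -> pair (fun x => p x - q x) r = pair p r - pair q r.
Proof.
move=> /L2_spinorE lp /L2_spinorE lq /L2_spinorE lr; rewrite /pair -sumrB; apply: eq_bigr => -[a a8] _ /=.
rewrite -int3B; [|exact: L2r_mul|exact: L2r_mul].
by congr int3; apply/funext => x; rewrite re8B mulrBl.
Qed.

Lemma closed_arith (A B a b e' e : R) : 0 <= a -> 0 <= b -> A <= 8 * (e' * a) -> B <= 8 * (e' * b) ->
  e' * (8 * (a + b) + 1) = e -> 0 < e' -> A + B <= e.
Proof. by move=> a0 b0 h1 h2 <- e0; nra. Qed.

(** Identities between scalar products pass to the closure of a graph, by the
    Cauchy-Schwarz inequality. *)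
Lemma closed_pair psi eta chi om : L2_spinor psi -> L2_spinor eta -> L2_spinor chi -> L2_spinor om ->
  (forall e : R, 0 < e -> exists p q, [/\ L2_spinor p, L2_spinor q, pair p chi = pair q om,
    l2norm (fun x => psi x - p x) < e & l2norm (fun x => eta x - q x) < e]) ->
  pair psi chi = pair eta om.
Proof.
move=> lpsi leta lchi lom H.
apply/eqP; rewrite -subr_eq0 -normr_le0; apply/ler_addgt0Pr => e e0; rewrite add0r.
have K0 : 0 < 8 * (l2norm chi + l2norm om) + 1 by rewrite ltr_wpDl// mulr_ge0// addr_ge0// l2norm_ge0.
have [p [q [lp lq E h1 h2]]] := H _ (divr_gt0 e0 K0).
have -> : pair psi chi - pair eta om = pair (fun x => psi x - p x) chi - pair (fun x => eta x - q x) om.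
  by rewrite !pairB// E; ring.
apply: le_trans (ler_normB _ _) _.
apply: (closed_arith (l2norm_ge0 chi) (l2norm_ge0 om) _ _ _ (divr_gt0 e0 K0)).
- apply: le_trans (pair_le (L2B lpsi lp) lchi) _; apply: ler_wpM2l => //; apply: ler_wpM2r; [exact: l2norm_ge0|exact: ltW h1].
- apply: le_trans (pair_le (L2B leta lq) lom) _; apply: ler_wpM2l => //; apply: ler_wpM2r; [exact: l2norm_ge0|exact: ltW h2].
- by rewrite divfK// gt_eqF.
Qed.

Lemma pair_imull p q : L2_spinor p -> L2_spinor q -> pair (imul p) q = - pair p (imul q).
Proof.
move=> /L2_spinorE lp /L2_spinorE lq.
have E k : (k < 4)%N -> int3 (fun x => re8 (imul p) k.*2 x * re8 q k.*2 x) + int3 (fun x => re8 (imul p) k.*2.+1 x * re8 q k.*2.+1 x) =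
   - (int3 (fun x => re8 p k.*2 x * re8 (imul q) k.*2 x) + int3 (fun x => re8 p k.*2.+1 x * re8 (imul q) k.*2.+1 x)).
  move=> k4.
  have e0 (s : spinor R) : re8 (imul s) k.*2 = (fun x => - re8 s k.*2.+1 x).
    by apply/funext => x; have [] := re8_imul s x k4.
  have e1 (s : spinor R) : re8 (imul s) k.*2.+1 = re8 s k.*2.
    by apply/funext => x; have [] := re8_imul s x k4.
  rewrite !e0 !e1.
  under eq_fun do rewrite mulNr; under [X in - (int3 X + _)]eq_fun do rewrite mulrN.
  by rewrite !int3N; [ring|exact: L2r_mul..].
rewrite /pair (sum8 (fun a => int3 (fun x => re8 (imul p) a x * re8 q a x))) (sum8 (fun a => int3 (fun x => re8 p a x * re8 (imul q) a x))).
have E0 := E 0%N isT; have E1 := E 1%N isT; have E2 := E 2%N isT; have E3 := E 3%N isT.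
rewrite [0.*2]/= [1.*2]/= [2.*2]/= [3.*2]/= in E0 E1 E2 E3.
move: E0 E1 E2 E3.
do 16!(move: (int3 _)); intros; lra.
Qed.

Variables (m mu : R).
Local Notation dirac := (dirac_op m mu).
Local Notation weak_graph := (weak_graph m mu).
Local Notation H0 := (op_restr (Hmin m mu) (test_spinor (~` [set (0 : T)]))).

Lemma weak_graph_test phi : (forall a, test (re8 phi a)) -> weak_graph phi (dirac phi).
Proof.
move=> tp; split; [exact: L2_test|exact: L2_dirac|].
have w := weak_test mu tp (fun a => L2r_inv_norm_test (tp a)) (or_intror (erefl (@test0 R))).
suff -> : massless_part m phi (dirac phi) = massless_dirac mu (re8 phi) by [].
apply/funext => a; apply/funext => x; rewrite /massless_part /massless_dirac.
have [a8|a8] := ltnP a 8; first by rewrite re8_dirac//; ring.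
have s0 j : dsign (R := R) j a = 0.
  by rewrite /dsign nth_default//; apply: leq_trans a8; move: j; apply: ord3P.
by rewrite /free_dirac /sum3 !s0 (re8_ge phi a8) (re8_ge (dirac phi) a8); ring.
Qed.

Lemma delta_test a h : test h -> (a < 8)%N -> forall b, test (re8 (cx8 (delta8 a h)) b).
Proof. by move=> th a8 b; rewrite re8_delta// /delta8; case: (b == a) => //; exact: test_0. Qed.

Lemma delta_test0 a h : test0 h -> (a < 8)%N -> forall b, test0 (re8 (cx8 (delta8 a h)) b).
Proof. by move=> th a8 b; rewrite re8_delta// /delta8; case: (b == a) => //; exact: test0_0. Qed.

Lemma Hmin_weak_graph psi eta : op_graph (Hmin m mu) psi eta -> weak_graph psi eta.
Proof.
move=> [[lpsi _] [leta [phi /test_spinorE tphi [e1 e2]]]].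
apply: weak_graph_of_pair => // a h a8 th.
have tc := delta_test th.1 a8; set chi := cx8 _ in tc *.
rewrite (pair_ae lpsi (L2_test tphi) (L2_dirac m mu tc) e1) (pair_ae leta (L2_dirac m mu tphi) (L2_test tc) e2).
exact: weak_graph_pair (weak_graph_test tphi) tc.
Qed.

(** The weak graph is an intersection of kernels of continuous functionals. *)
Lemma weak_graph_closed psi eta : L2_spinor psi -> L2_spinor eta ->
  (forall e : R, 0 < e -> exists p q, [/\ weak_graph p q,
      l2norm (fun x => psi x - p x) < e & l2norm (fun x => eta x - q x) < e]) -> weak_graph psi eta.
Proof.
move=> lpsi leta H; apply: weak_graph_of_pair => // a h a8 th.
have tc := delta_test th.1 a8.
apply: closed_pair => //; [exact: L2_dirac|exact: L2_test|] => e /H[p [q [w h1 h2]]].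
by exists p, q; split => //; [case: w|case: w|exact: weak_graph_pair].
Qed.

Lemma H0_Hmin psi eta : op_graph H0 psi eta -> op_graph (Hmin m mu) psi eta.
Proof. by move=> [[d _] v]. Qed.

Lemma test0_graph phi : (forall a, test0 (re8 phi a)) -> op_graph H0 phi (dirac phi).
Proof.
move=> t0; have t a := (t0 a).1.
have rf p : p = p %[ae leb] by exact: nearW.
split; split.
- by split; [exact: L2_test|exists phi => //; exact/test_spinorE].
- by exists phi => //; exact/test_spinor0E.
- exact: L2_dirac.
- by exists phi => //; exact/test_spinorE.
Qed.

Lemma nsqBC f g : nsq (fun x => f x - g x) = nsq (fun x => g x - f x).
Proof. by congr int3; apply/funext => x; ring. Qed.

Lemma cx8_test0 u : (forall a, test0 (u a)) -> forall a, test0 (re8 (cx8 u) a).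
Proof. by move=> tu a; have [a8|a8] := ltnP a 8; [rewrite re8_cx8|rewrite re8_ge//; exact: test0_0]. Qed.

(** The mass term is bounded, so weak_closure carries over to the operator
    with mass. *)
Lemma weak_graph_approx psi eta (e : R) : weak_graph psi eta -> 0 < e -> exists phi, [/\ forall a, test0 (re8 phi a),
   l2norm (fun x => psi x - phi x) < e & l2norm (fun x => eta x - dirac phi x) < e].
Proof.
move=> [lpsi leta w] e0.
have m2 : 0 <= m ^+ 2 := sqr_ge0 m.
pose d := e ^+ 2 / (32 * (1 + m ^+ 2)).
have D32 : 0 < 32 * (1 + m ^+ 2) by rewrite mulr_gt0// ltr_wpDr.
have d0 : 0 < d by rewrite divr_gt0// exprn_gt0.
have dE : d * (32 * (1 + m ^+ 2)) = e ^+ 2 by rewrite divfK// gt_eqF.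
have [u [tu h1 h2]] := weak_closure ((L2_spinorE _).1 lpsi) (L2_massless_part m lpsi leta) w d0.
have t0 := cx8_test0 tu; have t a := (t0 a).1.
have lp := L2_test t; have ld := L2_dirac m mu t.
exists (cx8 u); split => //.
  apply: (@l2norm_lt _ d) => //; first exact: L2B.
    by move=> a a8; rewrite re8BE re8_cx8//; rewrite nsqBC; exact: h1.
  by rewrite -dE; clear -d0 m2; nra.
apply: (@l2norm_lt _ (2 * d + 2 * (m ^+ 2 * d))) => //; first exact: L2B.
  move=> a a8; have [lD hD] := h2 a a8.
  have -> : re8 (fun x => eta x - dirac (cx8 u) x) a =
     (fun x => (massless_part m psi eta a x - massless_dirac mu u a x) + (beta_sign a * m) * (re8 psi a x - u a x)).
    apply/funext => x; rewrite re8B re8_dirac// /massless_part /massless_dirac re8_cx8//.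
    have -> : free_dirac (re8 (cx8 u)) a x = free_dirac u a x by apply: sum3_eq => j; rewrite re8_cx8// didx_lt8.
    ring.
  have lu := L2r_test (tu a).1; have lpa := (L2_spinorE _).1 lpsi a.
  apply: le_trans (nsqD_le (L2rB (L2_massless_part m lpsi leta a) lD) (L2rZ _ (L2rB lpa lu))) _.
  rewrite nsqZ; last exact: L2rB.
  have -> : (beta_sign a * m) ^+ 2 = m ^+ 2.
    by rewrite exprMn /beta_sign; case: ifP => _; rewrite ?sqrrN expr1n mul1r.
  apply: lerD; rewrite ler_wpM2l//; first by rewrite nsqBC.
  by rewrite ler_wpM2l// nsqBC; exact: h1.
by rewrite -dE; clear -d0 m2; nra.
Qed.

(** The closure of the operator on the punctured space is the weak graph: one
    inclusion is weak_graph_closed, the other weak_graph_approx. *)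
Lemma closed_H0 psi eta : closed_graph H0 psi eta <-> weak_graph psi eta.
Proof.
split.
  move=> [lp le H]; apply: weak_graph_closed => // e /H[p [q [g h1 h2]]].
  by exists p, q; split => //; exact/Hmin_weak_graph/H0_Hmin.
move=> w; have [lp le _] := w; split => // e e0.
have [phi [t0 h1 h2]] := weak_graph_approx w e0.
by exists phi, (dirac phi); split => //; exact: test0_graph.
Qed.

(** H_min lies between the operator on the punctured space and the weak graph. *)
Lemma closed_Hmin psi eta : closed_graph (Hmin m mu) psi eta <-> weak_graph psi eta.
Proof.
split.
  move=> [lp le H]; apply: weak_graph_closed => // e /H[p [q [g h1 h2]]].
  by exists p, q; split => //; exact/Hmin_weak_graph.
move=> /closed_H0[lp le H]; split => // e /H[p [q [g h1 h2]]].
by exists p, q; split => //; exact: H0_Hmin.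
Qed.

(** The complex structure commutes with the operator; this yields the
    imaginary parts of the scalar products below. *)
Lemma weak_graph_imul psi eta : weak_graph psi eta -> weak_graph (imul psi) (imul eta).
Proof.
move=> w; have [lp le _] := w; apply: weak_graph_of_pair; [exact: L2_imul|exact: L2_imul|] => a h a8 th.
have tc := delta_test th.1 a8.
rewrite (pair_imull lp (L2_dirac m mu tc)) (pair_imull le (L2_test tc)).
by rewrite -dirac_imul// (weak_graph_pair w (imul_test tc)).
Qed.

(** Symmetry of the weak graph, by approximating one of the two pairs by test
    functions. *)
Lemma weak_graph_sym psi eta p q : weak_graph psi eta -> weak_graph p q -> pair q psi = pair p eta.
Proof.
move=> w w'; have [lp le _] := w; have [lp' lq' _] := w'.
apply: closed_pair => // e e0; have [phi [t0 h1 h2]] := weak_graph_approx w' e0.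
have t a := (t0 a).1.
exists (dirac phi), phi; split => //; [exact: L2_dirac|exact: L2_test|].
by rewrite pairC (weak_graph_pair w t) pairC.
Qed.

Lemma weak_graph_l2dot psi eta p q : weak_graph psi eta -> weak_graph p q -> l2dot q psi = l2dot p eta.
Proof.
move=> w w'; have [lp le _] := w; have [lp' lq' _] := w'.
by rewrite !l2dotE// (weak_graph_sym w w') (weak_graph_sym (weak_graph_imul w) w').
Qed.

(** Conversely the adjoint is contained in the weak graph: test with spinors
    that have a single nonzero coordinate. *)
Lemma weak_graph_adjoint psi eta : L2_spinor psi -> L2_spinor eta ->
  (forall p q, op_graph H0 p q -> l2dot q psi = l2dot p eta) -> weak_graph psi eta.
Proof.
move=> lpsi leta H; apply: weak_graph_of_pair => // a h a8 th.
have t0 := delta_test0 th a8; have t b := (t0 b).1.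
have := H _ _ (test0_graph t0); rewrite !l2dotE//; [|exact: L2_test|exact: L2_dirac].
by move=> [e _]; rewrite pairC e pairC.
Qed.

Lemma H0_dense : densely_defined H0.
Proof.
move=> f lf e e0; have l8 := (L2_spinorE _).1 lf.
have d0 : 0 < e ^+ 2 / 16 by rewrite divr_gt0// exprn_gt0.
have /choice[u hu] a : exists g : T -> R, test0 g /\ nsq (fun x => re8 f a x - g x) <= e ^+ 2 / 16.
  by have [_ /(_ _ d0)[p tp hp]] := L2r_dense (l8 a); exists p.
have t0 := cx8_test0 (fun a => (hu a).1); have [dom _] := test0_graph t0.
exists (cx8 u) => //; apply: (@l2norm_lt _ (e ^+ 2 / 16)) => //.
- by apply: L2B => //; exact: L2_test (fun a => (t0 a).1).
- by move=> a a8; rewrite re8BE re8_cx8//; exact: (hu a).2.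
- have e2 : 0 < e ^+ 2 := exprn_gt0 2 e0.
  by clear -e2; lra.
Qed.

(** The weak graph is symmetric and contains the adjoint of the operator on
    the punctured space, whose closure it is; so it equals its own adjoint. *)
Lemma H0_ess_selfadjoint : essentially_self_adjoint H0.
Proof.
split; first split; first exact: H0_dense.
  move=> p q g; have w := Hmin_weak_graph (H0_Hmin g); have [lp lq _] := w.
  have v : L2_spinor q /\ forall p' q', op_graph H0 p' q' -> l2dot q' p = l2dot p' q.
    by split => // p' q' /H0_Hmin/Hmin_weak_graph w'; exact: weak_graph_l2dot.
  by split => //; split => //; exists q.
split.
  move=> f lf e e0; have [p dp h] := H0_dense lf e0; exists p => //.
  have [[lp [phi tphi ep]] _] := dp.
  have ld : L2_spinor (dirac phi) by apply: L2_dirac; exact/test_spinorE.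
  exists (dirac phi); apply/closed_H0; apply: Hmin_weak_graph; split; first by split => //; exists phi.
  by split => //; exists phi => //; split => //; exact: nearW.
have K psi eta : L2_spinor psi -> op_val (op_adjoint (op_closure H0)) psi eta <-> weak_graph psi eta.
  move=> lp; split.
    move=> [le H]; apply: weak_graph_adjoint => // p q g; apply: H.
    have w := (closed_H0 p q).2 (Hmin_weak_graph (H0_Hmin g)).
    by split => //; exists q.
  move=> w; have [_ le _] := w; split => // p q [_ /closed_H0 w']; exact: weak_graph_l2dot.
split.
  apply/seteqP; split => [psi [eta /closed_H0 w]|psi [lp [eta /(K _ _ lp) w]]].
    have [lp _ _] := w; split => //; exists eta; exact/K.
  by exists eta; exact/closed_H0.
move=> psi [eta0 /closed_H0[lp _ _]]; apply/seteqP; split => eta.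
  by move=> /closed_H0 w; exact/K.
by move=> /(K _ _ lp) w; exact/closed_H0.
Qed.

End selfadjoint.

(** * The maximal domain and the Sobolev space *)

Section domains.
Local Open Scope complex_scope.
Context {R : realType}.
Local Notation T := (R3 R).
Local Notation leb := (leb3 R).
Implicit Types (f g h : T -> R) (x y : T) (u v : nat -> T -> R) (a : nat) (z w : R[i]) (p q r psi phi eta chi om : spinor R).
Local Notation Re := complex.Re.
Local Notation Im := complex.Im.

Lemma re8_scale z p a x : re8 (fun x => z *: p x) a x = Re z * re8 p a x + Im z * re8 (imul p) a x.
Proof.
rewrite /re8; case: ifP => _; last by ring.
by rewrite /imul !mxE; case: ifP => _; rewrite !ReImE /=; ring.
Qed.

Lemma re8D p q a x : re8 (fun x => p x + q x) a x = re8 p a x + re8 q a x.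
Proof. by rewrite /re8; case: ifP => _; rewrite ?addr0// !mxE; case: ifP => _; rewrite !ReImE. Qed.

Lemma re8_lin z w p q a x : re8 (fun x => z *: p x + w *: q x) a x =
  Re z * re8 p a x + Im z * re8 (imul p) a x + (Re w * re8 q a x + Im w * re8 (imul q) a x).
Proof. by rewrite (re8D (fun x => z *: p x) (fun x => w *: q x)) (re8_scale z p) (re8_scale w q). Qed.

Lemma lin_arith (e a b c d s1 s2 s3 s4 : R) : e * (s1 * a + s2 * b + (s3 * c + s4 * d)) =
  s1 * (e * a) + s2 * (e * b) + (s3 * (e * c) + s4 * (e * d)).
Proof. ring. Qed.

Lemma pair_lin eta z w p q : L2_spinor eta -> L2_spinor p -> L2_spinor q ->
  pair eta (fun x => z *: p x + w *: q x) =
  Re z * pair eta p + Im z * pair eta (imul p) + (Re w * pair eta q + Im w * pair eta (imul q)).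
Proof.
move=> le lp lq; have li := L2_imul lp; have lj := L2_imul lq.
move: le lp lq li lj => /L2_spinorE le /L2_spinorE lp /L2_spinorE lq /L2_spinorE li /L2_spinorE lj.
rewrite /pair !mulr_sumr -!big_split; apply: eq_bigr => -[a a8] _ /=.
have i1 := L2r_mul (le a) (lp a); have i2 := L2r_mul (le a) (lq a).
have i3 := L2r_mul (le a) (li a); have i4' := L2r_mul (le a) (lj a).
have j1 := itgZ (Re z) i1; have j2 := itgZ (Re w) i2.
have j3 := itgZ (Im z) i3; have j4 := itgZ (Im w) i4'.
rewrite -(int3Z _ i1) -(int3Z _ i2) -(int3Z _ i3) -(int3Z _ i4') -(int3D j1 j3) -(int3D j2 j4) -(int3D (itgD j1 j3) (itgD j2 j4)).
by congr int3; apply/funext => x; rewrite re8_lin; exact: lin_arith.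
Qed.

Lemma imul_lin z w p q : imul (fun x => z *: p x + w *: q x) = (fun x => z *: imul p x + w *: imul q x).
Proof. by apply/funext => x; rewrite /imul scalerDr !scalerA (mulrC z) (mulrC w). Qed.

Lemma L2_lin z w p q : L2_spinor p -> L2_spinor q -> L2_spinor (fun x => z *: p x + w *: q x).
Proof.
move=> lp lq; have li := L2_imul lp; have lj := L2_imul lq.
move: lp lq li lj => /L2_spinorE lp /L2_spinorE lq /L2_spinorE li /L2_spinorE lj; apply/L2_spinorE => a.
have -> : re8 (fun x => z *: p x + w *: q x) a = (fun x => (Re z * re8 p a x + Im z * re8 (imul p) a x) +
    (Re w * re8 q a x + Im w * re8 (imul q) a x)).
  by apply/funext => x; exact: re8_lin.
by apply: L2rD; apply: L2rD; exact: L2rZ.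
Qed.

Lemma pair_imulr2 p q : L2_spinor p -> L2_spinor q -> pair p (imul (imul q)) = - pair p q.
Proof.
move=> /L2_spinorE lp /L2_spinorE lq; rewrite /pair -sumrN; apply: eq_bigr => -[a a8] _ /=.
have e x : re8 (imul (imul q)) a x = - re8 q a x.
  have -> : imul (imul q) = (fun x => (- 1) *: q x).
    apply/funext => y; rewrite /imul scalerA; congr (_ *: _).
    by apply: complex_eq; rewrite !ReImE /=; ring.
  by rewrite re8_scale !ReImE /=; ring.
rewrite -int3N; last exact: L2r_mul.
by congr int3; apply/funext => x; rewrite e mulrN.
Qed.

Lemma l2norm_imul p : L2_spinor p -> l2norm (imul p) = l2norm p.
Proof.
move=> lp; have li := L2_imul lp; rewrite !l2normE// !nsq8E pair_imull//.
by rewrite pair_imulr2// opprK.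
Qed.

Lemma normc_le z (c : R) : `|z| <= c%:C -> Re z ^+ 2 <= c ^+ 2.
Proof.
case: z => s t h; have {}h : Num.sqrt (s ^+ 2 + t ^+ 2) <= c by rewrite -lecR.
have p0 : 0 <= s ^+ 2 + t ^+ 2 by rewrite addr_ge0// sqr_ge0.
apply: (@le_trans _ _ (s ^+ 2 + t ^+ 2)); first by rewrite lerDl sqr_ge0.
by rewrite -(sqr_sqrtr p0) lerXn2r// nnegrE ?sqrtr_ge0//; apply: le_trans h; exact: sqrtr_ge0.
Qed.

Lemma normc_ge (s t c : R) : `|s| + `|t| <= c -> `|s +i* t| <= c%:C.
Proof.
move=> h; have h0 : 0 <= `|s| + `|t| by rewrite addr_ge0.
suff: Num.sqrt (s ^+ 2 + t ^+ 2) <= c by rewrite -lecR.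
apply: le_trans h; rewrite -[leRHS]ger0_norm// -sqrtr_sqr; apply: ler_wsqrtr.
rewrite sqrrD !real_normK ?num_real// lerD2r lerDl mulrn_wge0// mulr_ge0//.
Qed.

(** The scalar product with an element of the weak image is the bounded
    functional that defines the maximal domain. *)
Lemma l2dot_antilinear eta : L2_spinor eta -> bounded_antilinear (l2dot eta).
Proof.
move=> le; split.
  move=> z w p q lp lq; have li := L2_imul lp; have lj := L2_imul lq.
  rewrite !l2dotE//; last exact: L2_lin.
  rewrite imul_lin !pair_lin// !pair_imulr2//.
  by apply: complex_eq; rewrite !ReImE /=; ring.
exists (16 * l2norm eta) => f lf; have li := L2_imul lf.
rewrite l2dotE//; apply: normc_ge.
have h1 := pair_le le lf; have h2 := pair_le le li; rewrite l2norm_imul// in h2.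
by apply: le_trans (lerD h1 h2) _; rewrite le_eqVlt; apply/orP; left; apply/eqP; ring.
Qed.

(** The complex relation splits into real ones: test with real functions for
    one direction, and with real and imaginary parts for the other. *)
Lemma H1_rel (f g : T -> R[i]) (j : 'I_3) : L2 f -> L2 g ->
  (forall phi : T -> R[i], test_fun setT phi -> cintegral (fun x => f x * partial j phi x) = - cintegral (fun x => g x * phi x)) <->
  (forall h, test h -> int3 (fun x => Re (f x) * pd j h x) = - int3 (fun x => Re (g x) * h x)) /\
  (forall h, test h -> int3 (fun x => Im (f x) * pd j h x) = - int3 (fun x => Im (g x) * h x)).
Proof.
move=> [lf1 lf2] [lg1 lg2].
have E (k l : T -> R[i]) : cintegral (fun x => k x * l x) =
   int3 (fun x => Re (k x) * Re (l x) - Im (k x) * Im (l x)) +i* int3 (fun x => Re (k x) * Im (l x) + Im (k x) * Re (l x)).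
  rewrite /cintegral int3.unlock; congr (_ +i* _); congr (Rintegral _ _ _); apply/funext => x; rewrite !ReImE; ring.
split=> [H|[H1 H2] phi /test_funE[t1 t2]].
  have K h : test h -> int3 (fun x => Re (f x) * pd j h x) +i* int3 (fun x => Im (f x) * pd j h x) =
      - (int3 (fun x => Re (g x) * h x) +i* int3 (fun x => Im (g x) * h x)).
    move=> th; have := H (fun x => (h x)%:C).
    rewrite !E; have -> : (fun x => Re (f x) * Re (partial j (fun x => (h x)%:C) x) - Im (f x) * Im (partial j (fun x => (h x)%:C) x)) =
       (fun x => Re (f x) * pd j h x).
      by apply/funext => x; rewrite /partial /= derive_cst mulr0 subr0 pdE.
    have -> : (fun x => Re (f x) * Im (partial j (fun x => (h x)%:C) x) + Im (f x) * Re (partial j (fun x => (h x)%:C) x)) =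
       (fun x => Im (f x) * pd j h x).
      by apply/funext => x; rewrite /partial /= derive_cst mulr0 add0r pdE.
    have -> : (fun x => Re (g x) * Re (h x)%:C - Im (g x) * Im (h x)%:C) = (fun x => Re (g x) * h x).
      by apply/funext => x /=; rewrite mulr0 subr0.
    have -> : (fun x => Re (g x) * Im (h x)%:C + Im (g x) * Re (h x)%:C) = (fun x => Im (g x) * h x).
      by apply/funext => x /=; rewrite mulr0 add0r.
    by apply; apply/test_funE; split => //; exact: test_0.
  by split=> h /K[].
have P k : (fun x => pd j k x) = pd j k by [].
have l1 := L2r_test t1; have l2 := L2r_test t2.
have m1 := L2r_test (test_pd j t1); have m2 := L2r_test (test_pd j t2).
have pE x : partial j phi x = pd j (fun x => Re (phi x)) x +i* pd j (fun x => Im (phi x)) x by rewrite /partial !pdE.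
rewrite !E; under eq_fun do rewrite pE; under [X in _ +i* int3 X = _]eq_fun do rewrite pE.
rewrite /= (int3B (L2r_mul lf1 m1) (L2r_mul lf2 m2)) (int3D (L2r_mul lf1 m2) (L2r_mul lf2 m1)).
rewrite (int3B (L2r_mul lg1 l1) (L2r_mul lg2 l2)) (int3D (L2r_mul lg1 l2) (L2r_mul lg2 l1)).
rewrite (H1 _ t1) (H1 _ t2) (H2 _ t1) (H2 _ t2).
by apply: complex_eq; rewrite /=; ring.
Qed.

Lemma weakly_derivable0 : weakly_derivable (fun _ : T => 0).
Proof.
move=> j; exists (fun=> 0); first exact: L2r0.
by move=> h _; under eq_fun do rewrite mul0r; under [in RHS]eq_fun do rewrite mul0r; rewrite int30 oppr0.
Qed.

Lemma sobolevE psi : sobolev_H1_spinor psi <-> L2_spinor psi /\ forall a, weakly_derivable (re8 psi a).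
Proof.
split.
  move=> H; split; first by move=> k; have [] := H k.
  apply/(re8P psi weakly_derivable0) => k; have [lf dk] := H k.
  by split => j; have [g lg /(H1_rel j lf lg)[h1 h2]] := dk j; [exists (fun x => Re (g x))|exists (fun x => Im (g x))] => //; case: lg.
move=> [lp /(re8P psi weakly_derivable0) H] k; have [d1 d2] := H k; split; first exact: lp.
move=> j; have [g1 l1 e1] := d1 j; have [g2 l2 e2] := d2 j.
have lg : L2 (fun x => g1 x +i* g2 x) by split.
by exists (fun x => g1 x +i* g2 x) => //; apply/(H1_rel j (lp k) lg); split.
Qed.

Variables (m mu : R).
Local Notation dirac := (dirac_op m mu).
Local Notation weak_graph := (weak_graph m mu).

Lemma weak_graph_l2dirac psi eta phi : weak_graph psi eta -> test_spinor setT phi -> l2dot eta phi = l2dot psi (dirac phi).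
Proof.
move=> w /test_spinorE t; have [lp le _] := w.
rewrite !l2dotE//; [|exact: L2_dirac|exact: L2_test].
by rewrite -dirac_imul// (weak_graph_pair w t) (weak_graph_pair w (imul_test t)).
Qed.

Lemma cx8_delta_lin a (s t : R) f g : cx8 (delta8 a (fun x => s * f x + t * g x)) =
  (fun x => s%:C *: cx8 (delta8 a f) x + t%:C *: cx8 (delta8 a g) x).
Proof.
apply/funext => x; apply/matrixP => k l; rewrite !mxE /delta8.
by apply: complex_eq; rewrite !ReImE /=; case: eqP => _; case: eqP => _; ring.
Qed.

Lemma L2_delta a h : L2r h -> L2_spinor (cx8 (delta8 a h)).
Proof.
move=> lh; apply/L2_spinorE => b; have [b8|b8] := ltnP b 8; last by rewrite re8_ge//; exact: L2r0.
by rewrite re8_cx8// /delta8; case: (b == a) => //; exact: L2r0.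
Qed.

Lemma nsq8_delta a h : (a < 8)%N -> nsq8 (cx8 (delta8 a h)) = nsq h.
Proof.
move=> a8; rewrite /nsq8; under eq_bigr do rewrite re8_delta//.
rewrite (sum_delta (F := fun h b => nsq h))// => _.
by rewrite /nsq; under eq_fun do rewrite expr0n /=; exact: int30.
Qed.

(** Restrict the bounded functional to spinors with one real coordinate and
    represent each restriction by the Riesz theorem. *)
Lemma Hmax_weak_graph psi : op_dom (Hmax m mu) psi -> exists eta, weak_graph psi eta.
Proof.
move=> [lp [F [Flin [C FC]] HF]].
have /choice[v hv] a : exists g, L2r g /\ ((a < 8)%N -> forall h, L2r h -> Re (F (cx8 (delta8 a h))) = int3 (fun x => g x * h x)).
  have [a8|a8] := ltnP a 8; last by exists (fun=> 0); split => //; exact: L2r0.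
  have [|||g lg hg] := @L2r_riesz R (fun h => Re (F (cx8 (delta8 a h)))) (C ^+ 2 + 1).
  - by rewrite ltr_wpDl// sqr_ge0.
  - move=> s t f g lf lg; rewrite cx8_delta_lin Flin; [|exact: L2_delta|exact: L2_delta].
    by rewrite !ReImE /=; ring.
  - move=> h lh; have ld := L2_delta a lh.
    apply: le_trans (normc_le (FC _ ld)) _; rewrite l2normE// exprMn sqr_sqrtr ?nsq8_ge0// nsq8_delta//.
    by rewrite ler_wpM2r ?nsq_ge0// lerDl.
  by exists g; split.
have le : L2_spinor (cx8 v).
  apply/L2_spinorE => a; have [a8|a8] := ltnP a 8; first by rewrite re8_cx8//; exact: (hv a).1.
  by rewrite re8_ge//; exact: L2r0.
exists (cx8 v); apply: weak_graph_of_pair => // a h a8 th; have td := delta_test th.1 a8.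
have := HF _ ((test_spinorE _).2 td); rewrite l2dotE//; last exact: L2_dirac.
move=> e; rewrite pair_delta// re8_cx8// -(hv a).2//; last exact: L2r_test th.1.
by rewrite e.
Qed.

Lemma weak_graph_Hmax psi eta : weak_graph psi eta -> op_dom (Hmax m mu) psi.
Proof.
move=> w; have [lp le _] := w; split => //; exists (l2dot eta); first exact: l2dot_antilinear.
by move=> phi t; exact: weak_graph_l2dirac.
Qed.

Lemma weak_graph_sobolev psi eta : weak_graph psi eta -> sobolev_H1_spinor psi.
Proof.
move=> [lp le w]; apply/sobolevE; split => // a.
have [a8|a8] := ltnP a 8; last by rewrite re8_ge//; exact: weakly_derivable0.
exact: (weak_H1 ((L2_spinorE _).1 lp) (L2_massless_part m lp le) w a8).
Qed.

(** An H^1 spinor satisfies the weak free equation, so the Hardy inequality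
    with mu = 0 makes psi/|x| square integrable, and the potential may be
    added to the equation. *)
Lemma sobolev_weak_graph psi : sobolev_H1_spinor psi -> exists eta, weak_graph psi eta.
Proof.
move=> /sobolevE[lp d]; have lu := (L2_spinorE _).1 lp.
have D (b : nat * 'I_3) : exists g : T -> R, L2r g /\ forall h, test h ->
    int3 (fun x => re8 psi b.1 x * pd b.2 h x) = - int3 (fun x => g x * h x).
  by have [g lg hg] := d b.1 b.2; exists g.
have /choice[g hg] := D.
pose G b j := g (b, j).
have lG b j : L2r (G b j) by have [] := hg (b, j).
have eG b j h : test h -> int3 (fun x => re8 psi b x * pd j h x) = - int3 (fun x => G b j x * h x).
  by have [_] := hg (b, j); apply.
have [lv hvv] := weakly_derivable_weak lG eG.
set v := fun a x => _ in lv hvv.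
have w0 : weak_on 0 test0 (re8 psi) v.
  by move=> a h th; rewrite mulr0 mul0r addr0; exact: hvv th.1.
have [li _] := hardy_weak lu lv w0.
pose e a x := v a x + (beta_sign a * m * re8 psi a x + beta_sign a * mu * (inv_norm x * re8 psi a x)).
have le : L2_spinor (cx8 e).
  apply/L2_spinorE => a; have [a8|a8] := ltnP a 8; last by rewrite re8_ge//; exact: L2r0.
  rewrite re8_cx8//; apply: L2rD => //; apply: L2rD; apply: L2rZ => //; exact: li.
exists (cx8 e); apply: weak_graph_intro => // a h a8 th; have lh := L2r_test th.1.
have i1 := L2r_mul (lv a) lh.
have i2 : itg (fun x => re8 psi a x * (inv_norm x * h x)).
  by under eq_fun do rewrite mulrCA mulrA; exact: L2r_mul (li a a8) lh.
have -> : (fun x => massless_part m psi (cx8 e) a x * h x) = (fun x => v a x * h x + (beta_sign a * mu) * (re8 psi a x * (inv_norm x * h x))).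
  by apply/funext => x; rewrite /massless_part re8_cx8// /e; ring.
by rewrite (int3D i1 (itgZ (beta_sign a * mu) i2)) (int3Z _ i2) hvv//; exact: th.1.
Qed.

End domains.

Theorem corollary1p6 (R : realType) (m mu : R) :
  essentially_self_adjoint
    (op_restr (Hmin m mu) (test_spinor (~` [set (0 : R3 R)]))) /\
  op_dom (op_closure (Hmin m mu)) = op_dom (Hmax m mu) /\
  op_dom (Hmax m mu) = @sobolev_H1_spinor R.
Proof.
split; first exact: H0_ess_selfadjoint.
have dom psi : op_dom (Hmax m mu) psi <-> exists eta, weak_graph m mu psi eta.
  by split=> [|[eta]]; [exact: Hmax_weak_graph|exact: weak_graph_Hmax].
split; apply/seteqP; split => psi.
- by move=> [eta /closed_Hmin w]; apply/dom; exists eta.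
- by move=> /dom[eta w]; exists eta; exact/closed_Hmin.
- by move=> /dom[eta]; exact: weak_graph_sobolev.
- by move=> /sobolev_weak_graph h; exact/dom.
Qed.
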